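(* Let $(\mathbb{C},\mathcal{T}_{st})$ be the hexagonal triangulated plane with edge set $E$ and vertex set $V$. Let $I$ be a regular, translating invariant weight on $E$ such that either all values of $I$ lie in $(-\frac12,1]$ or all values of $I$ lie in $[0,+\infty)$, and such that for every triangle of $\mathcal{T}_{st}$ with edges $e_1,e_2,e_3$, $$I(e_i)+I(e_j)I(e_k)\ge 0,\qquad \{i,j,k\}=\{1,2,3\}.$$ Let $l$ be a weighted Delaunay inversive distance circle packing metric on $(\mathbb{C},\mathcal{T}_{st},I)$ induced by a constant label. Let $w:V\to\mathbb{R}$ be such that $w*l$ is an inversive distance circle packing metric on $(\mathbb{C},\mathcal{T}_{st},I)$. If $(\mathbb{C},\mathcal{T}_{st},I,w*l)$ is a weighted Delaunay triangulated surface isometric to an open set in the plane, then $w$ is a constant function.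
   Context: Hexagonal triangulated plane $(\mathbb{C},\mathcal{T}_{st})$: the vertex set is the lattice $V=L=\{m\vec v_1+n\vec v_2: m,n\in\mathbb{Z}\}$ with $\vec v_1=1$, $\vec v_2=e^{i\pi/3}$; edges join $v$ to $v\pm\vec v_1$, $v\pm\vec v_2$, $v\pm(\vec v_1-\vec v_2)$; faces are the resulting triangles. $E$, $F$ denote the edges and faces. A weight is a map $I:E\to(-1,+\infty)$. It is translating invariant if $I(e+\delta)=I(e)$ for all $e\in E$, $\delta\in L$, where $e+\delta$ is the edge $e$ translated by $\delta$. It is regular if there are no adjacent triangles $t_1$ (with edges $a,b,e$) and $t_2$ (with edges $c,d,e$) in $F$ such that $I(e)=1$, $I(a)=-I(b)$ and $I(c)=-I(d)$. A PL metric is a function $l:E\to(0,+\infty)$ satisfying the strict triangle inequality on every face; each face is then identified with a Euclidean triangle, and these are glued isometrically along edges. It is an inversive distance circle packing metric on $(\mathbb{C},\mathcal{T}_{st},I)$ if there is a function $u:V\to\mathbb{R}$ (a label) with $$l(e)=\sqrt{e^{2u(v)}+e^{2u(v')}+2I(e)e^{u(v)+u(v')}}$$ for every edge $e$ with end points $v,v'$; put $r=e^{u}$. If $l$ is induced by the label $u$ and $w:V\to\mathbb{R}$, then $w*l$ denotes the edge length function given by the same formula with label $u+w$. Weighted Delaunay: for a face realized as a Euclidean triangle $\triangle v_iv_jv_k$ in the plane, its geometric center $C_{ijk}$ is the unique point $p$ of the plane for which $|p-v_s|^2-r(v_s)^2$ is the same for $s=i,j,k$; $h_{ij,k}$ is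 the signed distance from $C_{ijk}$ to the line $v_iv_j$, positive if $C_{ijk}$ lies on the same side of this line as the triangle and negative if on the opposite side. The metric is weighted Delaunay if $h_{ij,k}+h_{ij,m}\ge0$ for every edge $v_iv_j$ shared by two faces $\triangle v_iv_jv_k$ and $\triangle v_iv_jv_m$. ''Isometric to an open set in the plane'' means that the surface obtained by gluing the Euclidean triangles with edge lengths $w*l$ is isometric (for the path metrics) to an open subset of the Euclidean plane; i.e. there is a homeomorphism onto an open subset of the plane which maps each face isometrically onto a Euclidean triangle. *)

(* Defs.v *)
From Stdlib Require Import Reals ZArith.
From Coquelicot Require Import Coquelicot.
Open Scope R_scope.

(** * The hexagonal triangulated plane *)

(* [(m, n)] stands for the lattice point [m v1 + n v2]; see [pos]. *)
Definition vertex : Type := (Z * Z)%type.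

Definition vadd (v d : vertex) : vertex :=
  ((fst v + fst d)%Z, (snd v + snd d)%Z).

Definition pos (v : vertex) : C :=
  (RtoC (IZR (fst v)) * RtoC 1
   + RtoC (IZR (snd v)) * (cos (PI / 3), sin (PI / 3)))%C.

Definition adj (v v' : vertex) : Prop :=
  v' = vadd v (1, 0)%Z \/ v' = vadd v (-1, 0)%Z \/
  v' = vadd v (0, 1)%Z \/ v' = vadd v (0, -1)%Z \/
  v' = vadd v (1, -1)%Z \/ v' = vadd v (-1, 1)%Z.

(* The triangles of the triangulation are exactly the triples of pairwise
   adjacent vertices; each one is counted with all orderings of its vertices. *)
Definition face (i j k : vertex) : Prop := adj i j /\ adj j k /\ adj k i.

(* An edge is an unordered pair of adjacent vertices, so a function on edges is
   a binary function on vertices that is symmetric on adjacent pairs.  Its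
   values at non-adjacent pairs never matter. *)
Definition edge_function (f : vertex -> vertex -> R) : Prop :=
  forall v v', adj v v' -> f v v' = f v' v.

Definition is_constant (f : vertex -> R) : Prop :=
  exists c : R, forall v, f v = c.

(** * Weights *)

Definition is_weight (I : vertex -> vertex -> R) : Prop :=
  edge_function I /\ forall v v', adj v v' -> -1 < I v v'.

Definition translating_invariant (I : vertex -> vertex -> R) : Prop :=
  forall v v' d, adj v v' -> I (vadd v d) (vadd v' d) = I v v'.

Definition regular (I : vertex -> vertex -> R) : Prop :=
  ~ exists i j k m : vertex,
      face i j k /\ face i j m /\ k <> m /\
      I i j = 1 /\ I i k = - I j k /\ I i m = - I j m.

(** * Metrics *)

Definition is_PL_metric (l : vertex -> vertex -> R) : Prop :=
  edge_function l /\
  (forall v v', adj v v' -> 0 < l v v') /\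
  (forall i j k, face i j k -> l i j < l j k + l k i).

Definition packing_length (I : vertex -> vertex -> R) (u : vertex -> R)
    (v v' : vertex) : R :=
  sqrt (exp (2 * u v) + exp (2 * u v') + 2 * I v v' * exp (u v + u v')).

Definition induced_by (I l : vertex -> vertex -> R) (u : vertex -> R) : Prop :=
  forall v v', adj v v' -> l v v' = packing_length I u v v'.

Definition is_packing_metric (I l : vertex -> vertex -> R) : Prop :=
  is_PL_metric l /\ exists u, induced_by I l u.

Definition label_add (w u : vertex -> R) : vertex -> R := fun v => u v + w v.

Definition radius (u : vertex -> R) : vertex -> R := fun v => exp (u v).

(* The edge length function [w * l], where [u] is the label inducing [l]. *)
Definition rescale (I : vertex -> vertex -> R) (w u : vertex -> R) :
    vertex -> vertex -> R :=
  packing_length I (label_add w u).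

(** * Weighted Delaunay condition *)

(* [A], [B], [D] are the vertices of a Euclidean triangle realizing the face
   [i j k] with the edge lengths [l]. *)
Definition realizes (l : vertex -> vertex -> R) (i j k : vertex)
    (A B D : C) : Prop :=
  Cmod (B - A) = l i j /\ Cmod (D - B) = l j k /\ Cmod (A - D) = l k i.

Definition is_center (A B D : C) (a b d : R) (p : C) : Prop :=
  Cmod (p - A) ^ 2 - a ^ 2 = Cmod (p - B) ^ 2 - b ^ 2 /\
  Cmod (p - B) ^ 2 - b ^ 2 = Cmod (p - D) ^ 2 - d ^ 2.

Definition cross (z z' : C) : R := Im (Cconj z * z').

(* [cross (B - A) (p - A) / Cmod (B - A)] is the distance from [p] to the line
   [A B], counted positively to the left of the vector from [A] to [B]; the sign
   makes it positive on the side of [D]. *)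
Definition signed_distance (A B D p : C) : R :=
  sign (cross (B - A) (D - A)) * (cross (B - A) (p - A) / Cmod (B - A)).

(* [is_height l r i j k h] : [h] is the number h_{ij,k} of the face [i j k].
   The realization is unique up to isometry, so [h] does not depend on it. *)
Definition is_height (l : vertex -> vertex -> R) (r : vertex -> R)
    (i j k : vertex) (h : R) : Prop :=
  exists A B D p : C,
    realizes l i j k A B D /\ is_center A B D (r i) (r j) (r k) p /\
    h = signed_distance A B D p.

Definition weighted_Delaunay (l : vertex -> vertex -> R) (r : vertex -> R) :
    Prop :=
  forall i j k m : vertex, face i j k -> face i j m -> k <> m ->
  forall h h' : R, is_height l r i j k h -> is_height l r i j m h' ->
  0 <= h + h'.

(** * Isometry with an open set of the plane *)

Definition barycenter (a b c : R) (A B D : C) : C :=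
  (RtoC a * A + RtoC b * B + RtoC c * D)%C.

Definition barycentric (a b c : R) : Prop :=
  0 <= a /\ 0 <= b /\ 0 <= c /\ a + b + c = 1.

(* The Euclidean metric that [l] puts on the face [i j k] is transported from
   the realizing triangle by the affine identification, i.e. by equality of
   barycentric coordinates; these identifications agree on common edges. *)
Definition isometric_on_face (l : vertex -> vertex -> R) (phi : C -> C)
    (i j k : vertex) : Prop :=
  forall A B D : C, realizes l i j k A B D ->
  forall a b c a' b' c' : R, barycentric a b c -> barycentric a' b' c' ->
  Cmod (phi (barycenter a b c (pos i) (pos j) (pos k))
        - phi (barycenter a' b' c' (pos i) (pos j) (pos k)))
  = Cmod (barycenter a b c A B D - barycenter a' b' c' A B D).

(* Since [U] is open, continuity of [psi] on the subspace [U] is continuity of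
   [psi] at each point of [U]; the values of [psi] outside [U] are irrelevant. *)
Definition homeomorphism_onto (phi : C -> C) (U : C -> Prop) : Prop :=
  (forall x : C, U (phi x)) /\
  (forall x : C, continuous phi x) /\
  exists psi : C -> C,
    (forall x : C, psi (phi x) = x) /\
    (forall y : C, U y -> phi (psi y) = y) /\
    (forall y : C, U y -> continuous psi y).

(* The surface glued from the triangles is the plane carrying the triangulation,
   each face being given the metric described at [isometric_on_face]. *)
Definition isometric_to_open_set (l : vertex -> vertex -> R) : Prop :=
  exists (U : C -> Prop) (phi : C -> C),
    open U /\ homeomorphism_onto phi U /\
    forall i j k, face i j k -> isometric_on_face l phi i j k.

(* Main.v *)
(* Laying out the surface in the plane turns [w] into the positive radii [r] of
   an embedded hexagonal circle pattern.  The angle sum at a vertex is monotone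
   along the path, linear in the inverse radii, between two weighted Delaunay
   flowers, which gives a maximum principle for the quotient of two patterns; it
   is applied to a pattern and its translates.  Neighbouring radii have bounded
   ratios: otherwise a rescaled limit would have vertices whose images collapse
   to a point, and a walk along the boundary of the collapsing set, followed
   through finitely many cases, leads to overlapping triangles.  Hence layouts
   are precompact up to similarity, and translating to near extremal values of
   [r (v + d) / r v] gives a limit in which [r] is multiplicative.  If such a
   limit is not constant, it is a logarithmic spiral pattern with a fixed point
   [O]: infinitely many triangles of comparable size stay at bounded distance
   from [O], so that two of them overlap.  If all triangles degenerate, the
   spiral lies on a line and its multipliers are real; positive ones contradict
   the Delaunay condition at a middle vertex, and a negative one makes strips
   of nearby nondegenerate layouts cross.  So [r (v + d) <= r v] for every unit
   vector [d], and [r] is constant. *)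
Require Import Defs.
From Stdlib Require Import Reals ZArith Lra Lia Psatz Classical ClassicalEpsilon List Cantor.
From Coquelicot Require Import Coquelicot.
Open Scope R_scope.

(** The obstacle is that a limit of layouts need not be a layout: with weights above 1 triangles can
    flatten, and absence of overlaps is not a closed condition. Limits are therefore kept together
    with approximating layouts. What passes by continuity (lengths, angle sums, linear Delaunay
    inequalities) is read off the limit; a contradiction by overlapping is pulled back to a nearby
    genuine layout. Flat triangles also force the maximum principle to start and end its paths where
    angles are continuous but perhaps not differentiable. The conditions on the weight enter at
    separate places. At a vertex whose radius becomes negligible against two adjacent neighbours,
    the angle tends to arccos(-I), with I the weight of the opposite edge; I > -1/2 makes it exceed
    pi/3, so that six such wedges around one point exceed a full turn. The inequalities I(e_i) +
    I(e_j) I(e_k) >= 0 and regularity give the derivative of the angle sum its sign at edges with I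
    <= 1; at edges with I > 1 the sign comes from the Delaunay condition. *)

(** * The lattice and its triangles *)

Definition rot (d : vertex) : vertex := ((- snd d)%Z, (fst d + snd d)%Z).
Definition rotinv (d : vertex) : vertex := ((fst d + snd d)%Z, (- fst d)%Z).

(** Listed counterclockwise: each vector is [rot] of the one before, [rot] being multiplication by
    e^(i pi/3) in lattice coordinates. *)
Definition unit_vec (d : vertex) : Prop :=
  d = (1, 0)%Z \/ d = (0, 1)%Z \/ d = (-1, 1)%Z \/
  d = (-1, 0)%Z \/ d = (0, -1)%Z \/ d = (1, -1)%Z.

Lemma vertex_dec (v v' : vertex) : {v = v'} + {v <> v'}.
Proof. decide equality; apply Z.eq_dec. Qed.

Lemma vadd_assoc (u v w : vertex) : vadd (vadd u v) w = vadd u (vadd v w).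
Proof. unfold vadd; simpl; f_equal; ring. Qed.

Lemma vadd_comm (u v : vertex) : vadd u v = vadd v u.
Proof. unfold vadd; simpl; f_equal; ring. Qed.

Lemma vadd_0_r (v : vertex) : vadd v (0, 0)%Z = v.
Proof. destruct v; unfold vadd; simpl; f_equal; ring. Qed.

Lemma vadd_0_l (v : vertex) : vadd (0, 0)%Z v = v.
Proof. destruct v; reflexivity. Qed.

Lemma vadd_cancel (v d d' : vertex) : vadd v d = vadd v d' -> d = d'.
Proof.
  destruct v, d, d'; unfold vadd; simpl; intros H; injection H; intros.
  f_equal; lia.
Qed.

Lemma rot_rotinv (d : vertex) : rot (rotinv d) = d.
Proof. destruct d; unfold rot, rotinv; simpl; f_equal; ring. Qed.

Lemma rotinv_rot (d : vertex) : rotinv (rot d) = d.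
Proof. destruct d; unfold rot, rotinv; simpl; f_equal; ring. Qed.

Lemma rot_vadd (v d : vertex) : rot (vadd v d) = vadd (rot v) (rot d).
Proof. unfold rot, vadd; simpl; f_equal; ring. Qed.

Lemma unit_rot (d : vertex) : unit_vec d -> unit_vec (rot d).
Proof.
  intros [-> | [-> | [-> | [-> | [-> | ->]]]]]; unfold unit_vec, rot; simpl; tauto.
Qed.

Lemma unit_rotinv (d : vertex) : unit_vec d -> unit_vec (rotinv d).
Proof.
  intros [-> | [-> | [-> | [-> | [-> | ->]]]]]; unfold unit_vec, rotinv; simpl; tauto.
Qed.

Lemma adj_vadd (v d : vertex) : unit_vec d -> adj v (vadd v d).
Proof.
  intros [-> | [-> | [-> | [-> | [-> | ->]]]]]; unfold adj; tauto.
Qed.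

Lemma adj_unit (v v' : vertex) :
  adj v v' -> exists d, unit_vec d /\ v' = vadd v d.
Proof.
  unfold unit_vec.
  intros [-> | [-> | [-> | [-> | [-> | ->]]]]]; eexists; (split; [|reflexivity]); tauto.
Qed.

Lemma adj_sym (v v' : vertex) : adj v v' -> adj v' v.
Proof.
  destruct v as [m n].
  intros [-> | [-> | [-> | [-> | [-> | ->]]]]]; unfold adj, vadd; simpl;
  [right; left | left | do 3 right; left | do 2 right; left |
   do 5 right | do 4 right; left];
  f_equal; ring.
Qed.

Lemma unit_nonzero (d : vertex) : unit_vec d -> d <> (0, 0)%Z.
Proof.
  intros [-> | [-> | [-> | [-> | [-> | ->]]]]]; discriminate.
Qed.

Lemma adj_irrefl (v v' : vertex) : adj v v' -> v <> v'.
Proof.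
  intros H E; destruct (adj_unit _ _ H) as [d [Hd ->]].
  apply (unit_nonzero d Hd), (vadd_cancel v). now rewrite vadd_0_r.
Qed.

Lemma face_left (v d : vertex) :
  unit_vec d -> face v (vadd v d) (vadd v (rot d)).
Proof.
  intros Hd; split; [now apply adj_vadd | split].
  - replace (vadd v (rot d)) with (vadd (vadd v d) (rot (rot d))).
    + now apply adj_vadd, unit_rot, unit_rot.
    + destruct v, d; unfold vadd, rot; simpl; f_equal; ring.
  - now apply adj_sym, adj_vadd, unit_rot.
Qed.

Lemma face_swap (i j k : vertex) : face i j k -> face i k j.
Proof. intros [H1 [H2 H3]]; repeat split; now apply adj_sym. Qed.

Lemma face_cycle (i j k : vertex) : face i j k -> face j k i.
Proof. intros [H1 [H2 H3]]; repeat split; assumption. Qed.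

Lemma face_right (v d : vertex) :
  unit_vec d -> face v (vadd v d) (vadd v (rotinv d)).
Proof.
  intros Hd; apply face_swap.
  rewrite <- (rot_rotinv d) at 2. now apply face_left, unit_rotinv.
Qed.

Lemma face_cases (i j k : vertex) : face i j k ->
  exists d, unit_vec d /\
    ((j = vadd i d /\ k = vadd i (rot d)) \/
     (k = vadd i d /\ j = vadd i (rot d))).
Proof.
  intros [H1 [H2 H3]].
  apply adj_sym in H3.
  destruct (adj_unit _ _ H1) as [d [Hd ->]].
  destruct (adj_unit _ _ H3) as [d' [Hd' ->]].
  destruct (adj_unit _ _ H2) as [e [He E]].
  rewrite vadd_assoc in E. apply vadd_cancel in E. subst d'.
  assert (vadd d e = rot d \/ d = rot (vadd d e)) as [K | K].
  { destruct Hd as [-> | [-> | [-> | [-> | [-> | ->]]]]];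
    destruct He as [-> | [-> | [-> | [-> | [-> | ->]]]]];
    unfold vadd, rot in *; simpl in *; try tauto;
    exfalso; destruct Hd' as [H | [H | [H | [H | [H | H]]]]]; discriminate H. }
  - exists d; split; [assumption | left; split; congruence].
  - exists (vadd d e); split; [assumption | right; split; congruence].
Qed.

(** * Barycentric coordinates in the lattice *)

(** In lattice coordinates max(|x|, |y|, |x + y|) is the norm whose unit ball is the hexagon formed
    by the six triangles at a vertex. On that hexagon one minus the norm is the barycentric weight
    of the centre, so the weight [a] bounds the displacement from [i]. *)
Lemma hat_le (i j k : vertex) (a b c x y : R) :
  face i j k -> barycentric a b c ->
  x = a * IZR (fst i) + b * IZR (fst j) + c * IZR (fst k) - IZR (fst i) ->
  y = a * IZR (snd i) + b * IZR (snd j) + c * IZR (snd k) - IZR (snd i) ->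
  -(1 - a) <= x <= 1 - a /\ -(1 - a) <= y <= 1 - a /\
  -(1 - a) <= x + y <= 1 - a.
Proof.
  intros Hf (Ha & Hb & Hc & Hs) -> ->.
  destruct (face_cases _ _ _ Hf) as [d [Hd [[-> ->] | [-> ->]]]];
  destruct i as [p q]; unfold vadd, rot; simpl;
  destruct Hd as [-> | [-> | [-> | [-> | [-> | ->]]]]]; simpl;
  rewrite ?plus_IZR; simpl; replace a with (1 - b - c) by lra;
  repeat split; nra.
Qed.

(** [(s, t)] is a corner of the triangle relative to the vertex under test. If a coordinate is at
    least 3 in size, the bound is immediate, because coordinates vary by at most 1 within a
    triangle. The remaining 25 positions with 6 directions are checked one by one. *)
Lemma hat_ge_aux (s t : Z) (d : vertex) (b c x y : R) :
  unit_vec d -> 0 <= b -> 0 <= c -> b + c <= 1 ->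
  x = IZR s + b * IZR (fst d) + c * IZR (fst (rot d)) ->
  y = IZR t + b * IZR (snd d) + c * IZR (snd (rot d)) ->
  (s, t) <> (0, 0)%Z -> vadd (s, t) d <> (0, 0)%Z ->
  vadd (s, t) (rot d) <> (0, 0)%Z ->
  x <= -1 \/ 1 <= x \/ y <= -1 \/ 1 <= y \/ x + y <= -1 \/ 1 <= x + y.
Proof.
  intros Hd Hb Hc Hs -> -> Hi Hj Hk.
  destruct (Z_le_gt_dec s (-3)) as [L | L].
  { left; apply IZR_le in L.
    destruct Hd as [-> | [-> | [-> | [-> | [-> | ->]]]]]; simpl in *; lra. }
  destruct (Z_le_gt_dec 3 s) as [L' | L'].
  { right; left; apply IZR_le in L'.
    destruct Hd as [-> | [-> | [-> | [-> | [-> | ->]]]]]; simpl in *; lra. }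
  destruct (Z_le_gt_dec t (-3)) as [M | M].
  { do 2 right; left; apply IZR_le in M.
    destruct Hd as [-> | [-> | [-> | [-> | [-> | ->]]]]]; simpl in *; lra. }
  destruct (Z_le_gt_dec 3 t) as [M' | M'].
  { do 3 right; left; apply IZR_le in M'.
    destruct Hd as [-> | [-> | [-> | [-> | [-> | ->]]]]]; simpl in *; lra. }
  assert (s = -2 \/ s = -1 \/ s = 0 \/ s = 1 \/ s = 2)%Z as Cs by lia.
  assert (t = -2 \/ t = -1 \/ t = 0 \/ t = 1 \/ t = 2)%Z as Ct by lia.
  clear L L' M M'.
  destruct Cs as [-> | [-> | [-> | [-> | ->]]]];
  destruct Ct as [-> | [-> | [-> | [-> | ->]]]];
  destruct Hd as [-> | [-> | [-> | [-> | [-> | ->]]]]];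
  unfold rot, vadd in *; simpl in *;
  first
  [ contradiction
  | left; lra
  | right; left; lra
  | do 2 right; left; lra
  | do 3 right; left; lra
  | do 4 right; left; lra
  | do 5 right; lra ].
Qed.

Lemma hat_ge (v i j k : vertex) (a b c x y : R) :
  face i j k -> barycentric a b c ->
  x = a * IZR (fst i) + b * IZR (fst j) + c * IZR (fst k) - IZR (fst v) ->
  y = a * IZR (snd i) + b * IZR (snd j) + c * IZR (snd k) - IZR (snd v) ->
  v <> i -> v <> j -> v <> k ->
  x <= -1 \/ 1 <= x \/ y <= -1 \/ 1 <= y \/ x + y <= -1 \/ 1 <= x + y.
Proof.
  intros Hf (Ha & Hb & Hc & Hs) Ex Ey Hi Hj Hk.
  destruct i as [p q]; destruct v as [m n].
  assert (forall e : vertex, vadd (p - m, q - n)%Z e = (0, 0)%Z ->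
            (m, n) = vadd (p, q) e) as Hne.
  { intros [e1 e2]; unfold vadd; simpl; intros E; injection E; intros.
    f_equal; lia. }
  assert ((p - m, q - n)%Z <> (0, 0)%Z) as H0.
  { intros E; apply Hi; injection E; intros; f_equal; lia. }
  replace a with (1 - b - c) in * by lra.
  destruct (face_cases _ _ _ Hf) as [d [Hd [[-> ->] | [-> ->]]]].
  - apply (hat_ge_aux (p - m) (q - n) d b c); auto; try lra.
    + rewrite Ex; unfold vadd; cbn [fst snd]; rewrite minus_IZR, !plus_IZR; ring.
    + rewrite Ey; unfold vadd; cbn [fst snd]; rewrite minus_IZR, !plus_IZR; ring.
  - apply (hat_ge_aux (p - m) (q - n) d c b); auto; try lra.
    + rewrite Ex; unfold vadd; cbn [fst snd]; rewrite minus_IZR, !plus_IZR; ring.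
    + rewrite Ey; unfold vadd; cbn [fst snd]; rewrite minus_IZR, !plus_IZR; ring.
Qed.

(** The point has hexagonal norm at most 1 - a relative to [i], and at least 1 because [i] is not a
    corner of the second face. *)
Lemma lattice_support (i j k i' j' k' : vertex) (a b c a' b' c' : R) :
  face i j k -> face i' j' k' -> barycentric a b c -> barycentric a' b' c' ->
  a * IZR (fst i) + b * IZR (fst j) + c * IZR (fst k)
  = a' * IZR (fst i') + b' * IZR (fst j') + c' * IZR (fst k') ->
  a * IZR (snd i) + b * IZR (snd j) + c * IZR (snd k)
  = a' * IZR (snd i') + b' * IZR (snd j') + c' * IZR (snd k') ->
  i <> i' -> i <> j' -> i <> k' -> a = 0.
Proof.
  intros Hf Hf' Hb Hb' Ex Ey Hi Hj Hk.
  pose proof (hat_le i j k a b c _ _ Hf Hb eq_refl eq_refl) as HL.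
  pose proof (hat_ge i i' j' k' a' b' c' _ _ Hf' Hb' eq_refl eq_refl Hi Hj Hk) as HG.
  destruct Hb as (Ha & Hb & Hc & Hs).
  rewrite <- Ex, <- Ey in HG. lra.
Qed.

(** * Vertex positions of a planar surface *)

(** Twice the signed area of the triangle, positive in counterclockwise order. *)
Definition crs (A B D : C) : R :=
  (fst B - fst A) * (snd D - snd A) - (snd B - snd A) * (fst D - fst A).

Definition dist2 (A B : C) : R := (fst B - fst A) ^ 2 + (snd B - snd A) ^ 2.

Definition same_point (i j k i' j' k' : C) (a b c a' b' c' : R) : Prop :=
  a * fst i + b * fst j + c * fst k = a' * fst i' + b' * fst j' + c' * fst k' /\
  a * snd i + b * snd j + c * snd k = a' * snd i' + b' * snd j' + c' * snd k'.

(** Two triangles meet only in what their common vertices span: at a common point, a vertex missing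
    from the other triangle has weight 0. Speaking of the first vertex is enough, as [face] admits
    every ordering. *)
Definition nonoverlapping (P : vertex -> C) : Prop :=
  forall i j k i' j' k' a b c a' b' c',
    face i j k -> face i' j' k' -> barycentric a b c -> barycentric a' b' c' ->
    same_point (P i) (P j) (P k) (P i') (P j') (P k') a b c a' b' c' ->
    i <> i' -> i <> j' -> i <> k' -> a = 0.

Definition oriented (P : vertex -> C) : Prop :=
  forall v d, unit_vec d -> 0 < crs (P v) (P (vadd v d)) (P (vadd v (rot d))).

Lemma Cmod_sqr (z : C) : Cmod z ^ 2 = fst z ^ 2 + snd z ^ 2.
Proof. unfold Cmod. apply pow2_sqrt. nra. Qed.

Lemma dist2_Cmod (A B : C) : dist2 A B = Cmod (B - A) ^ 2.
Proof. rewrite Cmod_sqr; unfold dist2; simpl; ring. Qed.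

Lemma dist2_sym (A B : C) : dist2 A B = dist2 B A.
Proof. unfold dist2; ring. Qed.

Lemma Cmod_eq_of_sqr (z : C) (r : R) :
  0 <= r -> fst z ^ 2 + snd z ^ 2 = r ^ 2 -> Cmod z = r.
Proof.
  intros Hr E. unfold Cmod. rewrite E. now apply sqrt_pow2.
Qed.

Lemma realization_exists (L1 L2 L3 : R) :
  0 < L1 -> 0 < L2 -> 0 < L3 ->
  L1 < L2 + L3 -> L2 < L3 + L1 -> L3 < L1 + L2 ->
  exists A B D : C, Cmod (B - A) = L1 /\ Cmod (D - B) = L2 /\ Cmod (A - D) = L3 /\
    0 < crs A B D.
Proof.
  intros P1 P2 P3 T1 T2 T3.
  pose (x := (L1 ^ 2 + L3 ^ 2 - L2 ^ 2) / (2 * L1)).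
  assert (Ex : 2 * L1 * x = L1 ^ 2 + L3 ^ 2 - L2 ^ 2) by (unfold x; field; lra).
  assert (0 < L3 ^ 2 - x ^ 2) as Hy.
  { replace (L3 ^ 2 - x ^ 2) with ((L3 - x) * (L3 + x)) by ring.
    assert (0 < (2 * L1) * (L3 - x)).
    { replace (2 * L1 * (L3 - x))
        with ((L2 - L3 + L1) * (L2 + L3 - L1)) by nra. nra. }
    assert (0 < (2 * L1) * (L3 + x)).
    { replace (2 * L1 * (L3 + x))
        with ((L1 + L3 - L2) * (L1 + L3 + L2)) by nra. nra. }
    apply Rmult_lt_0_compat; nra. }
  pose (y := sqrt (L3 ^ 2 - x ^ 2)).
  assert (Ey : y ^ 2 = L3 ^ 2 - x ^ 2) by (apply pow2_sqrt; lra).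
  assert (0 < y) by (apply sqrt_lt_R0; lra).
  exists (0, 0), (L1, 0), (x, y). repeat split.
  - apply Cmod_eq_of_sqr; [lra | simpl; ring].
  - apply Cmod_eq_of_sqr; [lra | simpl; nra].
  - apply Cmod_eq_of_sqr; [lra | simpl; nra].
  - unfold crs; simpl; nra.
Qed.

Lemma crs_sqr (A B D : C) :
  4 * crs A B D ^ 2 =
  4 * dist2 A B * dist2 A D - (dist2 A B + dist2 A D - dist2 B D) ^ 2.
Proof. unfold crs, dist2; ring. Qed.

(** Differences of the equations are linear in Z - W, with determinant [crs A B D]. This is what
    makes an isometry affine on a face. *)
Lemma equidistant_unique (A B D Z W : C) : crs A B D <> 0 ->
  dist2 Z A = dist2 W A -> dist2 Z B = dist2 W B -> dist2 Z D = dist2 W D ->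
  Z = W.
Proof.
  destruct A as [a1 a2], B as [b1 b2], D as [d1 d2], Z as [z1 z2], W as [w1 w2].
  unfold crs, dist2; simpl; intros Hc EA EB ED.
  assert (E1 : (z1 - w1) * (b1 - a1) + (z2 - w2) * (b2 - a2) = 0) by nra.
  assert (E2 : (z1 - w1) * (d1 - a1) + (z2 - w2) * (d2 - a2) = 0) by nra.
  assert (z1 - w1 = 0).
  { apply (Rmult_eq_reg_r ((b1 - a1) * (d2 - a2) - (b2 - a2) * (d1 - a1))); [|assumption].
    transitivity (((z1 - w1) * (b1 - a1) + (z2 - w2) * (b2 - a2)) * (d2 - a2)
      - ((z1 - w1) * (d1 - a1) + (z2 - w2) * (d2 - a2)) * (b2 - a2)); [ring|].
    rewrite E1, E2; ring. }
  assert (z2 - w2 = 0).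
  { apply (Rmult_eq_reg_r ((b1 - a1) * (d2 - a2) - (b2 - a2) * (d1 - a1))); [|assumption].
    transitivity (((z1 - w1) * (d1 - a1) + (z2 - w2) * (d2 - a2)) * (b1 - a1)
      - ((z1 - w1) * (b1 - a1) + (z2 - w2) * (b2 - a2)) * (d1 - a1)); [ring|].
    rewrite E1, E2; ring. }
  f_equal; lra.
Qed.

Lemma barycenter_coord (a b c : R) (A B D : C) :
  barycenter a b c A B D =
  (a * fst A + b * fst B + c * fst D, a * snd A + b * snd B + c * snd D).
Proof. unfold barycenter, RtoC, Cplus, Cmult; simpl; f_equal; ring. Qed.

Lemma dist2_barycenter (a b c : R) (A B D : C) : a + b + c = 1 ->
  dist2 (barycenter a b c A B D) A =
  b ^ 2 * dist2 A B + c ^ 2 * dist2 A D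
  + b * c * (dist2 A B + dist2 A D - dist2 B D).
Proof.
  intros H. rewrite barycenter_coord. unfold dist2; simpl.
  replace a with (1 - b - c) by lra. ring.
Qed.

Lemma barycenter_cycle (a b c : R) (A B D : C) :
  barycenter a b c A B D = barycenter b c a B D A.
Proof. rewrite !barycenter_coord; f_equal; ring. Qed.

Lemma pos_coord (v : vertex) :
  Defs.pos v = (IZR (fst v) + IZR (snd v) * cos (PI / 3), IZR (snd v) * sin (PI / 3)).
Proof. unfold Defs.pos, RtoC, Cplus, Cmult; simpl; f_equal; ring. Qed.

(** On each face [phi] preserves the distances to the three corners, so it is affine there. Its
    injectivity then transports [lattice_support] from the lattice to the images. *)
Lemma planar_layout (l : vertex -> vertex -> R) :
  is_PL_metric l -> isometric_to_open_set l ->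
  exists P : vertex -> C,
    (forall v v', adj v v' -> dist2 (P v) (P v') = l v v' ^ 2) /\
    nonoverlapping P /\
    (forall i j k, face i j k -> crs (P i) (P j) (P k) <> 0).
Proof.
  intros (Hsym & Hpos & Htri) (U & phi & _ & (_ & _ & psi & Hpsi & _) & Hiso).
  pose (P := fun v => phi (Defs.pos v)).
  assert (Hreal : forall i j k, face i j k ->
    exists A B D, realizes l i j k A B D /\ 0 < crs A B D).
  { intros i j k Hf.
    pose proof Hf as (H1 & H2 & H3).
    destruct (realization_exists (l i j) (l j k) (l k i)) as (A & B & D & HA & HB & HD & Hc);
      auto; try (apply Htri; auto using face_cycle).
    exists A, B, D; repeat split; auto. }
  assert (Hlen : forall i j k A B D, face i j k -> realizes l i j k A B D ->
    dist2 (P i) (P j) = dist2 A B /\ dist2 (P j) (P k) = dist2 B D /\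
    dist2 (P i) (P k) = dist2 A D /\
    forall a b c, barycentric a b c ->
      dist2 (phi (barycenter a b c (Defs.pos i) (Defs.pos j) (Defs.pos k))) (P i)
        = dist2 (barycenter a b c A B D) A /\
      dist2 (phi (barycenter a b c (Defs.pos i) (Defs.pos j) (Defs.pos k))) (P j)
        = dist2 (barycenter a b c A B D) B /\
      dist2 (phi (barycenter a b c (Defs.pos i) (Defs.pos j) (Defs.pos k))) (P k)
        = dist2 (barycenter a b c A B D) D).
  { intros i j k A B D Hf HR.
    pose proof (Hiso i j k Hf A B D HR) as HI.
    assert (b1 : forall A B D : C, barycenter 1 0 0 A B D = A).
    { intros [] [] []; rewrite barycenter_coord; simpl; f_equal; ring. }
    assert (b2 : forall A B D : C, barycenter 0 1 0 A B D = B).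
    { intros [] [] []; rewrite barycenter_coord; simpl; f_equal; ring. }
    assert (b3 : forall A B D : C, barycenter 0 0 1 A B D = D).
    { intros [] [] []; rewrite barycenter_coord; simpl; f_equal; ring. }
    assert (B1 : barycentric 1 0 0) by (unfold barycentric; lra).
    assert (B2 : barycentric 0 1 0) by (unfold barycentric; lra).
    assert (B3 : barycentric 0 0 1) by (unfold barycentric; lra).
    assert (HH : forall a b c, barycentric a b c ->
      dist2 (phi (barycenter a b c (Defs.pos i) (Defs.pos j) (Defs.pos k))) (P i)
        = dist2 (barycenter a b c A B D) A /\
      dist2 (phi (barycenter a b c (Defs.pos i) (Defs.pos j) (Defs.pos k))) (P j)
        = dist2 (barycenter a b c A B D) B /\
      dist2 (phi (barycenter a b c (Defs.pos i) (Defs.pos j) (Defs.pos k))) (P k)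
        = dist2 (barycenter a b c A B D) D).
    { intros a b c Hb.
      pose proof (HI _ _ _ _ _ _ B1 Hb) as E1.
      pose proof (HI _ _ _ _ _ _ B2 Hb) as E2.
      pose proof (HI _ _ _ _ _ _ B3 Hb) as E3.
      rewrite !b1 in E1; rewrite !b2 in E2; rewrite !b3 in E3.
      rewrite !dist2_Cmod. unfold P. rewrite E1, E2, E3. auto. }
    destruct (HH _ _ _ B1) as (_ & X12 & X13).
    destruct (HH _ _ _ B2) as (_ & _ & X23).
    rewrite !b1 in X12, X13; rewrite !b2 in X23. fold (P i) in X12, X13.
    fold (P j) in X23. auto. }
  assert (Hbary : forall i j k a b c, face i j k -> barycentric a b c ->
    phi (barycenter a b c (Defs.pos i) (Defs.pos j) (Defs.pos k))
    = barycenter a b c (P i) (P j) (P k) /\ crs (P i) (P j) (P k) <> 0).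
  { intros i j k a b c Hf Hb.
    destruct (Hreal i j k Hf) as (A & B & D & HR & Hc).
    destruct (Hlen i j k A B D Hf HR) as (E1 & E2 & E3 & HH).
    assert (Hc' : crs (P i) (P j) (P k) <> 0).
    { intros E0. pose proof (crs_sqr (P i) (P j) (P k)) as S1.
      pose proof (crs_sqr A B D) as S2. rewrite E1, E2, E3, <- S2, E0 in S1. nra. }
    split; [|assumption].
    destruct (HH a b c Hb) as (F1 & F2 & F3).
    destruct Hb as (_ & _ & _ & Hs).
    apply (equidistant_unique (P i) (P j) (P k)); auto.
    - rewrite F1, !dist2_barycenter, E1, E2, E3 by assumption. reflexivity.
    - rewrite F2, (barycenter_cycle a b c), (barycenter_cycle a b c (P i)).
      rewrite !dist2_barycenter by lra.
      rewrite (dist2_sym B A), (dist2_sym (P j) (P i)), (dist2_sym D A),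
        (dist2_sym (P k) (P i)), E1, E2, E3. reflexivity.
    - rewrite F3, <- (barycenter_cycle c a b), <- (barycenter_cycle c a b (P k)).
      rewrite !dist2_barycenter by lra.
      rewrite (dist2_sym D A), (dist2_sym (P k) (P i)), (dist2_sym D B),
        (dist2_sym (P k) (P j)), E1, E2, E3. reflexivity. }
  exists P. split; [|split].
  - intros v v' Hv.
    destruct (adj_unit _ _ Hv) as (d & Hd & ->).
    pose proof (face_left v d Hd) as Hf.
    destruct (Hreal _ _ _ Hf) as (A & B & D & HR & _).
    destruct (Hlen _ _ _ _ _ _ Hf HR) as (E1 & _).
    rewrite E1, dist2_Cmod. destruct HR as (-> & _). reflexivity.
  - intros i j k i' j' k' a b c a' b' c' Hf Hf' Hb Hb' [E1 E2].
    destruct (Hbary i j k a b c Hf Hb) as [F _].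
    destruct (Hbary i' j' k' a' b' c' Hf' Hb') as [F' _].
    assert (E : barycenter a b c (Defs.pos i) (Defs.pos j) (Defs.pos k)
              = barycenter a' b' c' (Defs.pos i') (Defs.pos j') (Defs.pos k')).
    { rewrite <- (Hpsi (barycenter a b c _ _ _)), F, barycenter_coord, E1, E2,
        <- barycenter_coord, <- F'. apply Hpsi. }
    rewrite !barycenter_coord, !pos_coord in E. simpl in E.
    injection E as E3 E4.
    assert (0 < sin (PI / 3)) as Hsin.
    { apply sin_gt_0; pose proof PI_RGT_0; lra. }
    assert (E5 : a * IZR (snd i) + b * IZR (snd j) + c * IZR (snd k)
      = a' * IZR (snd i') + b' * IZR (snd j') + c' * IZR (snd k')).
    { apply (Rmult_eq_reg_r (sin (PI / 3))); lra. }
    apply (lattice_support i j k i' j' k' a b c a' b' c'); auto.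
    apply (f_equal (fun t => t * cos (PI / 3))) in E5. lra.
  - intros i j k Hf. apply (Hbary i j k 1 0 0); auto.
    unfold barycentric; lra.
Qed.

(** * Orientation *)

Lemma barycentric_solve (A B D Z : C) : crs A B D <> 0 ->
  let u := crs Z B D / crs A B D in
  let v := crs A Z D / crs A B D in
  let w := crs A B Z / crs A B D in
  u + v + w = 1 /\
  fst Z = u * fst A + v * fst B + w * fst D /\
  snd Z = u * snd A + v * snd B + w * snd D.
Proof.
  intros Hc u v w; unfold u, v, w; clear u v w.
  destruct A as [a1 a2], B as [b1 b2], D as [d1 d2], Z as [z1 z2].
  unfold crs in *; simpl in *; repeat split; field; assumption.
Qed.

(** If both triangles lay on one side of their common edge, a point slightly off the midpoint [M]
    towards [D] would belong to both, with positive weight at [D]. *)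
Lemma opposite_sides (P : vertex -> C) (v d : vertex) :
  nonoverlapping P -> (forall i j k, face i j k -> crs (P i) (P j) (P k) <> 0) ->
  unit_vec d ->
  crs (P v) (P (vadd v d)) (P (vadd v (rot d)))
  * crs (P v) (P (vadd v d)) (P (vadd v (rotinv d))) < 0.
Proof.
  intros Hn Hc Hd.
  pose proof (face_left v d Hd) as Hf1. pose proof (face_right v d Hd) as Hf2.
  set (A := P v); set (B := P (vadd v d)); set (D := P (vadd v (rot d)));
  set (E := P (vadd v (rotinv d))).
  pose proof (Hc _ _ _ Hf1) as N1. pose proof (Hc _ _ _ Hf2) as N2.
  fold A B D in N1. fold A B E in N2.
  apply Rnot_le_lt; intros Hge.
  pose (c1 := crs A B D). pose (c2 := crs A B E).
  assert (Hq : 0 < c1 / c2).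
  { replace (c1 / c2) with ((c1 * c2) / (c2 * c2)) by (unfold c1, c2; field; assumption).
    apply Rdiv_lt_0_compat; [|apply (Rlt_0_sqr c2); exact N2].
    destruct Hge as [Hge | Hge]; [assumption|].
    symmetry in Hge. apply Rmult_integral in Hge. tauto. }
  pose (M := ((fst A + fst B) / 2, (snd A + snd B) / 2) : C).
  pose (e1 := (crs D B E / c2 - 1 / 2)). pose (e2 := (crs A D E / c2 - 1 / 2)).
  (* In the triangle [A], [B], [E] the point [Z] has weights 1/2 + s e1 at [A] and 1/2 + s e2 at
     [B]; this [s] is small enough to keep both nonnegative. *)
  pose (s := / (2 * (1 + Rabs e1 + Rabs e2))).
  pose proof (Rabs_pos e1). pose proof (Rabs_pos e2).
  assert (Hs : 0 < s) by (apply Rinv_0_lt_compat; lra).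
  assert (Hs1 : s * (2 * (1 + Rabs e1 + Rabs e2)) = 1) by (unfold s; field; lra).
  pose (Z := (fst M + s * (fst D - fst M), snd M + s * (snd D - snd M)) : C).
  destruct (barycentric_solve A B E Z N2) as (S1 & S2 & S3). fold c2 in S1, S2, S3.
  assert (Eu : crs Z B E / c2 = 1 / 2 + s * e1).
  { unfold e1, c2, Z, M, crs; simpl; field. exact N2. }
  assert (Ev : crs A Z E / c2 = 1 / 2 + s * e2).
  { unfold e2, c2, Z, M, crs; simpl; field. exact N2. }
  assert (Ew : crs A B Z / c2 = s * (c1 / c2)).
  { unfold c1, c2, Z, M, crs; simpl; field. exact N2. }
  assert (Hu : 0 <= 1 / 2 + s * e1).
  { pose proof (Rle_abs (- e1)) as K. rewrite Rabs_Ropp in K.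
    apply (Rmult_le_compat_l s) in K; [|lra].
    pose proof (Rmult_le_pos s (Rabs e2) ltac:(lra) ltac:(lra)). nra. }
  assert (Hv : 0 <= 1 / 2 + s * e2).
  { pose proof (Rle_abs (- e2)) as K. rewrite Rabs_Ropp in K.
    apply (Rmult_le_compat_l s) in K; [|lra].
    pose proof (Rmult_le_pos s (Rabs e1) ltac:(lra) ltac:(lra)). nra. }
  assert (s = 0); [|lra].
  apply (Hn (vadd v (rot d)) v (vadd v d) v (vadd v d) (vadd v (rotinv d))
    s ((1 - s) / 2) ((1 - s) / 2) (crs Z B E / c2) (crs A Z E / c2) (crs A B Z / c2)); auto.
  - now apply face_cycle, face_cycle.
  - unfold barycentric. assert (s <= 1) by nra. repeat split; lra.
  - unfold barycentric. rewrite Eu, Ev, Ew in *.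
    repeat split; try assumption. nra.
  - split.
    + fold A B D E. rewrite <- S2. unfold Z, M; simpl; field.
    + fold A B D E. rewrite <- S3. unfold Z, M; simpl; field.
  - rewrite <- (vadd_0_r v) at 2. intros K; apply vadd_cancel in K. revert K.
    now apply unit_nonzero, unit_rot.
  - intros K; apply vadd_cancel in K. revert K.
    destruct Hd as [-> | [-> | [-> | [-> | [-> | ->]]]]]; discriminate.
  - intros K; apply vadd_cancel in K. revert K.
    destruct Hd as [-> | [-> | [-> | [-> | [-> | ->]]]]]; discriminate.
Qed.

Lemma crs_cycle (A B D : C) : crs A B D = crs B D A.
Proof. unfold crs; ring. Qed.

Lemma crs_swap (A B D : C) : crs A B D = - crs A D B.
Proof. unfold crs; ring. Qed.

Lemma vertex_ind (Q : vertex -> Prop) :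
  Q (0, 0)%Z -> (forall v d, unit_vec d -> Q v -> Q (vadd v d)) -> forall v, Q v.
Proof.
  intros H0 Hs.
  assert (H1 : forall m, Q (m, 0)%Z).
  { intros m. pattern m. apply Z.bi_induction.
    - intros ? ? ->; tauto.
    - assumption.
    - intros z; split; intros Hz.
      + apply (Hs _ (1, 0)%Z) in Hz; [|unfold unit_vec; tauto].
        now replace (Z.succ z, 0)%Z with (vadd (z, 0)%Z (1, 0)%Z)
          by (unfold vadd; simpl; f_equal; lia).
      + apply (Hs _ (-1, 0)%Z) in Hz; [|unfold unit_vec; tauto].
        replace (z, 0)%Z with (vadd (Z.succ z, 0)%Z (-1, 0)%Z); [assumption|].
        unfold vadd; simpl; f_equal; lia. }
  intros [m n]. pattern n. apply Z.bi_induction.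
  - intros ? ? ->; tauto.
  - apply H1.
  - intros z; split; intros Hz.
    + apply (Hs _ (0, 1)%Z) in Hz; [|unfold unit_vec; tauto].
      replace (m, Z.succ z)%Z with (vadd (m, z)%Z (0, 1)%Z); [assumption|].
      unfold vadd; simpl; f_equal; lia.
    + apply (Hs _ (0, -1)%Z) in Hz; [|unfold unit_vec; tauto].
      replace (m, z)%Z with (vadd (m, Z.succ z)%Z (0, -1)%Z); [assumption|].
      unfold vadd; simpl; f_equal; lia.
Qed.

(** The sign passes from one triangle at a vertex to the next by [opposite_sides], and to a
    neighbouring vertex because a triangle at [v] is also one at [vadd v d]. *)
Lemma orientation_constant (P : vertex -> C) :
  nonoverlapping P -> (forall i j k, face i j k -> crs (P i) (P j) (P k) <> 0) ->
  oriented P \/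
  forall v d, unit_vec d -> crs (P v) (P (vadd v d)) (P (vadd v (rot d))) < 0.
Proof.
  intros Hn Hc.
  pose (S := fun v d => crs (P v) (P (vadd v d)) (P (vadd v (rot d)))).
  assert (H1 : forall v d, unit_vec d -> 0 < S v d -> 0 < S v (rot d)).
  { intros v d Hd HS.
    pose proof (opposite_sides P v (rot d) Hn Hc (unit_rot d Hd)) as K.
    rewrite rotinv_rot, (crs_swap _ _ (P (vadd v d))) in K.
    change (S v (rot d) * - S v d < 0) in K. nra. }
  assert (H1' : forall v d, unit_vec d -> S v d < 0 -> S v (rot d) < 0).
  { intros v d Hd HS.
    pose proof (opposite_sides P v (rot d) Hn Hc (unit_rot d Hd)) as K.
    rewrite rotinv_rot, (crs_swap _ _ (P (vadd v d))) in K.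
    change (S v (rot d) * - S v d < 0) in K. nra. }
  assert (Hall : forall (T : vertex -> Prop), (forall d, unit_vec d -> T d -> T (rot d)) ->
    forall d e, unit_vec d -> unit_vec e -> T d -> T e).
  { intros T HT d e Hd He H0.
    pose proof (HT _ Hd H0) as H2. pose proof (HT _ (unit_rot _ Hd) H2) as H3.
    pose proof (HT _ (unit_rot _ (unit_rot _ Hd)) H3) as H4.
    pose proof (HT _ (unit_rot _ (unit_rot _ (unit_rot _ Hd))) H4) as H5.
    pose proof (HT _ (unit_rot _ (unit_rot _ (unit_rot _ (unit_rot _ Hd)))) H5) as H6.
    destruct Hd as [-> | [-> | [-> | [-> | [-> | ->]]]]];
    unfold rot in *; simpl in *;
    destruct He as [-> | [-> | [-> | [-> | [-> | ->]]]]]; assumption. }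
  assert (Hmove : forall v d, S (vadd v d) (rot (rot d)) = S v d).
  { intros v d. unfold S.
    replace (vadd (vadd v d) (rot (rot d))) with (vadd v (rot d))
      by (destruct v, d; unfold vadd, rot; simpl; f_equal; ring).
    replace (vadd (vadd v d) (rot (rot (rot d)))) with v
      by (destruct v, d; unfold vadd, rot; simpl; f_equal; ring).
    now rewrite <- crs_cycle. }
  assert (u0 : unit_vec (1, 0)%Z) by (unfold unit_vec; tauto).
  pose proof (Hc _ _ _ (face_left (0, 0)%Z _ u0)) as N0.
  destruct (Rtotal_order (S (0, 0)%Z (1, 0)%Z) 0) as [K | [K | K]]; [right | tauto | left].
  - assert (forall v, forall d, unit_vec d -> S v d < 0); [|assumption].
    apply (vertex_ind (fun v => forall d, unit_vec d -> S v d < 0)).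
    + intros d Hd. apply (Hall (fun d => S (0, 0)%Z d < 0) (H1' (0, 0)%Z) (1, 0)%Z); auto.
    + intros v d Hd Hv e He.
      apply (Hall (fun e => S (vadd v d) e < 0) (H1' (vadd v d)) (rot (rot d)));
        auto using unit_rot.
      rewrite Hmove; auto.
  - assert (forall v, forall d, unit_vec d -> 0 < S v d); [|assumption].
    apply (vertex_ind (fun v => forall d, unit_vec d -> 0 < S v d)).
    + intros d Hd. apply (Hall (fun d => 0 < S (0, 0)%Z d) (H1 (0, 0)%Z) (1, 0)%Z); auto.
    + intros v d Hd Hv e He.
      apply (Hall (fun e => 0 < S (vadd v d) e) (H1 (vadd v d)) (rot (rot d)));
        auto using unit_rot.
      rewrite Hmove; auto.
Qed.

Lemma planar_oriented_layout (l : vertex -> vertex -> R) :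
  is_PL_metric l -> isometric_to_open_set l ->
  exists P : vertex -> C,
    (forall v v', adj v v' -> dist2 (P v) (P v') = l v v' ^ 2) /\
    nonoverlapping P /\ oriented P.
Proof.
  intros Hl Hi. destruct (planar_layout l Hl Hi) as (P & HP & Hn & Hc).
  destruct (orientation_constant P Hn Hc) as [Ho | Ho].
  - exists P; auto.
  (* Reflection reverses every orientation and keeps distances and incidences. *)
  - exists (fun v => Cconj (P v)). repeat split.
    + intros v v' Hv. rewrite <- (HP v v' Hv). unfold dist2, Cconj; simpl; ring.
    + intros i j k i' j' k' a b c a' b' c' Hf Hf' Hb Hb' [E1 E2].
      apply (Hn i j k i' j' k' a b c a' b' c'); auto.
      split; unfold Cconj in *; simpl in *; lra.
    + intros v d Hd. specialize (Ho v d Hd). unfold crs, Cconj in *; simpl in *. lra.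
Qed.

(** * Angles *)

Definition dotp (A B D : C) : R :=
  (fst B - fst A) * (fst D - fst A) + (snd B - snd A) * (snd D - snd A).

Definition cos_angle (A B D : C) : R :=
  dotp A B D / (sqrt (dist2 A B) * sqrt (dist2 A D)).

Definition angle (A B D : C) : R := acos (cos_angle A B D).

(** [t] is an argument of B - A, without reduction modulo 2 PI, so that arguments can be accumulated
    around a vertex. *)
Definition at_angle (A B : C) (t : R) : Prop :=
  fst B - fst A = sqrt (dist2 A B) * cos t /\
  snd B - snd A = sqrt (dist2 A B) * sin t.

Lemma dist2_nonneg (A B : C) : 0 <= dist2 A B.
Proof. apply Rplus_le_le_0_compat; apply pow2_ge_0. Qed.

Lemma dotp_crs (A B D : C) :
  dotp A B D ^ 2 + crs A B D ^ 2 = dist2 A B * dist2 A D.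
Proof. unfold dotp, crs, dist2; ring. Qed.

Lemma crs_pos_dist (A B D : C) : crs A B D <> 0 -> 0 < dist2 A B /\ 0 < dist2 A D.
Proof.
  intros H. pose proof (dotp_crs A B D) as E.
  pose proof (dist2_nonneg A B). pose proof (dist2_nonneg A D).
  assert (0 < crs A B D ^ 2) by (rewrite <- Rsqr_pow2; now apply Rlt_0_sqr).
  split; nra.
Qed.

Lemma at_angle_exists (A B : C) : 0 < dist2 A B -> exists t, at_angle A B t.
Proof.
  intros H. set (r := sqrt (dist2 A B)).
  assert (Hr : 0 < r) by now apply sqrt_lt_R0.
  assert (Hr2 : r * r = dist2 A B) by (apply sqrt_sqrt; lra).
  set (x := (fst B - fst A) / r). set (y := (snd B - snd A) / r).
  assert (Hxy : x * x + y * y = 1).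
  { unfold x, y. unfold dist2 in Hr2. field_simplify; [|lra].
    replace (r ^ 2) with (r * r) by ring. rewrite Hr2. field. unfold dist2 in H. nra. }
  assert (-1 <= x <= 1) by nra.
  assert (Ec : cos (acos x) = x) by (apply cos_acos; lra).
  assert (Es : sin (acos x) = sqrt (1 - x ^ 2)).
  { rewrite sin_acos by lra. rewrite Rsqr_pow2. reflexivity. }
  replace (1 - x ^ 2) with (y ^ 2) in Es by lra.
  destruct (Rle_dec 0 y) as [Hy | Hy].
  - exists (acos x). rewrite sqrt_pow2 in Es by assumption.
    split; [rewrite Ec | rewrite Es]; fold r; unfold x, y; field; lra.
  - exists (- acos x). rewrite <- (Rsqr_pow2 y), Rsqr_neg, Rsqr_pow2, sqrt_pow2 in Es by lra.
    split; [rewrite cos_neg, Ec | rewrite sin_neg, Es]; fold r; unfold x, y; field; lra.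
Qed.

Lemma cos_angle_spec (A B D : C) : crs A B D <> 0 ->
  cos_angle A B D ^ 2 = 1 - crs A B D ^ 2 / (dist2 A B * dist2 A D) /\
  -1 < cos_angle A B D < 1.
Proof.
  intros H. destruct (crs_pos_dist _ _ _ H) as [H1 H2].
  pose proof (dotp_crs A B D) as E.
  assert (E2 : cos_angle A B D ^ 2 = 1 - crs A B D ^ 2 / (dist2 A B * dist2 A D)).
  { unfold cos_angle, Rdiv. rewrite Rpow_mult_distr, pow_inv, Rpow_mult_distr.
    rewrite !pow2_sqrt by lra. rewrite <- E. field. rewrite E. nra. }
  split; [assumption|].
  assert (0 < crs A B D ^ 2 / (dist2 A B * dist2 A D)).
  { apply Rdiv_lt_0_compat; [|nra]. rewrite <- Rsqr_pow2; now apply Rlt_0_sqr. }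
  nra.
Qed.

Lemma angle_bound (A B D : C) : crs A B D <> 0 -> 0 < angle A B D < PI.
Proof.
  intros H. destruct (cos_angle_spec _ _ _ H) as [_ Hb].
  unfold angle. apply acos_bound_lt. assumption.
Qed.

Lemma sin_angle (A B D : C) : 0 < crs A B D ->
  sin (angle A B D) = crs A B D / (sqrt (dist2 A B) * sqrt (dist2 A D)).
Proof.
  intros H. assert (Hn : crs A B D <> 0) by lra.
  destruct (crs_pos_dist _ _ _ Hn) as [H1 H2].
  destruct (cos_angle_spec _ _ _ Hn) as [E Hb].
  unfold angle. rewrite sin_acos by lra. rewrite Rsqr_pow2, E.
  pose proof (sqrt_lt_R0 _ H1). pose proof (sqrt_lt_R0 _ H2).
  replace (1 - (1 - crs A B D ^ 2 / (dist2 A B * dist2 A D)))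
    with ((crs A B D / (sqrt (dist2 A B) * sqrt (dist2 A D))) ^ 2).
  - apply sqrt_pow2. apply Rlt_le, Rdiv_lt_0_compat; nra.
  - unfold Rdiv. rewrite Rpow_mult_distr, pow_inv, Rpow_mult_distr, !pow2_sqrt by lra. ring.
Qed.

Lemma at_angle_next (A B D : C) (t : R) : 0 < crs A B D -> at_angle A B t ->
  at_angle A D (t + angle A B D).
Proof.
  intros H [E1 E2]. assert (Hn : crs A B D <> 0) by lra.
  destruct (crs_pos_dist _ _ _ Hn) as [H1 H2].
  pose proof (sqrt_lt_R0 _ H1). pose proof (sqrt_lt_R0 _ H2).
  pose proof (sqrt_sqrt (dist2 A B) ltac:(lra)) as S1.
  destruct (cos_angle_spec _ _ _ Hn) as [_ Hb].
  pose proof (sin_angle _ _ _ H) as Hs.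
  assert (Hc : cos (angle A B D) = cos_angle A B D) by (apply cos_acos; lra).
  set (r := sqrt (dist2 A B)) in *. set (q := sqrt (dist2 A D)) in *.
  assert (Hct : cos t = (fst B - fst A) / r) by (rewrite E1; field; lra).
  assert (Hst : sin t = (snd B - snd A) / r) by (rewrite E2; field; lra).
  split.
  - fold q. rewrite cos_plus, Hc, Hs, Hct, Hst. unfold cos_angle. fold r q.
    apply (Rmult_eq_reg_r (r * r)); [|nra]. field_simplify; try lra.
    replace (r ^ 2) with (r * r) by ring. rewrite S1. unfold dotp, crs, dist2. ring.
  - fold q. rewrite sin_plus, Hc, Hs, Hct, Hst. unfold cos_angle. fold r q.
    apply (Rmult_eq_reg_r (r * r)); [|nra]. field_simplify; try lra.
    replace (r ^ 2) with (r * r) by ring. rewrite S1. unfold dotp, crs, dist2. ring.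
Qed.

Lemma cos_eq_1 (s : R) : cos s = 1 -> exists k : Z, s = 2 * IZR k * PI.
Proof.
  intros H. assert (sin (s / 2) = 0) as H0.
  { replace s with (2 * (s / 2)) in H by field. rewrite cos_2a_sin in H. nra. }
  apply sin_eq_0_0 in H0. destruct H0 as [k Hk]. exists k. lra.
Qed.

Lemma at_angle_diff (A B : C) (t t' : R) : 0 < dist2 A B ->
  at_angle A B t -> at_angle A B t' -> exists k : Z, t' - t = 2 * IZR k * PI.
Proof.
  intros H [E1 E2] [E3 E4]. apply cos_eq_1. rewrite cos_minus.
  pose proof (sqrt_lt_R0 _ H). set (r := sqrt (dist2 A B)) in *.
  assert (cos t' = cos t) by nra. assert (sin t' = sin t) by nra.
  pose proof (sin2_cos2 t) as K. unfold Rsqr in K. nra.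
Qed.

(** * The angles at a vertex *)

Definition dir (n : nat) : vertex := Nat.iter n rot (1, 0)%Z.

Lemma dir_unit (n : nat) : unit_vec (dir n).
Proof.
  induction n; simpl; [unfold unit_vec; tauto | now apply unit_rot].
Qed.

Lemma dir_period (n : nat) : dir (6 + n) = dir n.
Proof.
  unfold dir. simpl. destruct (Nat.iter n rot (1, 0)%Z). unfold rot; simpl; f_equal; ring.
Qed.

Fixpoint psum (f : nat -> R) (n : nat) : R :=
  match n with O => 0 | S m => psum f m + f m end.

Definition flower_angle (P : vertex -> C) (v : vertex) (n : nat) : R :=
  angle (P v) (P (vadd v (dir n))) (P (vadd v (dir (S n)))).

Lemma flower_crs (P : vertex -> C) (v : vertex) (n : nat) : oriented P ->
  0 < crs (P v) (P (vadd v (dir n))) (P (vadd v (dir (S n)))).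
Proof. intros Ho. apply Ho, dir_unit. Qed.

Lemma flower_at_angle (P : vertex -> C) (v : vertex) (t : R) (n : nat) : oriented P ->
  at_angle (P v) (P (vadd v (dir 0))) t ->
  at_angle (P v) (P (vadd v (dir n))) (t + psum (flower_angle P v) n).
Proof.
  intros Ho H0. induction n; simpl psum.
  - now rewrite Rplus_0_r.
  - rewrite <- Rplus_assoc. apply at_angle_next; [now apply flower_crs | assumption].
Qed.

Lemma psum_passes (f : nat -> R) (x : R) (n : nat) :
  0 <= x -> x < psum f n -> exists m, (m < n)%nat /\ psum f m <= x < psum f (S m).
Proof.
  intros H0. induction n; simpl; intros H; [lra|].
  destruct (Rle_dec (psum f n) x) as [K | K].
  - exists n; split; [lia | simpl; lra].
  - destruct IHn as (m & Hm & H1); [lra|]. exists m; split; [lia | assumption].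
Qed.

(** The ray from [A] to [E] starts inside the sector, so its points close to [A] lie in the
    triangle, wherever [E] itself is. The sector is half open, to include the ray through [B]. *)
Lemma sector_point (A B D E : C) (t s : R) :
  0 < crs A B D -> 0 < dist2 A E -> at_angle A B t -> at_angle A E (t + s) ->
  0 <= s < angle A B D ->
  exists x y z : R, 0 < x /\ x <= 1 /\ 0 <= y /\ 0 <= z /\ y + z <= 1 /\
    fst A + x * (fst E - fst A) = fst A + y * (fst B - fst A) + z * (fst D - fst A) /\
    snd A + x * (snd E - snd A) = snd A + y * (snd B - snd A) + z * (snd D - snd A).
Proof.
  intros H HE HB HEa Hs. assert (Hn : crs A B D <> 0) by lra.
  pose proof (at_angle_next _ _ _ _ H HB) as HD.
  destruct (angle_bound _ _ _ Hn) as [G1 G2].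
  destruct (crs_pos_dist _ _ _ Hn) as [H1 H2].
  set (w := angle A B D) in *.
  destruct HB as [B1 B2], HD as [D1 D2], HEa as [E1 E2].
  pose proof (sqrt_lt_R0 _ H1) as Q1. pose proof (sqrt_lt_R0 _ H2) as Q2.
  pose proof (sqrt_lt_R0 _ HE) as Q3.
  set (p := sqrt (dist2 A B)) in *. set (q := sqrt (dist2 A D)) in *.
  set (r := sqrt (dist2 A E)) in *.
  assert (K1 : 0 < sin w) by (apply sin_gt_0; lra).
  assert (K2 : 0 <= sin s) by (apply sin_ge_0; lra).
  assert (K3 : 0 < sin (w - s)) by (apply sin_gt_0; lra).
  set (y := sin (w - s) / (p * sin w)). set (z := sin s / (q * sin w)).
  assert (0 < y) by (apply Rdiv_lt_0_compat; nra).
  assert (0 <= z).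
  { apply Rmult_le_pos; [lra|]. apply Rlt_le, Rinv_0_lt_compat; nra. }
  assert (Xc : cos (t + s) = y * (fst B - fst A) + z * (fst D - fst A)).
  { rewrite B1, D1. unfold y, z. apply (Rmult_eq_reg_r (sin w)); [|lra].
    transitivity (sin (w - s) * cos t + sin s * cos (t + w)); [|field; lra].
    rewrite sin_minus, !cos_plus. ring. }
  assert (Xs : sin (t + s) = y * (snd B - snd A) + z * (snd D - snd A)).
  { rewrite B2, D2. unfold y, z. apply (Rmult_eq_reg_r (sin w)); [|lra].
    transitivity (sin (w - s) * sin t + sin s * sin (t + w)); [|field; lra].
    rewrite sin_minus, !sin_plus. ring. }
  (* Shrinks the unit vector at angle t + s until it fits both into the segment from [A] to [E] and
     into the triangle. *)
  set (h := / (1 + / r + y + z)).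
  assert (0 < / r) by now apply Rinv_0_lt_compat.
  assert (0 < h) by (apply Rinv_0_lt_compat; lra).
  assert (Hh : h * (1 + / r + y + z) = 1) by (unfold h; apply Rinv_l; lra).
  exists (h * / r), (h * y), (h * z).
  assert (0 < h * / r) by nra. assert (0 < h * y) by nra. assert (0 <= h * z) by nra.
  rewrite !Rmult_plus_distr_l, Rmult_1_r in Hh.
  repeat split; try lra.
  - rewrite E1, Xc. field. lra.
  - rewrite E2, Xs. field. lra.
Qed.

(** The neighbours close up after six steps, so the sum is a multiple of 2 PI, strictly between 0
    and 6 PI. If it were 4 PI, the edge to the first neighbour would, after one full turn, run into
    another triangle. *)
Lemma flower_angle_sum (P : vertex -> C) (v : vertex) :
  oriented P -> nonoverlapping P -> psum (flower_angle P v) 6 = 2 * PI.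
Proof.
  intros Ho Hn.
  assert (Hpos : forall n, 0 < dist2 (P v) (P (vadd v (dir n)))).
  { intros n. pose proof (flower_crs P v n Ho) as K.
    apply (crs_pos_dist _ _ _ (Rgt_not_eq _ _ K)). }
  destruct (at_angle_exists _ _ (Hpos 0%nat)) as [t Ht].
  pose proof (flower_at_angle P v t 6 Ho Ht) as H6.
  change (dir 6) with (dir 0) in H6.
  destruct (at_angle_diff _ _ _ _ (Hpos 0%nat) Ht H6) as [k Hk].
  assert (Hb : forall n, 0 < flower_angle P v n < PI).
  { intros n. apply angle_bound. apply Rgt_not_eq. now apply flower_crs. }
  pose proof PI_RGT_0 as HPI.
  assert (E : psum (flower_angle P v) 6 = 2 * IZR k * PI) by lra.
  pose proof (Hb 0%nat); pose proof (Hb 1%nat); pose proof (Hb 2%nat);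
  pose proof (Hb 3%nat); pose proof (Hb 4%nat); pose proof (Hb 5%nat).
  assert (0 < psum (flower_angle P v) 6 < 6 * PI) by (simpl; lra).
  assert (k = 1 \/ k = 2)%Z as [-> | ->].
  { assert (0 < k < 3)%Z; [|lia]. split; apply lt_IZR; nra. }
  - lra.
  - exfalso.
    assert (E4 : psum (flower_angle P v) 6 = 4 * PI) by lra.
    (* The first full turn ends in sector [m]. Each angle being less than PI, this is neither the
       first nor the last sector, so neither of its sides is the edge [dir 0]. *)
    destruct (psum_passes (flower_angle P v) (2 * PI) 6) as (m & Hm & Hm1); [lra | lra |].
    assert (m <> 0)%nat by (intros ->; simpl in Hm1; lra).
    assert (m <> 5)%nat.
    { intros ->. rewrite E4 in Hm1. simpl in E4, Hm1. lra. }
    pose proof (flower_at_angle P v t m Ho Ht) as Am.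
    assert (A0 : at_angle (P v) (P (vadd v (dir 0)))
      (t + psum (flower_angle P v) m + (2 * PI - psum (flower_angle P v) m))).
    { replace (t + psum (flower_angle P v) m + (2 * PI - psum (flower_angle P v) m))
        with (t + 2 * PI) by ring.
      destruct Ht as [T1 T2]. split; rewrite ?cos_plus, ?sin_plus, cos_2PI, sin_2PI; lra. }
    simpl in Hm1.
    destruct (sector_point _ _ _ _ _ _ (flower_crs P v m Ho) (Hpos 0%nat) Am A0)
      as (x & y & z & X1 & X2 & Y & Z & YZ & F1 & F2).
    { fold (flower_angle P v m). lra. }
    assert (x = 0); [|lra].
    apply (Hn (vadd v (dir 0)) v (vadd v (dir 1)) v (vadd v (dir m)) (vadd v (dir (S m)))
      x (1 - x) 0 (1 - y - z) y z).
    + apply face_swap, face_cycle, face_left, (dir_unit 0).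
    + apply face_left, dir_unit.
    + unfold barycentric; lra.
    + unfold barycentric; lra.
    + split; lra.
    + intros K. symmetry in K. revert K. apply adj_irrefl, adj_vadd, (dir_unit 0).
    + intros K. apply vadd_cancel in K.
      destruct m as [|[|[|[|[|[|m]]]]]]; try lia; discriminate K.
    + intros K. apply vadd_cancel in K.
      destruct m as [|[|[|[|[|[|m]]]]]]; try lia; discriminate K.
Qed.

(* On one side of a line through [P v], positivity of [crs] would be a strict
   order on the six neighbours. *)
Lemma flower_not_separated (P : vertex -> C) (v : vertex) (x y : R) : oriented P ->
  ~ (forall d, unit_vec d ->
      0 < x * (fst (P (vadd v d)) - fst (P v)) + y * (snd (P (vadd v d)) - snd (P v))).
Proof.
  intros Ho H.
  pose (f := fun n => x * (fst (P (vadd v (dir n))) - fst (P v))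
                    + y * (snd (P (vadd v (dir n))) - snd (P v))).
  pose (g := fun n => x * (snd (P (vadd v (dir n))) - snd (P v))
                    - y * (fst (P (vadd v (dir n))) - fst (P v))).
  assert (Hf : forall n, 0 < f n) by (intros n; apply H, dir_unit).
  assert (Hxy : 0 < x ^ 2 + y ^ 2).
  { pose proof (Hf 0%nat) as K. unfold f in K.
    destruct (Req_dec x 0) as [-> | ]; [destruct (Req_dec y 0) as [-> | ]|]; nra. }
  assert (Hg : forall n, g n / f n < g (S n) / f (S n)).
  { intros n. pose proof (flower_crs P v n Ho) as K.
    pose proof (Hf n). pose proof (Hf (S n)).
    assert (0 < f n * g (S n) - f (S n) * g n).
    { replace (f n * g (S n) - f (S n) * g n)
        with ((x ^ 2 + y ^ 2) * crs (P v) (P (vadd v (dir n))) (P (vadd v (dir (S n)))))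
        by (unfold f, g, crs; ring). nra. }
    apply Rlt_0_minus.
    replace (g (S n) / f (S n) - g n / f n)
      with ((f n * g (S n) - f (S n) * g n) / (f n * f (S n))) by (field; lra).
    apply Rdiv_lt_0_compat; nra. }
  pose proof (Hg 0%nat); pose proof (Hg 1%nat); pose proof (Hg 2%nat);
  pose proof (Hg 3%nat); pose proof (Hg 4%nat); pose proof (Hg 5%nat) as H5.
  change (g 6%nat) with (g 0%nat) in H5. change (f 6%nat) with (f 0%nat) in H5. lra.
Qed.

(** * Triangles in terms of radii *)

Definition sqr_length (p x y : R) : R := x ^ 2 + y ^ 2 + 2 * p * x * y.

(* Inner product, up to a positive factor, of the centre of a triangle with
   the normal of its first edge: positive exactly when the centre lies on the
   inner side. *)
Definition inner_side (p q s x y z : R) : R :=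
  x * y * (1 - p ^ 2) + y * z * (q + p * s) + x * z * (s + p * q).

Lemma dotp_dist (A B D : C) :
  2 * dotp A B D = dist2 A B + dist2 A D - dist2 B D.
Proof. unfold dotp, dist2; ring. Qed.

Lemma center_exists (A B D : C) (x y z : R) : crs A B D <> 0 ->
  exists p : C, is_center A B D x y z p /\
    2 * (crs A B p * crs A B D)
    = dist2 A B * (dist2 A D + x ^ 2 - z ^ 2)
      - dotp A B D * (dist2 A B + x ^ 2 - y ^ 2).
Proof.
  intros H.
  pose (f := (dist2 A B + x ^ 2 - y ^ 2) / 2).
  pose (e := (dist2 A D + x ^ 2 - z ^ 2) / 2).
  pose (k := crs A B D).
  pose (z1 := (f * (snd D - snd A) - e * (snd B - snd A)) / k).
  pose (z2 := (e * (fst B - fst A) - f * (fst D - fst A)) / k).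
  exists (fst A + z1, snd A + z2).
  assert (Ef : z1 * (fst B - fst A) + z2 * (snd B - snd A) = f).
  { unfold z1, z2, k, crs in *; field; exact H. }
  assert (Ee : z1 * (fst D - fst A) + z2 * (snd D - snd A) = e).
  { unfold z1, z2, k, crs in *; field; exact H. }
  unfold is_center. rewrite !Cmod_sqr. simpl. split; [split|].
  - unfold f, dist2 in Ef. nra.
  - unfold f, e, dist2 in Ef, Ee. nra.
  - transitivity (2 * (dist2 A B * e - dotp A B D * f)); [|unfold e, f; field].
    rewrite <- Ef, <- Ee. unfold crs, dist2, dotp; simpl. ring.
Qed.

Lemma height_formula (l : vertex -> vertex -> R) (r : vertex -> R) (i j k : vertex)
    (p q s : R) :
  0 < l i j -> 0 < l j k -> 0 < l k i ->
  l i j < l j k + l k i -> l j k < l k i + l i j -> l k i < l i j + l j k ->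
  l i j ^ 2 = sqr_length p (r i) (r j) -> l k i ^ 2 = sqr_length q (r i) (r k) ->
  l j k ^ 2 = sqr_length s (r j) (r k) ->
  exists c : R, 0 < c /\
    c ^ 2 = l i j ^ 2 * l k i ^ 2 - ((l i j ^ 2 + l k i ^ 2 - l j k ^ 2) / 2) ^ 2 /\
    is_height l r i j k
      (r i * r j * inner_side p q s (r i) (r j) (r k) / (c * l i j)).
Proof.
  intros H1 H2 H3 T1 T2 T3 E1 E2 E3.
  destruct (realization_exists (l i j) (l j k) (l k i)) as (A & B & D & RA & RB & RD & Hc);
    try assumption.
  exists (crs A B D).
  assert (F1 : dist2 A B = l i j ^ 2) by (rewrite dist2_Cmod; congruence).
  assert (F2 : dist2 B D = l j k ^ 2) by (rewrite dist2_Cmod; congruence).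
  assert (F3 : dist2 A D = l k i ^ 2) by (rewrite dist2_sym, dist2_Cmod; congruence).
  pose proof (dotp_dist A B D) as Hd.
  split; [assumption | split].
  - pose proof (dotp_crs A B D) as K. rewrite <- F1, <- F2, <- F3.
    replace ((dist2 A B + dist2 A D - dist2 B D) / 2) with (dotp A B D) by lra. lra.
  - destruct (center_exists A B D (r i) (r j) (r k)) as (z & Hz & Ez); [lra|].
    exists A, B, D, z. split; [|split; [assumption|]].
    { repeat split; assumption. }
    unfold signed_distance. rewrite RA.
    assert (forall X Y, cross (X - A) (Y - A) = crs A X Y) as Hcross.
    { intros X Y. unfold cross, crs, Im, Cmult, Cconj, Cminus, Cplus, Copp; simpl; ring. }
    rewrite !Hcross, (sign_eq_1 _ Hc), Rmult_1_l.
    apply (Rmult_eq_reg_r (l i j * crs A B D)); [|nra].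
    transitivity (r i * r j * inner_side p q s (r i) (r j) (r k)); [field; lra|].
    transitivity (crs A B z * crs A B D); [|field; lra].
    apply (Rmult_eq_reg_l 4); [|lra].
    transitivity (2 * (2 * (crs A B z * crs A B D))); [|ring]. rewrite Ez.
    replace (dotp A B D) with ((dist2 A B + dist2 A D - dist2 B D) / 2) by lra.
    rewrite F1, F2, F3, E1, E2, E3. unfold inner_side, sqr_length. field.
Qed.

(** After division by z^2 the right side no longer depends on the far vertex, and it is symmetric in
    [q] and [s]: the two triangles on an edge lead to the same constant. *)
Lemma inner_side_sqr (p q s x y z c : R) :
  c ^ 2 = sqr_length p x y * sqr_length q x z
    - ((sqr_length p x y + sqr_length q x z - sqr_length s y z) / 2) ^ 2 ->
  inner_side p q s x y z ^ 2 + (p ^ 2 - 1) * c ^ 2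
  = z ^ 2 * sqr_length p x y * (p ^ 2 + q ^ 2 + s ^ 2 + 2 * p * q * s - 1).
Proof.
  intros ->. unfold inner_side, sqr_length. field.
Qed.

Lemma sqr_lt (x y : R) : 0 <= x -> x < y -> x ^ 2 < y ^ 2.
Proof. nra. Qed.

Lemma sqr_lt_inv (x y : R) : 0 <= y -> x ^ 2 < y ^ 2 -> x < y.
Proof. intros H1 H2. destruct (Rlt_dec x y); [assumption|]. nra. Qed.

Lemma ratio_compare (k m g m' g' : R) : 0 < k -> 0 < g -> 0 < g' ->
  m ^ 2 + k * g ^ 2 = m' ^ 2 + k * g' ^ 2 -> m' < 0 -> 0 <= m -> m < - m' -> g' < g.
Proof.
  intros Hk Hg Hg' E H1 H2 H3. apply sqr_lt_inv; [lra|].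
  pose proof (sqr_lt m (- m') H2 H3).
  apply (Rmult_lt_reg_l k); [assumption|]. nra.
Qed.

(** On a curve m^2 + k g^2 = const with g > 0, the quotient m / g is an odd increasing function of
    m; hence m / g + m' / g' has the sign of m + m'. *)
Lemma ratio_sum_nonneg (k m g m' g' : R) : 0 < k -> 0 < g -> 0 < g' ->
  m ^ 2 + k * g ^ 2 = m' ^ 2 + k * g' ^ 2 -> 0 <= m / g + m' / g' -> 0 <= m + m'.
Proof.
  intros Hk Hg Hg' E H.
  assert (H1 : 0 <= m * g' + m' * g).
  { replace (m * g' + m' * g) with ((m / g + m' / g') * (g * g')) by (field; lra).
    apply Rmult_le_pos; nra. }
  destruct (Rle_dec 0 (m + m')) as [|N]; [assumption | exfalso].
  apply Rnot_le_lt in N.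
  destruct (Rle_dec 0 m) as [M | M]; destruct (Rle_dec 0 m') as [M' | M']; try nra.
  - assert (g' < g) by (apply (ratio_compare k m g m' g'); lra). nra.
  - assert (g < g') by (apply (ratio_compare k m' g' m g); lra). nra.
Qed.

Lemma ratio_sum_pos (k m g m' g' : R) : 0 < k -> 0 < g -> 0 < g' ->
  m ^ 2 + k * g ^ 2 = m' ^ 2 + k * g' ^ 2 -> 0 <= m + m' ->
  0 <= m / g + m' / g' /\ (m / g + m' / g' = 0 -> m + m' = 0).
Proof.
  intros Hk Hg Hg' E H.
  assert (H1 : m / g + m' / g' = (m * g' + m' * g) / (g * g')) by (field; lra).
  assert (Hgg : 0 < / (g * g')) by (apply Rinv_0_lt_compat; nra).
  assert (H2 : 0 <= m * g' + m' * g /\ (m * g' + m' * g = 0 -> m + m' = 0)).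
  { destruct (Req_dec (m + m') 0) as [K | K].
    - assert (m' = - m) by lra. subst m'.
      assert (g = g').
      { assert (k * (g ^ 2 - g' ^ 2) = 0) as Z by nra. apply Rmult_integral in Z.
        destruct Z as [Z | Z]; [lra|]. nra. }
      subst. split; [lra | auto].
    - destruct (Rle_dec 0 m) as [M | M]; destruct (Rle_dec 0 m') as [M' | M'].
      + split; [nra|]. intros. assert (m = 0) by nra. assert (m' = 0) by nra. lra.
      + assert (g < g').
        { apply sqr_lt_inv; [lra|]. pose proof (sqr_lt (- m') m ltac:(lra) ltac:(lra)).
          apply (Rmult_lt_reg_l k); [assumption|]. nra. }
        split; [nra | intros; nra].
      + assert (g' < g).
        { apply sqr_lt_inv; [lra|]. pose proof (sqr_lt (- m) m' ltac:(lra) ltac:(lra)).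
          apply (Rmult_lt_reg_l k); [assumption|]. nra. }
        split; [nra | intros; nra].
      + lra. }
  rewrite H1. unfold Rdiv. destruct H2 as [H2 H3]. split; [nra|].
  intros K. apply H3. apply Rmult_integral in K. lra.
Qed.

(* For [p > 1] the heights on both sides have the form [m / c] with
   [m ^ 2 + (p ^ 2 - 1) c ^ 2] the same, so the sign of their sum is that of a
   linear expression in the inverse radii. *)
Lemma Delaunay_linear (l : vertex -> vertex -> R) (r : vertex -> R) (i j k k' : vertex)
    (p q s : R) :
  is_PL_metric l -> weighted_Delaunay l r -> (forall v, 0 < r v) ->
  face i j k -> face i j k' -> k <> k' ->
  l i j ^ 2 = sqr_length p (r i) (r j) ->
  l k i ^ 2 = sqr_length q (r i) (r k) -> l j k ^ 2 = sqr_length s (r j) (r k) ->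
  l k' i ^ 2 = sqr_length s (r i) (r k') -> l j k' ^ 2 = sqr_length q (r j) (r k') ->
  1 < p -> (p - 1) * (/ r k + / r k') <= (q + s) * (/ r i + / r j).
Proof.
  intros (Hsym & Hpos & Htri) HD Hr Hf Hf' Hk E1 E2 E3 E4 E5 Hp.
  pose proof Hf as (A1 & A2 & A3). pose proof Hf' as (_ & A4 & A5).
  destruct (height_formula l r i j k p q s) as (c & Hc & Ec & Hh); auto;
    try (apply Htri; auto using face_cycle).
  destruct (height_formula l r i j k' p s q) as (c' & Hc' & Ec' & Hh'); auto;
    try (apply Htri; auto using face_cycle).
  pose proof (HD i j k k' Hf Hf' Hk _ _ Hh Hh') as H.
  rewrite E1, E2, E3 in Ec. rewrite E1, E4, E5 in Ec'.
  pose proof (inner_side_sqr p q s _ _ _ _ Ec) as S1.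
  pose proof (inner_side_sqr p s q _ _ _ _ Ec') as S2.
  pose proof (Hr i). pose proof (Hr j). pose proof (Hr k). pose proof (Hr k').
  pose proof (Hpos i j A1).
  set (M := inner_side p q s (r i) (r j) (r k)) in *.
  set (M' := inner_side p s q (r i) (r j) (r k')) in *.
  assert (0 <= M / r k + M' / r k') as K.
  { apply (ratio_sum_nonneg (p ^ 2 - 1) _ (c / r k) _ (c' / r k')).
    - nra.
    - apply Rdiv_lt_0_compat; lra.
    - apply Rdiv_lt_0_compat; lra.
    - transitivity ((M ^ 2 + (p ^ 2 - 1) * c ^ 2) / r k ^ 2); [field; lra|].
      transitivity ((M' ^ 2 + (p ^ 2 - 1) * c' ^ 2) / r k' ^ 2); [|field; lra].
      rewrite S1, S2. field. lra.
    - replace (M / r k / (c / r k) + M' / r k' / (c' / r k')) with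
        ((r i * r j * M / (c * l i j) + r i * r j * M' / (c' * l i j))
          * (l i j / (r i * r j))) by (field; repeat split; lra).
      apply Rmult_le_pos; [assumption|]. apply Rlt_le, Rdiv_lt_0_compat; nra. }
  apply Rminus_le_0.
  replace ((q + s) * (/ r i + / r j) - (p - 1) * (/ r k + / r k'))
    with ((M / r k + M' / r k') / ((1 + p) * r i * r j))
    by (unfold M, M', inner_side; field; lra).
  apply Rmult_le_pos; [assumption|]. apply Rlt_le, Rinv_0_lt_compat. repeat apply Rmult_lt_0_compat; lra.
Qed.

(** * The maximum principle *)

(** Outside [-1, 1] the function [acos] has the constant values PI and 0. It is thus monotone and
    continuous on the whole line, which covers degenerate triangles, whose cosine is 1 or -1. *)
Lemma acos_decreasing (x y : R) : x <= y -> acos y <= acos x.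
Proof.
  intros H.
  destruct (Rle_dec 1 y) as [Hy | Hy].
  { replace (acos y) with 0; [apply acos_bound|]. unfold acos.
    destruct (Rle_dec y (-1)); [lra|]. destruct (Rle_dec 1 y); [reflexivity | lra]. }
  destruct (Rle_dec x (-1)) as [Hx | Hx].
  { replace (acos x) with PI; [apply acos_bound|]. unfold acos.
    destruct (Rle_dec x (-1)); [reflexivity | lra]. }
  apply Rnot_lt_le; intros K.
  pose proof (acos_bound x). pose proof (acos_bound y).
  apply cos_decreasing_1 in K; try lra. rewrite !cos_acos in K; lra.
Qed.

Lemma acos_upper (x eps : R) : 0 < eps ->
  exists delta, 0 < delta /\ forall y, x - delta < y -> acos y < acos x + eps.
Proof.
  intros He. pose proof (acos_bound x) as Hb.
  destruct (Rlt_dec PI (acos x + eps)) as [H | H].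
  { exists 1; split; [lra|]. intros y _. pose proof (acos_bound y). lra. }
  apply Rnot_lt_le in H.
  assert (Hx : -1 < x).
  { apply Rnot_le_lt; intros K. revert H. unfold acos.
    destruct (Rle_dec x (-1)); lra. }
  assert (Hc : cos (acos x) <= x).
  { destruct (Rle_dec x 1); [rewrite cos_acos; lra|].
    pose proof (COS_bound (acos x)); lra. }
  assert (Hz : cos (acos x + eps / 2) < cos (acos x)) by (apply cos_decreasing_1; lra).
  exists (x - cos (acos x + eps / 2)). split; [lra|]. intros y Hy.
  apply Rle_lt_trans with (acos (cos (acos x + eps / 2))).
  - apply acos_decreasing; lra.
  - rewrite acos_cos; lra.
Qed.

Lemma continuous_acos (x : R) : continuous acos x.
Proof.
  apply continuity_pt_filterlim. intros eps He.
  destruct (acos_upper x eps He) as (d1 & D1 & H1).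
  (* The lower estimate is the upper one at -x, since acos (-x) = PI - acos x. *)
  destruct (acos_upper (- x) eps He) as (d2 & D2 & H2).
  exists (Rmin d1 d2). split; [apply Rmin_pos; assumption|].
  intros y [_ Hy]. unfold dist in *; simpl in *. unfold Rdist in *.
  pose proof (Rmin_l d1 d2). pose proof (Rmin_r d1 d2).
  apply Rabs_def2 in Hy.
  pose proof (H1 y ltac:(lra)). pose proof (H2 (- y) ltac:(lra)) as K.
  rewrite !acos_opp in K. apply Rabs_def1; lra.
Qed.

Lemma is_derive_acos (x : R) : -1 < x < 1 -> is_derive acos x (- / sqrt (1 - x ^ 2)).
Proof.
  intros H. apply is_derive_Reals.
  pose proof (derive_pt_acos x H) as K. apply derive_pt_eq_1 in K.
  rewrite Rsqr_pow2 in K. replace (- / sqrt (1 - x ^ 2)) with (-1 / sqrt (1 - x ^ 2)); [assumption|].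
  unfold Rdiv; ring.
Qed.

Definition base_norm (p x : R) : R := 1 + x ^ 2 + 2 * p * x.

(* The cosine of the angle at the first vertex, in terms of the inverse radii
   [x], [y] of the other two vertices, that of the first one being [1]. *)
Definition cosF (p q s x y : R) : R :=
  (x * y + p * y + q * x - s) / (sqrt (base_norm p x) * sqrt (base_norm q y)).

(** For a triangle with radii 1, 1/x, 1/y this is x^2 y^2 times the square of [crs], so it vanishes
    exactly for degenerate triangles. *)
Definition quad (p q s x y : R) : R :=
  (1 - s ^ 2) + (1 - q ^ 2) * x ^ 2 + (1 - p ^ 2) * y ^ 2
  + 2 * (s + p * q) * x * y + 2 * (q + p * s) * y + 2 * (p + q * s) * x.

(** This is x y times [inner_side] at the radii 1, 1/x, 1/y: it has the sign of the distance of the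
    center from the edge of weight [p]. *)
Definition side (p q s x y : R) : R :=
  y * (1 - p ^ 2) + (q + p * s) + x * (s + p * q).

Lemma base_norm_pos (p x : R) : -1 < p -> 0 < x -> 0 < base_norm p x.
Proof.
  intros Hp Hx. unfold base_norm. assert (0 <= (1 - x) ^ 2) by apply pow2_ge_0. nra.
Qed.

Lemma quad_eq (p q s x y : R) :
  base_norm p x * base_norm q y - (x * y + p * y + q * x - s) ^ 2 = quad p q s x y.
Proof. unfold base_norm, quad; ring. Qed.

Lemma side_sqr (p q s x y : R) :
  side p q s x y ^ 2 + (p ^ 2 - 1) * quad p q s x y
  = base_norm p x * (p ^ 2 + q ^ 2 + s ^ 2 + 2 * p * q * s - 1).
Proof. unfold base_norm, quad, side; ring. Qed.

Lemma cosF_sqr (p q s x y : R) : -1 < p -> -1 < q -> 0 < x -> 0 < y ->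
  1 - cosF p q s x y ^ 2 = quad p q s x y / (base_norm p x * base_norm q y).
Proof.
  intros Hp Hq Hx Hy.
  pose proof (base_norm_pos p x Hp Hx). pose proof (base_norm_pos q y Hq Hy).
  unfold cosF, Rdiv. rewrite Rpow_mult_distr, pow_inv, Rpow_mult_distr, !pow2_sqrt by lra.
  rewrite <- quad_eq. field. lra.
Qed.

(** The classical formula: the derivative of the angle at one vertex with respect to the logarithm
    of the radius at another is h / l, signed height over edge length. Passing to inverse radii
    produces the minus sign. *)
Lemma is_derive_angle (p q s x y dx dy t : R) :
  let xt := x + t * dx in let yt := y + t * dy in
  -1 < p -> -1 < q -> 0 < xt -> 0 < yt -> 0 < quad p q s xt yt ->
  is_derive (fun t => acos (cosF p q s (x + t * dx) (y + t * dy))) t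
    (- (dx * (side p q s xt yt / (base_norm p xt * sqrt (quad p q s xt yt)))
        + dy * (side q p s yt xt / (base_norm q yt * sqrt (quad p q s xt yt))))).
Proof.
  intros xt yt Hp Hq Hx Hy HQ.
  pose proof (base_norm_pos p xt Hp Hx) as N1. pose proof (base_norm_pos q yt Hq Hy) as N2.
  pose proof (sqrt_lt_R0 _ N1) as S1. pose proof (sqrt_lt_R0 _ N2) as S2.
  pose proof (sqrt_lt_R0 _ HQ) as S3.
  pose proof (cosF_sqr p q s xt yt Hp Hq Hx Hy) as E.
  assert (Hpos : 0 < 1 - cosF p q s xt yt ^ 2).
  { rewrite E. apply Rdiv_lt_0_compat; nra. }
  assert (Hb : -1 < cosF p q s xt yt < 1) by nra.
  assert (Hs : sqrt (1 - cosF p q s xt yt ^ 2)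
    = sqrt (quad p q s xt yt) / (sqrt (base_norm p xt) * sqrt (base_norm q yt))).
  { rewrite E, sqrt_div by nra. rewrite sqrt_mult by lra. reflexivity. }
  assert (Hd : is_derive (fun t => cosF p q s (x + t * dx) (y + t * dy)) t
    ((dx * (side p q s xt yt / base_norm p xt) + dy * (side q p s yt xt / base_norm q yt))
      / (sqrt (base_norm p xt) * sqrt (base_norm q yt)))).
  { unfold cosF, base_norm. auto_derive.
    - fold xt yt. unfold base_norm in *. repeat split; try lra.
      replace (1 + xt * (xt * 1) + 2 * p * xt) with (1 + xt ^ 2 + 2 * p * xt) by ring.
      replace (1 + yt * (yt * 1) + 2 * q * yt) with (1 + yt ^ 2 + 2 * q * yt) by ring.
      apply Rgt_not_eq. nra.
    - fold xt yt.
      replace (1 + xt * (xt * 1) + 2 * p * xt) with (base_norm p xt) by (unfold base_norm; ring).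
      replace (1 + yt * (yt * 1) + 2 * q * yt) with (base_norm q yt) by (unfold base_norm; ring).
      replace (1 + xt ^ 2 + 2 * p * xt) with (base_norm p xt) by reflexivity.
      replace (1 + yt ^ 2 + 2 * q * yt) with (base_norm q yt) by reflexivity.
      set (a := sqrt (base_norm p xt)) in *. set (b := sqrt (base_norm q yt)) in *.
      assert (Ea : base_norm p xt = a * a) by (symmetry; apply sqrt_sqrt; lra).
      assert (Eb : base_norm q yt = b * b) by (symmetry; apply sqrt_sqrt; lra).
      assert (F1 : side p q s xt yt
        = (yt + q) * (a * a) - (xt * yt + p * yt + q * xt - s) * (xt + p))
        by (rewrite <- Ea; unfold side, base_norm; ring).
      assert (F2 : side q p s yt xt
        = (xt + p) * (b * b) - (xt * yt + p * yt + q * xt - s) * (yt + q))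
        by (rewrite <- Eb; unfold side, base_norm; ring).
      rewrite Ea, Eb, F1, F2. field. lra. }
  pose proof (is_derive_comp acos (fun t => cosF p q s (x + t * dx) (y + t * dy)) t _ _
    (is_derive_acos _ Hb) Hd) as K.
  match type of Hd with is_derive _ _ ?D =>
    change (is_derive (fun t => acos (cosF p q s (x + t * dx) (y + t * dy))) t
      (D * - / sqrt (1 - cosF p q s xt yt ^ 2))) in K
  end.
  match type of K with is_derive _ _ ?D =>
    match goal with |- is_derive _ _ ?D' =>
      assert (Eq : D = D') by (rewrite Hs; field; repeat split; lra)
    end
  end.
  rewrite <- Eq. exact K.
Qed.

(** * The cone of inverse radii of triangles *)

(** The homogeneous form of [quad] in the three inverse radii; [polar3] is its bilinear form. *)
Definition quad3 (p q s x y z : R) : R :=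
  (1 - s ^ 2) * x ^ 2 + (1 - q ^ 2) * y ^ 2 + (1 - p ^ 2) * z ^ 2
  + 2 * (s + p * q) * y * z + 2 * (q + p * s) * x * z + 2 * (p + q * s) * x * y.

Definition polar3 (p q s x y z x' y' z' : R) : R :=
  (1 - s ^ 2) * x * x' + (1 - q ^ 2) * y * y' + (1 - p ^ 2) * z * z'
  + (s + p * q) * (y * z' + z * y') + (q + p * s) * (x * z' + z * x')
  + (p + q * s) * (x * y' + y * x').

(* The form has signature (1, 2): two vectors in the same nappe of its cone
   satisfy a reversed Cauchy-Schwarz inequality. *)
Lemma polar3_pos (p q s x y z x' y' z' : R) :
  0 <= p -> 0 <= q -> 1 < s ->
  0 < x -> 0 < y -> 0 < z -> 0 < x' -> 0 < y' -> 0 < z' ->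
  0 <= quad3 p q s x y z -> 0 <= quad3 p q s x' y' z' ->
  polar3 p q s x y z x' y' z' <= 0 -> x * y' = x' * y /\ x * z' = x' * z.
Proof.
  intros Hp Hq Hs X Y Z X' Y' Z' HQ HQ' HB.
  pose (E := p ^ 2 + q ^ 2 + s ^ 2 + 2 * p * q * s - 1).
  (* [L] is half the derivative of the form in [x]; completing the square writes the form as (E N -
     L^2) / (s^2 - 1). Since s > 1, [N] is itself indefinite, whence the reversed inequality M^2 >=
     N N'. *)
  pose (L := x * (1 - s ^ 2) + y * (p + q * s) + z * (q + p * s)).
  pose (L' := x' * (1 - s ^ 2) + y' * (p + q * s) + z' * (q + p * s)).
  pose (N := y ^ 2 + z ^ 2 + 2 * s * y * z).
  pose (N' := y' ^ 2 + z' ^ 2 + 2 * s * y' * z').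
  pose (M := y * y' + z * z' + s * (y * z' + z * y')).
  assert (HE : 0 < E).
  { unfold E. assert (0 <= p * q) by nra. assert (0 <= p * q * s) by nra. nra. }
  assert (HN : 0 < N) by (unfold N; assert (0 < y * z) by nra; nra).
  assert (HN' : 0 < N') by (unfold N'; assert (0 < y' * z') by nra; nra).
  assert (HM : 0 < M).
  { unfold M. assert (0 < y * y') by nra. assert (0 < z * z') by nra.
    assert (0 < y * z') by nra. assert (0 < z * y') by nra. nra. }
  assert (E1 : L ^ 2 + (s ^ 2 - 1) * quad3 p q s x y z = E * N)
    by (unfold L, E, N, quad3; ring).
  assert (E2 : L' ^ 2 + (s ^ 2 - 1) * quad3 p q s x' y' z' = E * N')
    by (unfold L', E, N', quad3; ring).
  assert (E3 : L * L' + (s ^ 2 - 1) * polar3 p q s x y z x' y' z' = E * M)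
    by (unfold L, L', E, M, polar3; ring).
  assert (E4 : M ^ 2 = N * N' + (s ^ 2 - 1) * (y * z' - z * y') ^ 2)
    by (unfold M, N, N'; ring).
  assert (Hs2 : 0 < s ^ 2 - 1) by nra.
  assert (I1 : L ^ 2 <= E * N) by nra.
  assert (I2 : L' ^ 2 <= E * N') by nra.
  assert (I3 : E * M <= L * L') by nra.
  assert (HEM : 0 < E * M) by nra.
  assert (I4 : (E * M) ^ 2 <= (L * L') ^ 2) by nra.
  assert (I5 : (L * L') ^ 2 <= (E * N) * (E * N')).
  { rewrite Rpow_mult_distr. apply Rmult_le_compat; auto using pow2_ge_0. }
  assert (I6 : E ^ 2 * ((s ^ 2 - 1) * (y * z' - z * y') ^ 2) <= 0).
  { rewrite Rpow_mult_distr, E4 in I4. nra. }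
  assert (HE2 : 0 < E ^ 2) by nra.
  assert (I7 : (y * z' - z * y') ^ 2 <= 0).
  { apply Rnot_lt_le; intros K.
    assert (0 < (s ^ 2 - 1) * (y * z' - z * y') ^ 2) by (now apply Rmult_lt_0_compat).
    nra. }
  assert (K : y * z' = z * y') by nra.
  assert (HK : exists c, 0 < c /\ y' = c * y /\ z' = c * z).
  { exists (y' / y). split; [now apply Rdiv_lt_0_compat|]. split; field_simplify; try lra.
    rewrite Rmult_comm, <- K. field. lra. }
  destruct HK as (c & Hc & -> & ->).
  assert (EM : M = c * N) by (unfold M, N; ring).
  assert (EN : N' = c ^ 2 * N) by (unfold N', N; ring).
  rewrite EM in *. rewrite EN in *.
  assert (HLL : L' = c * L).
  { assert ((L' - c * L) ^ 2 <= 0); [|nra].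
    replace ((L' - c * L) ^ 2) with (L' ^ 2 + c ^ 2 * L ^ 2 - 2 * c * (L * L')) by ring.
    assert (c ^ 2 * L ^ 2 <= c ^ 2 * (E * N)) by (apply Rmult_le_compat_l; nra).
    assert (c * (E * (c * N)) <= c * (L * L')) by (apply Rmult_le_compat_l; lra). nra. }
  assert (x' = c * x).
  { apply (Rmult_eq_reg_r (1 - s ^ 2)); [|lra]. unfold L, L' in HLL. lra. }
  subst x'. split; ring.
Qed.

Lemma quad3_swap (p q s x y z : R) : quad3 p q s x y z = quad3 p s q y x z.
Proof. unfold quad3; ring. Qed.

Lemma quad3_swap' (p q s x y z : R) : quad3 p q s x y z = quad3 s q p z y x.
Proof. unfold quad3; ring. Qed.

Lemma polar3_swap (p q s x y z x' y' z' : R) :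
  polar3 p q s x y z x' y' z' = polar3 p s q y x z y' x' z'.
Proof. unfold polar3; ring. Qed.

Lemma polar3_swap' (p q s x y z x' y' z' : R) :
  polar3 p q s x y z x' y' z' = polar3 s q p z y x z' y' x'.
Proof. unfold polar3; ring. Qed.

Lemma quad_quad3 (p q s x y : R) : quad p q s x y = quad3 p q s 1 x y.
Proof. unfold quad, quad3; ring. Qed.

Lemma polar_pos (p q s x y x' y' : R) :
  0 <= p -> 0 <= q -> 0 <= s -> 1 < p \/ 1 < q \/ 1 < s ->
  0 < x -> 0 < y -> 0 < x' -> 0 < y' ->
  0 <= quad p q s x y -> 0 <= quad p q s x' y' ->
  polar3 p q s 1 x y 1 x' y' <= 0 -> x = x' /\ y = y'.
Proof.
  intros Hp Hq Hs H X Y X' Y' HQ HQ' HB. rewrite quad_quad3 in HQ, HQ'.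
  destruct H as [H | [H | H]].
  - rewrite quad3_swap' in HQ, HQ'. rewrite polar3_swap' in HB.
    destruct (polar3_pos s q p y x 1 y' x' 1) as [E1 E2]; try assumption; try lra.
    split; nra.
  - rewrite quad3_swap in HQ, HQ'. rewrite polar3_swap in HB.
    destruct (polar3_pos p s q x 1 y x' 1 y') as [E1 E2]; try assumption; try lra.
    split; nra.
  - destruct (polar3_pos p q s 1 x y 1 x' y') as [E1 E2]; try assumption; try lra.
Qed.

(** * Admissible weights and the rigidity of a flower *)

(** [W n] is the weight of the edges in direction [dir n]; opposite directions belong to the same
    edges, hence the period 3. The triangle between the directions n and n + 1 has the weights W n,
    W (1 + n) and, opposite to the vertex, W (2 + n). Both triangles on an edge carry the same three
    weights, which gives regularity the form [gw_regular]. *)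
Record good_weights (W : nat -> R) : Prop := {
  gw_period : forall n, W (3 + n)%nat = W n;
  gw_gt : forall n, -1 < W n;
  gw_structure : forall n, 0 <= W n + W (1 + n)%nat * W (2 + n)%nat;
  gw_regular : forall n, W n = 1 -> W (1 + n)%nat + W (2 + n)%nat <> 0;
  gw_range : (forall n, - (1 / 2) < W n <= 1) \/ (forall n, 0 <= W n) }.

(** In the first case no triangle can degenerate. In the second every triangle has an edge of weight
    above 1, as the cone argument of [polar_pos] requires. *)
Lemma gw_cases (W : nat -> R) : good_weights W ->
  (forall n, W n <= 1) \/
  ((forall n, 0 <= W n) /\ forall n, 1 < W n \/ 1 < W (1 + n)%nat \/ 1 < W (2 + n)%nat).
Proof.
  intros H. destruct (gw_range W H) as [K | K].
  - left; intros n; apply K.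
  - destruct (classic (forall n, W n <= 1)) as [C | C]; [now left | right].
    split; [assumption|]. apply not_all_ex_not in C. destruct C as [m Hm].
    apply Rnot_le_lt in Hm.
    assert (G : forall k n, W (3 * k + n)%nat = W n).
    { induction k; intros n; [reflexivity|].
      replace (3 * S k + n)%nat with (3 + (3 * k + n))%nat by lia.
      now rewrite (gw_period W H). }
    assert (M : forall n, W n = W (n mod 3)%nat).
    { intros n. rewrite (Nat.div_mod_eq n 3) at 1. apply G. }
    intros n. rewrite (M m) in Hm. rewrite (M n), (M (1 + n)%nat), (M (2 + n)%nat).
    pose proof (Nat.mod_upper_bound n 3 ltac:(lia)).
    pose proof (Nat.mod_upper_bound m 3 ltac:(lia)).
    rewrite (Nat.Div0.add_mod 1 n 3), (Nat.Div0.add_mod 2 n 3).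
    set (i := (n mod 3)%nat) in *. set (j := (m mod 3)%nat) in *.
    destruct i as [|[|[|i]]]; destruct j as [|[|[|j]]]; try lia; simpl; auto.
Qed.

(** All six coefficients are nonnegative, by the structure inequalities and |W| <= 1. Some square
    term is positive unless all weights are 1, and then the mixed terms are. So any three radii form
    a genuine triangle. *)
Lemma quad_pos_le1 (W : nat -> R) (n : nat) (x y : R) : good_weights W ->
  (forall n, W n <= 1) -> 0 < x -> 0 < y ->
  0 < quad (W n) (W (1 + n)%nat) (W (2 + n)%nat) x y.
Proof.
  intros G H Hx Hy.
  pose proof (gw_gt W G n) as a1. pose proof (gw_gt W G (1 + n)) as a2.
  pose proof (gw_gt W G (2 + n)) as a3.
  pose proof (H n) as b1. pose proof (H (1 + n)%nat) as b2. pose proof (H (2 + n)%nat) as b3.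
  pose proof (gw_structure W G n) as c1. pose proof (gw_structure W G (1 + n)) as c2.
  pose proof (gw_structure W G (2 + n)) as c3.
  change (1 + (1 + n))%nat with (2 + n)%nat in *.
  change (2 + (1 + n))%nat with (3 + n)%nat in *.
  change (1 + (2 + n))%nat with (3 + n)%nat in *.
  change (2 + (2 + n))%nat with (3 + (1 + n))%nat in *. rewrite !(gw_period W G) in *.
  set (p := W n) in *. set (q := W (1 + n)%nat) in *. set (s := W (2 + n)%nat) in *.
  unfold quad.
  assert (0 < x * y) by nra. assert (0 < x ^ 2) by nra. assert (0 < y ^ 2) by nra.
  assert (d1 : 0 <= 1 - p ^ 2) by nra. assert (d2 : 0 <= 1 - q ^ 2) by nra.
  assert (d3 : 0 <= 1 - s ^ 2) by nra.
  assert (0 <= (s + p * q) * (x * y)) by (apply Rmult_le_pos; lra).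
  assert (0 <= (q + p * s) * y) by (apply Rmult_le_pos; lra).
  assert (0 <= (p + q * s) * x) by (apply Rmult_le_pos; lra).
  assert (0 <= (1 - q ^ 2) * x ^ 2) by (apply Rmult_le_pos; lra).
  assert (0 <= (1 - p ^ 2) * y ^ 2) by (apply Rmult_le_pos; lra).
  destruct (Req_dec s 1) as [Es | Es].
  - destruct (Req_dec q 1) as [Eq | Eq].
    + destruct (Req_dec p 1) as [Ep | Ep].
      * rewrite Es, Eq, Ep in *. nra.
      * assert (0 < (1 - p ^ 2) * y ^ 2) by (apply Rmult_lt_0_compat; nra). nra.
    + assert (0 < (1 - q ^ 2) * x ^ 2) by (apply Rmult_lt_0_compat; nra). nra.
  - assert (0 < 1 - s ^ 2) by nra. nra.
Qed.

(** Either there are no degenerate triangles, or they bound a cone with strictly convex slices. So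
    inside a segment all triangles are genuine, even when both ends are degenerate. *)
Lemma quad_segment_pos (W : nat -> R) (n : nat) (x y x' y' t : R) : good_weights W ->
  0 < x -> 0 < y -> 0 < x' -> 0 < y' -> 0 < t < 1 ->
  0 <= quad (W n) (W (1 + n)%nat) (W (2 + n)%nat) x y ->
  0 <= quad (W n) (W (1 + n)%nat) (W (2 + n)%nat) x' y' ->
  (x = x' /\ y = y') \/
  0 < quad (W n) (W (1 + n)%nat) (W (2 + n)%nat) (x + t * (x' - x)) (y + t * (y' - y)).
Proof.
  intros G X Y X' Y' Ht HQ HQ'. destruct (gw_cases W G) as [C | [C1 C2]].
  - right. apply quad_pos_le1; try assumption; nra.
  - set (p := W n) in *. set (q := W (1 + n)%nat) in *. set (s := W (2 + n)%nat) in *.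
    destruct (Rle_dec (polar3 p q s 1 x y 1 x' y') 0) as [B | B].
    + left. apply (polar_pos p q s); auto; try apply C1. apply C2.
    + right. apply Rnot_le_lt in B.
      replace (quad p q s (x + t * (x' - x)) (y + t * (y' - y))) with
        ((1 - t) ^ 2 * quad p q s x y + t ^ 2 * quad p q s x' y'
          + 2 * (t * (1 - t)) * polar3 p q s 1 x y 1 x' y')
        by (unfold quad, polar3; ring).
      assert (0 < t * (1 - t)) by nra.
      assert (0 < (t * (1 - t)) * polar3 p q s 1 x y 1 x' y') by (now apply Rmult_lt_0_compat).
      assert (0 <= (1 - t) ^ 2 * quad p q s x y) by (apply Rmult_le_pos; [apply pow2_ge_0 | lra]).
      assert (0 <= t ^ 2 * quad p q s x' y') by (apply Rmult_le_pos; [apply pow2_ge_0 | lra]).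
      lra.
Qed.

Lemma psum_ext (f g : nat -> R) (n : nat) :
  (forall k, f k = g k) -> psum f n = psum g n.
Proof. intros H. induction n; simpl; [reflexivity|]. now rewrite IHn, H. Qed.

Lemma is_derive_psum (f : nat -> R -> R) (df : nat -> R) (t : R) (n : nat) :
  (forall k, is_derive (f k) t (df k)) ->
  is_derive (fun t => psum (fun k => f k t) n) t (psum df n).
Proof.
  intros H. induction n; simpl.
  - apply (is_derive_const 0).
  - apply (is_derive_plus (fun t => psum (fun k => f k t) n) (f n)); auto.
Qed.

Lemma continuous_psum (f : nat -> R -> R) (t : R) (n : nat) :
  (forall k, continuous (f k) t) -> continuous (fun t => psum (fun k => f k t) n) t.
Proof.
  intros H. induction n; simpl.
  - apply continuous_const.
  - apply (continuous_plus (fun t => psum (fun k => f k t) n) (f n)); auto.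
Qed.

Lemma continuous_angle (p q s x y dx dy t : R) : -1 < p -> -1 < q ->
  0 < x + t * dx -> 0 < y + t * dy ->
  continuous (fun t => acos (cosF p q s (x + t * dx) (y + t * dy))) t.
Proof.
  intros Hp Hq Hx Hy.
  apply (continuous_comp (fun t => cosF p q s (x + t * dx) (y + t * dy)) acos).
  - pose proof (base_norm_pos p _ Hp Hx) as N1. pose proof (base_norm_pos q _ Hq Hy) as N2.
    pose proof (sqrt_lt_R0 _ N1) as S1. pose proof (sqrt_lt_R0 _ N2) as S2.
    apply (ex_derive_continuous (fun t => cosF p q s (x + t * dx) (y + t * dy))).
    unfold cosF. unfold base_norm in *. auto_derive.
    replace (1 + (x + t * dx) * ((x + t * dx) * 1) + 2 * p * (x + t * dx))
      with (1 + (x + t * dx) ^ 2 + 2 * p * (x + t * dx)) by ring.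
    replace (1 + (y + t * dy) * ((y + t * dy) * 1) + 2 * q * (y + t * dy))
      with (1 + (y + t * dy) ^ 2 + 2 * q * (y + t * dy)) by ring.
    repeat split; try lra. apply Rgt_not_eq. nra.
  - apply continuous_acos.
Qed.

(** Differentiability is asked only inside the interval: at the ends of the path a triangle may be
    degenerate, where the angle is merely known to be continuous. *)
Lemma mean_value_zero (f df : R -> R) :
  (forall t, 0 < t < 1 -> is_derive f t (df t)) ->
  (forall t, 0 <= t <= 1 -> continuous f t) -> f 0 = f 1 ->
  exists t, 0 < t < 1 /\ df t = 0.
Proof.
  intros Hd Hc E.
  assert (pr : forall t, 0 < t < 1 -> derivable_pt f t).
  { intros t Ht. exists (df t). apply is_derive_Reals. auto. }
  destruct (Rolle f 0 1 pr) as (t & Ht & Z).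
  - intros t Ht. apply continuity_pt_filterlim. now apply Hc.
  - lra.
  - assumption.
  - exists t. split; [assumption|].
    pose proof (derive_pt_eq_1 _ _ _ (pr t Ht) Z) as K. apply is_derive_Reals in K.
    rewrite <- (is_derive_unique _ _ _ K). symmetry. apply is_derive_unique. auto.
Qed.

(** For p <= 1 both numerators have nonnegative coefficients; if p = 1, regularity makes q + s
    positive. *)
Lemma side_sum_le1 (p q s x y z Q Q' : R) : -1 < p <= 1 ->
  0 <= q + p * s -> 0 <= s + p * q -> (p = 1 -> q + s <> 0) ->
  0 < x -> 0 < y -> 0 < z -> 0 < Q -> 0 < Q' ->
  0 < side p q s x y / sqrt Q + side p s q x z / sqrt Q'.
Proof.
  intros Hp H1 H2 Hr Hx Hy Hz HQ HQ'.
  pose proof (Rinv_0_lt_compat _ (sqrt_lt_R0 _ HQ)) as I1.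
  pose proof (Rinv_0_lt_compat _ (sqrt_lt_R0 _ HQ')) as I2.
  unfold side, Rdiv.
  assert (0 <= 1 - p ^ 2) by nra.
  assert (0 <= y * (1 - p ^ 2)) by nra. assert (0 <= z * (1 - p ^ 2)) by nra.
  assert (0 <= x * (s + p * q)) by nra. assert (0 <= x * (q + p * s)) by nra.
  destruct (Req_dec p 1) as [-> | Np].
  - assert (0 < q + s) by (specialize (Hr eq_refl); lra).
    assert (0 < x * (s + q)) by nra.
    apply Rplus_lt_0_compat; apply Rmult_lt_0_compat; nra.
  - assert (0 < 1 - p ^ 2) by nra.
    assert (0 < y * (1 - p ^ 2)) by nra. assert (0 < z * (1 - p ^ 2)) by nra.
    apply Rplus_lt_0_compat; apply Rmult_lt_0_compat; nra.
Qed.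

(** By [side_sqr] both pairs of numerator and denominator lie on one curve m^2 + (p^2 - 1) g^2 =
    const. So [ratio_sum_pos] reduces the claim to the sum of the numerators, which is the linear
    Delaunay expression. *)
Lemma side_sum_gt1 (p q s x y z : R) : 1 < p -> 0 < x ->
  0 < quad p q s x y -> 0 < quad p s q x z ->
  (p - 1) * (y + z) <= (q + s) * (1 + x) ->
  0 <= side p q s x y / sqrt (quad p q s x y) + side p s q x z / sqrt (quad p s q x z) /\
  (side p q s x y / sqrt (quad p q s x y) + side p s q x z / sqrt (quad p s q x z) = 0 ->
   (p - 1) * (y + z) = (q + s) * (1 + x)).
Proof.
  intros Hp Hx HQ HQ' HD.
  assert (E : side p q s x y + side p s q x z
    = (1 + p) * ((q + s) * (1 + x) - (p - 1) * (y + z))) by (unfold side; ring).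
  destruct (ratio_sum_pos (p ^ 2 - 1) (side p q s x y) (sqrt (quad p q s x y))
    (side p s q x z) (sqrt (quad p s q x z))) as [K1 K2].
  - nra.
  - now apply sqrt_lt_R0.
  - now apply sqrt_lt_R0.
  - rewrite !pow2_sqrt by lra. rewrite !side_sqr. ring.
  - rewrite E. apply Rmult_le_pos; lra.
  - split; [assumption|]. intros K. specialize (K2 K). rewrite E in K2.
    apply Rmult_integral in K2. lra.
Qed.

Definition triangle_quad (W x : nat -> R) (n : nat) : R :=
  quad (W n) (W (1 + n)%nat) (W (2 + n)%nat) (x n) (x (1 + n)%nat).

Definition triangle_angle (W x : nat -> R) (n : nat) : R :=
  acos (cosF (W n) (W (1 + n)%nat) (W (2 + n)%nat) (x n) (x (1 + n)%nat)).

Definition Delaunay_at (W x : nat -> R) (n : nat) : Prop :=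
  1 < W n ->
  (W n - 1) * (x (1 + n)%nat + x (5 + n)%nat) <= (W (1 + n)%nat + W (2 + n)%nat) * (1 + x n).

Definition flower (W x : nat -> R) : Prop :=
  (forall n, x (6 + n)%nat = x n) /\ (forall n, 0 < x n) /\
  (forall n, 0 <= triangle_quad W x n) /\ (forall n, Delaunay_at W x n).

(** [S] joins the two triangles on the edge to neighbour [n]; up to a positive factor it is the sum
    of the two heights. If it vanishes inside the path, the Delaunay inequality is an equality there
    and, being linear, at both ends; the difference of the end equalities is the last claim. *)
Lemma edge_term (W x x' : nat -> R) (t : R) (n : nat) : good_weights W ->
  flower W x -> flower W x' -> (forall n, x n <= x' n) -> 0 < t < 1 ->
  let z k := x k + t * (x' k - x k) in
  let S := side (W n) (W (1 + n)%nat) (W (2 + n)%nat) (z n) (z (1 + n)%nat)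
             / sqrt (triangle_quad W z n)
         + side (W n) (W (2 + n)%nat) (W (1 + n)%nat) (z n) (z (5 + n)%nat)
             / sqrt (triangle_quad W z (5 + n)) in
  0 <= (x' n - x n) * S /\
  ((x' n - x n) * S = 0 -> 0 < x' n - x n ->
   1 < W n /\ 0 < W (1 + n)%nat + W (2 + n)%nat /\
   (W n - 1) * ((x' (1 + n)%nat - x (1 + n)%nat) + (x' (5 + n)%nat - x (5 + n)%nat))
   = (W (1 + n)%nat + W (2 + n)%nat) * (x' n - x n)).
Proof.
  intros G (Px & Hx & Qx & Dx) (Px' & Hx' & Qx' & Dx') Hle Ht z S.
  destruct (Rle_lt_or_eq_dec _ _ (Hle n)) as [Hlt | Heq].
  2: { rewrite Heq, Rminus_diag. split; lra. }
  assert (Hz : forall k, 0 < z k).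
  { intros k. unfold z. pose proof (Hx k). pose proof (Hle k).
    assert (0 <= t * (x' k - x k)) by (apply Rmult_le_pos; lra). lra. }
  assert (Q1 : 0 < triangle_quad W z n).
  { destruct (quad_segment_pos W n (x n) (x (1 + n)%nat) (x' n) (x' (1 + n)%nat) t G)
      as [[K _] | K]; try apply Qx; try apply Qx'; auto.
    lra. }
  assert (E6 : z (6 + n)%nat = z n) by (unfold z; now rewrite Px, Px').
  assert (Q2 : 0 < triangle_quad W z (5 + n)).
  { destruct (quad_segment_pos W (5 + n) (x (5 + n)%nat) (x (6 + n)%nat)
      (x' (5 + n)%nat) (x' (6 + n)%nat) t G)
      as [[_ K] | K]; try apply Qx; try apply Qx'; auto.
    rewrite Px, Px' in K. lra. }
  assert (EQ : triangle_quad W z (5 + n)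
    = quad (W n) (W (2 + n)%nat) (W (1 + n)%nat) (z n) (z (5 + n)%nat)).
  { unfold triangle_quad.
    replace (z (1 + (5 + n))%nat) with (z n) by (symmetry; exact E6).
    replace (W (5 + n)%nat) with (W (2 + n)%nat) by (symmetry; apply (gw_period W G)).
    replace (W (1 + (5 + n))%nat) with (W n)
      by (symmetry; rewrite <- (gw_period W G n); apply (gw_period W G)).
    replace (W (2 + (5 + n))%nat) with (W (1 + n)%nat)
      by (symmetry; rewrite <- (gw_period W G (1 + n)); apply (gw_period W G)).
    unfold quad; ring. }
  unfold S. rewrite EQ in *. clear EQ S. unfold triangle_quad in *.
  destruct (Rle_dec (W n) 1) as [H1 | H1].
  - match goal with |- 0 <= _ * ?X /\ _ => assert (HS : 0 < X) end.
    { apply side_sum_le1; auto.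
      - split; [apply (gw_gt W G) | assumption].
      - pose proof (gw_structure W G (1 + n)) as K.
        change (2 + (1 + n))%nat with (3 + n)%nat in K. rewrite (gw_period W G) in K.
        change (1 + (1 + n))%nat with (2 + n)%nat in K. lra.
      - pose proof (gw_structure W G (2 + n)) as K.
        change (2 + (2 + n))%nat with (3 + (1 + n))%nat in K.
        change (1 + (2 + n))%nat with (3 + n)%nat in K.
        rewrite !(gw_period W G) in K. lra.
      - apply (gw_regular W G). }
    split.
    + apply Rmult_le_pos; lra.
    + intros K. apply Rmult_integral in K. lra.
  - apply Rnot_le_lt in H1.
    pose proof (Dx n H1) as D1. pose proof (Dx' n H1) as D2.
    destruct (side_sum_gt1 (W n) (W (1 + n)%nat) (W (2 + n)%nat) (z n) (z (1 + n)%nat)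
      (z (5 + n)%nat)) as [K1 K2]; auto.
    { pose proof (Rmult_le_compat_l (1 - t) _ _ ltac:(lra) D1).
      pose proof (Rmult_le_compat_l t _ _ ltac:(lra) D2). unfold z. lra. }
    match goal with |- 0 <= _ * ?X /\ _ => set (Y := X) in * end.
    split; [apply Rmult_le_pos; lra|].
    intros K _. apply Rmult_integral in K. destruct K as [K | K]; [lra|].
    specialize (K2 K). unfold z in K2.
    pose proof (Hx n). pose proof (Hx (1 + n)%nat). pose proof (Hx (5 + n)%nat).
    set (A := (W (1 + n)%nat + W (2 + n)%nat)) in *.
    assert (0 < (W n - 1) * (x (1 + n)%nat + x (5 + n)%nat)) by (apply Rmult_lt_0_compat; lra).
    split; [assumption | split].
    + apply Rnot_le_lt; intros HA. nra.
    + set (u := A * (1 + x n) - (W n - 1) * (x (1 + n)%nat + x (5 + n)%nat)) in *.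
      set (v := A * (1 + x' n) - (W n - 1) * (x' (1 + n)%nat + x' (5 + n)%nat)) in *.
      assert (0 <= u) by (unfold u; lra). assert (0 <= v) by (unfold v; lra).
      assert ((1 - t) * u + t * v = 0) by (unfold u, v; lra).
      assert (u = 0) by nra. assert (v = 0) by nra. unfold u, v in *. lra.
Qed.

Lemma max_ratio (W D : nat -> R) (N : nat) : (exists n, (n < N)%nat /\ 0 < D n) ->
  (forall n, 0 < D n -> 0 < W n) ->
  exists n, (n < N)%nat /\ 0 < D n /\
    forall k, (k < N)%nat -> 0 < D k -> D k * W n <= D n * W k.
Proof.
  intros He HW. induction N as [|N IH]; [destruct He as (n & Hn & _); lia|].
  destruct (classic (exists n, (n < N)%nat /\ 0 < D n)) as [C | C].
  - destruct (IH C) as (n & Hn & Pn & Hmax).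
    destruct (Rlt_dec 0 (D N)) as [PN | PN].
    + destruct (Rle_dec (D N * W n) (D n * W N)) as [K | K].
      * exists n; split; [lia | split; [assumption|]]. intros k Hk Pk.
        destruct (Nat.eq_dec k N) as [-> |]; [assumption|]. apply Hmax; [lia | assumption].
      * exists N; split; [lia | split; [assumption|]]. intros k Hk Pk.
        destruct (Nat.eq_dec k N) as [-> |]; [lra|].
        assert (D k * W n <= D n * W k) as K1 by (apply Hmax; [lia | assumption]).
        pose proof (HW n Pn) as P1. pose proof (HW k Pk) as P2. pose proof (HW N PN) as P3.
        apply (Rmult_le_reg_r (W n)); [assumption|].
        apply Rle_trans with (D n * W k * W N); [nra|].
        apply Rnot_le_lt in K. nra.
    + exists n; split; [lia | split; [assumption|]]. intros k Hk Pk.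
      destruct (Nat.eq_dec k N) as [-> |]; [lra|]. apply Hmax; [lia | assumption].
  - exists N. destruct He as (n & Hn & Pn).
    assert (n = N) as -> by (destruct (Nat.eq_dec n N); [assumption | exfalso; apply C; exists n; split; [lia | assumption]]).
    split; [lia | split; [assumption|]]. intros k Hk Pk.
    destruct (Nat.eq_dec k N) as [-> |]; [lra|].
    exfalso; apply C; exists k; split; [lia | assumption].
Qed.

Lemma periodic_mod (A : Type) (f : nat -> A) (p n : nat) : (p <> 0)%nat ->
  (forall n, f (p + n)%nat = f n) -> f n = f (n mod p)%nat.
Proof.
  intros Hp H.
  assert (G : forall k n, f (p * k + n)%nat = f n).
  { induction k; intros m; [now rewrite Nat.mul_0_r|].
    replace (p * S k + m)%nat with (p + (p * k + m))%nat by lia. now rewrite H. }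
  rewrite (Nat.div_mod_eq n p) at 1. apply G.
Qed.

(* The path from [x] to [x'] is linear in the inverse radii: along it both the
   Delaunay inequalities and nondegeneracy persist, so the angle sum is
   monotone. *)
Lemma flower_rigidity (W x x' : nat -> R) : good_weights W ->
  flower W x -> flower W x' -> (forall n, x n <= x' n) ->
  psum (triangle_angle W x) 6 = psum (triangle_angle W x') 6 ->
  forall n, x n = x' n.
Proof.
  intros G Fx Fx' Hle Hsum.
  pose proof Fx as (Px & Hx & Qx & _). pose proof Fx' as (Px' & Hx' & Qx' & _).
  pose (z := fun t k => x k + t * (x' k - x k)).
  assert (Hz : forall t k, 0 <= t <= 1 -> 0 < z t k).
  { intros t k Ht. unfold z. pose proof (Hx k). pose proof (Hle k).
    assert (0 <= t * (x' k - x k)) by (apply Rmult_le_pos; lra). lra. }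
  pose (a := fun k t => base_norm (W k) (z t k)).
  pose (L1 := fun k t => side (W k) (W (1 + k)%nat) (W (2 + k)%nat) (z t k) (z t (1 + k)%nat)
    / sqrt (triangle_quad W (z t) k)).
  pose (L2 := fun k t => side (W (1 + k)%nat) (W k) (W (2 + k)%nat) (z t (1 + k)%nat) (z t k)
    / sqrt (triangle_quad W (z t) k)).
  pose (df := fun k t => - ((x' k - x k) * (L1 k t / a k t)
    + (x' (1 + k)%nat - x (1 + k)%nat) * (L2 k t / a (1 + k)%nat t))).
  (* Equal angle sums at both ends make the derivative vanish at some interior time. *)
  destruct (mean_value_zero (fun t => psum (fun k => triangle_angle W (z t) k) 6)
    (fun t => psum (fun k => df k t) 6)) as (t & Ht & Hdf).
  - intros t Ht. apply is_derive_psum. intros k. unfold triangle_angle, z.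
    destruct (quad_segment_pos W k (x k) (x (1 + k)%nat) (x' k) (x' (1 + k)%nat) t G)
      as [[K1 K2] | K]; try apply Qx; try apply Qx'; auto.
    + unfold df. rewrite K1, K2, !Rminus_diag.
      rewrite !Rmult_0_l, Rplus_0_l, Ropp_0.
      apply (is_derive_ext (fun _ => acos (cosF (W k) (W (1 + k)%nat) (W (2 + k)%nat) (x' k) (x' (1 + k)%nat)))).
      * intros s. now rewrite !Rmult_0_r, !Rplus_0_r.
      * apply @is_derive_const.
    + pose proof (is_derive_angle (W k) (W (1 + k)%nat) (W (2 + k)%nat) (x k) (x (1 + k)%nat)
        (x' k - x k) (x' (1 + k)%nat - x (1 + k)%nat) t) as D. cbv zeta in D.
      match type of D with _ -> _ -> _ -> _ -> _ -> is_derive _ _ ?v =>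
        replace (df k t) with v
      end.
      * apply D; auto; try apply (gw_gt W G); apply Hz; lra.
      * unfold df, L1, L2, a, triangle_quad.
        fold (z t k) (z t (1 + k)%nat).
        assert (0 < base_norm (W k) (z t k)) by (apply base_norm_pos; [apply (gw_gt W G) | apply Hz; lra]).
        assert (0 < base_norm (W (1 + k)%nat) (z t (1 + k)%nat))
          by (apply base_norm_pos; [apply (gw_gt W G) | apply Hz; lra]).
        fold (z t k) (z t (1 + k)%nat) in K.
        pose proof (sqrt_lt_R0 _ K). field. lra.
  - intros t Ht. apply continuous_psum. intros k. unfold triangle_angle, z.
    apply continuous_angle; try apply (gw_gt W G); now apply Hz.
  - assert (Z0 : forall k, z 0 k = x k) by (intros; unfold z; ring).
    assert (Z1 : forall k, z 1 k = x' k) by (intros; unfold z; ring).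
    transitivity (psum (triangle_angle W x) 6); [|transitivity (psum (triangle_angle W x') 6)];
      [|exact Hsum|]; apply psum_ext; intros k; unfold triangle_angle;
      now rewrite ?Z0, ?Z1.
  (* Neighbour [k] enters the triangles [k] and [5 + k]; [T] regroups the derivative by edges. The
     terms are nonnegative, up to positive factors they add up to zero, and so each of them is
     zero. *)
  - pose (T := fun k => (x' k - x k) * (L1 k t + L2 (5 + k)%nat t)).
    assert (Hedge : forall k, 0 <= T k /\ (T k = 0 -> 0 < x' k - x k ->
      1 < W k /\ 0 < W (1 + k)%nat + W (2 + k)%nat /\
      (W k - 1) * ((x' (1 + k)%nat - x (1 + k)%nat) + (x' (5 + k)%nat - x (5 + k)%nat))
      = (W (1 + k)%nat + W (2 + k)%nat) * (x' k - x k))).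
    { intros k. pose proof (edge_term W x x' t k G Fx Fx' Hle Ht) as K. cbv zeta in K.
      unfold T, L1, L2. fold (z t) in K.
      assert (E6 : z t (6 + k)%nat = z t k) by (unfold z; now rewrite Px, Px').
      change (1 + (5 + k))%nat with (6 + k)%nat. rewrite E6.
      change (W (6 + k)%nat) with (W (3 + (3 + k))%nat).
      change (W (5 + k)%nat) with (W (3 + (2 + k))%nat).
      change (W (2 + (5 + k))%nat) with (W (3 + (3 + (1 + k)))%nat).
      rewrite !(gw_period W G). exact K. }
    assert (Ha : forall k, 0 < / a k t).
    { intros k. apply Rinv_0_lt_compat. apply base_norm_pos; [apply (gw_gt W G) | apply Hz; lra]. }
    assert (HT : psum (fun k => T k * / a k t) 6 = 0).
    { rewrite <- (Ropp_0), <- Hdf. unfold T, df. simpl psum.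
      change (L2 6%nat t) with (L2 (6 + 0)%nat t). change (L2 7%nat t) with (L2 (6 + 1)%nat t).
      change (L2 8%nat t) with (L2 (6 + 2)%nat t). change (L2 9%nat t) with (L2 (6 + 3)%nat t).
      change (L2 10%nat t) with (L2 (6 + 4)%nat t).
      assert (EL : forall k, L2 (6 + k)%nat t = L2 k t).
      { intros k. unfold L2, triangle_quad.
        change (1 + (6 + k))%nat with (6 + (1 + k))%nat.
        change (2 + (6 + k))%nat with (6 + (2 + k))%nat.
        assert (E6 : forall k, z t (6 + k)%nat = z t k) by (intros; unfold z; now rewrite Px, Px').
        assert (W6 : forall k, W (6 + k)%nat = W k).
        { intros m. change (6 + m)%nat with (3 + (3 + m))%nat. now rewrite !(gw_period W G). }
        now rewrite !E6, !W6. }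
      rewrite !EL.
      change (x 6%nat) with (x (6 + 0)%nat). change (x' 6%nat) with (x' (6 + 0)%nat).
      rewrite Px, Px'.
      assert (Ea : a 6%nat t = a 0%nat t).
      { unfold a. change (W 6%nat) with (W (3 + (3 + 0))%nat). rewrite !(gw_period W G).
        unfold z. change (x 6%nat) with (x (6 + 0)%nat).
        change (x' 6%nat) with (x' (6 + 0)%nat). now rewrite Px, Px'. }
      rewrite Ea. unfold Rdiv. ring. }
    assert (HT0 : forall k, (k < 6)%nat -> T k = 0).
    { assert (HTk : forall k, 0 <= T k * / a k t).
      { intros k. apply Rmult_le_pos; [apply Hedge | apply Rlt_le, Ha]. }
      simpl in HT.
      pose proof (HTk 0%nat); pose proof (HTk 1%nat); pose proof (HTk 2%nat);
      pose proof (HTk 3%nat); pose proof (HTk 4%nat); pose proof (HTk 5%nat).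
      assert (HH : forall k, T k * / a k t = 0 -> T k = 0).
      { intros k E. apply Rmult_integral in E. destruct E as [E | E]; [assumption|].
        pose proof (Ha k); lra. }
      intros k Hk. apply HH.
      destruct k as [|[|[|[|[|[|k]]]]]]; try lia; lra. }
    assert (W6 : forall k, W (6 + k)%nat = W k).
    { intros m. change (6 + m)%nat with (3 + (3 + m))%nat. now rewrite !(gw_period W G). }
    assert (HTall : forall k, 0 < x' k - x k ->
      1 < W k /\ 0 < W (1 + k)%nat + W (2 + k)%nat /\
      (W k - 1) * ((x' (1 + k)%nat - x (1 + k)%nat) + (x' (5 + k)%nat - x (5 + k)%nat))
      = (W (1 + k)%nat + W (2 + k)%nat) * (x' k - x k)).
    { intros k Hk.
      assert (E6 : forall j, x (j + k)%nat = x (j + (k mod 6))%nat /\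
        x' (j + k)%nat = x' (j + (k mod 6))%nat /\ W (j + k)%nat = W (j + (k mod 6))%nat).
      { intros j. repeat split.
        - apply (periodic_mod _ (fun k => x (j + k)%nat) 6 k); [lia|].
          intros m. replace (j + (6 + m))%nat with (6 + (j + m))%nat by lia. apply Px.
        - apply (periodic_mod _ (fun k => x' (j + k)%nat) 6 k); [lia|].
          intros m. replace (j + (6 + m))%nat with (6 + (j + m))%nat by lia. apply Px'.
        - apply (periodic_mod _ (fun k => W (j + k)%nat) 6 k); [lia|].
          intros m. replace (j + (6 + m))%nat with (6 + (j + m))%nat by lia. apply W6. }
      destruct (E6 0%nat) as (A1 & A2 & A3). destruct (E6 1%nat) as (B1 & B2 & B3).
      destruct (E6 2%nat) as (C1 & C2 & C3). destruct (E6 5%nat) as (D1 & D2 & D3).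
      change (0 + k)%nat with k in *. change (0 + k mod 6)%nat with (k mod 6)%nat in *.
      rewrite A1, A2, A3, B1, B2, B3, C3, D1, D2. rewrite A1, A2 in Hk.
      apply Hedge; [|assumption]. apply HT0. apply Nat.mod_upper_bound. lia. }
    intros n. apply NNPP; intros Hn.
    assert (He : exists n, (n < 6)%nat /\ 0 < x' n - x n).
    { exists (n mod 6)%nat. split; [apply Nat.mod_upper_bound; lia|].
      rewrite <- (periodic_mod _ x 6 n), <- (periodic_mod _ x' 6 n) by auto.
      pose proof (Hle n). lra. }
    (* With d_k = x'_k - x_k, all positive d_k satisfy (W_k - 1) (d_(k+1) + d_(k-1)) = (W_(k+1) +
       W_(k+2)) d_k. Where d_k / W_k is largest, at [m], the neighbours satisfy d <= (d_m / W_m) W,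
       and the equality would give W_m <= W_m - 1. *)
    destruct (max_ratio W (fun k => x' k - x k) 6 He) as (m & Hm & Pm & Hmax).
    { intros k Hk. pose proof (HTall k Hk). lra. }
    destruct (HTall m Pm) as (K1 & K2 & K3).
    assert (Hmax' : forall k, 0 <= W k -> (x' k - x k) * W m <= (x' m - x m) * W k).
    { intros k HWk.
      rewrite (periodic_mod _ x 6 k), (periodic_mod _ x' 6 k), (periodic_mod _ W 6 k) in * by auto.
      destruct (Rle_lt_or_eq_dec _ _ (Hle (k mod 6)%nat)) as [Hlt | Heq].
      - apply Hmax; [apply Nat.mod_upper_bound; lia | lra].
      - rewrite Heq, Rminus_diag, Rmult_0_l. apply Rmult_le_pos; lra. }
    assert (HWpos : forall k, 0 <= W k).
    { destruct (gw_cases W G) as [C | [C _]]; [|assumption]. pose proof (C m). lra. }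
    pose proof (Hmax' (1 + m)%nat (HWpos _)) as M1.
    pose proof (Hmax' (5 + m)%nat (HWpos _)) as M2.
    change (W (5 + m)%nat) with (W (3 + (2 + m))%nat) in M2. rewrite (gw_period W G) in M2.
    set (d := x' m - x m) in *. set (d1 := x' (1 + m)%nat - x (1 + m)%nat) in *.
    set (d5 := x' (5 + m)%nat - x (5 + m)%nat) in *.
    set (A := W (1 + m)%nat + W (2 + m)%nat) in *.
    assert (M3 : (d1 + d5) * W m <= d * A) by (unfold A; lra).
    assert (M4 : (W m - 1) * ((d1 + d5) * W m) <= (W m - 1) * (d * A))
      by (apply Rmult_le_compat_l; lra).
    assert (M5 : (W m - 1) * ((d1 + d5) * W m) = A * d * W m) by (rewrite <- K3; ring).
    assert (0 < d * A) by (apply Rmult_lt_0_compat; assumption). nra.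
Qed.

(** * Layouts *)

(** A planar realization of the radii [r]. The Delaunay condition is kept in linear form, in the
    inverse radii around [v] multiplied by r v; in this form it passes to limits. *)
Record layout (W : nat -> R) (r : vertex -> R) (P : vertex -> C) : Prop := {
  ly_pos : forall v, 0 < r v;
  ly_dist : forall v n, dist2 (P v) (P (vadd v (dir n)))
    = sqr_length (W n) (r v) (r (vadd v (dir n)));
  ly_oriented : oriented P;
  ly_nonoverlapping : nonoverlapping P;
  ly_Delaunay : forall v n, Delaunay_at W (fun k => r v / r (vadd v (dir k))) n }.

Definition ratio (r : vertex -> R) (v : vertex) (n : nat) : R := r v / r (vadd v (dir n)).

(** The edge from neighbour n to neighbour n + 1 points in direction n + 2; this is why W (2 + n) is
    the weight opposite to the vertex. *)
Lemma dir_sub (v : vertex) (n : nat) :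
  vadd v (dir (1 + n)) = vadd (vadd v (dir n)) (dir (2 + n)).
Proof.
  unfold dir; simpl. destruct (Nat.iter n rot (1, 0)%Z), v. unfold vadd, rot; simpl.
  f_equal; ring.
Qed.

Lemma layout_cos_angle (W : nat -> R) (r : vertex -> R) (P : vertex -> C)
    (v : vertex) (n : nat) : layout W r P ->
  cos_angle (P v) (P (vadd v (dir n))) (P (vadd v (dir (S n))))
  = cosF (W n) (W (1 + n)%nat) (W (2 + n)%nat) (ratio r v n) (ratio r v (1 + n)).
Proof.
  intros L. unfold cos_angle, cosF, ratio.
  pose proof (dotp_dist (P v) (P (vadd v (dir n))) (P (vadd v (dir (S n))))) as Hd.
  pose proof (ly_dist _ _ _ L v n) as E1. pose proof (ly_dist _ _ _ L v (1 + n)) as E2.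
  pose proof (ly_dist _ _ _ L (vadd v (dir n)) (2 + n)) as E3.
  rewrite <- dir_sub in E3. change (S n) with (1 + n)%nat in *.
  rewrite E1, E2, E3 in Hd. rewrite E1, E2.
  pose proof (ly_pos _ _ _ L v). pose proof (ly_pos _ _ _ L (vadd v (dir n))).
  pose proof (ly_pos _ _ _ L (vadd v (dir (1 + n)))).
  pose proof (flower_crs P v n (ly_oriented _ _ _ L)) as Hc.
  destruct (crs_pos_dist _ _ _ (Rgt_not_eq _ _ Hc)) as [D1 D2].
  change (S n) with (1 + n)%nat in *. rewrite E1 in D1. rewrite E2 in D2.
  set (x := r v) in *. set (y := r (vadd v (dir n))) in *.
  set (z := r (vadd v (dir (1 + n)))) in *.
  assert (F1 : base_norm (W n) (x / y) = sqr_length (W n) x y / y ^ 2)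
    by (unfold base_norm, sqr_length; field; lra).
  assert (F2 : base_norm (W (1 + n)%nat) (x / z) = sqr_length (W (1 + n)%nat) x z / z ^ 2)
    by (unfold base_norm, sqr_length; field; lra).
  rewrite F1, F2, !sqrt_div by nra. rewrite !sqrt_pow2 by lra.
  pose proof (sqrt_lt_R0 _ D1). pose proof (sqrt_lt_R0 _ D2).
  set (g := sqrt (sqr_length (W n) x y)) in *.
  set (g' := sqrt (sqr_length (W (1 + n)%nat) x z)) in *.
  apply (Rmult_eq_reg_l 2); [|lra].
  unfold Rdiv at 1. rewrite <- Rmult_assoc, Hd. unfold sqr_length. field.
  repeat split; lra.
Qed.

Lemma layout_quad_pos (W : nat -> R) (r : vertex -> R) (P : vertex -> C)
    (v : vertex) (n : nat) : good_weights W -> layout W r P ->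
  0 < triangle_quad W (ratio r v) n.
Proof.
  intros G L. unfold triangle_quad.
  pose proof (flower_crs P v n (ly_oriented _ _ _ L)) as Hc.
  destruct (cos_angle_spec _ _ _ (Rgt_not_eq _ _ Hc)) as [_ Hb].
  rewrite (layout_cos_angle W r P v n L) in Hb.
  assert (Hr : forall m, 0 < ratio r v m)
    by (intros; apply Rdiv_lt_0_compat; apply (ly_pos _ _ _ L)).
  pose proof (cosF_sqr (W n) (W (1 + n)%nat) (W (2 + n)%nat) _ _ (gw_gt W G n)
    (gw_gt W G (1 + n)) (Hr n) (Hr (1 + n)%nat)) as E.
  pose proof (base_norm_pos _ _ (gw_gt W G n) (Hr n)) as N1.
  pose proof (base_norm_pos _ _ (gw_gt W G (1 + n)) (Hr (1 + n)%nat)) as N2.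
  set (Q := quad _ _ _ _ _) in *. set (N := base_norm _ _ * base_norm _ _) in *.
  assert (HN : 0 < N) by (now apply Rmult_lt_0_compat).
  replace Q with (Q / N * N) by (field; lra). rewrite <- E.
  apply Rmult_lt_0_compat; [nra | assumption].
Qed.

Lemma layout_angle_sum (W : nat -> R) (r : vertex -> R) (P : vertex -> C) (v : vertex) :
  layout W r P -> psum (triangle_angle W (ratio r v)) 6 = 2 * PI.
Proof.
  intros L. rewrite <- (flower_angle_sum P v (ly_oriented _ _ _ L) (ly_nonoverlapping _ _ _ L)).
  apply psum_ext. intros n. unfold triangle_angle, flower_angle, angle.
  now rewrite (layout_cos_angle W r P v n L).
Qed.

(* [x] and [y] encode the multiplier [x + i y]. *)
Definition similar_point (x y : R) (q p : C) : C :=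
  (x * (fst p - fst q) - y * (snd p - snd q), y * (fst p - fst q) + x * (snd p - snd q)).

Lemma layout_similar (W : nat -> R) (r : vertex -> R) (P : vertex -> C)
    (u : vertex) (k x y : R) (q : C) :
  0 < k -> x ^ 2 + y ^ 2 = k ^ 2 -> layout W r P ->
  layout W (fun v => k * r (vadd u v)) (fun v => similar_point x y q (P (vadd u v))).
Proof.
  intros Hk E L. split.
  - intros v. apply Rmult_lt_0_compat; [assumption | apply (ly_pos _ _ _ L)].
  - intros v n. rewrite <- vadd_assoc.
    transitivity (k ^ 2 * dist2 (P (vadd u v)) (P (vadd (vadd u v) (dir n)))).
    + rewrite <- E. unfold dist2, similar_point; simpl; ring.
    + rewrite (ly_dist _ _ _ L). unfold sqr_length; ring.
  - intros v d Hd. rewrite <- !vadd_assoc.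
    pose proof (ly_oriented _ _ _ L (vadd u v) d Hd) as K.
    assert (forall A B D, crs (similar_point x y q A) (similar_point x y q B) (similar_point x y q D)
      = k ^ 2 * crs A B D) as ->.
    { intros A B D. rewrite <- E. unfold crs, similar_point; simpl; ring. }
    apply Rmult_lt_0_compat; [nra | assumption].
  - intros i j l i' j' l' a b c a' b' c' Hf Hf' Hb Hb' [E1 E2] N1 N2 N3.
    assert (T : forall i j l, face i j l -> face (vadd u i) (vadd u j) (vadd u l)).
    { intros i0 j0 l0 (A1 & A2 & A3).
      assert (TA : forall v v', adj v v' -> adj (vadd u v) (vadd u v')).
      { intros v v' Hv. destruct (adj_unit _ _ Hv) as (d & Hd & ->).
        rewrite <- vadd_assoc. now apply adj_vadd. }
      repeat split; auto. }
    assert (TN : forall v v', v <> v' -> vadd u v <> vadd u v').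
    { intros v v' Hv K. apply Hv. now apply (vadd_cancel u). }
    apply (ly_nonoverlapping _ _ _ L (vadd u i) (vadd u j) (vadd u l)
      (vadd u i') (vadd u j') (vadd u l') a b c a' b' c'); auto.
    destruct Hb as (_ & _ & _ & S1). destruct Hb' as (_ & _ & _ & S2).
    unfold same_point. unfold similar_point in E1, E2; cbn [fst snd] in E1, E2.
    assert (c = 1 - a - b) by lra. assert (c' = 1 - a' - b') by lra. subst c c'.
    set (X := a * fst (P (vadd u i)) + b * fst (P (vadd u j)) + (1 - a - b) * fst (P (vadd u l))
      - (a' * fst (P (vadd u i')) + b' * fst (P (vadd u j')) + (1 - a' - b') * fst (P (vadd u l')))).
    set (Y := a * snd (P (vadd u i)) + b * snd (P (vadd u j)) + (1 - a - b) * snd (P (vadd u l))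
      - (a' * snd (P (vadd u i')) + b' * snd (P (vadd u j')) + (1 - a' - b') * snd (P (vadd u l')))).
    assert (F1 : x * X - y * Y = 0) by (unfold X, Y; lra).
    assert (F2 : y * X + x * Y = 0) by (unfold X, Y; lra).
    assert (0 < k ^ 2) by nra.
    assert (X0 : k ^ 2 * X = 0).
    { rewrite <- E. transitivity (x * (x * X - y * Y) + y * (y * X + x * Y)); [ring|].
      rewrite F1, F2; ring. }
    assert (Y0 : k ^ 2 * Y = 0).
    { rewrite <- E. transitivity (x * (y * X + x * Y) - y * (x * X - y * Y)); [ring|].
      rewrite F1, F2; ring. }
    apply Rmult_integral in X0. apply Rmult_integral in Y0. unfold X, Y in *. lra.
  - intros v n. pose proof (ly_Delaunay _ _ _ L (vadd u v) n) as K.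
    unfold Delaunay_at in *. intros H. specialize (K H). rewrite <- !vadd_assoc.
    pose proof (ly_pos _ _ _ L (vadd (vadd u v) (dir n))).
    pose proof (ly_pos _ _ _ L (vadd (vadd u v) (dir (1 + n)))).
    pose proof (ly_pos _ _ _ L (vadd (vadd u v) (dir (5 + n)))).
    assert (S1 : forall a b, 0 < b -> k * a / (k * b) = a / b) by (intros; field; lra).
    rewrite !S1 by assumption. exact K.
Qed.

(** * Incidence in a layout *)

Definition lerp (s : R) (A B : C) : C :=
  ((1 - s) * fst A + s * fst B, (1 - s) * snd A + s * snd B).

Lemma adj_face (i j : vertex) : adj i j ->
  exists k k', face i j k /\ face i j k' /\ k <> k'.
Proof.
  intros H. destruct (adj_unit _ _ H) as (d & Hd & ->).
  exists (vadd i (rot d)), (vadd i (rotinv d)).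
  split; [now apply face_left | split; [now apply face_right|]].
  intros E. apply vadd_cancel in E. revert E.
  destruct Hd as [-> | [-> | [-> | [-> | [-> | ->]]]]]; discriminate.
Qed.

(** Unless s = 1, the common point has positive weight at [i], and [i] is no corner of a suitable
    triangle on the other edge. *)
Lemma edges_meet (P : vertex -> C) (i j a b : vertex) (s t : R) : nonoverlapping P ->
  adj i j -> adj a b -> 0 <= s <= 1 -> 0 <= t <= 1 ->
  lerp s (P i) (P j) = lerp t (P a) (P b) -> i <> a -> i <> b -> s = 1.
Proof.
  intros Hn H1 H2 Hs Ht E Ha Hb.
  destruct (adj_face i j H1) as (k & _ & Hk & _).
  destruct (adj_face a b H2) as (c & c' & Hc & Hc' & Hcc).
  (* Of the two triangles on the edge from [a] to [b], at least one avoids [i]. *)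
  assert (exists c, face a b c /\ i <> c) as (f & Hf & Hif).
  { destruct (vertex_dec i c) as [-> |]; [exists c' | exists c]; auto. }
  unfold lerp in E. injection E as E1 E2.
  assert (1 - s = 0); [|lra].
  apply (Hn i j k a b f (1 - s) s 0 (1 - t) t 0); auto.
  - unfold barycentric; lra.
  - unfold barycentric; lra.
  - split; lra.
Qed.

Lemma edge_meets_face (P : vertex -> C) (i j a b c : vertex) (s x y z : R) : nonoverlapping P ->
  adj i j -> face a b c -> 0 <= s <= 1 -> barycentric x y z ->
  fst (lerp s (P i) (P j)) = x * fst (P a) + y * fst (P b) + z * fst (P c) ->
  snd (lerp s (P i) (P j)) = x * snd (P a) + y * snd (P b) + z * snd (P c) ->
  i <> a -> i <> b -> i <> c -> s = 1.
Proof.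
  intros Hn H1 H2 Hs Ht E1 E2 Ha Hb Hc.
  destruct (adj_face i j H1) as (k & _ & Hk & _).
  unfold lerp in *; simpl in *. assert (1 - s = 0); [|lra].
  apply (Hn i j k a b c (1 - s) s 0 x y z); auto.
  - unfold barycentric; lra.
  - split; lra.
Qed.

Lemma lerp_flip (s : R) (A B : C) : lerp s A B = lerp (1 - s) B A.
Proof. unfold lerp; f_equal; ring. Qed.

Lemma on_segment (A B Z : C) : fst B < fst Z -> fst Z < fst A -> crs A B Z = 0 ->
  exists t, 0 < t < 1 /\ Z = lerp t A B.
Proof.
  intros H1 H2 H. exists ((fst A - fst Z) / (fst A - fst B)).
  set (t := (fst A - fst Z) / (fst A - fst B)).
  assert (Et : t * (fst A - fst B) = fst A - fst Z) by (unfold t; field; lra).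
  split.
  - split; [apply Rdiv_lt_0_compat; lra|]. nra.
  - destruct A as [a1 a2], B as [b1 b2], Z as [z1 z2]. unfold lerp, crs in *; simpl in *.
    f_equal; [lra|]. apply (Rmult_eq_reg_r (a1 - b1)); [|lra]. nra.
Qed.

(* A point is below the segment from [A] leftwards to [B] when [0 < crs A B Z]. *)
Lemma same_side (P : vertex -> C) (i j a b : vertex) : nonoverlapping P ->
  adj i j -> adj a b -> i <> a -> i <> b -> j <> a -> j <> b ->
  fst (P b) < fst (P i) < fst (P a) -> fst (P b) < fst (P j) < fst (P a) ->
  0 < crs (P a) (P b) (P i) -> 0 < crs (P a) (P b) (P j).
Proof.
  intros Hn H1 H2 N1 N2 N3 N4 B1 B2 Hi. apply Rnot_le_lt; intros Hj.
  set (ci := crs (P a) (P b) (P i)) in *. set (cj := crs (P a) (P b) (P j)) in *.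
  set (s := ci / (ci - cj)).
  assert (Es : s * (ci - cj) = ci) by (unfold s; field; lra).
  assert (Hs : 0 < s <= 1).
  { split; [apply Rdiv_lt_0_compat; lra|]. nra. }
  destruct (on_segment (P a) (P b) (lerp s (P i) (P j))) as (t & Ht & E).
  - unfold lerp; simpl. nra.
  - unfold lerp; simpl. nra.
  - transitivity ((1 - s) * ci + s * cj); [unfold ci, cj, crs, lerp; simpl; ring|]. lra.
  - assert (s = 1) by (apply (edges_meet P i j a b s t); auto; lra).
    rewrite lerp_flip in E.
    assert (1 - s = 1); [|lra].
    apply (edges_meet P j i a b (1 - s) t); auto; try lra. now apply adj_sym.
Qed.

(** Vertically above [k], the edge from [a'] to [b'] has a point [Z], which by the last hypothesis
    is not above the edge from [a] to [b]. So [Z] lies in the triangle at [k], and an edge avoiding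
    [k] can meet that triangle in an inner point of the edge only by being its opposite side. *)
Lemma below_edge_clash (P : vertex -> C) (k a b k' a' b' : vertex) : nonoverlapping P ->
  face k a b -> adj a' b' -> k <> a' -> k <> b' ->
  fst (P b) < fst (P k) < fst (P a) -> fst (P b') < fst (P k) < fst (P a') ->
  0 < crs (P k) (P a) (P b) -> 0 < crs (P a') (P b') (P k) ->
  (forall Z, fst Z = fst (P k) -> crs (P a') (P b') Z = 0 -> 0 <= crs (P a) (P b) Z) ->
  a' = a /\ b' = b.
Proof.
  intros Hn Hf He N1 N2 B1 B2 Hc Hk' HZ.
  set (t := (fst (P a') - fst (P k)) / (fst (P a') - fst (P b'))).
  assert (Et : t * (fst (P a') - fst (P b')) = fst (P a') - fst (P k)) by (unfold t; field; lra).
  assert (Ht : 0 < t < 1) by (split; [apply Rdiv_lt_0_compat; lra | nra]).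
  set (Z := lerp t (P a') (P b')).
  assert (Z1 : fst Z = fst (P k)) by (unfold Z, lerp; simpl; lra).
  assert (Z2 : crs (P a') (P b') Z = 0).
  { unfold crs, Z, lerp; simpl; ring. }
  specialize (HZ Z Z1 Z2).
  destruct (barycentric_solve (P k) (P a) (P b) Z (Rgt_not_eq _ _ Hc)) as (S1 & S2 & S3).
  assert (Hh : 0 < snd Z - snd (P k)).
  { unfold crs in Hk', Z2. rewrite Z1 in Z2. nra. }
  assert (W1 : 0 <= crs Z (P a) (P b) / crs (P k) (P a) (P b)).
  { apply Rmult_le_pos; [|apply Rlt_le, Rinv_0_lt_compat; assumption].
    rewrite crs_cycle. exact HZ. }
  assert (W2 : 0 <= crs (P k) Z (P b) / crs (P k) (P a) (P b)).
  { apply Rmult_le_pos; [|apply Rlt_le, Rinv_0_lt_compat; assumption].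
    unfold crs. rewrite Z1. nra. }
  assert (W3 : 0 <= crs (P k) (P a) Z / crs (P k) (P a) (P b)).
  { apply Rmult_le_pos; [|apply Rlt_le, Rinv_0_lt_compat; assumption].
    unfold crs. rewrite Z1. nra. }
  assert (Ha' : a' = a \/ a' = b).
  { apply NNPP; intros C. apply not_or_and in C. destruct C as [C1 C2].
    assert (t = 1); [|lra].
    apply (edge_meets_face P a' b' k a b t (crs Z (P a) (P b) / crs (P k) (P a) (P b))
      (crs (P k) Z (P b) / crs (P k) (P a) (P b)) (crs (P k) (P a) Z / crs (P k) (P a) (P b))); auto; try lra.
    unfold barycentric; auto. }
  assert (Hb' : b' = a \/ b' = b).
  { apply NNPP; intros C. apply not_or_and in C. destruct C as [C1 C2].
    assert (1 - t = 1); [|lra].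
    apply (edge_meets_face P b' a' k a b (1 - t) (crs Z (P a) (P b) / crs (P k) (P a) (P b))
      (crs (P k) Z (P b) / crs (P k) (P a) (P b)) (crs (P k) (P a) Z / crs (P k) (P a) (P b))); auto; try lra.
    - now apply adj_sym.
    - unfold barycentric; auto.
    - rewrite <- lerp_flip. exact S2.
    - rewrite <- lerp_flip. exact S3. }
  destruct Ha' as [-> | ->]; [|lra]. destruct Hb' as [-> | ->]; [lra | auto].
Qed.

(* The two bounding edges [a b] and [a' b'] are graphs over an interval
   containing the cluster of small vertices, which lies below both. *)
Lemma wedge_clash (P : vertex -> C) (k a b k' a' b' : vertex) : nonoverlapping P ->
  face k a b -> face k' a' b' -> k <> a' -> k <> b' -> k' <> a -> k' <> b ->
  fst (P b) < fst (P k) < fst (P a) -> fst (P b') < fst (P k') < fst (P a') ->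
  fst (P b) < fst (P k') < fst (P a) -> fst (P b') < fst (P k) < fst (P a') ->
  0 < crs (P k) (P a) (P b) -> 0 < crs (P k') (P a') (P b') ->
  0 < crs (P a) (P b) (P k') -> 0 < crs (P a') (P b') (P k) ->
  a' = a /\ b' = b.
Proof.
  intros Hn Hf Hf' N1 N2 N3 N4 B1 B2 B3 B4 C1 C2 C3 C4.
  pose proof Hf as (_ & He & _). pose proof Hf' as (_ & He' & _).
  set (A := P a) in *. set (B := P b) in *. set (A' := P a') in *. set (B' := P b') in *.
  set (h := fun x => snd B + (snd A - snd B) * (x - fst B) / (fst A - fst B)).
  set (h' := fun x => snd B' + (snd A' - snd B') * (x - fst B') / (fst A' - fst B')).
  assert (E1 : forall Z, crs A B Z = (fst A - fst B) * (h (fst Z) - snd Z))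
    by (intros; unfold crs, h; field; lra).
  assert (E2 : forall Z, crs A' B' Z = (fst A' - fst B') * (h' (fst Z) - snd Z))
    by (intros; unfold crs, h'; field; lra).
  (* If the second edge is the lower one above [k], or the first is the lower one above [k'], an
     edge enters a triangle. Otherwise the edges change their order between the two abscissas, so
     they cross. *)
  destruct (Rle_dec (h' (fst (P k))) (h (fst (P k)))) as [K | K].
  - apply (below_edge_clash P k a b k' a' b'); auto.
    intros Z Z1 Z2. fold A' B' in Z2. rewrite E2 in Z2. fold A B. rewrite E1, Z1 in *.
    apply Rmult_le_pos; [lra|]. apply Rmult_integral in Z2. lra.
  - destruct (Rle_dec (h (fst (P k'))) (h' (fst (P k')))) as [K' | K'].
    + destruct (below_edge_clash P k' a' b' k a b) as [-> ->]; auto.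
      intros Z Z1 Z2. fold A B in Z2. rewrite E1 in Z2. fold A' B'. rewrite E2, Z1 in *.
      apply Rmult_le_pos; [lra|]. apply Rmult_integral in Z2. lra.
    + apply Rnot_le_lt in K. apply Rnot_le_lt in K'.
      set (x := fst (P k)) in *. set (x' := fst (P k')) in *.
      set (g := h' x - h x) in *. set (g' := h x' - h' x') in *.
      assert (Hg : 0 < g) by (unfold g; lra). assert (Hg' : 0 < g') by (unfold g'; lra).
      set (s := g / (g + g')).
      assert (Es : s * (g + g') = g) by (unfold s; field; lra).
      assert (Hs : 0 < s < 1) by (split; [apply Rdiv_lt_0_compat; lra | nra]).
      set (y := (1 - s) * x + s * x').
      assert (Hy : h y = h' y).
      { assert (h y - h' y = - ((1 - s) * g) + s * g') as Hyy; [|lra].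
        unfold g, g', y, h, h'. field. lra. }
      destruct (on_segment A B (y, h y)) as (t & Ht & Et).
      { simpl. unfold y. nra. } { simpl. unfold y. nra. }
      { rewrite E1. simpl. ring. }
      destruct (on_segment A' B' (y, h y)) as (t' & Ht' & Et').
      { simpl. unfold y. nra. } { simpl. unfold y. nra. }
      { rewrite E2. simpl. rewrite Hy. ring. }
      rewrite Et in Et'.
      assert (Ha' : a' = a \/ a' = b).
      { apply NNPP; intros D. apply not_or_and in D. destruct D as [D1 D2].
        assert (t' = 1); [|lra].
        apply (edges_meet P a' b' a b t' t); auto; lra. }
      assert (Hb' : b' = a \/ b' = b).
      { apply NNPP; intros D. apply not_or_and in D. destruct D as [D1 D2].
        assert (1 - t' = 1); [|lra].
        apply (edges_meet P b' a' a b (1 - t') t); auto; try lra.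
        - now apply adj_sym.
        - rewrite <- lerp_flip. symmetry. exact Et'. }
      unfold A', B', A, B, x, x' in *.
      destruct Ha' as [-> | ->]; [|lra]. destruct Hb' as [-> | ->]; [lra | auto].
Qed.

Lemma list_max (A : Type) (f : A -> R) (l : list A) : l <> nil ->
  exists x, In x l /\ forall y, In y l -> f y <= f x.
Proof.
  induction l as [|a l IH]; intros H; [congruence|].
  destruct l as [|b l].
  - exists a. split; [now left|]. intros y [<- | []]; lra.
  - destruct IH as (x & Hx & Hm); [discriminate|].
    destruct (Rle_dec (f x) (f a)) as [K | K].
    + exists a. split; [now left|]. intros y [<- | Hy]; [lra|]. specialize (Hm y Hy). lra.
    + exists x. split; [now right|]. intros y [<- | Hy]; [lra|]. auto.
Qed.

(** The vertex of the list farthest from [p] has all its neighbours in the disk around [p] through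
    itself. A disk being strictly convex, they lie strictly on one side of a line through that
    vertex, against [flower_not_separated]. *)
Lemma island_impossible (P : vertex -> C) (l : list vertex) (p : C) (rho : R) :
  oriented P -> l <> nil ->
  (forall a, In a l -> rho < dist2 p (P a)) ->
  (forall a d, In a l -> unit_vec d ->
    In (vadd a d) l \/ dist2 p (P (vadd a d)) <= rho) -> False.
Proof.
  intros Ho Hl H1 H2.
  destruct (list_max _ (fun a => dist2 p (P a)) l Hl) as (a & Ha & Hm).
  apply (flower_not_separated P a (fst p - fst (P a)) (snd p - snd (P a)) Ho).
  intros d Hd.
  assert (K : dist2 p (P (vadd a d)) <= dist2 p (P a)).
  { destruct (H2 a d Ha Hd) as [K | K]; [now apply Hm|]. specialize (H1 a Ha). lra. }
  destruct (crs_pos_dist _ _ _ (Rgt_not_eq _ _ (Ho a d Hd))) as [D _].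
  unfold dist2 in *. nra.
Qed.

(** * Compactness *)

Definition vertex_of_nat (n : nat) : vertex :=
  let (p, q) := of_nat n in
  let (a, b) := of_nat p in
  let (c, d) := of_nat q in
  ((Z.of_nat a - Z.of_nat b)%Z, (Z.of_nat c - Z.of_nat d)%Z).

Lemma vertex_of_nat_surj (v : vertex) : exists n, vertex_of_nat n = v.
Proof.
  destruct v as [x y].
  exists (to_nat (to_nat (Z.to_nat x, Z.to_nat (- x)), to_nat (Z.to_nat y, Z.to_nat (- y)))).
  unfold vertex_of_nat. rewrite !cancel_of_to. f_equal; lia.
Qed.

(** The indices satisfy n <= phi n, which is enough to carry limits over, by [is_lim_seq_along]. *)
Lemma convergent_subsequence (u : nat -> R) (B : R) : (forall n, Rabs (u n) <= B) ->
  exists phi : nat -> nat, (forall n, (n <= phi n)%nat) /\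
    exists l : R, is_lim_seq (fun n => u (phi n)) l.
Proof.
  intros H.
  destruct (Bolzano_Weierstrass u (fun x => - B <= x <= B)) as [l Hl].
  - apply compact_P3.
  - intros n. specialize (H n). apply Rabs_le_between in H. exact H.
  - assert (Hc : forall n : nat, exists m, (n <= m)%nat /\ Rabs (u m - l) < / (INR n + 1)).
    { intros n. assert (Hp : 0 < / (INR n + 1)).
      { apply Rinv_0_lt_compat. pose proof (pos_INR n). lra. }
      destruct (Hl (fun x => Rabs (x - l) < / (INR n + 1)) n) as (m & H1 & H2).
      - exists (mkposreal _ Hp). intros x Hx. exact Hx.
      - exists m. split; [exact H1 | exact H2]. }
    exists (fun n => proj1_sig (constructive_indefinite_description _ (Hc n))).
    split.
    + intros n. apply (proj2_sig (constructive_indefinite_description _ (Hc n))).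
    + exists l. apply is_lim_seq_Reals. intros eps He.
      destruct (archimed_cor1 eps He) as (N & HN & HN0).
      exists N. intros n Hn. unfold Rdist.
      destruct (proj2_sig (constructive_indefinite_description _ (Hc n))) as [_ K].
      eapply Rlt_trans; [exact K|]. eapply Rle_lt_trans; [|exact HN].
      apply Rinv_le_contravar; [apply lt_0_INR; lia|].
      apply le_INR in Hn. lra.
Qed.

Lemma is_lim_seq_along (u : nat -> R) (phi : nat -> nat) (l : Rbar) :
  (forall n, (n <= phi n)%nat) -> is_lim_seq u l -> is_lim_seq (fun n => u (phi n)) l.
Proof.
  intros H Hu. apply (is_lim_seq_subseq u l phi); [|assumption].
  intros Q [N HN]. exists N. intros n Hn. apply HN. specialize (H n). lia.
Qed.

Lemma diagonal_subsequence (f : nat -> vertex -> R) (B : vertex -> R) :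
  (forall n v, Rabs (f n v) <= B v) ->
  exists phi : nat -> nat, (forall n, (n <= phi n)%nat) /\
    forall v, exists l : R, is_lim_seq (fun n => f (phi n) v) l.
Proof.
  intros H.
  assert (Hp : forall (v : vertex) (s : nat -> nat), exists psi : nat -> nat,
    (forall n, (n <= psi n)%nat) /\ exists l : R, is_lim_seq (fun n => f (s (psi n)) v) l).
  { intros v s. apply (convergent_subsequence (fun n => f (s n) v) (B v)). auto. }
  pose (pick := fun v s => proj1_sig (constructive_indefinite_description _ (Hp v s))).
  assert (P1 : forall v s n, (n <= pick v s n)%nat).
  { intros v s. apply (proj2_sig (constructive_indefinite_description _ (Hp v s))). }
  assert (P2 : forall v s, exists l : R, is_lim_seq (fun n => f (s (pick v s n)) v) l).
  { intros v s. apply (proj2_sig (constructive_indefinite_description _ (Hp v s))). }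
  (* Row k is the composition of the first k extractions; row k + 1 converges at the vertex number
     k. By [HS] a later row takes, at n, the value of an earlier row at some m >= n, so the diagonal
     converges everywhere. *)
  pose (S := fix S k := match k with
    | O => fun n : nat => n
    | Datatypes.S k => fun n => S k (pick (vertex_of_nat k) (S k) n)
    end).
  assert (HS : forall K j n, exists m, (n <= m)%nat /\ S (j + K)%nat n = S K m).
  { intros K j. induction j; intros n; [exists n; split; [lia | reflexivity]|].
    simpl. destruct (IHj (pick (vertex_of_nat (j + K)) (S (j + K)%nat) n)) as (m & Hm & E).
    exists m. split; [|exact E]. pose proof (P1 (vertex_of_nat (j + K)) (S (j + K)%nat) n). lia. }
  exists (fun n => S n n). split.
  - intros n. destruct (HS O n n) as (m & Hm & E). rewrite Nat.add_0_r in E.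
    rewrite E. exact Hm.
  - intros v. destruct (vertex_of_nat_surj v) as [k <-].
    destruct (P2 (vertex_of_nat k) (S k)) as [l Hl]. exists l.
    change (is_lim_seq (fun n => f (S (Datatypes.S k) n) (vertex_of_nat k)) l) in Hl.
    assert (Hm : forall n, exists m, (n <= m)%nat /\
      S (n + Datatypes.S k)%nat (n + Datatypes.S k)%nat = S (Datatypes.S k) m).
    { intros n. destruct (HS (Datatypes.S k) n (n + Datatypes.S k)%nat) as (m & H1 & H2).
      exists m. split; [lia | exact H2]. }
    apply (is_lim_seq_incr_n _ (Datatypes.S k)).
    pose (t := fun n => proj1_sig (constructive_indefinite_description _ (Hm n))).
    apply (is_lim_seq_ext (fun n => f (S (Datatypes.S k) (t n)) (vertex_of_nat k))).
    + intros n. unfold t. destruct (constructive_indefinite_description _ (Hm n)) as (m & Hm1 & Hm2).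
      simpl. now rewrite Hm2.
    + apply (is_lim_seq_along (fun n => f (S (Datatypes.S k) n) (vertex_of_nat k)) t); [|exact Hl].
      intros n. unfold t. destruct (constructive_indefinite_description _ (Hm n)) as (m & Hm1 & Hm2).
      exact Hm1.
Qed.

Lemma eventually_all_lt (Q : nat -> nat -> Prop) (N : nat) :
  (forall i, (i < N)%nat -> eventually (Q i)) ->
  eventually (fun n => forall i, (i < N)%nat -> Q i n).
Proof.
  induction N; intros H.
  - exists O. intros; lia.
  - destruct (IHN ltac:(intros; apply H; lia)) as [M1 H1].
    destruct (H N ltac:(lia)) as [M2 H2].
    exists (Nat.max M1 M2). intros n Hn i Hi.
    destruct (Nat.eq_dec i N) as [-> |]; [apply H2; lia | apply H1; lia].
Qed.

Lemma is_lim_seq_eventually_lt (u : nat -> R) (l c : R) :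
  is_lim_seq u l -> l < c -> eventually (fun n => u n < c).
Proof.
  intros H Hc. apply (H (fun x => x < c)). exists (mkposreal (c - l) ltac:(lra)).
  intros y Hy. unfold ball in Hy; simpl in Hy. unfold AbsRing_ball, abs, minus, plus, opp in Hy.
  simpl in Hy. apply Rabs_def2 in Hy. lra.
Qed.

Lemma is_lim_seq_eventually_gt (u : nat -> R) (l c : R) :
  is_lim_seq u l -> c < l -> eventually (fun n => c < u n).
Proof.
  intros H Hc. apply (H (fun x => c < x)). exists (mkposreal (l - c) ltac:(lra)).
  intros y Hy. unfold ball in Hy; simpl in Hy. unfold AbsRing_ball, abs, minus, plus, opp in Hy.
  simpl in Hy. apply Rabs_def2 in Hy. lra.
Qed.

(** * Closed walks along the boundary between small and big vertices *)

(* A state [(k, j)] is the edge from [k] to [k + dir j]. *)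
Definition state : Type := (vertex * nat)%type.
Definition tip (s : state) : vertex := vadd (fst s) (dir (snd s)).
Definition apex (s : state) : vertex := vadd (fst s) (dir (S (snd s))).
(** Both moves cross the triangle on the left of the edge. A left turn keeps the tail, a right turn
    keeps the tip; choosing according to the size of [apex] keeps tails small and tips big, so the
    walk follows the boundary of a cluster of small vertices. *)
Definition turn_left (s : state) : state := (fst s, (S (snd s) mod 6)%nat).
Definition turn_right (s : state) : state := (apex s, ((5 + snd s) mod 6)%nat).

Lemma dir_mod (n : nat) : dir (n mod 6) = dir n.
Proof. symmetry. apply (periodic_mod _ dir 6 n); [lia | apply dir_period]. Qed.

Lemma tip_left (s : state) : tip (turn_left s) = apex s.
Proof. unfold tip, turn_left, apex. cbn [fst snd]. now rewrite dir_mod. Qed.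

Lemma tip_right (s : state) : tip (turn_right s) = tip s.
Proof.
  unfold tip, turn_right, apex. cbn [fst snd]. rewrite dir_mod.
  unfold dir; simpl. destruct (Nat.iter (snd s) rot (1, 0)%Z), (fst s).
  unfold vadd, rot; simpl; f_equal; ring.
Qed.

Definition state_eqb (s t : state) : bool :=
  ((fst (fst s) =? fst (fst t))%Z && (snd (fst s) =? snd (fst t))%Z
   && (snd s =? snd t)%nat)%bool.

Lemma state_eqb_eq (s t : state) : state_eqb s t = true <-> s = t.
Proof.
  destruct s as [[a b] c], t as [[a' b'] c']. unfold state_eqb; simpl.
  rewrite !Bool.andb_true_iff, !Z.eqb_eq, Nat.eqb_eq.
  split; [intros [[-> ->] ->]; reflexivity | intros E; injection E; auto].
Qed.

Definition vertex_mem (v : vertex) (l : list vertex) : bool :=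
  existsb (fun u => ((fst u =? fst v)%Z && (snd u =? snd v)%Z)%bool) l.

Lemma vertex_mem_In (v : vertex) (l : list vertex) : vertex_mem v l = true -> In v l.
Proof.
  unfold vertex_mem. rewrite existsb_exists. intros ([a b] & H1 & H2).
  destruct v as [c d]. simpl in H2. rewrite Bool.andb_true_iff, !Z.eqb_eq in H2.
  destruct H2 as [-> ->]. exact H1.
Qed.

Definition enclosed (ks hs : list vertex) : bool :=
  forallb (fun a => forallb (fun j => vertex_mem (vadd a (dir j)) (ks ++ hs)) (seq 0 6)) hs.

(* Explores all walks from [s] that return to [start], with at most [lefts]
   left turns and never five consecutive right turns ([rights] right turns
   being still allowed), and checks that the tips of each such walk are
   surrounded by its tails. *)
Fixpoint search (fuel : nat) (start s : state) (moved : bool) (lefts rights : nat)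
    (ks hs : list vertex) : bool :=
  match fuel with
  | O => false
  | S fuel =>
      let ks := fst s :: ks in
      let hs := tip s :: hs in
      if (moved && state_eqb s start)%bool then enclosed ks hs
      else
        ((match lefts with
          | O => true
          | S lefts => search fuel start (turn_left s) true lefts 4 ks hs
          end) &&
         (match rights with
          | O => true
          | S rights => search fuel start (turn_right s) true lefts rights ks hs
          end))%bool
  end.

(** The walk starts with a left turn, hence no right turn is allowed at first. Five left turns, each
    followed by at most four right turns, are at most 25 moves; running out of the fuel 40 would
    yield [false]. *)
Lemma search_true : forallb (fun j =>
  search 40 ((0, 0)%Z, j) ((0, 0)%Z, j) false 5 0 nil nil) (seq 0 6) = true.
Proof. vm_compute. reflexivity. Qed.

Fixpoint lefts_in (t : nat -> bool) (i n : nat) : nat :=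
  match n with
  | O => O
  | S n => ((if t i then 0 else 1) + lefts_in t (S i) n)%nat
  end.

Definition shift (u : vertex) (s : state) : state := (vadd u (fst s), snd s).

Lemma tip_shift (u : vertex) (s : state) : tip (shift u s) = vadd u (tip s).
Proof. unfold tip, shift; simpl. apply vadd_assoc. Qed.

Lemma left_shift (u : vertex) (s : state) : turn_left (shift u s) = shift u (turn_left s).
Proof. reflexivity. Qed.

Lemma right_shift (u : vertex) (s : state) : turn_right (shift u s) = shift u (turn_right s).
Proof. unfold turn_right, shift, apex; cbn [fst snd]. now rewrite vadd_assoc. Qed.

Lemma shift_inj (u : vertex) (s s' : state) : shift u s = shift u s' -> s = s'.
Proof.
  destruct s as [v j], s' as [v' j']. unfold shift; cbn [fst snd]. intros E.
  injection E as E1 E2 E3. subst. destruct v, v'. simpl in *. repeat f_equal; lia.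
Qed.

Definition is_walk (st : nat -> state) (t : nat -> bool) : Prop :=
  forall i, st (S i) = if t i then turn_right (st i) else turn_left (st i).

(** The remaining [n] steps of the actual walk, translated by [u], follow one branch of the search.
    If the branch returns to [start] early, it stops there, and the part walked so far is already
    enclosed. *)
Lemma search_sound (st : nat -> state) (t : nat -> bool) (u : vertex) (start : state) :
  is_walk st t ->
  (forall j, exists j', (j <= j' <= j + 4)%nat /\ t j' = false) ->
  forall fuel s moved lefts rights ks hs i n,
  search fuel start s moved lefts rights ks hs = true ->
  st i = shift u s -> st (i + n)%nat = shift u start ->
  (n = 0%nat -> moved = true) -> (lefts_in t i n <= lefts)%nat ->
  ((rights < n)%nat -> exists j', (i <= j' <= i + rights)%nat /\ t j' = false) ->
  exists ks' hs', enclosed ks' hs' = true /\ hs' <> nil /\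
    (forall x, In x ks' -> In x ks \/
      exists j, (i <= j <= i + n)%nat /\ vadd u x = fst (st j)) /\
    (forall x, In x hs' -> In x hs \/
      exists j, (i <= j <= i + n)%nat /\ vadd u x = tip (st j)).
Proof.
  intros Hw Hfive. induction fuel as [|fuel IH]; [discriminate|].
  intros s moved lefts rights ks hs i n Hs Hi He Hn Hl Hr.
  simpl in Hs.
  destruct (moved && state_eqb s start)%bool eqn:Em.
  - exists (fst s :: ks), (tip s :: hs). split; [exact Hs | split; [discriminate|split]].
    + intros x [<- | Hx]; [right | now left].
      exists i. split; [lia|]. rewrite Hi. reflexivity.
    + intros x [<- | Hx]; [right | now left].
      exists i. split; [lia|]. rewrite Hi. now rewrite tip_shift.
  - destruct n as [|n].
    + rewrite (Hn eq_refl) in Em. simpl in Em. rewrite Nat.add_0_r, Hi in He.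
      apply shift_inj in He. apply state_eqb_eq in He. congruence.
    + apply Bool.andb_true_iff in Hs. destruct Hs as [HsL HsR].
      specialize (Hw i). simpl in Hl.
      replace (i + S n)%nat with (S i + n)%nat in * by lia.
      assert (HC : exists ks' hs', enclosed ks' hs' = true /\ hs' <> nil /\
        (forall x, In x ks' -> In x (fst s :: ks) \/
          exists j, (S i <= j <= S i + n)%nat /\ vadd u x = fst (st j)) /\
        (forall x, In x hs' -> In x (tip s :: hs) \/
          exists j, (S i <= j <= S i + n)%nat /\ vadd u x = tip (st j))).
      { destruct (t i) eqn:Et.
        - destruct rights as [|rights].
          { destruct Hr as (j' & Hj & Hf); [lia|]. assert (j' = i) by lia. congruence. }
          eapply (IH _ _ _ _ _ _ (S i) n HsR).
          + rewrite Hw, Hi. apply right_shift.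
          + exact He.
          + reflexivity.
          + exact Hl.
          + intros Hlt. destruct Hr as (j' & Hj & Hf); [lia|]. exists j'. split; [|exact Hf].
            assert (j' <> i) by congruence. lia.
        - destruct lefts as [|lefts]; [simpl in Hl; lia|].
          eapply (IH _ _ _ _ _ _ (S i) n HsL).
          + rewrite Hw, Hi. apply left_shift.
          + exact He.
          + reflexivity.
          + simpl in Hl. lia.
          + intros _. destruct (Hfive (S i)) as (j' & Hj & Hf). exists j'. split; [lia | exact Hf]. }
      destruct HC as (ks' & hs' & H1 & H2 & H3 & H4).
      exists ks', hs'. split; [assumption | split; [assumption | split]].
      * intros x Hx. destruct (H3 x Hx) as [[<- | K] | (j & Hj & K)].
        -- right. exists i. split; [lia|]. now rewrite Hi.
        -- now left.
        -- right. exists j. split; [lia | assumption].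
      * intros x Hx. destruct (H4 x Hx) as [[<- | K] | (j & Hj & K)].
        -- right. exists i. split; [lia|]. now rewrite Hi, tip_shift.
        -- now left.
        -- right. exists j. split; [lia | assumption].
Qed.

Lemma unit_dir (d : vertex) : unit_vec d -> exists m, (m < 6)%nat /\ d = dir m.
Proof.
  intros [-> | [-> | [-> | [-> | [-> | ->]]]]];
  [exists 0%nat | exists 1%nat | exists 2%nat | exists 3%nat | exists 4%nat | exists 5%nat];
  (split; [lia | reflexivity]).
Qed.

Lemma enclosed_spec (ks hs : list vertex) (a d : vertex) :
  enclosed ks hs = true -> In a hs -> unit_vec d -> In (vadd a d) (ks ++ hs).
Proof.
  intros H Ha Hd. destruct (unit_dir d Hd) as (m & Hm & ->).
  unfold enclosed in H. rewrite forallb_forall in H. specialize (H a Ha).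
  rewrite forallb_forall in H. apply vertex_mem_In, H. apply in_seq. lia.
Qed.

(** The list [hs] is made for [island_impossible]: the tails will be near one point and the tips far
    from it. *)
Lemma closed_walk_enclosed (st : nat -> state) (t : nat -> bool) (i n : nat) :
  is_walk st t -> (forall j, (snd (st j) < 6)%nat) ->
  (forall j, exists j', (j <= j' <= j + 4)%nat /\ t j' = false) ->
  (0 < n)%nat -> t i = false -> st (i + n)%nat = st i -> (lefts_in t i n <= 5)%nat ->
  exists hs, hs <> nil /\
    (forall a, In a hs -> exists j, (i <= j <= i + n)%nat /\ a = tip (st j)) /\
    (forall a d, In a hs -> unit_vec d ->
      In (vadd a d) hs \/ exists j, (i <= j <= i + n)%nat /\ vadd a d = fst (st j)).
Proof.
  intros Hw Hsnd Hfive Hn Hi Hc Hl.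
  pose (u := fst (st i)). pose (s := ((0, 0)%Z, snd (st i)) : state).
  assert (Es : st i = shift u s).
  { unfold s, u, shift; simpl. rewrite vadd_0_r. now destruct (st i). }
  pose proof search_true as HS. rewrite forallb_forall in HS.
  specialize (HS (snd (st i))). cbv beta in HS.
  assert (HS' : search 40 s s false 5 0 nil nil = true).
  { apply HS. apply in_seq. specialize (Hsnd i). lia. }
  destruct (search_sound st t u s Hw Hfive _ _ _ _ _ _ _ i n HS') as (ks & hs & H1 & H2 & H3 & H4).
  - exact Es.
  - now rewrite Hc.
  - lia.
  - exact Hl.
  - intros _. exists i. split; [lia | exact Hi].
  - exists (map (vadd u) hs). split; [|split].
    + destruct hs; [congruence | discriminate].
    + intros a Ha. apply in_map_iff in Ha. destruct Ha as (x & <- & Hx).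
      destruct (H4 x Hx) as [[] | (j & Hj & E)]. exists j; auto.
    + intros a d Ha Hd. apply in_map_iff in Ha. destruct Ha as (x & <- & Hx).
      rewrite vadd_assoc. pose proof (enclosed_spec _ _ x d H1 Hx Hd) as K.
      apply in_app_or in K. destruct K as [K | K].
      * right. destruct (H3 _ K) as [[] | (j & Hj & E)]. exists j; auto.
      * left. now apply in_map.
Qed.

(** * Overlapping wedges *)

(** The sine of the angle between B - A and B - A' is [sg], of size at most e / R0; the cosine is
    positive because e < R0. So the angle is [asin sg]. *)
Lemma at_angle_close (A A' B : C) (t e R0 eta : R) :
  0 < eta < PI / 2 -> 0 <= e -> 0 < R0 -> e < R0 -> e <= R0 * sin eta ->
  dist2 A A' <= e ^ 2 -> R0 ^ 2 <= dist2 A B -> R0 ^ 2 <= dist2 A' B ->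
  at_angle A B t -> exists t', at_angle A' B t' /\ t - eta <= t' <= t + eta.
Proof.
  intros Heta He HR HeR Hs HAA HAB HAB' [E1 E2].
  assert (D1 : 0 < dist2 A B) by nra. assert (D2 : 0 < dist2 A' B) by nra.
  pose proof (sqrt_lt_R0 _ D1) as L1. pose proof (sqrt_lt_R0 _ D2) as L2.
  pose proof (sqrt_sqrt (dist2 A B) ltac:(lra)) as S1.
  pose proof (sqrt_sqrt (dist2 A' B) ltac:(lra)) as S2.
  assert (L1' : R0 <= sqrt (dist2 A B)).
  { rewrite <- (sqrt_pow2 R0) by lra. now apply sqrt_le_1_alt. }
  assert (L2' : R0 <= sqrt (dist2 A' B)).
  { rewrite <- (sqrt_pow2 R0) by lra. now apply sqrt_le_1_alt. }
  set (l := sqrt (dist2 A B)) in *. set (l' := sqrt (dist2 A' B)) in *.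
  pose (x := fst B - fst A). pose (y := snd B - snd A).
  pose (x' := fst B - fst A'). pose (y' := snd B - snd A').
  pose (cr := x * y' - y * x'). pose (dt := x * x' + y * y').
  assert (X1 : x ^ 2 + y ^ 2 = l * l) by (rewrite S1; reflexivity).
  assert (X2 : x' ^ 2 + y' ^ 2 = l' * l') by (rewrite S2; reflexivity).
  assert (X3 : (x - x') ^ 2 + (y - y') ^ 2 <= e ^ 2).
  { eapply Rle_trans; [|exact HAA]. unfold x, x', y, y', dist2. right; ring. }
  assert (Hdt : 0 < dt).
  { assert (2 * dt = (x ^ 2 + y ^ 2) + (x' ^ 2 + y' ^ 2) - ((x - x') ^ 2 + (y - y') ^ 2))
      by (unfold dt; ring). nra. }
  assert (Hid : cr ^ 2 + dt ^ 2 = (l * l') ^ 2).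
  { replace ((l * l') ^ 2) with ((l * l) * (l' * l')) by ring.
    rewrite <- X1, <- X2. unfold cr, dt; ring. }
  assert (Hcr : cr ^ 2 <= (l * e) ^ 2).
  { assert (cr ^ 2 <= (x ^ 2 + y ^ 2) * ((x - x') ^ 2 + (y - y') ^ 2)).
    { replace cr with (y * (x - x') - x * (y - y')) by (unfold cr; ring).
      assert (0 <= (x * (x - x') + y * (y - y')) ^ 2) by apply pow2_ge_0. nra. }
    rewrite X1 in *. replace ((l * e) ^ 2) with (l * l * e ^ 2) by ring.
    eapply Rle_trans; [eassumption|]. apply Rmult_le_compat_l; nra. }
  set (sg := cr / (l * l')).
  assert (Hll : 0 < l * l') by nra.
  assert (Hsg : sg * (l * l') = cr) by (unfold sg; field; lra).
  assert (Hsg1 : sg ^ 2 < 1).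
  { apply (Rmult_lt_reg_r ((l * l') ^ 2)); [nra|].
    replace (sg ^ 2 * (l * l') ^ 2) with (cr ^ 2) by (rewrite <- Hsg; ring). nra. }
  assert (Hsg2 : sg ^ 2 <= sin eta ^ 2).
  { assert (0 < sin eta) by (apply sin_gt_0; lra).
    apply (Rmult_le_reg_r ((l * l') ^ 2)); [nra|].
    replace (sg ^ 2 * (l * l') ^ 2) with (cr ^ 2) by (rewrite <- Hsg; ring).
    eapply Rle_trans; [exact Hcr|].
    replace (sin eta ^ 2 * (l * l') ^ 2) with ((l * (l' * sin eta)) ^ 2) by ring.
    apply pow_incr. split; [nra|]. apply Rmult_le_compat_l; [lra|]. nra. }
  assert (Hsin : 0 < sin eta) by (apply sin_gt_0; lra).
  assert (Hsgb : - sin eta <= sg <= sin eta) by (split; nra).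
  pose proof (SIN_bound eta) as Hb.
  assert (Hb1 : -1 <= sg <= 1) by lra.
  pose proof (asin_bound sg) as Ab.
  assert (Es : sin (asin sg) = sg) by (apply sin_asin; lra).
  assert (Ec : cos (asin sg) = dt / (l * l')).
  { rewrite cos_asin by lra. rewrite Rsqr_pow2.
    replace (1 - sg ^ 2) with ((dt / (l * l')) ^ 2).
    - apply sqrt_pow2. apply Rlt_le, Rdiv_lt_0_compat; lra.
    - unfold sg. unfold Rdiv. rewrite !Rpow_mult_distr, !pow_inv.
      replace (dt ^ 2) with ((l * l') ^ 2 - cr ^ 2) by lra. field. lra. }
  assert (C1 : cos t = x / l) by (unfold x; rewrite E1; field; lra).
  assert (C2 : sin t = y / l) by (unfold y; rewrite E2; field; lra).
  exists (t + asin sg). split.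
  - split; fold l'.
    + rewrite cos_plus, Es, Ec, C1, C2. unfold sg. fold x'.
      replace (l' * (x / l * (dt / (l * l')) - y / l * (cr / (l * l'))))
        with ((x * dt - y * cr) / (l * l)) by (field; lra).
      replace (x * dt - y * cr) with (x' * (x ^ 2 + y ^ 2)) by (unfold dt, cr; ring).
      rewrite X1. field. lra.
    + rewrite sin_plus, Es, Ec, C1, C2. unfold sg. fold y'.
      replace (l' * (y / l * (dt / (l * l')) + x / l * (cr / (l * l'))))
        with ((y * dt + x * cr) / (l * l)) by (field; lra).
      replace (y * dt + x * cr) with (y' * (x ^ 2 + y ^ 2)) by (unfold dt, cr; ring).
      rewrite X1. field. lra.
  - split.
    + apply Rnot_lt_le; intros K. assert (K1 : asin sg < - eta) by lra.
      apply sin_increasing_1 in K1; try lra. rewrite Es, sin_neg in K1. lra.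
    + apply Rnot_lt_le; intros K. assert (K1 : eta < asin sg) by lra.
      apply sin_increasing_1 in K1; try lra.
Qed.

(** Six arcs longer than PI / 3, each starting up to [eta] where the one before ends, exceed a full
    turn. The first arc that passes [T] covers part of the initial arc again; the common part has
    length at least delta / 2 and [xi] is its middle. *)
Lemma overlap (alpha omega : nat -> R) (delta eta : R) :
  0 < delta -> 0 < eta -> 12 * eta <= delta ->
  (forall m, (m <= 5)%nat -> PI / 3 + delta <= omega m <= PI) ->
  (forall m, (m < 5)%nat ->
    alpha m + omega m - eta <= alpha (S m) <= alpha m + omega m + eta) ->
  exists m xi, (1 <= m <= 5)%nat /\
    alpha 0%nat + delta / 4 <= xi <= alpha 0%nat + omega 0%nat - delta / 4 /\
    alpha m + delta / 4 <= xi + 2 * PI <= alpha m + omega m - delta / 4.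
Proof.
  intros Hd He Hde Hw Ha. pose proof PI_RGT_0.
  set (T := alpha 0%nat + 2 * PI + delta / 2).
  assert (H6 : T <= alpha 5%nat + omega 5%nat).
  { pose proof (Hw 0%nat ltac:(lia)); pose proof (Hw 1%nat ltac:(lia));
    pose proof (Hw 2%nat ltac:(lia)); pose proof (Hw 3%nat ltac:(lia));
    pose proof (Hw 4%nat ltac:(lia)); pose proof (Hw 5%nat ltac:(lia)).
    pose proof (Ha 0%nat ltac:(lia)); pose proof (Ha 1%nat ltac:(lia));
    pose proof (Ha 2%nat ltac:(lia)); pose proof (Ha 3%nat ltac:(lia));
    pose proof (Ha 4%nat ltac:(lia)). unfold T. lra. }
  assert (Hfirst : forall M, (M <= 5)%nat -> T <= alpha M + omega M ->
    exists m, (m <= M)%nat /\ T <= alpha m + omega m /\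
      (m = 0%nat \/ alpha (Nat.pred m) + omega (Nat.pred m) < T)).
  { induction M; intros HM HT.
    - exists 0%nat. auto.
    - destruct (Rle_dec T (alpha M + omega M)) as [K | K].
      + destruct (IHM ltac:(lia) K) as (m & H1 & H2). exists m. split; [lia | exact H2].
      + exists (S M). split; [lia | split; [assumption | right; simpl; lra]]. }
  destruct (Hfirst 5%nat ltac:(lia) H6) as (m & Hm & HT & Hp).
  assert (m <> 0)%nat.
  { intros ->. pose proof (Hw 0%nat ltac:(lia)). unfold T in HT. lra. }
  destruct Hp as [Hp | Hp]; [contradiction|].
  destruct m as [|m]; [contradiction|]. simpl in Hp.
  pose proof (Ha m ltac:(lia)) as A1. pose proof (Hw (S m) Hm) as W1.
  pose proof (Hw 0%nat ltac:(lia)) as W0.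
  set (lo := Rmax (alpha (S m)) (alpha 0%nat + 2 * PI)).
  set (hi := Rmin (alpha (S m) + omega (S m)) (alpha 0%nat + 2 * PI + omega 0%nat)).
  assert (Hlh : delta / 2 <= hi - lo).
  { unfold lo, hi, Rmax, Rmin, T in *.
    destruct (Rle_dec (alpha (S m)) (alpha 0%nat + 2 * PI));
    destruct (Rle_dec (alpha (S m) + omega (S m)) (alpha 0%nat + 2 * PI + omega 0%nat)); lra. }
  pose proof (Rmax_l (alpha (S m)) (alpha 0%nat + 2 * PI)).
  pose proof (Rmax_r (alpha (S m)) (alpha 0%nat + 2 * PI)).
  pose proof (Rmin_l (alpha (S m) + omega (S m)) (alpha 0%nat + 2 * PI + omega 0%nat)).
  pose proof (Rmin_r (alpha (S m) + omega (S m)) (alpha 0%nat + 2 * PI + omega 0%nat)).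
  exists (S m), ((lo + hi) / 2 - 2 * PI).
  unfold lo, hi in *. split; [lia | split; lra].
Qed.

(** * Bounded ratios of neighbouring radii *)

Definition small (r : nat -> vertex -> R) (v : vertex) : Prop :=
  is_lim_seq (fun n => r n v) 0.

Definition big (r : nat -> vertex -> R) (v : vertex) : Prop :=
  exists c, 0 < c /\ eventually (fun n => c <= r n v).

Record collapsing (W : nat -> R) (r : nat -> vertex -> R) (P : nat -> vertex -> C) : Prop := {
  cl_layout : forall n, layout W (r n) (P n);
  cl_small_big : forall v, small r v \/ big r v }.

Lemma eventually_and (A B : nat -> Prop) :
  eventually A -> eventually B -> eventually (fun n => A n /\ B n).
Proof.
  intros [M HM] [N HN]. exists (Nat.max M N). intros n Hn.
  split; [apply HM | apply HN]; lia.
Qed.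

Lemma eventually_imp (A B : nat -> Prop) :
  (forall n, A n -> B n) -> eventually A -> eventually B.
Proof. intros H [M HM]. exists M. auto. Qed.

Lemma eventually_witness (A : nat -> Prop) : eventually A -> exists n, A n.
Proof. intros [M HM]. exists M. apply HM. lia. Qed.

Lemma small_not_big (r : nat -> vertex -> R) (v : vertex) : small r v -> big r v -> False.
Proof.
  intros Hs (c & Hc & Hb).
  pose proof (is_lim_seq_eventually_lt _ _ c Hs Hc) as Hl.
  destruct (eventually_witness _ (eventually_and _ _ Hb Hl)) as (n & H1 & H2). lra.
Qed.

Lemma small_small_dist (W : nat -> R) (r : nat -> vertex -> R) (P : nat -> vertex -> C)
    (v : vertex) (m : nat) : collapsing W r P -> small r v -> small r (vadd v (dir m)) ->
  is_lim_seq (fun n => dist2 (P n v) (P n (vadd v (dir m)))) 0.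
Proof.
  intros H H1 H2.
  apply (is_lim_seq_ext (fun n => r n v * r n v + r n (vadd v (dir m)) * r n (vadd v (dir m))
    + 2 * W m * (r n v * r n (vadd v (dir m))))).
  { intros n. rewrite (ly_dist _ _ _ (cl_layout _ _ _ H n)). unfold sqr_length; ring. }
  replace (Finite 0) with (Finite (0 * 0 + 0 * 0 + 2 * W m * (0 * 0))) by (f_equal; ring).
  apply is_lim_seq_plus'; [apply is_lim_seq_plus'|]; [| |apply (is_lim_seq_scal_l _ (2 * W m) (0 * 0))];
  apply is_lim_seq_mult'; assumption.
Qed.

Lemma small_big_dist (W : nat -> R) (r : nat -> vertex -> R) (P : nat -> vertex -> C)
    (v : vertex) (m : nat) : good_weights W -> collapsing W r P ->
  small r v -> big r (vadd v (dir m)) ->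
  exists c, 0 < c /\ eventually (fun n => c <= dist2 (P n v) (P n (vadd v (dir m)))).
Proof.
  intros G H H1 (c & Hc & H2). exists ((c / 2) ^ 2). split; [nra|].
  pose proof (is_lim_seq_eventually_lt _ _ (c / 2) H1 ltac:(lra)) as H3.
  generalize (eventually_and _ _ H2 H3). apply eventually_imp. intros n [K1 K2].
  pose proof (cl_layout _ _ _ H n) as L.
  rewrite (ly_dist _ _ _ L). pose proof (ly_pos _ _ _ L v) as K3.
  pose proof (gw_gt W G m) as K4. unfold sqr_length.
  set (x := r n v) in *. set (y := r n (vadd v (dir m))) in *.
  assert (0 < x * y) by nra.
  replace (x ^ 2 + y ^ 2 + 2 * W m * x * y)
    with ((y - x) ^ 2 + 2 * ((1 + W m) * (x * y))) by ring.
  assert (0 < (1 + W m) * (x * y)) by (apply Rmult_lt_0_compat; lra).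
  assert ((c / 2) ^ 2 <= (y - x) ^ 2) by (apply pow_incr; lra). lra.
Qed.

(** Both ratios tend to 0, where [cosF] has the value -s: next to big neighbours, the angle at a
    small vertex is governed by the weight of the opposite edge alone. *)
Lemma small_big_angle (W : nat -> R) (r : nat -> vertex -> R) (P : nat -> vertex -> C)
    (v : vertex) (m : nat) (c : R) : good_weights W -> collapsing W r P ->
  small r v -> big r (vadd v (dir m)) -> big r (vadd v (dir (S m))) ->
  - W (2 + m)%nat < c ->
  eventually (fun n => cos_angle (P n v) (P n (vadd v (dir m))) (P n (vadd v (dir (S m)))) < c).
Proof.
  intros G H H1 H2 H3 Hc.
  assert (Hr : forall k, big r (vadd v (dir k)) -> is_lim_seq (fun n => ratio (r n) v k) 0).
  { intros k (b & Hb & Hk).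
    apply (is_lim_seq_le_le_loc (fun _ => 0) _ (fun n => r n v * / b)).
    - generalize Hk. apply eventually_imp. intros n Kn.
      pose proof (ly_pos _ _ _ (cl_layout _ _ _ H n) v). unfold ratio, Rdiv.
      split.
      + apply Rmult_le_pos; [lra|]. apply Rlt_le, Rinv_0_lt_compat. lra.
      + apply Rmult_le_compat_l; [lra|]. apply Rinv_le_contravar; lra.
    - apply is_lim_seq_const.
    - replace (Finite 0) with (Finite (0 * / b)) by (f_equal; ring).
      apply is_lim_seq_mult'; [exact H1 | apply is_lim_seq_const]. }
  pose proof (Hr _ H2) as X. pose proof (Hr _ H3) as Y.
  set (x := fun n => ratio (r n) v m) in *. set (y := fun n => ratio (r n) v (S m)) in *.
  set (p := W m). set (q := W (1 + m)%nat). set (s := W (2 + m)%nat) in *.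
  assert (HN : forall p u, is_lim_seq u 0 -> is_lim_seq (fun n => sqrt (base_norm p (u n))) 1).
  { intros p0 u Hu. rewrite <- sqrt_1.
    apply (is_lim_seq_continuous sqrt (fun n => base_norm p0 (u n)) 1).
    - apply continuity_pt_sqrt. lra.
    - apply (is_lim_seq_ext (fun n => 1 + u n * u n + 2 * p0 * u n)).
      { intros; unfold base_norm; ring. }
      replace (Finite 1) with (Finite (1 + 0 * 0 + 2 * p0 * 0)) by (f_equal; ring).
      apply is_lim_seq_plus'.
      + apply is_lim_seq_plus'; [apply is_lim_seq_const | apply is_lim_seq_mult'; assumption].
      + apply is_lim_seq_mult'; [apply is_lim_seq_const | assumption]. }
  assert (HF : is_lim_seq (fun n => cosF p q s (x n) (y n)) (- s)).
  { unfold cosF.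
    replace (Finite (- s)) with (Finite ((0 * 0 + p * 0 + q * 0 - s) / (1 * 1))) by (f_equal; field).
    apply is_lim_seq_div'; [| apply is_lim_seq_mult'; apply HN; assumption | lra].
    apply is_lim_seq_minus'; [|apply is_lim_seq_const].
    apply is_lim_seq_plus'; [apply is_lim_seq_plus'|]; apply is_lim_seq_mult';
      try assumption; apply is_lim_seq_const. }
  pose proof (is_lim_seq_eventually_lt _ _ c HF Hc) as E.
  revert E. apply eventually_imp. intros n K.
  rewrite (layout_cos_angle W (r n) (P n) v m (cl_layout _ _ _ H n)). exact K.
Qed.

Definition turn (r : nat -> vertex -> R) (s : state) : bool :=
  if excluded_middle_informative (small r (apex s)) then true else false.

Fixpoint walk (r : nat -> vertex -> R) (s : state) (i : nat) : state :=
  match i with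
  | O => s
  | S i => let s' := walk r s i in if turn r s' then turn_right s' else turn_left s'
  end.

Lemma walk_invariant (W : nat -> R) (r : nat -> vertex -> R) (P : nat -> vertex -> C) (s : state) :
  collapsing W r P -> (snd s < 6)%nat -> small r (fst s) -> big r (tip s) ->
  forall i, (snd (walk r s i) < 6)%nat /\ small r (fst (walk r s i)) /\ big r (tip (walk r s i)) /\
    (turn r (walk r s i) = false -> big r (apex (walk r s i))).
Proof.
  intros H H1 H2 H3.
  assert (HT : forall s', turn r s' = false -> big r (apex s')).
  { intros s' E. unfold turn in E.
    destruct (excluded_middle_informative (small r (apex s'))); [discriminate|].
    destruct (cl_small_big _ _ _ H (apex s')); [contradiction | assumption]. }
  intros i. induction i as [|i (I1 & I2 & I3 & I4)]; [simpl; auto|].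
  cbn [walk]. cbv zeta. set (s' := walk r s i) in *.
  destruct (turn r s') eqn:E.
  - split; [apply Nat.mod_upper_bound; lia | split; [|split]].
    + simpl. unfold turn in E.
      destruct (excluded_middle_informative (small r (apex s'))); [assumption | discriminate].
    + now rewrite tip_right.
    + apply HT.
  - split; [apply Nat.mod_upper_bound; lia | split; [|split]].
    + exact I2.
    + rewrite tip_left. auto.
    + apply HT.
Qed.

Lemma dist2_triangle (A B D : C) : dist2 A D <= 2 * (dist2 A B + dist2 B D).
Proof.
  apply Rminus_le_0.
  replace (2 * (dist2 A B + dist2 B D) - dist2 A D)
    with (((fst A - fst B) - (fst B - fst D)) ^ 2 + ((snd A - snd B) - (snd B - snd D)) ^ 2)
    by (unfold dist2; ring).
  apply Rplus_le_le_0_compat; apply pow2_ge_0.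
Qed.

Lemma dist2_self (A : C) : dist2 A A = 0.
Proof. unfold dist2; ring. Qed.

Lemma walk_tails_collapse (W : nat -> R) (r : nat -> vertex -> R) (P : nat -> vertex -> C) (s : state) :
  collapsing W r P -> (snd s < 6)%nat -> small r (fst s) -> big r (tip s) ->
  forall i, is_lim_seq (fun n => dist2 (P n (fst s)) (P n (fst (walk r s i)))) 0.
Proof.
  intros H H1 H2 H3 i. induction i.
  - apply (is_lim_seq_ext (fun _ => 0)); [intros; simpl; now rewrite dist2_self|].
    apply is_lim_seq_const.
  - assert (Hstep : is_lim_seq (fun n => dist2 (P n (fst (walk r s i))) (P n (fst (walk r s (S i))))) 0).
    { pose proof (walk_invariant W r P s H H1 H2 H3 i) as (_ & I2 & _).
      pose proof (walk_invariant W r P s H H1 H2 H3 (S i)) as (_ & J2 & _).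
      cbn [walk] in *. cbv zeta in *. destruct (turn r (walk r s i)).
      - now apply (small_small_dist W r P).
      - apply (is_lim_seq_ext (fun _ => 0)); [intros; simpl; now rewrite dist2_self|].
        apply is_lim_seq_const. }
    apply (is_lim_seq_le_le (fun _ => 0) _ (fun n => 2 * (dist2 (P n (fst s)) (P n (fst (walk r s i)))
      + dist2 (P n (fst (walk r s i))) (P n (fst (walk r s (S i))))))).
    + intros n. split; [apply dist2_nonneg | apply dist2_triangle].
    + apply is_lim_seq_const.
    + replace (Finite 0) with (Finite (2 * (0 + 0))) by (f_equal; ring).
      apply is_lim_seq_mult'; [apply is_lim_seq_const|]. now apply is_lim_seq_plus'.
Qed.

Lemma common_lower_bound (Q : nat -> R -> Prop) (N : nat) :
  (forall i x y, 0 < x <= y -> Q i y -> Q i x) ->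
  (forall i, (i < N)%nat -> exists c, 0 < c /\ Q i c) ->
  exists c, 0 < c /\ forall i, (i < N)%nat -> Q i c.
Proof.
  intros Hm. induction N; intros H.
  - exists 1. split; [lra | intros; lia].
  - destruct IHN as (c & Hc & Hq); [intros; apply H; lia|].
    destruct (H N ltac:(lia)) as (c' & Hc' & Hq').
    exists (Rmin c c'). pose proof (Rmin_pos _ _ Hc Hc').
    pose proof (Rmin_l c c'). pose proof (Rmin_r c c').
    split; [assumption|]. intros i Hi.
    destruct (Nat.eq_dec i N) as [-> |].
    + apply (Hm N _ c'); auto.
    + apply (Hm i _ c); auto. apply Hq. lia.
Qed.

(* Everything the planar argument needs about a single layout in which the
   tails of the first 40 edges of the walk are clustered. *)
Record clustered (r : nat -> vertex -> R) (s : state) (P : vertex -> C) (R0 e c : R) : Prop := {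
  ct_tails : forall i, (i < 40)%nat -> dist2 (P (fst s)) (P (fst (walk r s i))) <= e ^ 2;
  ct_tips : forall i, (i < 40)%nat -> R0 ^ 2 <= dist2 (P (fst (walk r s i))) (P (tip (walk r s i)));
  ct_angles : forall i, (i < 40)%nat -> turn r (walk r s i) = false ->
    R0 ^ 2 <= dist2 (P (fst (walk r s i))) (P (apex (walk r s i))) /\
    cos_angle (P (fst (walk r s i))) (P (tip (walk r s i))) (P (apex (walk r s i))) < c }.

Lemma clustered_exists (W : nat -> R) (r : nat -> vertex -> R) (P : nat -> vertex -> C)
    (s : state) (c kappa : R) :
  good_weights W -> collapsing W r P ->
  (snd s < 6)%nat -> small r (fst s) -> big r (tip s) ->
  (forall m, - W m < c) -> 0 < kappa ->
  exists R0 n, 0 < R0 /\ clustered r s (P n) R0 (R0 * kappa) c.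
Proof.
  intros G H H1 H2 H3 Hc Hk.
  pose proof (walk_invariant W r P s H H1 H2 H3) as Hinv.
  destruct (common_lower_bound (fun i R0 => eventually (fun n =>
    R0 ^ 2 <= dist2 (P n (fst (walk r s i))) (P n (tip (walk r s i))) /\
    (turn r (walk r s i) = false ->
     R0 ^ 2 <= dist2 (P n (fst (walk r s i))) (P n (apex (walk r s i)))))) 40) as (R0 & HR0 & HQ).
  { intros i x y Hxy. apply eventually_imp. intros n [A B].
    assert (x ^ 2 <= y ^ 2) by (apply pow_incr; lra).
    split; [lra|]. intros E. specialize (B E). lra. }
  { intros i Hi. destruct (Hinv i) as (_ & I2 & I3 & I4).
    destruct (small_big_dist W r P _ _ G H I2 I3) as (c1 & Hc1 & E1).
    assert (exists c2, 0 < c2 /\ eventually (fun n => turn r (walk r s i) = false ->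
      c2 <= dist2 (P n (fst (walk r s i))) (P n (apex (walk r s i))))) as (c2 & Hc2 & E2).
    { destruct (turn r (walk r s i)).
      - exists 1. split; [lra|]. exists O. discriminate.
      - destruct (small_big_dist W r P _ _ G H I2 (I4 eq_refl)) as (c2 & Hc2 & E2).
        exists c2. split; [assumption|]. revert E2. apply eventually_imp. auto. }
    assert (Hm : 0 < Rmin c1 c2) by (now apply Rmin_pos).
    exists (sqrt (Rmin c1 c2)). split; [now apply sqrt_lt_R0|].
    rewrite pow2_sqrt by lra. pose proof (Rmin_l c1 c2). pose proof (Rmin_r c1 c2).
    generalize (eventually_and _ _ E1 E2). apply eventually_imp. intros n [A B].
    split; [unfold tip; lra|]. intros E. specialize (B E). lra. }
  assert (HE1 := eventually_all_lt _ 40 HQ).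
  assert (HE2 : eventually (fun n => forall i, (i < 40)%nat ->
    dist2 (P n (fst s)) (P n (fst (walk r s i))) < (R0 * kappa) ^ 2)).
  { apply (eventually_all_lt (fun i n => dist2 (P n (fst s)) (P n (fst (walk r s i))) < (R0 * kappa) ^ 2)).
    intros i Hi. apply (is_lim_seq_eventually_lt _ 0); [now apply (walk_tails_collapse W r P)|].
    apply pow_lt. nra. }
  assert (HE3 : eventually (fun n => forall i, (i < 40)%nat -> turn r (walk r s i) = false ->
    cos_angle (P n (fst (walk r s i))) (P n (tip (walk r s i))) (P n (apex (walk r s i))) < c)).
  { apply (eventually_all_lt (fun i n => turn r (walk r s i) = false ->
      cos_angle (P n (fst (walk r s i))) (P n (tip (walk r s i))) (P n (apex (walk r s i))) < c)).
    intros i Hi. destruct (Hinv i) as (_ & I2 & I3 & I4).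
    destruct (turn r (walk r s i)); [exists O; discriminate|].
    generalize (small_big_angle W r P _ _ c G H I2 I3 (I4 eq_refl) (Hc _)).
    apply eventually_imp. auto. }
  destruct (eventually_witness _ (eventually_and _ _ HE1 (eventually_and _ _ HE2 HE3)))
    as (n & A1 & A2 & A3).
  exists R0, n. split; [assumption|]. split.
  - intros i Hi. apply Rlt_le. auto.
  - intros i Hi. apply (A1 i Hi).
  - intros i Hi E. split; [apply (A1 i Hi); assumption | auto].
Qed.

Lemma tip_tail (s : state) : fst s = vadd (tip s) (dir (3 + snd s)).
Proof.
  unfold tip, dir; simpl. destruct (Nat.iter (snd s) rot (1, 0)%Z), (fst s).
  unfold vadd, rot; simpl; f_equal; ring.
Qed.

(** Five right turns in a row pivot about one tip and carry the tail through all its six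
    neighbours. *)
Lemma right_turns_around (st : nat -> state) (t : nat -> bool) (j : nat) :
  is_walk st t -> (snd (st j) < 6)%nat -> (forall q, (q <= 4)%nat -> t (j + q)%nat = true) ->
  forall d, unit_vec d -> exists q, (q <= 5)%nat /\ vadd (tip (st j)) d = fst (st (j + q)%nat).
Proof.
  intros Hw Hs Ht.
  assert (HI : forall q, (q <= 5)%nat ->
    tip (st (j + q)%nat) = tip (st j) /\ snd (st (j + q)%nat) = ((5 * q + snd (st j)) mod 6)%nat).
  { induction q; intros Hq.
    - rewrite Nat.add_0_r. split; [reflexivity|]. rewrite Nat.mod_small; simpl; lia.
    - destruct (IHq ltac:(lia)) as [I1 I2].
      replace (j + S q)%nat with (S (j + q)) by lia. rewrite (Hw (j + q)%nat), Ht by lia.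
      split; [now rewrite tip_right|]. unfold turn_right; cbn [snd]. rewrite I2.
      rewrite Nat.Div0.add_mod_idemp_r. f_equal. lia. }
  intros d Hd. destruct (unit_dir d Hd) as (m & Hm & ->).
  set (k := snd (st j)) in *.
  assert (HE : exists q, (q <= 5)%nat /\ m = ((3 + (5 * q + k) mod 6) mod 6)%nat).
  { destruct m as [|[|[|[|[|[|m]]]]]]; try lia;
    destruct k as [|[|[|[|[|[|k]]]]]]; try lia;
    first [ exists 0%nat; split; [lia | reflexivity] | exists 1%nat; split; [lia | reflexivity]
          | exists 2%nat; split; [lia | reflexivity] | exists 3%nat; split; [lia | reflexivity]
          | exists 4%nat; split; [lia | reflexivity] | exists 5%nat; split; [lia | reflexivity] ]. }
  destruct HE as (q & Hq & Em). exists q. split; [assumption|].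
  destruct (HI q Hq) as [I1 I2]. rewrite (tip_tail (st (j + q)%nat)), I1, I2, Em, dir_mod.
  reflexivity.
Qed.

Lemma tip_far (r : nat -> vertex -> R) (s : state) (P : vertex -> C) (R0 kappa c : R) :
  0 < R0 -> 0 < kappa <= 1 / 4 -> clustered r s P R0 (R0 * kappa) c ->
  forall j, (j < 40)%nat -> (R0 * kappa) ^ 2 < dist2 (P (fst s)) (P (tip (walk r s j))).
Proof.
  intros HR Hk Hcl j Hj.
  pose proof (ct_tails _ _ _ _ _ _ Hcl j Hj) as T1.
  pose proof (ct_tips _ _ _ _ _ _ Hcl j Hj) as T2.
  pose proof (dist2_triangle (P (fst (walk r s j))) (P (fst s)) (P (tip (walk r s j)))) as T3.
  rewrite (dist2_sym (P (fst (walk r s j))) (P (fst s))) in T3.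
  assert ((R0 * kappa) ^ 2 <= (R0 / 4) ^ 2) by (apply pow_incr; nra).
  nra.
Qed.

(** Otherwise the cluster surrounds a single tip, an island with one vertex. *)
Lemma left_turn_within_five (W : nat -> R) (r : nat -> vertex -> R) (s : state)
    (P : vertex -> C) (R0 kappa c : R) :
  oriented P -> (snd s < 6)%nat -> 0 < R0 -> 0 < kappa <= 1 / 4 ->
  clustered r s P R0 (R0 * kappa) c ->
  (forall i, (snd (walk r s i) < 6)%nat) ->
  forall j, (j + 5 < 40)%nat -> exists j', (j <= j' <= j + 4)%nat /\ turn r (walk r s j') = false.
Proof.
  intros Ho Hs HR Hk Hcl Hsnd j Hj. apply NNPP; intros HN.
  assert (Ht : forall q, (q <= 4)%nat -> turn r (walk r s (j + q)) = true).
  { intros q Hq. destruct (turn r (walk r s (j + q))) eqn:E; [reflexivity|].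
    exfalso; apply HN. exists (j + q)%nat. split; [lia | assumption]. }
  apply (island_impossible P (tip (walk r s j) :: nil) (P (fst s)) ((R0 * kappa) ^ 2) Ho).
  - discriminate.
  - intros a [<- | []]. apply (tip_far r s P R0 kappa c); auto; lia.
  - intros a d [<- | []] Hd. right.
    destruct (right_turns_around (walk r s) (fun i => turn r (walk r s i)) j) with (d := d)
      as (q & Hq & E); auto.
    { intros i. reflexivity. }
    rewrite E. apply (ct_tails _ _ _ _ _ _ Hcl). lia.
Qed.

(* Beyond the window where it is controlled, a walk is modified to turn left. *)
Definition eventually_left (r : nat -> vertex -> R) (s : state) (i : nat) : bool :=
  if (i <? 34)%nat then turn r (walk r s i) else false.

Fixpoint windowed_walk (r : nat -> vertex -> R) (s : state) (i : nat) : state :=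
  match i with
  | O => s
  | S i => if eventually_left r s i then turn_right (windowed_walk r s i)
           else turn_left (windowed_walk r s i)
  end.

Lemma windowed_walk_eq (r : nat -> vertex -> R) (s : state) (i : nat) :
  (i <= 34)%nat -> windowed_walk r s i = walk r s i.
Proof.
  induction i; intros Hi; [reflexivity|]. simpl. rewrite IHi by lia.
  unfold eventually_left. destruct (Nat.ltb_spec i 34); [reflexivity | lia].
Qed.

Lemma windowed_snd (r : nat -> vertex -> R) (s : state) (i : nat) :
  (snd s < 6)%nat -> (snd (windowed_walk r s i) < 6)%nat.
Proof.
  intros H. destruct i; [exact H|]. simpl.
  destruct (eventually_left r s i); apply Nat.mod_upper_bound; lia.
Qed.

(** [lam m] is the position of the left turn number [m], counted from 0. *)
Definition left_index (lam : nat -> nat) (t : nat -> bool) : Prop :=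
  (lam 0 <= 4)%nat /\ t (lam 0%nat) = false /\
  forall m, (S (lam m) <= lam (S m) <= lam m + 5)%nat /\ t (lam (S m)) = false /\
    forall l, (lam m < l < lam (S m))%nat -> t l = true.

Lemma left_index_exists (t : nat -> bool) :
  (forall j, exists j', (j <= j' <= j + 4)%nat /\ t j' = false) ->
  exists lam, left_index lam t.
Proof.
  intros H.
  assert (Hn : forall j, exists j', (j <= j' <= j + 4)%nat /\ t j' = false /\
    forall l, (j <= l < j')%nat -> t l = true).
  { intros j. destruct (H j) as (j' & Hj & Hf).
    assert (HM : forall k, (k <= 4)%nat -> t (j + k)%nat = false ->
      exists k', (k' <= k)%nat /\ t (j + k')%nat = false /\
        forall l, (j <= l < j + k')%nat -> t l = true).
    { intros k. induction k as [k IH] using lt_wf_ind. intros Hk Ek.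
      destruct (classic (exists l, (l < k)%nat /\ t (j + l)%nat = false)) as [(l & Hl & El) | N].
      - destruct (IH l Hl ltac:(lia) El) as (k' & A1 & A2). exists k'. split; [lia | exact A2].
      - exists k. split; [lia | split; [assumption|]]. intros l Hl.
        destruct (t l) eqn:E; [reflexivity|]. exfalso; apply N.
        exists (l - j)%nat. split; [lia|]. now replace (j + (l - j))%nat with l by lia. }
    destruct (HM (j' - j)%nat) as (k' & A1 & A2 & A3); [lia | | ].
    - now replace (j + (j' - j))%nat with j' by lia.
    - exists (j + k')%nat. split; [lia | split; assumption]. }
  pose (nx := fun j => proj1_sig (constructive_indefinite_description _ (Hn j))).
  assert (Hnx : forall j, (j <= nx j <= j + 4)%nat /\ t (nx j) = false /\
    forall l, (j <= l < nx j)%nat -> t l = true).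
  { intros j. apply (proj2_sig (constructive_indefinite_description _ (Hn j))). }
  exists (fix lam m := match m with O => nx 0%nat | S m => nx (S (lam m)) end).
  split; [|split].
  - apply (Hnx 0%nat).
  - apply (Hnx 0%nat).
  - intros m. set (lam := fix lam m := match m with O => nx 0%nat | S m => nx (S (lam m)) end).
    change (lam (S m)) with (nx (S (lam m))).
    destruct (Hnx (S (lam m))) as (A1 & A2 & A3).
    split; [lia | split; [assumption|]]. intros l Hl. apply A3. lia.
Qed.

Lemma lefts_in_app (t : nat -> bool) (i n n' : nat) :
  lefts_in t i (n + n') = (lefts_in t i n + lefts_in t (i + n) n')%nat.
Proof.
  revert i. induction n; intros i; simpl.
  - now rewrite Nat.add_0_r.
  - rewrite IHn. replace (S i + n)%nat with (i + S n)%nat by lia. lia.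
Qed.

Lemma lefts_in_rights (t : nat -> bool) (i n : nat) :
  (forall l, (i <= l < i + n)%nat -> t l = true) -> lefts_in t i n = 0%nat.
Proof.
  revert i. induction n; intros i H; simpl; [reflexivity|].
  rewrite H by lia. rewrite IHn; [reflexivity|]. intros l Hl. apply H. lia.
Qed.

Lemma left_index_count (lam : nat -> nat) (t : nat -> bool) (m : nat) : left_index lam t ->
  (lam 0 <= lam m)%nat /\ lefts_in t (lam 0%nat) (lam m - lam 0%nat) = m /\
  (lam m <= lam 0%nat + 5 * m)%nat.
Proof.
  intros (H1 & H2 & H3). induction m as [|m (I1 & I2 & I3)].
  - rewrite Nat.sub_diag. simpl. lia.
  - destruct (H3 m) as (A1 & A2 & A3). split; [lia | split; [|lia]].
    replace (lam (S m) - lam 0)%nat with ((lam m - lam 0) + (1 + (lam (S m) - S (lam m))))%nat by lia.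
    rewrite lefts_in_app, I2. replace (lam 0 + (lam m - lam 0))%nat with (lam m) by lia.
    rewrite lefts_in_app. simpl lefts_in at 1.
    assert (t (lam m) = false) as -> by (destruct m; [assumption | apply H3]).
    rewrite lefts_in_rights; [lia|]. intros l Hl. apply A3. lia.
Qed.

Lemma tip_constant (st : nat -> state) (t : nat -> bool) (i n : nat) : is_walk st t ->
  (forall l, (i <= l < i + n)%nat -> t l = true) -> tip (st (i + n)%nat) = tip (st i).
Proof.
  intros Hw. induction n; intros H; [now rewrite Nat.add_0_r|].
  replace (i + S n)%nat with (S (i + n)) by lia. rewrite Hw, H by lia.
  rewrite tip_right. apply IHn. intros; apply H; lia.
Qed.

Lemma left_index_tip (st : nat -> state) (t : nat -> bool) (lam : nat -> nat) (m : nat) :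
  is_walk st t -> left_index lam t -> tip (st (lam (S m))) = apex (st (lam m)).
Proof.
  intros Hw (H1 & H2 & H3). destruct (H3 m) as (A1 & A2 & A3).
  replace (lam (S m)) with (S (lam m) + (lam (S m) - S (lam m)))%nat by lia.
  rewrite (tip_constant st t); [|assumption|].
  - rewrite Hw. assert (t (lam m) = false) as -> by (destruct m; [assumption | apply H3]).
    apply tip_left.
  - intros l Hl. apply A3. lia.
Qed.

(** * Rotating a wedge to the vertical *)

Lemma cos_ge_sin (x mu : R) : 0 <= mu -> - (PI / 2) + mu <= x <= PI / 2 - mu -> sin mu <= cos x.
Proof.
  intros Hmu Hx. rewrite <- cos_shift.
  destruct (Rle_dec 0 x).
  - apply cos_decr_1; lra.
  - rewrite <- (cos_neg x). apply cos_decr_1; lra.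
Qed.

(** The multiplier sin xi + i cos xi adds PI / 2 - xi to every argument, so it turns the direction
    [xi] to the vertical. *)
Lemma at_angle_rotate (A B q : C) (t xi : R) : at_angle A B t ->
  fst (similar_point (sin xi) (cos xi) q B) - fst (similar_point (sin xi) (cos xi) q A)
  = sqrt (dist2 A B) * cos (t - xi + PI / 2).
Proof.
  intros [E1 E2]. unfold similar_point; cbn [fst snd].
  replace (t - xi + PI / 2) with (PI / 2 - (xi - t)) by ring. rewrite cos_shift, sin_minus.
  transitivity (sin xi * (fst B - fst A) - cos xi * (snd B - snd A)); [ring|].
  rewrite E1, E2. ring.
Qed.

(** A wedge containing the direction [xi] with margin [mu] becomes a wedge around the vertical: its
    first side ends at the right and its second at the left, each by at least R0 sin mu. The edge
    between them is then a graph over a neighbourhood of the abscissa of the vertex. *)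
Lemma wedge_bounds (A B D q : C) (t xi mu R0 : R) : 0 < R0 -> 0 <= mu ->
  0 < crs A B D -> at_angle A B t -> t + mu <= xi <= t + angle A B D - mu ->
  R0 ^ 2 <= dist2 A B -> R0 ^ 2 <= dist2 A D ->
  let f := similar_point (sin xi) (cos xi) q in
  fst (f A) + R0 * sin mu <= fst (f B) /\ fst (f D) <= fst (f A) - R0 * sin mu.
Proof.
  intros HR Hmu Hc Ht Hxi H1 H2 f.
  pose proof (angle_bound _ _ _ (Rgt_not_eq _ _ Hc)) as Hb.
  pose proof (at_angle_next _ _ _ _ Hc Ht) as Ht'.
  assert (L1 : R0 <= sqrt (dist2 A B)).
  { rewrite <- (sqrt_pow2 R0) by lra. now apply sqrt_le_1_alt. }
  assert (L2 : R0 <= sqrt (dist2 A D)).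
  { rewrite <- (sqrt_pow2 R0) by lra. now apply sqrt_le_1_alt. }
  assert (Hs : 0 <= sin mu) by (apply sin_ge_0; lra).
  pose proof (at_angle_rotate _ _ q _ xi Ht) as E1.
  pose proof (at_angle_rotate _ _ q _ xi Ht') as E2.
  fold f in E1, E2.
  pose proof (cos_ge_sin (t - xi + PI / 2) mu Hmu ltac:(lra)) as C1.
  pose proof (cos_ge_sin (t + angle A B D - xi + PI / 2 - PI) mu Hmu ltac:(lra)) as C2.
  replace (t + angle A B D - xi + PI / 2 - PI) with (- (PI - (t + angle A B D - xi + PI / 2))) in C2 by ring.
  rewrite cos_neg, Rtrigo_facts.cos_pi_minus in C2.
  split; nra.
Qed.

Lemma sqr_le_bounds (x y : R) : 0 <= y -> x ^ 2 <= y ^ 2 -> - y <= x <= y.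
Proof. intros Hy H. split; apply Rnot_lt_le; intros K; nra. Qed.

Lemma nonoverlapping_ext (P P' : vertex -> C) :
  (forall v, P v = P' v) -> nonoverlapping P -> nonoverlapping P'.
Proof.
  intros E H i j k i' j' k' a b c a' b' c' Hf Hf' Hb Hb' HS.
  rewrite <- !E in HS. now apply (H i j k i' j' k' a b c a' b' c').
Qed.

Lemma state_determined (s s' : state) : (snd s < 6)%nat -> (snd s' < 6)%nat ->
  tip s = tip s' -> apex s = apex s' -> s = s'.
Proof.
  intros H H' E1 E2.
  assert (E3 : dir (2 + snd s) = dir (2 + snd s')).
  { apply (vadd_cancel (tip s)). rewrite E1 at 2. unfold tip.
    rewrite <- !dir_sub. exact E2. }
  assert (E4 : snd s = snd s').
  { revert E3. generalize dependent (snd s). generalize dependent (snd s'). intros k Hk j Hj E.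
    destruct k as [|[|[|[|[|[|k]]]]]]; try lia;
    destruct j as [|[|[|[|[|[|j]]]]]]; try lia; try reflexivity; discriminate E. }
  assert (E5 : fst s = fst s') by (rewrite (tip_tail s), (tip_tail s'), E1, E4; reflexivity).
  destruct s, s'; simpl in *; congruence.
Qed.

(** This is where the lower bound -1/2 on the weights enters: cosines tending to -W stay below some
    c < 1/2, hence angles stay above arccos c > PI / 3. *)
Lemma angle_gap (W : nat -> R) : good_weights W ->
  exists c, 0 < c < 1 / 2 /\ forall m, - W m < c.
Proof.
  intros G.
  assert (HW : forall m, - W m < 1 / 2).
  { intros m. destruct (gw_range W G) as [K | K]; specialize (K m); lra. }
  set (c := Rmax 0 (Rmax (- W 0%nat) (Rmax (- W 1%nat) (- W 2%nat)))).
  assert (Hc : 0 <= c < 1 / 2).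
  { unfold c. split; [apply Rmax_l|]. pose proof (HW 0%nat). pose proof (HW 1%nat).
    pose proof (HW 2%nat). repeat apply Rmax_lub_lt; lra. }
  exists ((c + 1 / 2) / 2). split; [lra|]. intros m.
  assert (- W m <= c); [|lra].
  rewrite (periodic_mod _ W 3 m); [|lia | apply (gw_period W G)].
  pose proof (Nat.mod_upper_bound m 3 ltac:(lia)).
  pose proof (Rmax_r 0 (Rmax (- W 0%nat) (Rmax (- W 1%nat) (- W 2%nat)))).
  pose proof (Rmax_l (- W 0%nat) (Rmax (- W 1%nat) (- W 2%nat))).
  pose proof (Rmax_r (- W 0%nat) (Rmax (- W 1%nat) (- W 2%nat))).
  pose proof (Rmax_l (- W 1%nat) (- W 2%nat)). pose proof (Rmax_r (- W 1%nat) (- W 2%nat)).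
  unfold c. destruct (m mod 3)%nat as [|[|[|k]]]; try lia; lra.
Qed.

Lemma crs_similar (x y : R) (q A B D : C) : x ^ 2 + y ^ 2 = 1 ->
  crs (similar_point x y q A) (similar_point x y q B) (similar_point x y q D) = crs A B D.
Proof.
  intros E. transitivity ((x ^ 2 + y ^ 2) * crs A B D); [|rewrite E; ring].
  unfold crs, similar_point; simpl; ring.
Qed.

Lemma dist2_similar (x y : R) (q A B : C) : x ^ 2 + y ^ 2 = 1 ->
  dist2 (similar_point x y q A) (similar_point x y q B) = dist2 A B.
Proof.
  intros E. transitivity ((x ^ 2 + y ^ 2) * dist2 A B); [|rewrite E; ring].
  unfold dist2, similar_point; simpl; ring.
Qed.

Lemma walk_face (s : state) : face (fst s) (tip s) (apex s).
Proof. apply face_left, dir_unit. Qed.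

(** Each left turn shows a wedge of angle above PI / 3 at a tail, and all tails nearly coincide.
    Among six consecutive wedges the first shares a direction with a later one. With this direction
    vertical, both opposite edges pass over the cluster, and [wedge_clash] makes them equal. So the
    walk closes up after at most five left turns, and its tips contain an island. *)
Lemma collapse_impossible (W : nat -> R) (r : nat -> vertex -> R) (P0 : nat -> vertex -> C)
    (v : vertex) (j : nat) : good_weights W -> collapsing W r P0 ->
  small r v -> big r (vadd v (dir j)) -> False.
Proof.
  intros G H Hv Hj. pose proof PI_RGT_0 as HPI.
  pose (s := (v, (j mod 6)%nat) : state).
  assert (Hs6 : (snd s < 6)%nat) by (apply Nat.mod_upper_bound; lia).
  assert (Hs1 : small r (fst s)) by assumption.
  assert (Hs2 : big r (tip s)) by (unfold tip, s; cbn [fst snd]; now rewrite dir_mod).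
  pose proof (walk_invariant W r P0 s H Hs6 Hs1 Hs2) as Hinv.
  destruct (angle_gap W G) as (c & Hc & HcW).
  set (theta := acos c).
  assert (Hth : PI / 3 < theta < PI / 2).
  { unfold theta. pose proof (acos_bound c). split.
    - apply Rnot_le_lt; intros K. apply cos_decr_1 in K; try lra.
      rewrite cos_PI3, cos_acos in K by lra. lra.
    - apply Rnot_le_lt; intros K. apply cos_decr_1 in K; try lra.
      rewrite cos_PI2, cos_acos in K by lra. lra. }
  set (delta := theta - PI / 3). set (eta := delta / 12).
  assert (Hd : 0 < delta < PI / 6) by (unfold delta; lra).
  assert (He : 0 < eta < PI / 2) by (unfold eta; lra).
  assert (Hse : 0 < sin eta) by (apply sin_gt_0; lra).
  assert (Hse1 : sin eta < sin (delta / 4)) by (apply sin_increasing_1; unfold eta in *; lra).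
  pose proof (SIN_bound (delta / 4)).
  (* Tails lie within e = R0 kappa of the first one, so within 2 e of each other, and 2 e <= R0 sin
     eta is what [at_angle_close] asks for. *)
  set (kappa := sin eta / 4).
  assert (Hk : 0 < kappa <= 1 / 4) by (unfold kappa; lra).
  destruct (clustered_exists W r P0 s c kappa G H Hs6 Hs1 Hs2 HcW (proj1 Hk))
    as (R0 & n & HR0 & Hcl).
  pose proof (cl_layout _ _ _ H n) as L. set (P := P0 n) in *.
  pose proof (ly_oriented _ _ _ L) as Ho. pose proof (ly_nonoverlapping _ _ _ L) as Hno.
  set (e := R0 * kappa) in *.
  assert (He0 : 0 < e) by (unfold e; nra).
  assert (He4 : 4 * e = R0 * sin eta) by (unfold e, kappa; field).
  set (st := windowed_walk r s). set (t := eventually_left r s).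
  assert (Hw : is_walk st t) by (intros i; reflexivity).
  assert (Hfive : forall j, exists j', (j <= j' <= j + 4)%nat /\ t j' = false).
  (* Before step 30 the next left turn of the true walk falls into the window of 34 steps; from then
     on the modified walk has one at step i + 4 at the latest. The six left turns used below have
     positions at most 4 + 5 * 5 = 29. *)
  { intros i. destruct (Nat.lt_ge_cases i 30) as [Hi | Hi].
    - destruct (left_turn_within_five W r s P R0 kappa c Ho Hs6 HR0 Hk Hcl
        (fun i => proj1 (Hinv i)) i ltac:(lia)) as (j' & A1 & A2).
      exists j'. split; [assumption|]. unfold t, eventually_left.
      destruct (Nat.ltb_spec j' 34); [assumption | reflexivity].
    - exists (i + 4)%nat. split; [lia|]. unfold t, eventually_left.
      destruct (Nat.ltb_spec (i + 4) 34); [lia | reflexivity]. }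
  destruct (left_index_exists t Hfive) as (lam & Hlam).
  assert (Hlam5 : forall m, (m <= 5)%nat -> (lam m <= 29)%nat).
  { intros m Hm. pose proof (left_index_count lam t m Hlam). destruct Hlam. lia. }
  assert (Hst : forall i, (i <= 34)%nat -> st i = walk r s i) by apply windowed_walk_eq.
  assert (HtF : forall m, (m <= 5)%nat -> turn r (walk r s (lam m)) = false).
  { intros m Hm. assert (t (lam m) = false) as K.
    { destruct Hlam as (A1 & A2 & A3). destruct m; [assumption | apply A3]. }
    unfold t, eventually_left in K. pose proof (Hlam5 m Hm).
    destruct (Nat.ltb_spec (lam m) 34); [assumption | lia]. }
  pose (k := fun m => fst (st (lam m))). pose (a := fun m => tip (st (lam m))).
  pose (b := fun m => apex (st (lam m))).
  assert (Hab : forall m, a (S m) = b m).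
  { intros m. unfold a, b. now apply (left_index_tip st t). }
  assert (Hface : forall m, face (k m) (a m) (b m)) by (intros m; apply walk_face).
  assert (Hcrs : forall m, 0 < crs (P (k m)) (P (a m)) (P (b m))).
  { intros m. apply (flower_crs P (fst (st (lam m))) (snd (st (lam m))) Ho). }
  assert (Hbig : forall i, (i <= 34)%nat -> small r (fst (st i)) /\ big r (tip (st i))).
  { intros i Hi. rewrite Hst by assumption. split; apply Hinv. }
  assert (Hbigb : forall m, (m <= 5)%nat -> big r (b m)).
  { intros m Hm. unfold b. pose proof (Hlam5 m Hm). rewrite Hst by lia. now apply Hinv, HtF. }
  assert (Hne : forall u u', small r u -> big r u' -> u <> u').
  { intros u u' A B ->. exact (small_not_big r u' A B). }
  assert (Htail : forall i i', (i <= 34)%nat -> (i' <= 34)%nat ->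
    dist2 (P (fst (st i))) (P (fst (st i'))) <= (2 * e) ^ 2).
  { intros i i' Hi Hi'. rewrite !Hst by assumption.
    pose proof (ct_tails _ _ _ _ _ _ Hcl i ltac:(lia)) as T1.
    pose proof (ct_tails _ _ _ _ _ _ Hcl i' ltac:(lia)) as T2.
    pose proof (dist2_triangle (P (fst (walk r s i))) (P (fst s)) (P (fst (walk r s i')))) as T3.
    rewrite (dist2_sym (P (fst (walk r s i))) (P (fst s))) in T3. nra. }
  assert (Hfar : forall m, (m <= 5)%nat ->
    R0 ^ 2 <= dist2 (P (k m)) (P (a m)) /\ R0 ^ 2 <= dist2 (P (k m)) (P (b m))).
  { intros m Hm. unfold k, a, b. pose proof (Hlam5 m Hm). rewrite !Hst by lia. split.
    - apply (ct_tips _ _ _ _ _ _ Hcl). lia.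
    - apply (ct_angles _ _ _ _ _ _ Hcl); [lia | now apply HtF]. }
  pose (omega := fun m => angle (P (k m)) (P (a m)) (P (b m))).
  assert (Homega : forall m, (m <= 5)%nat -> PI / 3 + delta <= omega m <= PI).
  { intros m Hm. pose proof (angle_bound _ _ _ (Rgt_not_eq _ _ (Hcrs m))) as Hb.
    fold (omega m) in Hb. split; [|lra].
    replace (PI / 3 + delta) with theta by (unfold delta; ring).
    unfold theta, omega, angle. apply acos_decreasing. apply Rlt_le.
    unfold k, a, b. pose proof (Hlam5 m Hm). rewrite !Hst by lia.
    apply (ct_angles _ _ _ _ _ _ Hcl); [lia | now apply HtF]. }
  (* Each wedge begins where the one before ends, up to [eta]: the point b m = a (S m) is seen from
     two nearly equal tails. *)
  assert (Halpha : forall M, (M <= 5)%nat -> exists alpha : nat -> R,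
    (forall m, (m <= M)%nat -> at_angle (P (k m)) (P (a m)) (alpha m)) /\
    (forall m, (m < M)%nat ->
      alpha m + omega m - eta <= alpha (S m) <= alpha m + omega m + eta)).
  { induction M; intros HM.
    - destruct (at_angle_exists (P (k 0%nat)) (P (a 0%nat))) as (t0 & Ht0).
      { pose proof (Hfar 0%nat ltac:(lia)). nra. }
      exists (fun _ => t0). split; [|intros; lia].
      intros m Hm. replace m with 0%nat by lia. exact Ht0.
    - destruct (IHM ltac:(lia)) as (al & A1 & A2).
      pose proof (at_angle_next _ _ _ _ (Hcrs M) (A1 M ltac:(lia))) as Hn.
      fold (omega M) in Hn.
      destruct (at_angle_close (P (k M)) (P (k (S M))) (P (b M)) (al M + omega M)
        (2 * e) R0 eta) as (t' & T1 & T2); auto.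
      + lra.
      + nra.
      + lra.
      + apply Htail; pose proof (Hlam5 M ltac:(lia)); pose proof (Hlam5 (S M) ltac:(lia)); lia.
      + apply Hfar; lia.
      + rewrite <- Hab. apply Hfar; lia.
      + exists (fun m => if (m <=? M)%nat then al m else t'). split.
        * intros m Hm. destruct (Nat.leb_spec m M); [now apply A1|].
          replace m with (S M) by lia. rewrite Hab. exact T1.
        * intros m Hm. destruct (Nat.leb_spec m M); [|lia].
          destruct (Nat.leb_spec (S m) M); [apply A2; lia|].
          replace m with M by lia. exact T2. }
  destruct (Halpha 5%nat ltac:(lia)) as (alpha & A1 & A2).
  destruct (overlap alpha omega delta eta) as (m & xi & Hm & X1 & X2); auto; try lra.
  { unfold eta; lra. }
  assert (Hsc : sin xi ^ 2 + cos xi ^ 2 = 1).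
  { rewrite <- !Rsqr_pow2. apply sin2_cos2. }
  pose (f := similar_point (sin xi) (cos xi) (0, 0)).
  pose (P' := fun v => f (P v)).
  assert (Hno' : nonoverlapping P').
  { pose proof (layout_similar W (r n) P (0, 0)%Z 1 (sin xi) (cos xi) (0, 0)
      ltac:(lra) ltac:(rewrite Hsc; ring) L) as L'.
    apply (nonoverlapping_ext (fun v => f (P (vadd (0, 0)%Z v)))).
    - intros u. unfold P'. now rewrite vadd_0_l.
    - apply (ly_nonoverlapping _ _ _ L'). }
  assert (Hcrs' : forall u u' u'', crs (P' u) (P' u') (P' u'') = crs (P u) (P u') (P u'')).
  { intros u u' u''. now apply crs_similar. }
  set (X := R0 * sin (delta / 4)).
  assert (HX : 2 * e < X) by (unfold X; nra).
  assert (B0 : fst (P' (k 0%nat)) + X <= fst (P' (a 0%nat)) /\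
    fst (P' (b 0%nat)) <= fst (P' (k 0%nat)) - X).
  { apply (wedge_bounds _ _ _ _ (alpha 0%nat)); auto; try lra; try apply Hfar; try lia.
    apply A1; lia. }
  assert (Bm : fst (P' (k m)) + X <= fst (P' (a m)) /\
    fst (P' (b m)) <= fst (P' (k m)) - X).
  { unfold P', f.
    replace (sin xi) with (sin (xi + 2 * PI)) by (rewrite sin_plus, sin_2PI, cos_2PI; ring).
    replace (cos xi) with (cos (xi + 2 * PI)) by (rewrite cos_plus, sin_2PI, cos_2PI; ring).
    apply (wedge_bounds _ _ _ _ (alpha m)); auto; try lra; try apply Hfar; try lia.
    apply A1; lia. }
  assert (Hclose : forall i i', (i <= 34)%nat -> (i' <= 34)%nat ->
    - (2 * e) <= fst (P' (fst (st i))) - fst (P' (fst (st i'))) <= 2 * e).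
  { intros i i' Hi Hi'. apply sqr_le_bounds; [lra|].
    eapply Rle_trans; [|apply (Htail i i' Hi Hi')].
    rewrite <- (dist2_similar (sin xi) (cos xi) (0, 0) _ _ Hsc). fold f.
    unfold P', dist2. pose proof (pow2_ge_0 (snd (f (P (fst (st i')))) - snd (f (P (fst (st i)))))).
    nra. }
  pose proof (left_index_count lam t m Hlam) as (Hl0 & Hlc & Hl5).
  pose proof (Hlam5 m ltac:(lia)) as Hlm. pose proof (Hlam5 0%nat ltac:(lia)) as Hl00.
  (* The edge from [a w] to [b w] joins big vertices, so an edge between small ones shares no vertex
     with it and cannot cross it. Hence along the walk the tails stay below it. *)
  assert (Hpath : forall w, (w <= 5)%nat ->
    (forall l, (lam 0 <= l <= lam m)%nat -> fst (P' (b w)) < fst (P' (fst (st l))) < fst (P' (a w))) ->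
    forall l, (lam 0 <= l < lam m)%nat ->
    (0 < crs (P' (a w)) (P' (b w)) (P' (fst (st l))) <->
     0 < crs (P' (a w)) (P' (b w)) (P' (fst (st (S l)))))).
  { intros w Hwm Hin l Hl.
    assert (Hor : fst (st (S l)) = fst (st l) \/ adj (fst (st l)) (fst (st (S l)))).
    { rewrite (Hw l). destruct (t l); [right | now left]. apply adj_vadd, dir_unit. }
    destruct Hor as [-> | Hadj]; [tauto|].
    pose proof (Hface w) as (_ & Hedge & _).
    assert (Sl : small r (fst (st l))) by (apply Hbig; lia).
    assert (Sl' : small r (fst (st (S l)))) by (apply Hbig; lia).
    assert (Ba : big r (a w)).
    { apply (Hbig (lam w)). pose proof (Hlam5 w Hwm). lia. }
    pose proof (Hbigb w Hwm) as Bb.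
    split; intros K.
    - apply (same_side P' (fst (st l))); auto; apply Hin; lia.
    - apply (same_side P' (fst (st (S l)))); auto; try (apply Hin; lia). now apply adj_sym. }
  assert (Hin0 : forall l, (lam 0 <= l <= lam m)%nat ->
    fst (P' (b 0%nat)) < fst (P' (fst (st l))) < fst (P' (a 0%nat))).
  { intros l Hl. pose proof (Hclose l (lam 0%nat) ltac:(lia) ltac:(lia)).
    fold (k 0%nat) in *. lra. }
  assert (Hinm : forall l, (lam 0 <= l <= lam m)%nat ->
    fst (P' (b m)) < fst (P' (fst (st l))) < fst (P' (a m))).
  { intros l Hl. pose proof (Hclose l (lam m) ltac:(lia) ltac:(lia)).
    fold (k m) in *. lra. }
  assert (Hup : forall q, (lam 0 + q <= lam m)%nat ->
    0 < crs (P' (a 0%nat)) (P' (b 0%nat)) (P' (fst (st (lam 0 + q)%nat)))).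
  { induction q; intros Hq.
    - rewrite Nat.add_0_r. fold (k 0%nat). rewrite <- crs_cycle, Hcrs'. apply Hcrs.
    - replace (lam 0 + S q)%nat with (S (lam 0 + q))%nat by lia.
      apply (proj1 (Hpath 0%nat ltac:(lia) Hin0 (lam 0 + q)%nat ltac:(lia))). apply IHq. lia. }
  assert (Hdown : forall q, (lam 0 + q <= lam m)%nat ->
    0 < crs (P' (a m)) (P' (b m)) (P' (fst (st (lam m - q)%nat)))).
  { induction q; intros Hq.
    - rewrite Nat.sub_0_r. fold (k m). rewrite <- crs_cycle, Hcrs'. apply Hcrs.
    - apply (proj2 (Hpath m ltac:(lia) Hinm (lam m - S q)%nat ltac:(lia))).
      replace (S (lam m - S q)) with (lam m - q)%nat by lia. apply IHq. lia. }
  assert (Hlt : (lam 0 < lam m)%nat).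
  { destruct (Nat.eq_dec (lam 0%nat) (lam m)) as [E | E]; [|lia].
    rewrite <- E, Nat.sub_diag in Hlc. simpl in Hlc. lia. }
  assert (Sk : forall w, (w <= 5)%nat -> small r (k w)).
  { intros w Hwm. apply (Hbig (lam w)). pose proof (Hlam5 w Hwm). lia. }
  assert (Ba : forall w, (w <= 5)%nat -> big r (a w)).
  { intros w Hwm. apply (Hbig (lam w)). pose proof (Hlam5 w Hwm). lia. }
  destruct (wedge_clash P' (k 0%nat) (a 0%nat) (b 0%nat) (k m) (a m) (b m)) as [Ea Eb]; auto;
    try (apply Hne; [apply Sk | first [apply Ba | apply Hbigb]]; lia).
  - apply Hin0; lia.
  - apply Hinm; lia.
  - apply Hin0; lia.
  - apply Hinm; lia.
  - rewrite Hcrs'. apply Hcrs.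
  - rewrite Hcrs'. apply Hcrs.
  - replace (k m) with (fst (st (lam 0 + (lam m - lam 0))%nat))
      by (unfold k; do 2 f_equal; lia). apply Hup. lia.
  - replace (k 0%nat) with (fst (st (lam m - (lam m - lam 0))%nat))
      by (unfold k; do 2 f_equal; lia). apply Hdown. lia.
  - assert (Hclosed : st (lam m) = st (lam 0%nat)).
    { apply state_determined; try (apply windowed_snd; assumption).
      - exact Ea.
      - exact Eb. }
    destruct (closed_walk_enclosed st t (lam 0%nat) (lam m - lam 0)%nat Hw) as (hs & H1 & H2 & H3); auto.
    + intros i. now apply windowed_snd.
    + lia.
    + apply Hlam.
    + rewrite <- Hclosed. f_equal. lia.
    + rewrite Hlc. lia.
    + apply (island_impossible P hs (P (fst s)) (e ^ 2) Ho H1).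
      * intros x Hx. destruct (H2 x Hx) as (i & Hi & ->). rewrite Hst by lia.
        apply (tip_far r s P R0 kappa c HR0 Hk Hcl). lia.
      * intros x d Hx Hdd. destruct (H3 x d Hx Hdd) as [K | (i & Hi & ->)]; [now left | right].
        rewrite Hst by lia. apply (ct_tails _ _ _ _ _ _ Hcl). lia.
Qed.

(** * The ring lemma *)

Lemma lim_le (u v : nat -> R) (l l' : R) : (forall n, u n <= v n) ->
  is_lim_seq u l -> is_lim_seq v l' -> l <= l'.
Proof. intros H Hu Hv. exact (is_lim_seq_le u v l l' H Hu Hv). Qed.

Lemma is_lim_seq_sqr (u : nat -> R) (l : R) :
  is_lim_seq u l -> is_lim_seq (fun n => u n ^ 2) (l ^ 2).
Proof.
  intros H. apply (is_lim_seq_ext (fun n => u n * u n)); [intros; ring|].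
  replace (l ^ 2) with (l * l) by ring. now apply is_lim_seq_mult'.
Qed.

Ltac limits :=
  lazymatch goal with
  | |- is_lim_seq (fun _ => ?c) _ => apply is_lim_seq_const
  | |- is_lim_seq (fun k => @?f k + @?g k) (Finite (?a + ?b)) =>
      apply (is_lim_seq_plus' f g a b); cbv beta; limits
  | |- is_lim_seq (fun k => @?f k - @?g k) (Finite (?a - ?b)) =>
      apply (is_lim_seq_minus' f g a b); cbv beta; limits
  | |- is_lim_seq (fun k => @?f k * @?g k) (Finite (?a * ?b)) =>
      apply (is_lim_seq_mult' f g a b); cbv beta; limits
  | |- is_lim_seq (fun k => @?f k ^ 2) (Finite (?a ^ 2)) =>
      apply (is_lim_seq_sqr f a); cbv beta; limits
  | |- _ => idtac
  end.

Lemma dir_back (v : vertex) (n : nat) : vadd (vadd v (dir n)) (dir (3 + n)) = v.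
Proof.
  unfold dir; simpl. destruct (Nat.iter n rot (1, 0)%Z), v.
  unfold vadd, rot; simpl; f_equal; ring.
Qed.

Lemma layout_normalized (W : nat -> R) (r : vertex -> R) (P : vertex -> C) (u : vertex) :
  layout W r P ->
  layout W (fun v => / r u * r (vadd u v))
    (fun v => similar_point (/ r u) 0 (P u) (P (vadd u v))).
Proof.
  intros L. apply layout_similar; [|ring | assumption].
  apply Rinv_0_lt_compat, (ly_pos _ _ _ L).
Qed.

Definition ratio_bounded (M : R) (r : vertex -> R) : Prop :=
  forall v n, r v <= M * r (vadd v (dir n)).

(** If the ratios are unbounded, rescaling the larger radius to 1 puts a vertex whose radius tends
    to 0 next to one of radius 1. *)
Lemma ring_lemma_dir (W : nat -> R) (r : vertex -> R) (P : vertex -> C) (n : nat) :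
  good_weights W -> layout W r P -> exists M, forall v, r v <= M * r (vadd v (dir n)).
Proof.
  intros G L. apply NNPP; intros HN.
  assert (Hv : forall k : nat, exists v, INR k * r (vadd v (dir n)) < r v).
  { intros k. apply NNPP; intros H. apply HN. exists (INR k). intros v.
    apply Rnot_lt_le; intros K. apply H. exists v. exact K. }
  pose (v := fun k => proj1_sig (constructive_indefinite_description _ (Hv k))).
  assert (Hvk : forall k, INR k * r (vadd (v k) (dir n)) < r (v k)).
  { intros k. apply (proj2_sig (constructive_indefinite_description _ (Hv k))). }
  pose (rk := fun k u => / r (v k) * r (vadd (v k) u)).
  pose (Pk := fun k u => similar_point (/ r (v k)) 0 (P (v k)) (P (vadd (v k) u))).
  assert (Hpos : forall u, 0 < r u) by apply (ly_pos _ _ _ L).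
  assert (Hrk : forall k u, 0 < rk k u).
  { intros k u. apply Rmult_lt_0_compat; [apply Rinv_0_lt_compat|]; apply Hpos. }
  (* Radii may be unbounded, so they are cut off at 1: limit 0 then means small, and a positive
     limit means big. *)
  destruct (diagonal_subsequence (fun k u => Rmin 1 (rk k u)) (fun _ => 1)) as (phi & Hphi & Hlim).
  { intros k u. pose proof (Hrk k u). pose proof (Rmin_l 1 (rk k u)).
    assert (0 < Rmin 1 (rk k u)) by (apply Rmin_pos; lra).
    rewrite Rabs_pos_eq; lra. }
  apply (collapse_impossible W (fun k => rk (phi k)) (fun k => Pk (phi k)) (dir n) (3 + n) G).
  - split.
    + intros k. now apply layout_normalized.
    + intros u. destruct (Hlim u) as (l & Hl).
      assert (Hl0 : 0 <= l).
      { apply (lim_le (fun _ => 0) _ 0 l) in Hl; [exact Hl | | apply is_lim_seq_const].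
        intros k. apply Rlt_le, Rmin_pos; [lra | apply Hrk]. }
      destruct (Req_dec l 0) as [-> | Hne].
      * left. unfold small. apply (is_lim_seq_ext_loc (fun k => Rmin 1 (rk (phi k) u))); [|exact Hl].
        generalize (is_lim_seq_eventually_lt _ 0 1 Hl ltac:(lra)). apply eventually_imp.
        intros k Hk. unfold Rmin in *. destruct (Rle_dec 1 (rk (phi k) u)); lra.
      * right. exists (l / 2). split; [lra|].
        generalize (is_lim_seq_eventually_gt _ l (l / 2) Hl ltac:(lra)). apply eventually_imp.
        intros k Hk. pose proof (Rmin_r 1 (rk (phi k) u)). lra.
  - unfold small.
    apply (is_lim_seq_le_le_loc (fun _ => 0) _ (fun k => / INR k)).
    + exists 1%nat. intros k Hk. specialize (Hphi k).
      split; [apply Rlt_le, Hrk|].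
      assert (0 < INR k) by (apply lt_0_INR; lia).
      assert (INR k <= INR (phi k)) by (now apply le_INR).
      unfold rk. specialize (Hvk (phi k)). pose proof (Hpos (v (phi k))).
      pose proof (Hpos (vadd (v (phi k)) (dir n))).
      apply (Rmult_le_reg_l (r (v (phi k)) * INR k)); [nra|].
      field_simplify; nra.
    + apply is_lim_seq_const.
    + apply (is_lim_seq_inv INR p_infty); [apply is_lim_seq_INR | discriminate].
  - exists 1. split; [lra|]. exists O. intros k _.
    pose proof (dir_back (0, 0)%Z n) as E. rewrite vadd_0_l in E. rewrite E.
    unfold rk. rewrite vadd_0_r. right. symmetry. apply Rinv_l. apply Rgt_not_eq, Hpos.
Qed.

Lemma ring_lemma (W : nat -> R) (r : vertex -> R) (P : vertex -> C) :
  good_weights W -> layout W r P -> exists M, 1 <= M /\ ratio_bounded M r.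
Proof.
  intros G L.
  assert (H : forall N, exists M, 1 <= M /\
    forall n, (n < N)%nat -> forall v, r v <= M * r (vadd v (dir n))).
  { induction N as [|N (M & HM & IH)].
    - exists 1. split; [lra | intros; lia].
    - destruct (ring_lemma_dir W r P N G L) as (M' & H').
      exists (Rmax M M'). pose proof (Rmax_l M M'). pose proof (Rmax_r M M').
      split; [lra|]. intros n Hn v. pose proof (ly_pos _ _ _ L (vadd v (dir n))).
      destruct (Nat.eq_dec n N) as [-> |].
      + specialize (H' v). eapply Rle_trans; [exact H'|]. apply Rmult_le_compat_r; lra.
      + eapply Rle_trans; [exact (IH n ltac:(lia) v)|]. apply Rmult_le_compat_r; lra. }
  destruct (H 6%nat) as (M & HM & HB). exists M. split; [assumption|].
  intros v n. rewrite <- (dir_mod n). apply HB. apply Nat.mod_upper_bound. lia.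
Qed.

(** * Limits of layouts *)

Definition converges (rn : nat -> vertex -> R) (Pn : nat -> vertex -> C)
    (r : vertex -> R) (P : vertex -> C) : Prop :=
  forall v, is_lim_seq (fun n => rn n v) (r v) /\
    is_lim_seq (fun n => fst (Pn n v)) (fst (P v)) /\
    is_lim_seq (fun n => snd (Pn n v)) (snd (P v)).

(** Strict orientation and nonoverlapping may be lost in the limit, so the approximating layouts are
    part of the definition. *)
Definition limit_layout (W : nat -> R) (M : R) (r : vertex -> R) (P : vertex -> C) : Prop :=
  (forall v, 0 < r v) /\ exists rn Pn,
    (forall n, layout W (rn n) (Pn n) /\ ratio_bounded M (rn n)) /\ converges rn Pn r P.

Ltac converge H :=
  lazymatch goal with
  | |- is_lim_seq (fun _ => fst _) _ => exact (proj1 (proj2 (H _)))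
  | |- is_lim_seq (fun _ => snd _) _ => exact (proj2 (proj2 (H _)))
  | |- _ => exact (proj1 (H _))
  end.

Lemma layout_limit (W : nat -> R) (M : R) (r : vertex -> R) (P : vertex -> C) :
  layout W r P -> ratio_bounded M r -> limit_layout W M r P.
Proof.
  intros L HM. split; [apply (ly_pos _ _ _ L)|].
  exists (fun _ => r), (fun _ => P). split; [auto|].
  intros v. repeat split; apply is_lim_seq_const.
Qed.

Lemma limit_ratio_bounded (W : nat -> R) (M : R) (r : vertex -> R) (P : vertex -> C) :
  limit_layout W M r P -> ratio_bounded M r.
Proof.
  intros (_ & rn & Pn & H & Hc) v n.
  apply (lim_le (fun k => rn k v) (fun k => M * rn k (vadd v (dir n)))
    (r v) (M * r (vadd v (dir n)))).
  - intros k. apply H.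
  - converge Hc.
  - limits. converge Hc.
Qed.

Lemma converges_dist2 rn Pn r P (u v : vertex) : converges rn Pn r P ->
  is_lim_seq (fun n => dist2 (Pn n u) (Pn n v)) (dist2 (P u) (P v)).
Proof.
  intros H. unfold dist2. limits; converge H.
Qed.

Lemma converges_crs rn Pn r P (u v w : vertex) : converges rn Pn r P ->
  is_lim_seq (fun n => crs (Pn n u) (Pn n v) (Pn n w)) (crs (P u) (P v) (P w)).
Proof.
  intros H. unfold crs. limits; converge H.
Qed.

Lemma is_lim_seq_eq (u : nat -> R) (l c : R) : (forall n, u n = c) -> is_lim_seq u l -> l = c.
Proof.
  intros H Hl. assert (K : is_lim_seq u c).
  { apply (is_lim_seq_ext (fun _ => c)); [auto | apply is_lim_seq_const]. }
  apply is_lim_seq_unique in Hl. apply is_lim_seq_unique in K. congruence.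
Qed.

Lemma limit_dist (W : nat -> R) (M : R) (r : vertex -> R) (P : vertex -> C) (v : vertex) (n : nat) :
  limit_layout W M r P ->
  dist2 (P v) (P (vadd v (dir n))) = sqr_length (W n) (r v) (r (vadd v (dir n))).
Proof.
  intros (_ & rn & Pn & H & Hc). apply Rminus_diag_uniq.
  apply (is_lim_seq_eq (fun k => dist2 (Pn k v) (Pn k (vadd v (dir n)))
    - sqr_length (W n) (rn k v) (rn k (vadd v (dir n))))).
  - intros k. rewrite (ly_dist _ _ _ (proj1 (H k))). ring.
  - unfold sqr_length. limits; [now apply (converges_dist2 rn Pn r P) | converge Hc ..].
Qed.

Lemma limit_crs (W : nat -> R) (M : R) (r : vertex -> R) (P : vertex -> C) (v d : vertex) :
  limit_layout W M r P -> unit_vec d ->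
  0 <= crs (P v) (P (vadd v d)) (P (vadd v (rot d))).
Proof.
  intros (_ & rn & Pn & H & Hc) Hd.
  apply (lim_le (fun _ => 0)
    (fun k => crs (Pn k v) (Pn k (vadd v d)) (Pn k (vadd v (rot d)))) 0).
  - intros k. apply Rlt_le, (ly_oriented _ _ _ (proj1 (H k))). assumption.
  - apply is_lim_seq_const.
  - now apply (converges_crs rn Pn r P).
Qed.

Lemma converges_ratio W rn Pn r P (v : vertex) (n : nat) :
  (forall k, layout W (rn k) (Pn k)) -> (forall v, 0 < r v) -> converges rn Pn r P ->
  is_lim_seq (fun k => ratio (rn k) v n) (ratio r v n).
Proof.
  intros H Hr Hc. unfold ratio.
  apply (is_lim_seq_div' _ _ (r v) (r (vadd v (dir n)))); [converge Hc | converge Hc |].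
  apply Rgt_not_eq, Hr.
Qed.

(** The conditions of a flower are weak inequalities, apart from the positive radii, and the angle
    sum is continuous up to degenerate triangles because [acos] is. *)
Lemma limit_flower (W : nat -> R) (M : R) (r : vertex -> R) (P : vertex -> C) (v : vertex) :
  good_weights W -> limit_layout W M r P ->
  flower W (ratio r v) /\ psum (triangle_angle W (ratio r v)) 6 = 2 * PI.
Proof.
  intros G (Hr & rn & Pn & H & Hc).
  assert (HL : forall k, layout W (rn k) (Pn k)) by (intros; apply H).
  pose proof (fun n => converges_ratio W rn Pn r P v n HL Hr Hc) as HR.
  assert (Hpos : forall n, 0 < ratio r v n) by (intros; apply Rdiv_lt_0_compat; apply Hr).
  split; [split; [|split; [|split]]|].
  - intros n. unfold ratio. now rewrite dir_period.
  - exact Hpos.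
  - intros n. apply (lim_le (fun _ => 0) (fun k => triangle_quad W (ratio (rn k) v) n) 0).
    + intros k. apply Rlt_le. now apply (layout_quad_pos W (rn k) (Pn k)).
    + apply is_lim_seq_const.
    + unfold triangle_quad, quad.
      limits; apply HR.
  - intros m Hm.
    apply (lim_le
      (fun k => (W m - 1) * (ratio (rn k) v (1 + m) + ratio (rn k) v (5 + m)))
      (fun k => (W (1 + m)%nat + W (2 + m)%nat) * (1 + ratio (rn k) v m))
      ((W m - 1) * (ratio r v (1 + m) + ratio r v (5 + m)))
      ((W (1 + m)%nat + W (2 + m)%nat) * (1 + ratio r v m))).
    + intros k. apply (ly_Delaunay _ _ _ (HL k) v m Hm).
    + limits; apply HR.
    + limits; apply HR.
  - assert (HA : forall n, is_lim_seq (fun k => triangle_angle W (ratio (rn k) v) n)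
      (triangle_angle W (ratio r v) n)).
    { intros n. unfold triangle_angle.
      apply (is_lim_seq_continuous acos
        (fun k => cosF (W n) (W (1 + n)%nat) (W (2 + n)%nat) (ratio (rn k) v n) (ratio (rn k) v (1 + n)))).
      - apply continuity_pt_filterlim, continuous_acos.
      - assert (HB : forall p m, -1 < p -> is_lim_seq (fun k => sqrt (base_norm p (ratio (rn k) v m)))
          (sqrt (base_norm p (ratio r v m)))).
        { intros p m Hp.
          apply (is_lim_seq_continuous sqrt (fun k => base_norm p (ratio (rn k) v m))).
          - apply continuity_pt_sqrt. apply Rlt_le, base_norm_pos; auto.
          - unfold base_norm.
            limits; apply HR. }
        unfold cosF. apply is_lim_seq_div'.
        + limits; apply HR.
        + apply is_lim_seq_mult'; apply HB; apply (gw_gt W G).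
        + apply Rgt_not_eq, Rmult_lt_0_compat; apply sqrt_lt_R0, base_norm_pos; auto; apply (gw_gt W G). }
    assert (HS : forall N, is_lim_seq (fun k => psum (triangle_angle W (ratio (rn k) v)) N)
      (psum (triangle_angle W (ratio r v)) N)).
    { induction N; simpl; [apply is_lim_seq_const|]. now apply is_lim_seq_plus'. }
    apply (is_lim_seq_eq _ _ _ (fun k => layout_angle_sum W (rn k) (Pn k) v (HL k)) (HS 6%nat)).
Qed.

Lemma limit_similar (W : nat -> R) (M : R) (r : vertex -> R) (P : vertex -> C)
    (u : vertex) (k x y : R) (q : C) :
  0 < k -> x ^ 2 + y ^ 2 = k ^ 2 -> limit_layout W M r P ->
  limit_layout W M (fun v => k * r (vadd u v)) (fun v => similar_point x y q (P (vadd u v))).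
Proof.
  intros Hk E (Hr & rn & Pn & H & Hc). split.
  { intros v. apply Rmult_lt_0_compat; [assumption | apply Hr]. }
  exists (fun n v => k * rn n (vadd u v)), (fun n v => similar_point x y q (Pn n (vadd u v))).
  split.
  - intros n. destruct (H n) as [H1 H2]. split; [now apply layout_similar|].
    intros v m. rewrite <- vadd_assoc. specialize (H2 (vadd u v) m).
    replace (M * (k * rn n (vadd (vadd u v) (dir m))))
      with (k * (M * rn n (vadd (vadd u v) (dir m)))) by ring.
    apply Rmult_le_compat_l; lra.
  - intros v. destruct (Hc (vadd u v)) as (C1 & C2 & C3). split; [|split]; unfold similar_point; cbn [fst snd];
    limits; assumption.
Qed.

Definition normalized (r : vertex -> R) (P : vertex -> C) : Prop :=
  r (0, 0)%Z = 1 /\ P (0, 0)%Z = (0, 0).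

(** The bound holds for all normalized limits at once, as compactness requires. Along a path each
    edge multiplies the radius by a bounded factor and moves the point by a bounded multiple of the
    radii. *)
Lemma limit_bounds (W : nat -> R) (M : R) : forall v, exists B, 0 < B /\
  forall r P, limit_layout W M r P -> normalized r P ->
    / B <= r v <= B /\ Rabs (fst (P v)) <= B /\ Rabs (snd (P v)) <= B.
Proof.
  apply (vertex_ind (fun v => exists B, 0 < B /\
    forall r P, limit_layout W M r P -> normalized r P ->
    / B <= r v <= B /\ Rabs (fst (P v)) <= B /\ Rabs (snd (P v)) <= B)).
  - exists 1. split; [lra|]. intros r P _ [-> ->]. simpl. rewrite Rabs_R0. lra.
  - intros v d Hd (B & HB & HI). destruct (unit_dir d Hd) as (n & _ & ->).
    set (B1 := Rmax 1 M * B). set (B' := B1 + (B + B1) * (1 + Rabs (W n))).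
    pose proof (Rmax_l 1 M). pose proof (Rmax_r 1 M). pose proof (Rabs_pos (W n)).
    assert (HB1 : B <= B1) by (unfold B1; nra).
    assert (HBB : (B + B1) * 1 <= (B + B1) * (1 + Rabs (W n))) by (apply Rmult_le_compat_l; lra).
    assert (HB' : B1 <= B') by (unfold B'; lra).
    exists B'. split; [lra|]. intros r P HL HN.
    destruct (HI r P HL HN) as ((I1 & I1') & I2 & I3).
    pose proof (limit_ratio_bounded W M r P HL) as HM.
    pose proof (HM v n) as M1. pose proof (HM (vadd v (dir n)) (3 + n)%nat) as M2.
    rewrite dir_back in M2. pose proof (proj1 HL) as Hr.
    pose proof (Hr v). pose proof (Hr (vadd v (dir n))).
    set (x := r v) in *. set (y := r (vadd v (dir n))) in *.
    assert (Y1 : y <= B1) by (unfold B1; nra).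
    assert (Y2 : / B1 <= y).
    { assert (x <= Rmax 1 M * y) by nra.
      unfold B1. rewrite Rinv_mult.
      apply (Rmult_le_reg_l (Rmax 1 M)); [lra|].
      replace (Rmax 1 M * (/ Rmax 1 M * / B)) with (/ B) by (field; lra). lra. }
    assert (Y3 : / B' <= y).
    { eapply Rle_trans; [|exact Y2]. apply Rinv_le_contravar; lra. }
    pose proof (limit_dist W M r P v n HL) as D. fold x y in D.
    assert (D1 : dist2 (P v) (P (vadd v (dir n))) <= ((B + B1) * (1 + Rabs (W n))) ^ 2).
    { rewrite D. unfold sqr_length. pose proof (Rle_abs (W n)).
      assert (0 < x * y) by nra.
      assert (W n * (x * y) <= Rabs (W n) * (x * y)) by (apply Rmult_le_compat_r; lra).
      assert ((x + y) ^ 2 <= (B + B1) ^ 2) by (apply pow_incr; lra).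
      assert (x ^ 2 + y ^ 2 + 2 * W n * x * y <= (x + y) ^ 2 * (1 + Rabs (W n))).
      { assert (0 <= Rabs (W n) * (x ^ 2 + y ^ 2)) by (apply Rmult_le_pos; nra). nra. }
      assert ((x + y) ^ 2 * (1 + Rabs (W n)) <= (B + B1) ^ 2 * (1 + Rabs (W n)) ^ 2).
      { apply Rmult_le_compat; try nra. }
      rewrite Rpow_mult_distr. lra. }
    assert (HBW : 0 <= (B + B1) * (1 + Rabs (W n))) by lra.
    assert (F1 : - ((B + B1) * (1 + Rabs (W n))) <= fst (P (vadd v (dir n))) - fst (P v)
      <= (B + B1) * (1 + Rabs (W n))).
    { apply sqr_le_bounds; [assumption|]. eapply Rle_trans; [|exact D1].
      unfold dist2. pose proof (pow2_ge_0 (snd (P (vadd v (dir n))) - snd (P v))). lra. }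
    assert (F2 : - ((B + B1) * (1 + Rabs (W n))) <= snd (P (vadd v (dir n))) - snd (P v)
      <= (B + B1) * (1 + Rabs (W n))).
    { apply sqr_le_bounds; [assumption|]. eapply Rle_trans; [|exact D1].
      unfold dist2. pose proof (pow2_ge_0 (fst (P (vadd v (dir n))) - fst (P v))). lra. }
    apply Rabs_le_between in I2. apply Rabs_le_between in I3.
    split; [lra|]. split; apply Rabs_le_between; unfold B'; lra.
Qed.

Lemma is_lim_seq_eventually_close (u : nat -> R) (l eps : R) : 0 < eps ->
  is_lim_seq u l -> eventually (fun n => Rabs (u n - l) < eps).
Proof.
  intros He H.
  generalize (eventually_and _ _ (is_lim_seq_eventually_lt u l (l + eps) H ltac:(lra))
    (is_lim_seq_eventually_gt u l (l - eps) H ltac:(lra))).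
  apply eventually_imp. intros n [A B]. apply Rabs_def1; lra.
Qed.

Lemma limit_approx (W : nat -> R) (M : R) (r : vertex -> R) (P : vertex -> C) (N : nat) (eps : R) :
  limit_layout W M r P -> 0 < eps ->
  exists r' P', layout W r' P' /\ ratio_bounded M r' /\
    forall i, (i < N)%nat ->
      Rabs (r' (vertex_of_nat i) - r (vertex_of_nat i)) < eps /\
      Rabs (fst (P' (vertex_of_nat i)) - fst (P (vertex_of_nat i))) < eps /\
      Rabs (snd (P' (vertex_of_nat i)) - snd (P (vertex_of_nat i))) < eps.
Proof.
  intros (Hr & rn & Pn & H & Hc) He.
  assert (HE := eventually_all_lt (fun i n =>
      Rabs (rn n (vertex_of_nat i) - r (vertex_of_nat i)) < eps /\
      Rabs (fst (Pn n (vertex_of_nat i)) - fst (P (vertex_of_nat i))) < eps /\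
      Rabs (snd (Pn n (vertex_of_nat i)) - snd (P (vertex_of_nat i))) < eps) N).
  destruct HE as [n Hn].
  - intros i _. destruct (Hc (vertex_of_nat i)) as (C1 & C2 & C3).
    apply eventually_and; [|apply eventually_and];
      apply (is_lim_seq_eventually_close (fun n => _)); assumption.
  - exists (rn n), (Pn n). destruct (H n) as [H1 H2]. split; [assumption | split; [assumption|]].
    intros i Hi. exact (Hn n (Nat.le_refl n) i Hi).
Qed.

Lemma is_lim_seq_inv_succ : is_lim_seq (fun n => / (INR n + 1)) 0.
Proof.
  apply (is_lim_seq_ext (fun n => / INR (S n))); [intros; now rewrite S_INR|].
  apply (is_lim_seq_incr_1 (fun n => / INR n)).
  apply (is_lim_seq_inv INR p_infty); [apply is_lim_seq_INR | discriminate].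
Qed.

Lemma is_lim_seq_perturb (u v : nat -> R) (l : R) (i : nat) : is_lim_seq u l ->
  (forall n, (i < n)%nat -> Rabs (v n - u n) < / (INR n + 1)) -> is_lim_seq v l.
Proof.
  intros Hu H.
  apply (is_lim_seq_ext (fun n => u n + (v n - u n))); [intros; ring|].
  replace (Finite l) with (Finite (l + 0)) by (f_equal; ring).
  apply is_lim_seq_plus'; [assumption|].
  apply is_lim_seq_abs_0.
  apply (is_lim_seq_le_le_loc (fun _ => 0) _ (fun n => / (INR n + 1))).
  - exists (S i). intros n Hn. split; [apply Rabs_pos | apply Rlt_le, H; lia].
  - apply is_lim_seq_const.
  - apply is_lim_seq_inv_succ.
Qed.

(** The n-th limit is replaced by one of its layouts that agrees with it up to 1 / (n + 1) at the
    first n vertices. *)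
Lemma limit_closed (W : nat -> R) (M : R) rn Pn (r : vertex -> R) (P : vertex -> C) :
  (forall n, limit_layout W M (rn n) (Pn n)) -> converges rn Pn r P -> (forall v, 0 < r v) ->
  limit_layout W M r P.
Proof.
  intros H Hc Hr. split; [assumption|].
  assert (Hex : forall n : nat, exists y : (vertex -> R) * (vertex -> C),
    layout W (fst y) (snd y) /\ ratio_bounded M (fst y) /\
    forall i, (i < n)%nat ->
      Rabs (fst y (vertex_of_nat i) - rn n (vertex_of_nat i)) < / (INR n + 1) /\
      Rabs (fst (snd y (vertex_of_nat i)) - fst (Pn n (vertex_of_nat i))) < / (INR n + 1) /\
      Rabs (snd (snd y (vertex_of_nat i)) - snd (Pn n (vertex_of_nat i))) < / (INR n + 1)).
  { intros n. destruct (limit_approx W M (rn n) (Pn n) n (/ (INR n + 1)) (H n)) as (r' & P' & K).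
    - apply Rinv_0_lt_compat. pose proof (pos_INR n). lra.
    - exists (r', P'). exact K. }
  pose (y := fun n => proj1_sig (constructive_indefinite_description _ (Hex n))).
  assert (Hy : forall n, layout W (fst (y n)) (snd (y n)) /\ ratio_bounded M (fst (y n)) /\
    forall i, (i < n)%nat ->
      Rabs (fst (y n) (vertex_of_nat i) - rn n (vertex_of_nat i)) < / (INR n + 1) /\
      Rabs (fst (snd (y n) (vertex_of_nat i)) - fst (Pn n (vertex_of_nat i))) < / (INR n + 1) /\
      Rabs (snd (snd (y n) (vertex_of_nat i)) - snd (Pn n (vertex_of_nat i))) < / (INR n + 1)).
  { intros n. apply (proj2_sig (constructive_indefinite_description _ (Hex n))). }
  exists (fun n => fst (y n)), (fun n => snd (y n)). split.
  - intros n. destruct (Hy n) as (A & B & _). auto.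
  - intros v. destruct (vertex_of_nat_surj v) as [i <-].
    destruct (Hc (vertex_of_nat i)) as (C1 & C2 & C3).
    split; [|split]; eapply (is_lim_seq_perturb _ _ _ i); try eassumption;
    intros n Hn; apply (Hy n); assumption.
Qed.

Lemma limit_compact (W : nat -> R) (M : R) rn Pn :
  (forall n, limit_layout W M (rn n) (Pn n)) -> (forall n, normalized (rn n) (Pn n)) ->
  exists phi r P, (forall n, (n <= phi n)%nat) /\
    converges (fun n => rn (phi n)) (fun n => Pn (phi n)) r P /\
    limit_layout W M r P /\ normalized r P.
Proof.
  intros H HN.
  pose (B := fun v => proj1_sig (constructive_indefinite_description _ (limit_bounds W M v))).
  assert (HB : forall v, 0 < B v /\ forall r P, limit_layout W M r P -> normalized r P ->
    / B v <= r v <= B v /\ Rabs (fst (P v)) <= B v /\ Rabs (snd (P v)) <= B v).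
  { intros v. apply (proj2_sig (constructive_indefinite_description _ (limit_bounds W M v))). }
  assert (HB' : forall n v, / B v <= rn n v <= B v /\ Rabs (fst (Pn n v)) <= B v /\
    Rabs (snd (Pn n v)) <= B v).
  { intros n v. apply HB; auto. }
  destruct (diagonal_subsequence rn B) as (p1 & H1 & L1).
  { intros n v. destruct (HB' n v) as ((A1 & A2) & _). destruct (HB v) as [A3 _].
    assert (0 < / B v) by (now apply Rinv_0_lt_compat). rewrite Rabs_pos_eq; lra. }
  destruct (diagonal_subsequence (fun n v => fst (Pn (p1 n) v)) B) as (p2 & H2 & L2).
  { intros n v. apply HB'. }
  destruct (diagonal_subsequence (fun n v => snd (Pn (p1 (p2 n)) v)) B) as (p3 & H3 & L3).
  { intros n v. apply HB'. }
  pose (phi := fun n => p1 (p2 (p3 n))).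
  pose (r := fun v => proj1_sig (constructive_indefinite_description _ (L1 v))).
  assert (Lr : forall v, is_lim_seq (fun n => rn (p1 n) v) (r v)).
  { intros v. apply (proj2_sig (constructive_indefinite_description _ (L1 v))). }
  pose (x := fun v => proj1_sig (constructive_indefinite_description _ (L2 v))).
  assert (Lx : forall v, is_lim_seq (fun n => fst (Pn (p1 (p2 n)) v)) (x v)).
  { intros v. apply (proj2_sig (constructive_indefinite_description _ (L2 v))). }
  pose (y := fun v => proj1_sig (constructive_indefinite_description _ (L3 v))).
  assert (Ly : forall v, is_lim_seq (fun n => snd (Pn (phi n) v)) (y v)).
  { intros v. apply (proj2_sig (constructive_indefinite_description _ (L3 v))). }
  assert (Hconv : converges (fun n => rn (phi n)) (fun n => Pn (phi n)) r (fun v => (x v, y v))).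
  { intros v. cbn [fst snd]. split; [|split].
    - apply (is_lim_seq_along (fun n => rn (p1 n) v) (fun n => p2 (p3 n))); [|apply Lr].
      intros n. specialize (H3 n). specialize (H2 (p3 n)). lia.
    - apply (is_lim_seq_along (fun n => fst (Pn (p1 (p2 n)) v)) p3); [assumption | apply Lx].
    - apply Ly. }
  assert (Hpos : forall v, 0 < r v).
  { intros v. apply Rlt_le_trans with (/ B v).
    - apply Rinv_0_lt_compat, HB.
    - apply (lim_le (fun _ => / B v) (fun n => rn (p1 n) v)).
      + intros n. apply HB'.
      + apply is_lim_seq_const.
      + apply Lr. }
  exists phi, r, (fun v => (x v, y v)). split; [|split; [assumption | split]].
  - intros n. unfold phi. specialize (H3 n). specialize (H2 (p3 n)). specialize (H1 (p2 (p3 n))). lia.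
  - apply (limit_closed W M (fun n => rn (phi n)) (fun n => Pn (phi n))); auto.
  - split; cbn [fst snd].
    + apply (is_lim_seq_eq (fun n => rn (p1 n) (0, 0)%Z)); [intros; apply HN | apply Lr].
    + f_equal.
      * apply (is_lim_seq_eq (fun n => fst (Pn (p1 (p2 n)) (0, 0)%Z))); [|apply Lx].
        intros n. now rewrite (proj2 (HN _)).
      * apply (is_lim_seq_eq (fun n => snd (Pn (phi n) (0, 0)%Z))); [|apply Ly].
        intros n. now rewrite (proj2 (HN _)).
Qed.

Lemma limit_normalize (W : nat -> R) (M : R) (r : vertex -> R) (P : vertex -> C) (u : vertex) :
  limit_layout W M r P ->
  limit_layout W M (fun v => / r u * r (vadd u v))
    (fun v => similar_point (/ r u) 0 (P u) (P (vadd u v))) /\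
  normalized (fun v => / r u * r (vadd u v))
    (fun v => similar_point (/ r u) 0 (P u) (P (vadd u v))).
Proof.
  intros L. pose proof (proj1 L u). split.
  - apply limit_similar; [|ring | assumption]. now apply Rinv_0_lt_compat.
  - split.
    + rewrite vadd_0_r. apply Rinv_l. lra.
    + rewrite vadd_0_r. unfold similar_point. f_equal; ring.
Qed.

(** Where equality holds, the flowers at [v] and at its translate have ordered inverse radii and the
    same angle sum 2 PI. By [flower_rigidity] they agree, so equality spreads to the neighbours. *)
Lemma limit_maximum_principle (W : nat -> R) (M : R) (r : vertex -> R) (P : vertex -> C)
    (n : nat) (L : R) : good_weights W -> limit_layout W M r P ->
  (forall v, r (vadd v (dir n)) <= L * r v) ->
  r (vadd (0, 0)%Z (dir n)) = L * r (0, 0)%Z ->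
  forall v, r (vadd v (dir n)) = L * r v.
Proof.
  intros G HL Hle H0. pose proof (proj1 HL) as Hr.
  apply (vertex_ind (fun v => r (vadd v (dir n)) = L * r v)); [assumption|].
  intros v d Hd Hv. destruct (unit_dir d Hd) as (k & _ & ->).
  destruct (limit_flower W M r P v G HL) as [F1 S1].
  destruct (limit_flower W M r P (vadd v (dir n)) G HL) as [F2 S2].
  assert (HLpos : 0 < L).
  { pose proof (Hr v). pose proof (Hr (vadd v (dir n))). rewrite Hv in *. nra. }
  assert (Hswap : forall m, vadd (vadd v (dir n)) (dir m) = vadd (vadd v (dir m)) (dir n)).
  { intros m. rewrite !vadd_assoc. f_equal. apply vadd_comm. }
  assert (E : ratio r v k = ratio r (vadd v (dir n)) k).
  { apply (flower_rigidity W _ _ G F1 F2); [|congruence].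
    intros m. unfold ratio. rewrite Hswap, Hv.
    pose proof (Hle (vadd v (dir m))) as K.
    pose proof (Hr v). pose proof (Hr (vadd v (dir m))). pose proof (Hr (vadd (vadd v (dir m)) (dir n))).
    apply (Rmult_le_reg_r (r (vadd v (dir m)) * r (vadd (vadd v (dir m)) (dir n)))); [nra|].
    field_simplify; try lra. nra. }
  unfold ratio in E. rewrite Hswap, Hv in E.
  pose proof (Hr v). pose proof (Hr (vadd v (dir k))). pose proof (Hr (vadd (vadd v (dir k)) (dir n))).
  apply (Rmult_eq_reg_l (r v / (r (vadd v (dir k)) * r (vadd (vadd v (dir k)) (dir n))))).
  - transitivity (r v / r (vadd v (dir k))); [field; lra|]. rewrite E. field. lra.
  - apply Rgt_not_eq, Rdiv_lt_0_compat; [assumption | nra].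
Qed.

(** [L] is the supremum of the quotients; moving nearly extremal vertices to the origin makes it
    attained in the limit. The last clause preserves relations gained earlier, so the construction
    can be repeated for a second direction. *)
Lemma extremal_limit (W : nat -> R) (M : R) (r : vertex -> R) (P : vertex -> C) (n : nat) :
  good_weights W -> limit_layout W M r P ->
  exists L r' P', (forall v, r (vadd v (dir n)) <= L * r v) /\
    limit_layout W M r' P' /\ normalized r' P' /\
    (forall v, r' (vadd v (dir n)) = L * r' v) /\
    (forall m c, (forall v, r (vadd v (dir m)) = c * r v) ->
      forall v, r' (vadd v (dir m)) = c * r' v).
Proof.
  intros G HL. pose proof (proj1 HL) as Hr.
  pose (E := fun x => exists v, x = r (vadd v (dir n)) / r v).
  assert (HB : bound E).
  { exists M. intros x (v & ->).
    pose proof (limit_ratio_bounded W M r P HL (vadd v (dir n)) (3 + n)%nat) as K.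
    rewrite dir_back in K. pose proof (Hr v).
    apply (Rmult_le_reg_r (r v)); [assumption|]. field_simplify; lra. }
  destruct (completeness E HB) as (L & HU & HLub).
  { exists (r (vadd (0, 0)%Z (dir n)) / r (0, 0)%Z). now exists (0, 0)%Z. }
  assert (HLe : forall v, r (vadd v (dir n)) <= L * r v).
  { intros v. pose proof (Hr v). assert (K : r (vadd v (dir n)) / r v <= L) by (apply HU; now exists v).
    apply (Rmult_le_compat_r (r v)) in K; [|lra].
    replace (r (vadd v (dir n)) / r v * r v) with (r (vadd v (dir n))) in K by (field; lra). exact K. }
  assert (Hex : forall k : nat, exists v, (L - / (INR k + 1)) * r v < r (vadd v (dir n))).
  { intros k. assert (0 < / (INR k + 1)).
    { apply Rinv_0_lt_compat. pose proof (pos_INR k). lra. }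
    apply NNPP; intros HN. assert (L <= L - / (INR k + 1)); [|lra].
    apply HLub. intros x (v & ->). apply Rnot_lt_le; intros K. apply HN. exists v.
    pose proof (Hr v). apply (Rmult_lt_compat_r (r v)) in K; [|assumption].
    replace (r (vadd v (dir n)) / r v * r v) with (r (vadd v (dir n))) in K by (field; lra). exact K. }
  pose (u := fun k => proj1_sig (constructive_indefinite_description _ (Hex k))).
  assert (Hu : forall k, (L - / (INR k + 1)) * r (u k) < r (vadd (u k) (dir n))).
  { intros k. apply (proj2_sig (constructive_indefinite_description _ (Hex k))). }
  pose (rk := fun k v => / r (u k) * r (vadd (u k) v)).
  pose (Pk := fun k v => similar_point (/ r (u k)) 0 (P (u k)) (P (vadd (u k) v))).
  destruct (limit_compact W M rk Pk) as (phi & r' & P' & Hphi & Hc & HL' & HN').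
  { intros k. now apply limit_normalize. }
  { intros k. now apply (limit_normalize W M). }
  assert (Hrel : forall m c, (forall v, r (vadd v (dir m)) = c * r v) ->
      forall v, r' (vadd v (dir m)) = c * r' v).
  { intros m c Hm v. apply Rminus_diag_uniq.
    apply (is_lim_seq_eq (fun k => rk (phi k) (vadd v (dir m)) - c * rk (phi k) v)).
    - intros k. unfold rk. rewrite <- vadd_assoc, Hm. ring.
    - limits; [exact (proj1 (Hc (vadd v (dir m)))) | exact (proj1 (Hc v))]. }
  assert (Hle' : forall v, r' (vadd v (dir n)) <= L * r' v).
  { intros v. apply (lim_le (fun k => rk (phi k) (vadd v (dir n))) (fun k => L * rk (phi k) v)).
    - intros k. unfold rk. rewrite <- vadd_assoc.
      specialize (HLe (vadd (u (phi k)) v)).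
      assert (0 < / r (u (phi k))) by (apply Rinv_0_lt_compat, Hr).
      apply (Rmult_le_compat_l (/ r (u (phi k)))) in HLe; lra.
    - exact (proj1 (Hc (vadd v (dir n)))).
    - limits. exact (proj1 (Hc v)). }
  exists L, r', P'. split; [assumption | split; [assumption | split; [assumption | split; [|assumption]]]].
  apply (limit_maximum_principle W M r' P'); auto.
  apply Rle_antisym; [apply Hle'|]. rewrite (proj1 HN'), vadd_0_l, Rmult_1_r.
  apply (lim_le (fun k => L - / (INR k + 1)) (fun k => rk (phi k) (dir n))).
  - intros k. specialize (Hu (phi k)). specialize (Hphi k). apply le_INR in Hphi.
    pose proof (pos_INR k). pose proof (Hr (u (phi k))).
    assert (/ (INR (phi k) + 1) <= / (INR k + 1)) by (apply Rinv_le_contravar; lra).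
    unfold rk. apply (Rmult_le_reg_l (r (u (phi k)))); [assumption|].
    rewrite <- Rmult_assoc, Rinv_r, Rmult_1_l by lra.
    apply Rlt_le. eapply Rle_lt_trans; [|exact Hu]. rewrite Rmult_comm. apply Rmult_le_compat_r; lra.
  - replace (Finite L) with (Finite (L - 0)) by (f_equal; ring).
    apply is_lim_seq_minus'; [apply is_lim_seq_const|].
    apply is_lim_seq_inv_succ.
  - exact (proj1 (Hc (dir n))).
Qed.

(** * Nearly degenerate spirals *)

(** The ordinate of the line through [A] and [B] at abscissa [x]. *)
Definition height (A B : C) (x : R) : R :=
  snd B + (snd A - snd B) * (x - fst B) / (fst A - fst B).

Lemma crs_height (A B Z : C) : fst B < fst A ->
  crs A B Z = (fst A - fst B) * (height A B (fst Z) - snd Z).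
Proof. intros H. unfold crs, height. field. lra. Qed.

Lemma crs_rev (A B D : C) : crs A B D = - crs D B A.
Proof. unfold crs; ring. Qed.

Lemma height_l (A B : C) : fst B < fst A -> height A B (fst A) = snd A.
Proof. intros H. unfold height. field. lra. Qed.

Lemma height_r (A B : C) : fst B < fst A -> height A B (fst B) = snd B.
Proof. intros H. unfold height. field. lra. Qed.

Lemma height_lerp (A B : C) (x : R) : fst B < fst A -> fst B <= x <= fst A ->
  exists t, 0 <= t <= 1 /\ (x, height A B x) = lerp t A B.
Proof.
  intros H Hx. set (t := (fst A - x) / (fst A - fst B)).
  assert (Et : t * (fst A - fst B) = fst A - x) by (unfold t; field; lra).
  exists t. split; [split; nra|]. unfold lerp, height. f_equal; [lra|].
  unfold t. field. lra.
Qed.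

Lemma above_segment (A B A' B' : C) (x y : R) : fst B < fst A -> fst B' < fst A' ->
  fst B <= x <= fst A -> height A B x <= y ->
  height A' B' (fst A) <= snd A -> height A' B' (fst B) <= snd B ->
  height A' B' x <= y.
Proof.
  intros H H' Hx Hy HA HB. eapply Rle_trans; [|exact Hy].
  apply Rminus_le_0.
  replace (height A B x - height A' B' x) with
    (((x - fst B) * (snd A - height A' B' (fst A))
      + (fst A - x) * (snd B - height A' B' (fst B))) / (fst A - fst B))
    by (unfold height; field; lra).
  apply Rmult_le_pos; [nra|]. apply Rlt_le, Rinv_0_lt_compat. lra.
Qed.

(** The segments from [Rp n] to [Lp n] cross the axis and widen with n. Counterclockwise triangles
    between consecutive ones force each segment below the ends of the one before, and these
    relations compose by [above_segment]. *)
Lemma strip_above (Rp Lp : nat -> C) (N : nat) :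
  (forall n, (n <= N)%nat -> 0 < fst (Rp n) < fst (Rp (S n)) /\ fst (Lp (S n)) < fst (Lp n) < 0) ->
  (forall n, (n <= N)%nat -> 0 < crs (Rp n) (Lp n) (Rp (S n)) /\
    0 < crs (Lp n) (Lp (S n)) (Rp (S n))) ->
  forall k, (k <= N)%nat ->
    height (Rp (S k)) (Lp (S k)) (fst (Rp 0%nat)) <= snd (Rp 0%nat) /\
    height (Rp (S k)) (Lp (S k)) (fst (Lp 0%nat)) <= snd (Lp 0%nat).
Proof.
  intros Hx Hc.
  assert (HL : forall k, (k <= N)%nat -> height (Rp (S k)) (Lp (S k)) (fst (Lp k)) <= snd (Lp k)).
  { intros k Hk. destruct (Hc k Hk) as [_ C]. destruct (Hx k Hk) as [X1 X2].
    rewrite crs_rev, crs_height in C by lra. nra. }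
  assert (HR : forall k, (k <= N)%nat -> height (Rp (S k)) (Lp (S k)) (fst (Rp k)) <= snd (Rp k)).
  { intros k Hk. destruct (Hc k Hk) as [C _]. destruct (Hx k Hk) as [X1 X2].
    rewrite crs_rev, crs_height in C by lra.
    apply (above_segment (Rp (S k)) (Lp k)); try lra.
    - nra.
    - rewrite height_l; lra.
    - now apply HL. }
  assert (Hmono : forall k, (k <= N)%nat -> fst (Rp 0%nat) <= fst (Rp k) /\ fst (Lp k) <= fst (Lp 0%nat)).
  { induction k; intros Hk; [lra|]. destruct (IHk ltac:(lia)). destruct (Hx k ltac:(lia)). lra. }
  induction k; intros Hk; [split; [apply HR | apply HL]; lia|].
  destruct (IHk ltac:(lia)) as [I1 I2]. destruct (Hx (S k) Hk) as [X1 X2].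
  destruct (Hmono (S k) Hk) as [M1 M2]. destruct (Hx 0%nat ltac:(lia)) as [Y1 Y2].
  split; apply (above_segment (Rp (S k)) (Lp (S k))); try lra; try assumption;
  first [now apply HR | now apply HL].
Qed.

(** The difference of the heights is affine, so a change of order over common abscissas would
    produce a common point. *)
Lemma segments_ordered (A B A' B' : C) (x x' : R) : fst B < fst A -> fst B' < fst A' ->
  (forall s t, 0 <= s <= 1 -> 0 <= t <= 1 -> lerp s A B <> lerp t A' B') ->
  fst B <= x <= fst A -> fst B' <= x <= fst A' ->
  fst B <= x' <= fst A -> fst B' <= x' <= fst A' ->
  height A B x <= height A' B' x -> height A B x' < height A' B' x'.
Proof.
  intros H H' Hd X1 X2 X3 X4 Hle. apply Rnot_le_lt; intros Hge.
  assert (HE : exists y, fst B <= y <= fst A /\ fst B' <= y <= fst A' /\ height A B y = height A' B' y).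
  { set (g := height A' B' x - height A B x) in *.
    set (g' := height A B x' - height A' B' x') in *.
    destruct (Req_dec (g + g') 0) as [E | E].
    - exists x. split; [assumption | split; [assumption|]]. unfold g, g' in *. lra.
    - assert (Hg : 0 < g + g') by (unfold g, g' in *; lra).
      set (s := g / (g + g')).
      assert (Es : s * (g + g') = g) by (unfold s; field; lra).
      assert (Hs : 0 <= s <= 1) by (unfold g, g' in *; split; nra).
      exists ((1 - s) * x + s * x').
      split; [split; nra | split; [split; nra|]].
      assert (K : height A B ((1 - s) * x + s * x') - height A' B' ((1 - s) * x + s * x')
        = - ((1 - s) * g) + s * g').
      { unfold g, g', height. field. lra. }
      lra. }
  destruct HE as (y & Y1 & Y2 & E).
  destruct (height_lerp A B y H Y1) as (s & Hs & E1).
  destruct (height_lerp A' B' y H' Y2) as (t & Ht & E2).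
  apply (Hd s t Hs Ht). rewrite <- E1, <- E2, E. reflexivity.
Qed.

Lemma edges_disjoint (P : vertex -> C) (i j a b : vertex) (s t : R) : nonoverlapping P ->
  adj i j -> adj a b -> i <> a -> i <> b -> j <> a -> j <> b ->
  0 <= s <= 1 -> 0 <= t <= 1 -> lerp s (P i) (P j) <> lerp t (P a) (P b).
Proof.
  intros Hn H1 H2 N1 N2 N3 N4 Hs Ht E.
  assert (s = 1) by (now apply (edges_meet P i j a b s t)).
  rewrite lerp_flip in E.
  assert (1 - s = 1); [|lra].
  apply (edges_meet P j i a b (1 - s) t); auto; try lra. now apply adj_sym.
Qed.

Definition pt (P : vertex -> C) (m : Z) (n : nat) : C := P (m, Z.of_nat n).

Lemma adj_row (m : Z) (n : Z) : adj (m, n) (m + 1, n)%Z.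
Proof.
  replace (m + 1, n)%Z with (vadd (m, n) (dir 0)).
  - apply adj_vadd, dir_unit.
  - unfold vadd; simpl; f_equal; ring.
Qed.

Lemma up_face (m n : Z) : face (m, n) (m + 1, n)%Z (m, n + 1)%Z.
Proof.
  replace (m + 1, n)%Z with (vadd (m, n) (dir 0)).
  - replace (m, n + 1)%Z with (vadd (m, n) (rot (dir 0))).
    + apply face_left, dir_unit.
    + unfold vadd; simpl; f_equal; ring.
  - unfold vadd; simpl; f_equal; ring.
Qed.

Lemma down_face (m n : Z) : face (m + 1, n)%Z (m + 1, n + 1)%Z (m, n + 1)%Z.
Proof.
  replace (m + 1, n + 1)%Z with (vadd (m + 1, n)%Z (dir 1)).
  - replace (m, n + 1)%Z with (vadd (m + 1, n)%Z (rot (dir 1))).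
    + apply face_left, dir_unit.
    + unfold vadd; simpl; f_equal; ring.
  - unfold vadd; simpl; f_equal; ring.
Qed.

Lemma oriented_up (P : vertex -> C) (m : Z) (n : nat) : oriented P ->
  0 < crs (pt P m n) (pt P (m + 1) n) (pt P m (S n)).
Proof.
  intros Ho. unfold pt. rewrite Nat2Z.inj_succ.
  pose proof (Ho (m, Z.of_nat n) (dir 0) (dir_unit 0)) as K.
  unfold vadd in K; simpl in K. rewrite Z.add_0_r in K.
  replace (m + 0)%Z with m in K by ring. exact K.
Qed.

Lemma oriented_down (P : vertex -> C) (m : Z) (n : nat) : oriented P ->
  0 < crs (pt P (m + 1) n) (pt P (m + 1) (S n)) (pt P m (S n)).
Proof.
  intros Ho. unfold pt. rewrite Nat2Z.inj_succ.
  pose proof (Ho (m + 1, Z.of_nat n)%Z (dir 1) (dir_unit 1)) as K.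
  unfold vadd in K; simpl in K.
  replace (m + 1 + 0)%Z with (m + 1)%Z in K by ring.
  replace (m + 1 + -1)%Z with m in K by ring. exact K.
Qed.

(* The vertices [(m, n)] lie alternately to the right ([m] even) and to the left
   ([m] odd) of the vertical axis, which is crossed by the edges
   joining [(m, n)] and [(m + 1, n)].  The strip [m = 1] lies above the
   strips [m = 0] and [m = 2], which separate each other. *)
Lemma spiral_clash (P : vertex -> C) (N k' k : nat) : oriented P -> nonoverlapping P ->
  (forall m n, (m = 0 \/ m = 2)%Z -> (n <= N)%nat ->
     0 < fst (pt P m n) < fst (pt P m (S n))) ->
  (forall m n, (m = 1 \/ m = 3)%Z -> (n <= N)%nat ->
     fst (pt P m (S n)) < fst (pt P m n) < 0) ->
  (1 < k')%nat -> (k' < k)%nat -> (k <= N)%nat ->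
  fst (pt P 3 k') < fst (pt P 1 1) -> fst (pt P 2 k') < fst (pt P 0 k) -> False.
Proof.
  intros Ho Hn HE HO Hk1 Hk2 HkN X1 X2.
  assert (Hg : forall m m' n n' s t, (m' <> m)%Z -> (m' <> m + 1)%Z \/ n <> n' ->
    (m' + 1 <> m)%Z \/ n <> n' -> 0 <= s <= 1 -> 0 <= t <= 1 ->
    lerp s (pt P m n) (pt P (m + 1) n) <> lerp t (pt P m' n') (pt P (m' + 1) n')).
  { intros m m' n n' s t M1 M2 M3 Hs Ht. unfold pt.
    apply edges_disjoint; auto using adj_row; intros E; injection E; intros; lia. }
  assert (E0 : forall n, (n <= N)%nat -> 0 < fst (pt P 0 n) < fst (pt P 0 (S n)))
    by (intros; apply HE; auto).
  assert (E2 : forall n, (n <= N)%nat -> 0 < fst (pt P 2 n) < fst (pt P 2 (S n)))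
    by (intros; apply HE; auto).
  assert (O1 : forall n, (n <= N)%nat -> fst (pt P 1 (S n)) < fst (pt P 1 n) < 0)
    by (intros; apply HO; auto).
  assert (O3 : forall n, (n <= N)%nat -> fst (pt P 3 (S n)) < fst (pt P 3 n) < 0)
    by (intros; apply HO; auto).
  assert (T0 : forall n, (n < N)%nat ->
    height (pt P 0 (S n)) (pt P 1 (S n)) (fst (pt P 1 0)) <= snd (pt P 1 0)).
  { intros n Hn'. apply (strip_above (pt P 0) (pt P 1) N); [| |lia].
    - intros i Hi. auto.
    - intros i Hi. split; [apply (oriented_up P 0) | apply (oriented_down P 0)]; assumption. }
  assert (T2 : forall n, (n < N)%nat ->
    height (pt P 2 (S n)) (pt P 3 (S n)) (fst (pt P 2 0)) <= snd (pt P 2 0)).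
  { intros n Hn'. apply (strip_above (pt P 2) (pt P 3) N); [| |lia].
    - intros i Hi. auto.
    - intros i Hi. split; [apply (oriented_up P 2) | apply (oriented_down P 2)]; assumption. }
  assert (T1 : forall n, (n < N)%nat ->
    snd (pt P 1 0) <= height (pt P 2 (S n)) (pt P 1 (S n)) (fst (pt P 1 0)) /\
    snd (pt P 2 0) <= height (pt P 2 (S n)) (pt P 1 (S n)) (fst (pt P 2 0))).
  { intros n Hn'.
    (* A half turn exchanges left and right, above and below; it brings the strip m = 1 into the
       position treated by [strip_above]. *)
    pose (op := fun p : C => (- fst p, - snd p)).
    assert (Hop : forall A B D : C, crs (op A) (op B) (op D) = crs A B D)
      by (intros; unfold crs, op; simpl; ring).
    destruct (strip_above (fun i => op (pt P 1 i)) (fun i => op (pt P 2 i)) N) with (k := n)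
      as [K1 K2]; [| |lia|].
    - intros i Hi. unfold op; simpl. specialize (O1 i Hi). specialize (E2 i Hi). lra.
    - intros i Hi. rewrite !Hop. split; [apply (oriented_up P 1) | apply (oriented_down P 1)]; assumption.
    - specialize (O1 (S n) ltac:(lia)). specialize (E2 (S n) ltac:(lia)).
      assert (Hh : forall x, height (op (pt P 1 (S n))) (op (pt P 2 (S n))) (- x)
        = - height (pt P 2 (S n)) (pt P 1 (S n)) x).
      { intros x. unfold height, op; simpl. field. lra. }
      unfold op at 3 4 in K1. unfold op at 3 4 in K2. simpl in K1, K2.
      rewrite Hh in K1, K2. lra. }
  assert (mono : forall (f : nat -> R) n, (forall i, (i <= N)%nat -> f i < f (S i)) ->
    (n <= N)%nat -> f 0%nat <= f n).
  { intros f n Hf. induction n; intros Hn'; [lra|].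
    specialize (IHn ltac:(lia)). specialize (Hf n ltac:(lia)). lra. }
  assert (m0 : forall n, (n <= N)%nat -> fst (pt P 0 0) <= fst (pt P 0 n))
    by (intros n Hn'; apply (mono (fun i => fst (pt P 0 i))); [apply E0 | assumption]).
  assert (m2 : forall n, (n <= N)%nat -> fst (pt P 2 0) <= fst (pt P 2 n))
    by (intros n Hn'; apply (mono (fun i => fst (pt P 2 i))); [apply E2 | assumption]).
  assert (m1 : forall n, (n <= N)%nat -> fst (pt P 1 n) <= fst (pt P 1 0)).
  { intros n Hn'. assert (- fst (pt P 1 0) <= - fst (pt P 1 n)); [|lra].
    apply (mono (fun i => - fst (pt P 1 i))); [|assumption].
    intros i Hi. specialize (O1 i Hi). lra. }
  assert (C0 : forall n n' x, (1 <= n <= N)%nat -> (1 <= n' <= N)%nat -> n <> n' ->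
    fst (pt P 1 n) <= x <= fst (pt P 0 n) -> fst (pt P 1 n') <= x <= fst (pt P 2 n') ->
    height (pt P 0 n) (pt P 1 n) x < height (pt P 2 n') (pt P 1 n') x).
  { intros n n' x Hnn Hnn' Hne Xa Xb.
    pose proof (O1 0%nat ltac:(lia)). pose proof (m1 n ltac:(lia)). pose proof (m1 n' ltac:(lia)).
    pose proof (E0 n ltac:(lia)). pose proof (E2 n' ltac:(lia)).
    apply (segments_ordered _ _ _ _ (fst (pt P 1 0))); try lra.
    - intros s t Hs Ht. rewrite (lerp_flip t).
      apply (Hg 0%Z 1%Z); auto; lra || lia.
    - destruct n as [|n]; [lia|]. destruct n' as [|n']; [lia|].
      eapply Rle_trans; [apply T0; lia | apply T1; lia]. }
  assert (C1 : forall n n' x, (1 <= n <= N)%nat -> (1 <= n' <= N)%nat -> n <> n' ->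
    fst (pt P 3 n) <= x <= fst (pt P 2 n) -> fst (pt P 1 n') <= x <= fst (pt P 2 n') ->
    height (pt P 2 n) (pt P 3 n) x < height (pt P 2 n') (pt P 1 n') x).
  { intros n n' x Hnn Hnn' Hne Xa Xb.
    pose proof (E2 0%nat ltac:(lia)). pose proof (m2 n ltac:(lia)). pose proof (m2 n' ltac:(lia)).
    pose proof (O3 n ltac:(lia)). pose proof (O1 n' ltac:(lia)).
    apply (segments_ordered _ _ _ _ (fst (pt P 2 0))); try lra.
    - intros s t Hs Ht. rewrite (lerp_flip t).
      apply (Hg 2%Z 1%Z); auto; lra || lia.
    - destruct n as [|n]; [lia|]. destruct n' as [|n']; [lia|].
      eapply Rle_trans; [apply T2; lia | apply T1; lia]. }
  pose proof (O3 k' ltac:(lia)) as Y3. pose proof (E2 k' ltac:(lia)) as Y2.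
  pose proof (O1 1%nat ltac:(lia)) as Y1. pose proof (E0 1%nat ltac:(lia)) as Y0.
  pose proof (E2 1%nat ltac:(lia)) as Y2'. pose proof (O1 k' ltac:(lia)) as Y1'.
  pose proof (E0 k ltac:(lia)) as Y0k. pose proof (O1 k ltac:(lia)) as Y1k.
  (* Edge [k'] of the strip m = 2 crosses the axis at [y2]. The two size hypotheses put this below
     edge 1 and above edge [k] of the strip m = 0, so the crossing point falls into a triangle of
     that strip. *)
  set (y2 := height (pt P 2 k') (pt P 3 k') 0).
  assert (A1 : y2 < height (pt P 0 1) (pt P 1 1) 0).
  { apply (segments_ordered _ _ _ _ (fst (pt P 1 1))); try lra.
    - intros s t Hs Ht. apply (Hg 2%Z 0%Z); auto; lra || lia.
    - rewrite height_r by lra. apply Rlt_le.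
      rewrite <- (height_r (pt P 2 1) (pt P 1 1)) by lra.
      apply C1; try lia; lra. }
  assert (A2 : height (pt P 0 k) (pt P 1 k) 0 < y2).
  { apply (segments_ordered _ _ _ _ (fst (pt P 2 k'))); try lra.
    - intros s t Hs Ht. apply (Hg 0%Z 2%Z); auto; lra || lia.
    - rewrite height_l by lra. apply Rlt_le.
      rewrite <- (height_l (pt P 2 k') (pt P 1 k')) by lra.
      apply C0; try lia; lra. }
  assert (HI : exists n, (1 <= n < k)%nat /\ height (pt P 0 (S n)) (pt P 1 (S n)) 0 <= y2 <=
    height (pt P 0 n) (pt P 1 n) 0).
  { assert (HH : forall q, (1 + q <= k)%nat -> height (pt P 0 (1 + q)) (pt P 1 (1 + q)) 0 < y2 ->
      exists n, (1 <= n < k)%nat /\ height (pt P 0 (S n)) (pt P 1 (S n)) 0 <= y2 <=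
      height (pt P 0 n) (pt P 1 n) 0).
    { induction q; intros Hq Hh; [simpl in Hh; lra|].
      destruct (Rlt_dec (height (pt P 0 (1 + q)) (pt P 1 (1 + q)) 0) y2) as [L | L].
      - apply IHq; [lia | assumption].
      - exists (1 + q)%nat. split; [lia|]. simpl in *. lra. }
    apply (HH (k - 1)%nat); [lia|]. now replace (1 + (k - 1))%nat with k by lia. }
  destruct HI as (n & Hnk & Hy).
  pose proof (E0 n ltac:(lia)) as Z0. pose proof (O1 n ltac:(lia)) as Z1.
  pose proof (oriented_up P 0 n Ho) as U. pose proof (oriented_down P 0 n Ho) as D.
  change (0 + 1)%Z with 1%Z in U, D.
  destruct (height_lerp (pt P 2 k') (pt P 3 k') 0) as (s & Hs & Es); try lra.
  fold y2 in Es.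
  assert (Hmeet : forall a b c x y z, face a b c -> barycentric x y z ->
    (forall v, v = a \/ v = b \/ v = c -> (fst v <= 1)%Z) ->
    0 = x * fst (P a) + y * fst (P b) + z * fst (P c) ->
    y2 = x * snd (P a) + y * snd (P b) + z * snd (P c) -> False).
  { intros a b c x y z Hf Hb Hv F1 F2.
    assert (Hne : forall m v, (2 <= m)%Z -> v = a \/ v = b \/ v = c -> (m, Z.of_nat k') <> v).
    { intros m v Hm Hv' <-. specialize (Hv _ Hv'). simpl in Hv. lia. }
    assert (G1 : fst (lerp s (pt P 2 k') (pt P 3 k')) = 0) by (now rewrite <- Es).
    assert (G2 : snd (lerp s (pt P 2 k') (pt P 3 k')) = y2) by (now rewrite <- Es).
    unfold pt in G1, G2.
    assert (s = 1).
    { apply (edge_meets_face P (2, Z.of_nat k')%Z (3, Z.of_nat k')%Z a b c s x y z); auto;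
        try (apply Hne; [lia | auto]); try congruence. apply (adj_row 2). }
    rewrite lerp_flip in G1, G2.
    assert (1 - s = 1); [|lra].
    apply (edge_meets_face P (3, Z.of_nat k')%Z (2, Z.of_nat k')%Z a b c (1 - s) x y z); auto;
      try (apply Hne; [lia | auto]); try congruence; try lra.
    apply adj_sym, (adj_row 2). }
  (* The diagonal edge that separates the two triangles between edges [n] and [n + 1]; comparing
     [y2] with [e] selects the triangle. *)
  set (e := height (pt P 0 (S n)) (pt P 1 n) 0).
  destruct (Rle_dec e y2) as [He | He].
  - destruct (barycentric_solve (pt P 0 n) (pt P 1 n) (pt P 0 (S n)) (0, y2) (Rgt_not_eq _ _ U))
      as (S1 & S2 & S3). cbn [fst snd] in S2, S3.
    set (c := crs (pt P 0 n) (pt P 1 n) (pt P 0 (S n))) in *.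
    assert (Ic : 0 < / c) by (now apply Rinv_0_lt_compat).
    assert (W1 : 0 <= crs (0, y2) (pt P 1 n) (pt P 0 (S n)) / c).
    { apply Rmult_le_pos; [|lra]. rewrite crs_rev, crs_height by lra. cbn [fst snd].
      fold e. nra. }
    assert (W3 : 0 <= crs (pt P 0 n) (pt P 1 n) (0, y2) / c).
    { apply Rmult_le_pos; [|lra]. rewrite crs_height by lra. cbn [fst snd]. nra. }
    set (w1 := crs (0, y2) (pt P 1 n) (pt P 0 (S n)) / c) in *.
    set (w2 := crs (pt P 0 n) (0, y2) (pt P 0 (S n)) / c) in *.
    set (w3 := crs (pt P 0 n) (pt P 1 n) (0, y2) / c) in *.
    assert (W2 : 0 <= w2) by nra.
    apply (Hmeet _ _ _ w1 w2 w3 (up_face 0 (Z.of_nat n))).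
    + unfold barycentric; auto.
    + intros v [-> | [-> | ->]]; simpl; lia.
    + unfold pt in S2. rewrite Nat2Z.inj_succ in S2. exact S2.
    + unfold pt in S3. rewrite Nat2Z.inj_succ in S3. exact S3.
  - apply Rnot_le_lt in He.
    destruct (barycentric_solve (pt P 1 n) (pt P 1 (S n)) (pt P 0 (S n)) (0, y2) (Rgt_not_eq _ _ D))
      as (S1 & S2 & S3). cbn [fst snd] in S2, S3.
    set (c := crs (pt P 1 n) (pt P 1 (S n)) (pt P 0 (S n))) in *.
    assert (Ic : 0 < / c) by (now apply Rinv_0_lt_compat).
    assert (W1 : 0 <= crs (0, y2) (pt P 1 (S n)) (pt P 0 (S n)) / c).
    { apply Rmult_le_pos; [|lra]. rewrite crs_rev, crs_height by lra. cbn [fst snd]. nra. }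
    assert (W2 : 0 <= crs (pt P 1 n) (0, y2) (pt P 0 (S n)) / c).
    { apply Rmult_le_pos; [|lra]. rewrite crs_cycle, crs_cycle, crs_height by lra.
      cbn [fst snd]. fold e. nra. }
    set (w1 := crs (0, y2) (pt P 1 (S n)) (pt P 0 (S n)) / c) in *.
    set (w2 := crs (pt P 1 n) (0, y2) (pt P 0 (S n)) / c) in *.
    set (w3 := crs (pt P 1 n) (pt P 1 (S n)) (0, y2) / c) in *.
    assert (W3 : 0 <= w3) by nra.
    apply (Hmeet _ _ _ w1 w2 w3 (down_face 0 (Z.of_nat n))).
    + unfold barycentric; auto.
    + intros v [-> | [-> | ->]]; simpl; lia.
    + unfold pt in S2. rewrite Nat2Z.inj_succ in S2. exact S2.
    + unfold pt in S3. rewrite Nat2Z.inj_succ in S3. exact S3.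
Qed.

(** * Log-linear limits *)

Lemma lattice_constant (A : Type) (f : vertex -> A) :
  (forall v, f (vadd v (dir 0)) = f v) -> (forall v, f (vadd v (dir 1)) = f v) ->
  forall v, f v = f (0, 0)%Z.
Proof.
  intros H0 H1.
  assert (H2 : forall v, f (vadd v (dir 2)) = f v).
  { intros v. rewrite <- (H0 (vadd v (dir 2))), <- (H1 v). f_equal.
    unfold vadd; simpl; f_equal; ring. }
  assert (Hb : forall n, (forall v, f (vadd v (dir n)) = f v) ->
    forall v, f (vadd v (dir (3 + n))) = f v).
  { intros n Hn v. rewrite <- (Hn (vadd v (dir (3 + n)))). f_equal.
    pose proof (dir_back v (3 + n)) as E. change (3 + (3 + n))%nat with (6 + n)%nat in E.
    now rewrite dir_period in E. }
  apply (vertex_ind (fun v => f v = f (0, 0)%Z)); [reflexivity|].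
  intros v d Hd Hv. destruct (unit_dir d Hd) as (m & Hm & ->). rewrite <- Hv.
  destruct m as [|[|[|[|[|[|m]]]]]]; try lia; auto.
  - exact (Hb 0%nat H0 v).
  - exact (Hb 1%nat H1 v).
  - exact (Hb 2%nat H2 v).
Qed.

(** The complex number (D - A) / (B - A), which determines a triangle up to direct similarity. *)
Definition quotient (A B D : C) : C := (dotp A B D / dist2 A B, crs A B D / dist2 A B).

Lemma quotient_spec (A B D : C) : 0 < dist2 A B ->
  (D - A = quotient A B D * (B - A))%C.
Proof.
  intros H. destruct A as [a1 a2], B as [b1 b2], D as [d1 d2].
  unfold quotient, dotp, crs, dist2, Cminus, Cmult, Cplus, Copp in *; simpl in *.
  f_equal; field; lra.
Qed.

(** Side lengths determine [crs] up to sign. As both values are nonnegative, proportional triangles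
    are directly similar, degenerate ones included. *)
Lemma quotient_scale (A B D A' B' D' : C) (k : R) : 0 < k -> 0 < dist2 A B ->
  dist2 A' B' = k ^ 2 * dist2 A B -> dist2 A' D' = k ^ 2 * dist2 A D ->
  dist2 B' D' = k ^ 2 * dist2 B D -> 0 <= crs A B D -> 0 <= crs A' B' D' ->
  crs A' B' D' = k ^ 2 * crs A B D /\ quotient A' B' D' = quotient A B D.
Proof.
  intros Hk H E1 E2 E3 C1 C2.
  assert (Hk2 : 0 < k ^ 2) by nra.
  assert (Ec : crs A' B' D' = k ^ 2 * crs A B D).
  { pose proof (crs_sqr A B D) as S1. pose proof (crs_sqr A' B' D') as S2.
    rewrite E1, E2, E3 in S2.
    assert (E : crs A' B' D' ^ 2 = (k ^ 2 * crs A B D) ^ 2).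
    { apply (Rmult_eq_reg_l 4); [|lra].
      replace (4 * (k ^ 2 * crs A B D) ^ 2) with (k ^ 4 * (4 * crs A B D ^ 2)) by ring.
      rewrite S1, S2. ring. }
    rewrite <- (sqrt_pow2 _ C2), E. apply sqrt_pow2. apply Rmult_le_pos; lra. }
  split; [assumption|]. unfold quotient.
  pose proof (dotp_dist A B D) as D1. pose proof (dotp_dist A' B' D') as D2.
  assert (Ed : dotp A' B' D' = k ^ 2 * dotp A B D) by
    (apply (f_equal (Rmult (k ^ 2))) in D1; rewrite E1, E2, E3 in D2; lra).
  rewrite Ec, Ed, E1. f_equal; field; split; lra.
Qed.

Lemma RtoC_neq_0 (z : C) : Cmod z <> 0 -> z <> 0.
Proof. intros H ->. apply H. apply Cmod_0. Qed.

Record log_linear (W : nat -> R) (M : R) (r : vertex -> R) (P : vertex -> C) : Prop := {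
  ll_limit : limit_layout W M r P;
  ll_normalized : normalized r P;
  ll_mult : forall v m, r (vadd v (dir m)) = r (dir m) * r v }.

Lemma log_linear_intro (W : nat -> R) (M : R) (r : vertex -> R) (P : vertex -> C) (L L' : R) :
  limit_layout W M r P -> normalized r P ->
  (forall v, r (vadd v (dir 0)) = L * r v) -> (forall v, r (vadd v (dir 1)) = L' * r v) ->
  log_linear W M r P.
Proof.
  intros HL HN H0 H1. split; auto. pose proof (proj1 HL) as Hr.
  assert (Hc : forall m, (exists c, forall v, r (vadd v (dir m)) = c * r v) ->
    forall v, r (vadd v (dir m)) = r (dir m) * r v).
  { intros m (c & Hm) v. rewrite Hm. f_equal.
    specialize (Hm (0, 0)%Z). rewrite vadd_0_l, (proj1 HN) in Hm. lra. }
  assert (Hpos : 0 < L /\ 0 < L').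
  { specialize (H0 (0, 0)%Z). specialize (H1 (0, 0)%Z). rewrite (proj1 HN) in *.
    pose proof (Hr (vadd (0, 0)%Z (dir 0))). pose proof (Hr (vadd (0, 0)%Z (dir 1))). lra. }
  assert (H2 : forall v, r (vadd v (dir 2)) = L' / L * r v).
  { intros v. apply (Rmult_eq_reg_l L); [|lra]. rewrite <- H0.
    replace (vadd (vadd v (dir 2)) (dir 0)) with (vadd v (dir 1))
      by (unfold vadd; simpl; f_equal; ring).
    rewrite H1. field. lra. }
  assert (Hb : forall m, (exists c, forall v, r (vadd v (dir m)) = c * r v) ->
    exists c, forall v, r (vadd v (dir (3 + m))) = c * r v).
  { intros m (c & Hm). exists (/ c). intros v.
    assert (Hcc : c <> 0).
    { intros ->. pose proof (Hr (vadd v (dir m))) as K. rewrite Hm in K. lra. }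
    apply (Rmult_eq_reg_l c); [|assumption]. rewrite <- Hm.
    pose proof (dir_back v (3 + m)) as E. change (3 + (3 + m))%nat with (6 + m)%nat in E.
    rewrite dir_period in E. rewrite E. field. assumption. }
  assert (Hall : forall m, (m < 6)%nat -> exists c, forall v, r (vadd v (dir m)) = c * r v).
  { intros m Hm. destruct m as [|[|[|[|[|[|m]]]]]]; try lia.
    - now exists L.
    - now exists L'.
    - now exists (L' / L).
    - apply (Hb 0%nat). now exists L.
    - apply (Hb 1%nat). now exists L'.
    - apply (Hb 2%nat). now exists (L' / L). }
  intros v m. rewrite <- (dir_mod m). apply Hc, Hall. apply Nat.mod_upper_bound. lia.
Qed.

Lemma log_linear_dist (W : nat -> R) (M : R) (r : vertex -> R) (P : vertex -> C) (v : vertex) (n : nat) :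
  log_linear W M r P ->
  dist2 (P v) (P (vadd v (dir n))) = r v ^ 2 * sqr_length (W n) 1 (r (dir n)).
Proof.
  intros H. rewrite (limit_dist W M r P v n (ll_limit _ _ _ _ H)), (ll_mult _ _ _ _ H).
  unfold sqr_length; ring.
Qed.

Lemma sqr_length_pos (p x y : R) : -1 < p -> 0 < x -> 0 < y -> 0 < sqr_length p x y.
Proof.
  intros Hp Hx Hy. unfold sqr_length. assert (0 < x * y) by nra.
  assert (0 <= (x - y) ^ 2) by apply pow2_ge_0. nra.
Qed.

Lemma log_linear_triangle (W : nat -> R) (M : R) (r : vertex -> R) (P : vertex -> C)
    (v : vertex) (n : nat) : good_weights W -> log_linear W M r P ->
  0 < dist2 (P v) (P (vadd v (dir n))) /\
  crs (P v) (P (vadd v (dir n))) (P (vadd v (dir (S n))))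
  = r v ^ 2 * crs (P (0, 0)%Z) (P (dir n)) (P (dir (S n))) /\
  quotient (P v) (P (vadd v (dir n))) (P (vadd v (dir (S n))))
  = quotient (P (0, 0)%Z) (P (dir n)) (P (dir (S n))).
Proof.
  intros G H. pose proof (ll_limit _ _ _ _ H) as HL. pose proof (proj1 HL) as Hr.
  assert (Hd : forall v n, 0 < dist2 (P v) (P (vadd v (dir n)))).
  { intros u m. rewrite (log_linear_dist W M r P) by assumption.
    apply Rmult_lt_0_compat; [apply pow_lt, Hr|].
    apply sqr_length_pos; [apply (gw_gt W G) | lra | apply Hr]. }
  split; [apply Hd|].
  pose proof (Hd (0, 0)%Z n) as D0. rewrite vadd_0_l in D0.
  apply quotient_scale; auto.
  - rewrite <- (vadd_0_l (dir n)) at 2. rewrite !(log_linear_dist W M r P) by assumption.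
    rewrite (proj1 (ll_normalized _ _ _ _ H)). ring.
  - rewrite <- (vadd_0_l (dir (S n))) at 2. rewrite !(log_linear_dist W M r P) by assumption.
    rewrite (proj1 (ll_normalized _ _ _ _ H)). ring.
  - change (S n) with (1 + n)%nat. rewrite (dir_sub v n), (log_linear_dist W M r P), (ll_mult _ _ _ _ H) by assumption.
    pose proof (dir_sub (0, 0)%Z n) as E. rewrite !vadd_0_l in E. rewrite E.
    rewrite (log_linear_dist W M r P) by assumption. ring.
  - pose proof (limit_crs W M r P (0, 0)%Z (dir n) HL (dir_unit n)) as K.
    rewrite !vadd_0_l in K. exact K.
  - apply (limit_crs W M r P v (dir n) HL (dir_unit n)).
Qed.

Lemma Cmod2_dist2 (A B : C) : Cmod (B - A) ^ 2 = dist2 A B.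
Proof. symmetry. apply dist2_Cmod. Qed.

(* Both kinds of triangles are similar to fixed ones, so the layout is invariant
   under similarities; [O] is their common fixed point. *)
Lemma spiral_form (W : nat -> R) (M : R) (r : vertex -> R) (P : vertex -> C) :
  good_weights W -> log_linear W M r P -> r (dir 0) <> 1 ->
  exists O A B : C,
    (forall v, P (vadd v (dir 0)) - O = A * (P v - O))%C /\
    (forall v, P (vadd v (dir 1)) - O = B * (P v - O))%C /\
    (exists c, 0 < c /\ forall v, Cmod (P v - O)%C = c * r v) /\
    (crs (P (0, 0)%Z) (P (dir 0)) (P (dir 1)) = 0 ->
     crs (P (0, 0)%Z) (P (dir 1)) (P (dir 2)) = 0 -> snd A = 0 /\ snd B = 0).
Proof.
  intros G H Hne. pose proof (ll_limit _ _ _ _ H) as HL. pose proof (proj1 HL) as Hr.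
  set (be := quotient (P (0, 0)%Z) (P (dir 0)) (P (dir 1))).
  set (ga := quotient (P (0, 0)%Z) (P (dir 1)) (P (dir 2))).
  assert (T : forall v n, 0 < dist2 (P v) (P (vadd v (dir n)))).
  { intros v n. now apply (log_linear_triangle W M r P). }
  assert (HB : forall v, (P (vadd v (dir 1)) - P v = be * (P (vadd v (dir 0)) - P v))%C).
  { intros v. destruct (log_linear_triangle W M r P v 0 G H) as (D & _ & E).
    unfold be. rewrite <- E. now apply quotient_spec. }
  assert (HG : forall v, (P (vadd v (dir 2)) - P v = ga * (P (vadd v (dir 1)) - P v))%C).
  { intros v. destruct (log_linear_triangle W M r P v 1 G H) as (D & _ & E).
    unfold ga. rewrite <- E. now apply quotient_spec. }
  pose (z := fun v => (P (vadd v (dir 0)) - P v)%C).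
  assert (Hz : forall v, Cmod (z v) ^ 2 = r v ^ 2 * sqr_length (W 0%nat) 1 (r (dir 0))).
  { intros v. unfold z. rewrite Cmod2_dist2. now apply (log_linear_dist W M r P). }
  assert (Hs0 : 0 < sqr_length (W 0%nat) 1 (r (dir 0)))
    by (apply sqr_length_pos; [apply (gw_gt W G) | lra | apply Hr]).
  assert (Hzm : forall v, Cmod (z v) = r v * sqrt (sqr_length (W 0%nat) 1 (r (dir 0)))).
  { intros v. rewrite <- (sqrt_pow2 (Cmod (z v))) by apply Cmod_ge_0. rewrite Hz.
    rewrite sqrt_mult by (try apply pow2_ge_0; lra). rewrite sqrt_pow2; [reflexivity|].
    apply Rlt_le, Hr. }
  pose proof (sqrt_lt_R0 _ Hs0) as Hsq.
  set (sq := sqrt (sqr_length (W 0%nat) 1 (r (dir 0)))) in *.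
  assert (Hz0 : forall v, z v <> 0).
  { intros v. apply RtoC_neq_0. rewrite Hzm. pose proof (Hr v).
    apply Rgt_not_eq, Rmult_lt_0_compat; assumption. }
  assert (Hneq : forall v n, (P (vadd v (dir n)) - P v)%C <> 0).
  { intros v n K. pose proof (T v n) as D. rewrite dist2_Cmod, K, Cmod_0 in D. lra. }
  assert (Hbe : be <> 0).
  { intros K. apply (Hneq (0, 0)%Z 1%nat). rewrite HB, K. ring. }
  assert (Hga : ga <> 0).
  { intros K. apply (Hneq (0, 0)%Z 2%nat). rewrite HG, K. ring. }
  (* [z v] is the edge vector in direction 0. Expressing the edge from v + dir 0 to v + dir 1 by
     both kinds of triangles gives (be - 1) z v = ga be z (v + dir 0), whence [A]. Closing the
     parallelogram on dir 0 and dir 1 gives [B]. *)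
  set (A := ((be - 1) / (ga * be))%C).
  set (B := (be * A + 1 - be)%C).
  assert (HA : forall v, z (vadd v (dir 0)) = (A * z v)%C).
  { intros v.
    assert (E1 : ((be - 1) * z v = ga * (be * z (vadd v (dir 0))))%C).
    { unfold z at 2. rewrite <- HB, <- HG.
      replace (vadd (vadd v (dir 0)) (dir 2)) with (vadd v (dir 1))
        by (unfold vadd; simpl; f_equal; ring).
      replace ((be - 1) * z v)%C with (be * z v - z v)%C by ring.
      unfold z at 1. rewrite <- HB. unfold z. ring. }
    unfold A. replace ((be - 1) / (ga * be) * z v)%C with ((be - 1) * z v / (ga * be))%C by (field; auto).
    rewrite E1. field. auto. }
  assert (HBz : forall v, z (vadd v (dir 1)) = (B * z v)%C).
  { intros v. unfold B.
    replace ((be * A + 1 - be) * z v)%C with (be * (A * z v) + z v - be * z v)%C by ring.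
    rewrite <- HA. unfold z. rewrite <- !HB.
    replace (vadd (vadd v (dir 1)) (dir 0)) with (vadd (vadd v (dir 0)) (dir 1))
      by (unfold vadd; simpl; f_equal; ring). ring. }
  assert (HAm : Cmod A = r (dir 0)).
  { assert (K : Cmod (z (vadd (0, 0)%Z (dir 0))) = Cmod A * Cmod (z (0, 0)%Z))
      by (rewrite HA; apply Cmod_mult).
    rewrite !Hzm, (ll_mult _ _ _ _ H), (proj1 (ll_normalized _ _ _ _ H)) in K.
    apply (Rmult_eq_reg_r sq); lra. }
  assert (HA1 : (A - 1)%C <> 0).
  { intros K. apply Hne. rewrite <- HAm. replace A with (RtoC 1).
    - apply Cmod_1.
    - replace A with (A - 1 + 1)%C by ring. rewrite K. ring. }
  (* The sum of the geometric series of edge vectors in direction 0; A <> 1 because |A| = r (dir 0)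
     differs from 1. *)
  set (O := (P (0, 0)%Z - z (0, 0)%Z / (A - 1))%C).
  assert (HO : forall v, (P v - z v / (A - 1) = O)%C).
  { apply (lattice_constant C (fun v => P v - z v / (A - 1))%C).
    - intros v. rewrite HA.
      replace (P (vadd v (dir 0))) with (P v + z v)%C by (unfold z; ring). field. assumption.
    - intros v. rewrite HBz.
      replace (P (vadd v (dir 1))) with (P v + be * z v)%C by (unfold z; rewrite <- HB; ring).
      unfold B. field. assumption. }
  assert (HPO : forall v, (P v - O = z v / (A - 1))%C) by (intros v; rewrite <- (HO v); ring).
  exists O, A, B. split; [|split; [|split]].
  - intros v. rewrite !HPO, HA. field. assumption.
  - intros v. rewrite !HPO, HBz. field. assumption.
  - assert (Hm : 0 < Cmod (A - 1)) by (apply Cmod_gt_0; assumption).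
    exists (sq / Cmod (A - 1)). split; [now apply Rdiv_lt_0_compat|].
    intros v. rewrite HPO, Cmod_div, Hzm by assumption. field. lra.
  - intros Z1 Z2.
    assert (K1 : snd be = 0) by (unfold be, quotient; cbn [snd]; rewrite Z1; unfold Rdiv; ring).
    assert (K2 : snd ga = 0) by (unfold ga, quotient; cbn [snd]; rewrite Z2; unfold Rdiv; ring).
    assert (Kb : be = RtoC (fst be)) by (rewrite (surjective_pairing be), K1; reflexivity).
    assert (Kg : ga = RtoC (fst ga)) by (rewrite (surjective_pairing ga), K2; reflexivity).
    assert (fst be <> 0) by (intros K; apply Hbe; rewrite Kb, K; reflexivity).
    assert (fst ga <> 0) by (intros K; apply Hga; rewrite Kg, K; reflexivity).
    assert (EA : A = RtoC ((fst be - 1) / (fst ga * fst be))).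
    { rewrite RtoC_div, RtoC_minus, RtoC_mult, <- Kb, <- Kg; [reflexivity|].
      now apply Rmult_integral_contrapositive_currified. }
    split; [now rewrite EA|].
    unfold B. rewrite EA, Kb. simpl. ring.
Qed.

Definition centroid (A B D : C) : C :=
  (/ 3 * (fst A + fst B + fst D), / 3 * (snd A + snd B + snd D)).

Lemma centroid_not_inside (P : vertex -> C) (i j k i' j' k' : vertex) :
  nonoverlapping P -> face i j k -> face i' j' k' -> i' <> i -> i' <> j -> i' <> k ->
  let Z := centroid (P i') (P j') (P k') in
  0 < crs Z (P j) (P k) -> 0 < crs (P i) Z (P k) -> 0 < crs (P i) (P j) Z -> False.
Proof.
  intros Hn Hf Hf' N1 N2 N3 Z C1 C2 C3.
  assert (HS : crs (P i) (P j) (P k) = crs Z (P j) (P k) + crs (P i) Z (P k) + crs (P i) (P j) Z)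
    by (unfold crs; ring).
  assert (Hc : 0 < crs (P i) (P j) (P k)) by lra.
  destruct (barycentric_solve (P i) (P j) (P k) Z (Rgt_not_eq _ _ Hc)) as (S1 & S2 & S3).
  assert (/ 3 = 0); [|lra].
  apply (Hn i' j' k' i j k (/ 3) (/ 3) (/ 3) (crs Z (P j) (P k) / crs (P i) (P j) (P k))
    (crs (P i) Z (P k) / crs (P i) (P j) (P k)) (crs (P i) (P j) Z / crs (P i) (P j) (P k))); auto.
  - repeat split; lra.
  - assert (forall x, 0 < x -> 0 <= x / crs (P i) (P j) (P k))
      by (intros; apply Rlt_le; now apply Rdiv_lt_0_compat).
    repeat split; auto.
  - split; [rewrite <- S2 | rewrite <- S3]; unfold Z, centroid; cbn [fst snd]; lra.
Qed.

(** [crs Z B D] is affine in [Z] and equals a third of [crs A B D] at the centroid; the displacement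
    changes it by at most 2 K eps. *)
Lemma near_centroid (A B D Z : C) (K eps : R) :
  Rabs (fst (B - D)%C) <= K -> Rabs (snd (B - D)%C) <= K ->
  Rabs (fst (Z - centroid A B D)%C) <= eps -> Rabs (snd (Z - centroid A B D)%C) <= eps ->
  6 * K * eps < crs A B D -> 0 < crs Z B D.
Proof.
  intros H1 H2 H3 H4 H5.
  set (x := fst (Z - centroid A B D)%C) in *. set (y := snd (Z - centroid A B D)%C) in *.
  set (p := fst (B - D)%C) in *. set (q := snd (B - D)%C) in *.
  assert (E : crs Z B D = crs A B D / 3 + x * q - y * p).
  { unfold crs, x, y, p, q, centroid, Cminus, Cplus, Copp; simpl; field. }
  pose proof (Rmult_le_compat _ _ _ _ (Rabs_pos x) (Rabs_pos q) H3 H2) as E1.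
  pose proof (Rmult_le_compat _ _ _ _ (Rabs_pos y) (Rabs_pos p) H4 H1) as E2.
  rewrite <- Rabs_mult in E1, E2.
  pose proof (Rle_abs (- (x * q))) as F1. rewrite Rabs_Ropp in F1.
  pose proof (Rle_abs (y * p)). lra.
Qed.

Lemma centroid_cycle (A B D : C) : centroid A B D = centroid B D A.
Proof. unfold centroid. f_equal; ring. Qed.

Lemma log_linear_ln (W : nat -> R) (M : R) (r : vertex -> R) (P : vertex -> C) (v : vertex) :
  log_linear W M r P ->
  ln (r v) = IZR (fst v) * ln (r (dir 0)) + IZR (snd v) * ln (r (dir 1)).
Proof.
  intros H. pose proof (proj1 (ll_limit _ _ _ _ H)) as Hr.
  apply Rminus_diag_uniq.
  rewrite (lattice_constant R (fun v => ln (r v) - (IZR (fst v) * ln (r (dir 0)) + IZR (snd v) * ln (r (dir 1))))).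
  - rewrite (proj1 (ll_normalized _ _ _ _ H)), ln_1. simpl. ring.
  - intros u. rewrite (ll_mult _ _ _ _ H), ln_mult by apply Hr.
    unfold vadd; cbn [fst snd]. rewrite !plus_IZR. simpl. ring.
  - intros u. rewrite (ll_mult _ _ _ _ H), ln_mult by apply Hr.
    unfold vadd; cbn [fst snd]. rewrite !plus_IZR. simpl. ring.
Qed.

(** The logarithm of [r] is additive on the lattice with step a = ln (r (dir 0)) <> 0 along rows, so
    every row has a vertex where its size is at most |a|. *)
Lemma log_linear_recurrent (W : nat -> R) (M : R) (r : vertex -> R) (P : vertex -> C) :
  log_linear W M r P -> r (dir 0) <> 1 ->
  exists (K : R) (v : nat -> vertex), 0 < K /\ forall q,
    snd (v q) = Z.of_nat q /\ / K <= r (v q) <= K.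
Proof.
  intros H Hne. pose proof (proj1 (ll_limit _ _ _ _ H)) as Hr.
  set (a := ln (r (dir 0))). set (b := ln (r (dir 1))).
  assert (Ha : a <> 0).
  { intros E. apply Hne. apply ln_inv; [apply Hr | lra | now rewrite ln_1]. }
  exists (exp (Rabs a)), (fun q => (- up (INR q * b / a), Z.of_nat q)%Z).
  split; [apply exp_pos|]. intros q. split; [reflexivity|].
  set (u := (- up (INR q * b / a), Z.of_nat q)%Z).
  assert (Hl : Rabs (ln (r u)) <= Rabs a).
  { rewrite (log_linear_ln W M r P u H). fold a b. unfold u; cbn [fst snd].
    rewrite opp_IZR, <- INR_IZR_INZ.
    replace (- IZR (up (INR q * b / a)) * a + INR q * b)
      with (a * (- (IZR (up (INR q * b / a)) - INR q * b / a))) by (field; assumption).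
    rewrite Rabs_mult, Rabs_Ropp. destruct (archimed (INR q * b / a)).
    rewrite (Rabs_pos_eq (_ - _)) by lra. pose proof (Rabs_pos a). nra. }
  rewrite <- (exp_ln (r u)) by apply Hr. rewrite <- exp_Ropp.
  apply Rabs_le_between in Hl.
  assert (Hm : forall x y, x <= y -> exp x <= exp y).
  { intros x y [L | ->]; [left; now apply exp_increasing | right; reflexivity]. }
  split; apply Hm; lra.
Qed.

Lemma dir_snd (n : nat) : (Z.abs (snd (dir n)) <= 1)%Z.
Proof.
  destruct (dir_unit n) as [E | [E | [E | [E | [E | E]]]]]; rewrite E; simpl; lia.
Qed.

(** The vertices of [log_linear_recurrent] carry infinitely many similar copies of one genuine
    triangle, of area bounded below and at bounded distance from [O]. Two centroids are so close
    that one lies inside the other triangle, and this persists in a nearby layout. *)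
Lemma nondegenerate_impossible (W : nat -> R) (M : R) (r : vertex -> R) (P : vertex -> C) (n : nat) :
  good_weights W -> log_linear W M r P -> r (dir 0) <> 1 ->
  0 < crs (P (0, 0)%Z) (P (dir n)) (P (dir (S n))) -> False.
Proof.
  intros G H Hne Hc0.
  destruct (spiral_form W M r P G H Hne) as (O & _ & _ & _ & _ & (c & Hc & HO) & _).
  destruct (log_linear_recurrent W M r P H Hne) as (K & v & HK & Hv).
  pose proof (ll_limit _ _ _ _ H) as HL. pose proof (proj1 HL) as Hr.
  pose (a := dir n). pose (b := dir (S n)).
  set (K' := c * (1 + r a + r b) * K).
  assert (Hka : 0 < r a) by apply Hr. assert (Hkb : 0 < r b) by apply Hr.
  assert (HB : forall q d, d = (0, 0)%Z \/ d = a \/ d = b ->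
    Rabs (fst (P (vadd (v q) d)) - fst O) <= K' /\ Rabs (snd (P (vadd (v q) d)) - snd O) <= K').
  { intros q d Hd. destruct (Hv q) as (_ & _ & Hq). pose proof (Hr (v q)).
    assert (Hm : Cmod (P (vadd (v q) d) - O)%C <= K').
    { rewrite HO. unfold K'. rewrite Rmult_assoc. apply Rmult_le_compat_l; [lra|].
      destruct Hd as [-> | [-> | ->]].
      - rewrite vadd_0_r. nra.
      - unfold a at 1. rewrite (ll_mult _ _ _ _ H). fold a. nra.
      - unfold b at 1. rewrite (ll_mult _ _ _ _ H). fold b. nra. }
    pose proof (Rmax_Cmod (P (vadd (v q) d) - O)%C) as Hx.
    pose proof (Rmax_l (Rabs (fst (P (vadd (v q) d) - O)%C)) (Rabs (snd (P (vadd (v q) d) - O)%C))).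
    pose proof (Rmax_r (Rabs (fst (P (vadd (v q) d) - O)%C)) (Rabs (snd (P (vadd (v q) d) - O)%C))).
    split; [change (fst (P (vadd (v q) d)) - fst O) with (fst (P (vadd (v q) d) - O)%C)
           | change (snd (P (vadd (v q) d)) - snd O) with (snd (P (vadd (v q) d) - O)%C)]; lra. }
  assert (HK' : 0 <= K').
  { destruct (HB 0%nat a) as [X _]; auto. pose proof (Rabs_pos (fst (P (vadd (v 0%nat) a)) - fst O)). lra. }
  pose (g := fun q => centroid (P (v q)) (P (vadd (v q) a)) (P (vadd (v q) b))).
  assert (Hg : forall q, Rabs (fst (g q) - fst O) <= K' /\ Rabs (snd (g q) - snd O) <= K').
  { intros q. destruct (HB q (0, 0)%Z) as [X1 Y1]; auto.
    destruct (HB q a) as [X2 Y2]; auto. destruct (HB q b) as [X3 Y3]; auto.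
    rewrite vadd_0_r in *. unfold g, centroid; cbn [fst snd].
    split; apply Rabs_le_between; apply Rabs_le_between in X1, X2, X3, Y1, Y2, Y3; lra. }
  destruct (convergent_subsequence (fun q => fst (g q) - fst O) K') as (p1 & H1 & x & Hx).
  { intros q. apply Hg. }
  destruct (convergent_subsequence (fun q => snd (g (p1 q)) - snd O) K') as (p2 & H2 & y & Hy).
  { intros q. apply Hg. }
  pose (phi := fun q => p1 (p2 q)).
  assert (Hphi : forall q, (q <= phi q)%nat) by (intros q; unfold phi; specialize (H1 (p2 q)); specialize (H2 q); lia).
  apply (is_lim_seq_along (fun n => fst (g (p1 n)) - fst O) p2) in Hx; [|assumption].
  set (c0 := crs (P (0, 0)%Z) (P (dir n)) (P (dir (S n)))) in *.
  assert (Hcq : forall q, (/ K) ^ 2 * c0 <= crs (P (v q)) (P (vadd (v q) a)) (P (vadd (v q) b))).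
  { intros q. destruct (log_linear_triangle W M r P (v q) n G H) as (_ & E & _).
    unfold a, b. rewrite E. fold c0. apply Rmult_le_compat_r; [lra|].
    pose proof (Rinv_0_lt_compat _ HK). apply pow_incr. split; [lra | apply Hv]. }
  set (de := (/ K) ^ 2 * c0) in *.
  assert (Hde : 0 < de) by (unfold de; apply Rmult_lt_0_compat; [apply pow_lt, Rinv_0_lt_compat|]; assumption).
  set (eps := de / (12 * K' + 1) / 2).
  assert (Heps : 0 < eps) by (unfold eps; apply Rdiv_lt_0_compat; [apply Rdiv_lt_0_compat|]; lra).
  assert (Heps2 : 6 * (2 * K') * (2 * eps) < de).
  { unfold eps. replace (6 * (2 * K') * (2 * (de / (12 * K' + 1) / 2))) with (de * (12 * K' / (12 * K' + 1)))
      by (field; lra).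
    rewrite <- (Rmult_1_r de) at 2. apply Rmult_lt_compat_l; [assumption|].
    apply (Rmult_lt_reg_r (12 * K' + 1)); [lra|]. field_simplify; lra. }
  assert (Hev : eventually (fun q => (Rabs (fst (g (phi q)) - fst O - x) <= eps) /\
      Rabs (snd (g (phi q)) - snd O - y) <= eps)).
  { apply eventually_and.
    - generalize (eventually_and _ _ (is_lim_seq_eventually_lt _ x (x + eps) Hx ltac:(lra))
        (is_lim_seq_eventually_gt _ x (x - eps) Hx ltac:(lra))).
      apply eventually_imp. intros q Hq. apply Rabs_le_between. unfold phi. lra.
    - generalize (eventually_and _ _ (is_lim_seq_eventually_lt _ y (y + eps) Hy ltac:(lra))
        (is_lim_seq_eventually_gt _ y (y - eps) Hy ltac:(lra))).
      apply eventually_imp. intros q Hq. apply Rabs_le_between. unfold phi. lra. }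
  destruct Hev as [N HN].
  (* Rows at least 2 apart: the corner [v q'] is then none of the corners of the triangle at
     [v q]. *)
  set (q := phi N). set (q' := phi (N + phi N + 2)%nat).
  assert (Hqq : (q + 2 <= q')%nat).
  { unfold q, q'. specialize (Hphi (N + phi N + 2)%nat). lia. }
  destruct (HN N ltac:(lia)) as [X1 Y1]. destruct (HN (N + phi N + 2)%nat ltac:(lia)) as [X2 Y2].
  fold q in X1, Y1. fold q' in X2, Y2.
  assert (Hd : Rabs (fst (g q' - g q)%C) <= 2 * eps /\ Rabs (snd (g q' - g q)%C) <= 2 * eps).
  { change (fst (g q' - g q)%C) with (fst (g q') - fst (g q)).
    change (snd (g q' - g q)%C) with (snd (g q') - snd (g q)).
    apply Rabs_le_between in X1, X2, Y1, Y2. split; apply Rabs_le_between; lra. }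
  assert (Hdiff : forall d d', d = (0, 0)%Z \/ d = a \/ d = b -> d' = (0, 0)%Z \/ d' = a \/ d' = b ->
    Rabs (fst (P (vadd (v q) d) - P (vadd (v q) d'))%C) <= 2 * K' /\
    Rabs (snd (P (vadd (v q) d) - P (vadd (v q) d'))%C) <= 2 * K').
  { intros d d' D1 D2. destruct (HB q d D1) as [U1 V1]. destruct (HB q d' D2) as [U2 V2].
    change (fst (P (vadd (v q) d) - P (vadd (v q) d'))%C) with (fst (P (vadd (v q) d)) - fst (P (vadd (v q) d'))).
    change (snd (P (vadd (v q) d) - P (vadd (v q) d'))%C) with (snd (P (vadd (v q) d)) - snd (P (vadd (v q) d'))).
    apply Rabs_le_between in U1, U2, V1, V2. split; apply Rabs_le_between; lra. }
  specialize (Hcq q).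
  pose (i := v q). pose (j := vadd (v q) a). pose (k := vadd (v q) b).
  pose (i' := v q'). pose (j' := vadd (v q') a). pose (k' := vadd (v q') b).
  assert (C1 : 0 < crs (g q') (P j) (P k)).
  { apply (near_centroid (P i) _ _ _ (2 * K') (2 * eps)); try apply Hd.
    - apply (Hdiff a b); auto.
    - apply (Hdiff a b); auto.
    - unfold i, j, k. lra. }
  assert (C2 : 0 < crs (P i) (g q') (P k)).
  { rewrite crs_cycle.
    destruct (Hdiff b (0, 0)%Z) as [D1 D2]; auto. rewrite vadd_0_r in D1, D2.
    apply (near_centroid (P j) _ _ _ (2 * K') (2 * eps)); try assumption;
      try (rewrite <- centroid_cycle; apply Hd).
    rewrite <- crs_cycle. unfold i, j, k. lra. }
  assert (C3 : 0 < crs (P i) (P j) (g q')).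
  { rewrite <- crs_cycle.
    destruct (Hdiff (0, 0)%Z a) as [D1 D2]; auto. rewrite vadd_0_r in D1, D2.
    apply (near_centroid (P k) _ _ _ (2 * K') (2 * eps)); try assumption;
      try (rewrite centroid_cycle; apply Hd).
    rewrite crs_cycle. unfold i, j, k. lra. }
  destruct HL as (_ & rn & Pn & Hn & Hconv).
  pose (gn := fun m => centroid (Pn m i') (Pn m j') (Pn m k')).
  assert (L1 : is_lim_seq (fun m => crs (gn m) (Pn m j) (Pn m k)) (crs (g q') (P j) (P k)))
    by (unfold crs, gn, g, centroid; cbn [fst snd]; limits; converge Hconv).
  assert (L2 : is_lim_seq (fun m => crs (Pn m i) (gn m) (Pn m k)) (crs (P i) (g q') (P k)))
    by (unfold crs, gn, g, centroid; cbn [fst snd]; limits; converge Hconv).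
  assert (L3 : is_lim_seq (fun m => crs (Pn m i) (Pn m j) (gn m)) (crs (P i) (P j) (g q')))
    by (unfold crs, gn, g, centroid; cbn [fst snd]; limits; converge Hconv).
  destruct (eventually_witness _ (eventually_and _ _ (is_lim_seq_eventually_gt _ _ 0 L1 C1)
    (eventually_and _ _ (is_lim_seq_eventually_gt _ _ 0 L2 C2) (is_lim_seq_eventually_gt _ _ 0 L3 C3))))
    as (m & F1 & F2 & F3).
  apply (centroid_not_inside (Pn m) i j k i' j' k'); auto.
  - apply (ly_nonoverlapping _ _ _ (proj1 (Hn m))).
  - apply face_left, dir_unit.
  - apply face_left, dir_unit.
  - intros E. apply (f_equal snd) in E. unfold i, i' in E. rewrite !(proj1 (Hv _)) in E. lia.
  - intros E. apply (f_equal snd) in E. unfold i', j, vadd in E; cbn [snd] in E.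
    rewrite !(proj1 (Hv _)) in E. pose proof (dir_snd n). unfold a in E. lia.
  - intros E. apply (f_equal snd) in E. unfold i', k, vadd in E; cbn [snd] in E.
    rewrite !(proj1 (Hv _)) in E. pose proof (dir_snd (S n)). unfold b in E. lia.
Qed.

(** * Degenerate spirals on a line *)

Lemma face_rot (i j k : vertex) : face i j k -> face (rot i) (rot j) (rot k).
Proof.
  assert (H : forall v v', adj v v' -> adj (rot v) (rot v')).
  { intros v v' Hv. destruct (adj_unit v v' Hv) as (d & Hd & ->).
    rewrite rot_vadd. now apply adj_vadd, unit_rot. }
  intros (H1 & H2 & H3). repeat split; auto.
Qed.

(** Turning the lattice by 60 degrees shifts the numbering of directions by one, which reduces
    statements about direction n to direction 0. *)
Lemma layout_rot (W : nat -> R) (r : vertex -> R) (P : vertex -> C) : layout W r P ->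
  layout (fun n => W (S n)) (fun v => r (rot v)) (fun v => P (rot v)).
Proof.
  intros L. split.
  - intros v. apply (ly_pos _ _ _ L).
  - intros v n. rewrite rot_vadd. apply (ly_dist _ _ _ L (rot v) (S n)).
  - intros v d Hd. rewrite !rot_vadd. apply (ly_oriented _ _ _ L). now apply unit_rot.
  - intros i j k i' j' k' a b c a' b' c' Hf Hf' Hb Hb' HS N1 N2 N3.
    assert (Hr : forall x y, x <> y -> rot x <> rot y).
    { intros x y Hx E. apply Hx. now rewrite <- (rotinv_rot x), E, rotinv_rot. }
    apply (ly_nonoverlapping _ _ _ L (rot i) (rot j) (rot k) (rot i') (rot j') (rot k') a b c a' b' c');
      auto using face_rot.
  - intros v n Hn. rewrite !rot_vadd. apply (ly_Delaunay _ _ _ L (rot v) (S n) Hn).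
Qed.

(** Three vertices on a ray from [O] have radii 1, U, V and distances c, cU, cV from [O]; with s =
    c^2 - 1 the equations express the three edge lengths. The vertex of radius 1 is in the middle.
    The edge between the outer two, with a vertex of radius U V across it, then violates the linear
    Delaunay inequality. *)
Lemma middle_not_Delaunay_aux (s U V p q w : R) : 0 < U < 1 -> 1 < V -> 0 <= p -> 0 <= q ->
  s * (1 - U) ^ 2 = 2 * (1 + p) * U -> s * (1 - V) ^ 2 = 2 * (1 + q) * V ->
  s * (U - V) ^ 2 = 2 * (1 + w) * (U * V) ->
  1 < w /\ (p + q) * (U + V) < (w - 1) * (1 + U * V).
Proof.
  intros HU HV Hp Hq E1 E2 E3.
  set (x := 1 - U) in *. set (y := V - 1).
  assert (Hx : 0 < x < 1) by (unfold x; lra). assert (Hy : 0 < y) by (unfold y; lra).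
  assert (E2' : s * y ^ 2 = 2 * (1 + q) * V) by (rewrite <- E2; unfold y; ring).
  assert (E3' : s * (x + y) ^ 2 = 2 * (1 + w) * (U * V)) by (rewrite <- E3; unfold x, y; ring).
  clear E2 E3.
  assert (HUV : 0 < U * V) by nra.
  assert (Hs : 0 < s).
  { apply (Rmult_lt_reg_r (x ^ 2)); [nra|]. rewrite E1. nra. }
  split.
  - destruct (Rle_or_lt y x) as [K | K].
    + assert (s * (4 * y ^ 2) <= s * (x + y) ^ 2) by (apply Rmult_le_compat_l; nra).
      assert (4 * V <= (1 + w) * (U * V)) by nra.
      assert (4 <= (1 + w) * U) by (apply (Rmult_le_reg_r V); nra).
      nra.
    + assert (A : 2 * U <= s * x ^ 2) by nra.
      assert (B : 2 * U * (x + y) ^ 2 <= 2 * (1 + w) * (U * V) * x ^ 2).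
      { rewrite <- E3'. replace (s * (x + y) ^ 2 * x ^ 2) with (s * x ^ 2 * (x + y) ^ 2) by ring.
        apply Rmult_le_compat_r; [apply pow2_ge_0 | assumption]. }
      assert (D : (x + y) ^ 2 <= (1 + w) * (V * x ^ 2)).
      { apply (Rmult_le_reg_l (2 * U)); [lra|]. nra. }
      assert (F : 2 * (V * x ^ 2) < (x + y) ^ 2).
      { replace V with (1 + y) by (unfold y; ring).
        assert (y * x * x < y * x * 1) by (apply Rmult_lt_compat_l; nra). nra. }
      assert (0 < V * x ^ 2) by nra. nra.
  - apply (Rmult_lt_reg_r (U * V)); [assumption|].
    assert (Hd : (w - 1) * (1 + U * V) * (U * V) - (p + q) * (U + V) * (U * V)
      = 2 * s * (U * V) * (x * y) + 2 * (U * V) * (x * y)).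
    { replace ((w - 1) * (1 + U * V) * (U * V)) with
        ((1 + U * V) * (2 * (1 + w) * (U * V) / 2 - 2 * (U * V))) by field.
      replace ((p + q) * (U + V) * (U * V)) with
        ((U + V) * (V * (2 * (1 + p) * U) / 2 + U * (2 * (1 + q) * V) / 2 - 2 * (U * V))) by field.
      rewrite <- E1, <- E2', <- E3'. unfold x, y. field. }
    assert (0 < x * y) by nra.
    assert (0 < 2 * s * (U * V) * (x * y) + 2 * (U * V) * (x * y)).
    { assert (0 < (U * V) * (x * y)) by (now apply Rmult_lt_0_compat).
      assert (0 < s * ((U * V) * (x * y))) by (now apply Rmult_lt_0_compat). lra. }
    lra.
Qed.

Lemma middle_not_Delaunay (s U V p q w : R) : 0 < U -> 0 < V -> (1 - U) * (1 - V) < 0 ->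
  0 <= p -> 0 <= q ->
  s * (1 - U) ^ 2 = 2 * (1 + p) * U -> s * (1 - V) ^ 2 = 2 * (1 + q) * V ->
  s * (U - V) ^ 2 = 2 * (1 + w) * (U * V) ->
  1 < w /\ (p + q) * (U + V) < (w - 1) * (1 + U * V).
Proof.
  intros HU HV Hm Hp Hq E1 E2 E3. destruct (Rlt_or_le U 1) as [K | K].
  - apply (middle_not_Delaunay_aux s U V p q w); auto; nra.
  - rewrite (Rplus_comm p q), (Rplus_comm U V), (Rmult_comm U V).
    apply (middle_not_Delaunay_aux s V U q p w); auto; nra.
Qed.

Lemma crs_quad (A B D : C) (p q s X Y : R) : 0 < X -> 0 < Y ->
  dist2 A B = sqr_length p 1 X -> dist2 A D = sqr_length q 1 Y -> dist2 B D = sqr_length s X Y ->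
  crs A B D ^ 2 = X ^ 2 * Y ^ 2 * quad p q s (/ X) (/ Y).
Proof.
  intros HX HY E1 E2 E3. pose proof (crs_sqr A B D) as H. rewrite E1, E2, E3 in H.
  apply (Rmult_eq_reg_l 4); [|lra]. rewrite H. unfold sqr_length, quad. field. lra.
Qed.

Lemma log_linear_le1_nondegenerate (W : nat -> R) (M : R) (r : vertex -> R) (P : vertex -> C) (n : nat) :
  good_weights W -> (forall n, W n <= 1) -> log_linear W M r P ->
  crs (P (0, 0)%Z) (P (dir n)) (P (dir (S n))) <> 0.
Proof.
  intros G H1 H E. pose proof (proj1 (ll_limit _ _ _ _ H)) as Hr.
  assert (Hd : forall m, dist2 (P (0, 0)%Z) (P (dir m)) = sqr_length (W m) 1 (r (dir m))).
  { intros m. pose proof (log_linear_dist W M r P (0, 0)%Z m H) as K.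
    rewrite vadd_0_l, (proj1 (ll_normalized _ _ _ _ H)) in K. rewrite K. ring. }
  pose proof (limit_dist W M r P (dir n) (2 + n) (ll_limit _ _ _ _ H)) as K.
  pose proof (dir_sub (0, 0)%Z n) as F. rewrite !vadd_0_l in F. rewrite <- F in K.
  pose proof (crs_quad _ _ _ _ _ _ _ _ (Hr (dir n)) (Hr (dir (1 + n))) (Hd n) (Hd (1 + n)%nat) K) as Q.
  change (S n) with (1 + n)%nat in E. rewrite E in Q.
  pose proof (Hr (dir n)) as R1. pose proof (Hr (dir (1 + n))) as R2.
  pose proof (quad_pos_le1 W n _ _ G H1 (Rinv_0_lt_compat _ R1) (Rinv_0_lt_compat _ R2)) as Q0.
  assert (0 < r (dir n) ^ 2 * r (dir (1 + n)) ^ 2 * quad (W n) (W (1 + n)%nat) (W (2 + n)%nat) (/ r (dir n)) (/ r (dir (1 + n)))); [|lra].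
  apply Rmult_lt_0_compat; [|assumption]. apply Rmult_lt_0_compat; nra.
Qed.

(** The corners of each triangle are distinct points of one ray from [O], so one of them is in the
    middle; [HD], used for three directions, excludes each corner in turn. *)
Lemma positive_multipliers_impossible (W : nat -> R) (M : R) (r : vertex -> R) (P : vertex -> C)
    (O : C) (c : R) (m : nat -> R) :
  good_weights W -> (forall n, 0 <= W n) -> log_linear W M r P -> 0 < c ->
  (forall v, Cmod (P v - O)%C = c * r v) ->
  (forall n, P (dir n) - O = RtoC (m n) * (P (0, 0)%Z - O))%C ->
  (forall n, 0 < m n) -> (forall n, m (1 + n)%nat = m n * m (2 + n)%nat) ->
  (forall n, m (3 + n)%nat = / m n) -> False.
Proof.
  intros G HW H Hc HO Hm Hpos H2 H3.
  assert (Hr0 : r (0, 0)%Z = 1) by apply (ll_normalized _ _ _ _ H).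
  assert (Hrm : forall n, r (dir n) = m n).
  { intros n. apply (Rmult_eq_reg_l c); [|lra].
    rewrite <- HO, Hm, Cmod_mult, HO, Hr0, Cmod_R, Rabs_pos_eq by (apply Rlt_le, Hpos). ring. }
  assert (HE : forall n, (c ^ 2 - 1) * (1 - m n) ^ 2 = 2 * (1 + W n) * m n).
  { intros n. pose proof (log_linear_dist W M r P (0, 0)%Z n H) as K.
    rewrite vadd_0_l, Hr0, Hrm, dist2_Cmod in K.
    replace (P (dir n) - P (0, 0)%Z)%C with (RtoC (m n - 1) * (P (0, 0)%Z - O))%C in K.
    - rewrite Cmod_mult, HO, Hr0, Cmod_R, Rpow_mult_distr, <- Rsqr_pow2, <- Rsqr_abs, Rsqr_pow2 in K.
      unfold sqr_length in K. lra.
    - rewrite RtoC_minus. replace (P (dir n)) with (RtoC (m n) * (P (0, 0)%Z - O) + O)%C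
        by (rewrite <- Hm; ring). ring. }
  assert (Hne : forall n, m n <> 1).
  { intros n E. specialize (HE n). pose proof (gw_gt W G n). rewrite E in HE. lra. }
  (* The corner [dir (1 + n)] is not strictly between the origin and [dir n]. Dividing by its
     multiplier [g] gives it radius 1, as in [middle_not_Delaunay]; the vertex across the opposite
     edge is [dir (5 + n)]. *)
  assert (HD : forall n, 0 <= (m (1 + n)%nat - 1) * (m (1 + n)%nat - m n)).
  { intros n. apply Rnot_lt_le; intros K.
    pose proof (Hpos n) as P0. pose proof (Hpos (1 + n)%nat) as P1.
    set (g := m (1 + n)%nat) in *.
    assert (P2 : m (2 + n)%nat = g / m n) by (unfold g; rewrite H2; field; lra).
    pose proof (HE n) as F0. pose proof (HE (1 + n)%nat) as F1. pose proof (HE (2 + n)%nat) as F2.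
    rewrite P2 in F2. fold g in F1.
    destruct (middle_not_Delaunay (c ^ 2 - 1) (/ g) (m n / g) (W (1 + n)%nat) (W (2 + n)%nat) (W n)) as [Hw HL].
    - now apply Rinv_0_lt_compat.
    - now apply Rdiv_lt_0_compat.
    - replace ((1 - / g) * (1 - m n / g)) with ((g - 1) * (g - m n) / g ^ 2) by (field; lra).
      apply Ropp_lt_cancel. rewrite Ropp_0. unfold Rdiv. rewrite Ropp_mult_distr_l.
      apply Rmult_lt_0_compat; [lra|]. apply Rinv_0_lt_compat. nra.
    - apply HW.
    - apply HW.
    - transitivity (/ g ^ 2 * ((c ^ 2 - 1) * (1 - g) ^ 2)); [field; lra|]. rewrite F1. field. lra.
    - transitivity ((m n / g) ^ 2 * ((c ^ 2 - 1) * (1 - g / m n) ^ 2)); [field; lra|]. rewrite F2. field. lra.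
    - transitivity (/ g ^ 2 * ((c ^ 2 - 1) * (1 - m n) ^ 2)); [field; lra|]. rewrite F0. field. lra.
    - destruct (limit_flower W M r P (0, 0)%Z G (ll_limit _ _ _ _ H)) as [(_ & _ & _ & HDel) _].
      specialize (HDel n Hw). unfold ratio in HDel. rewrite !vadd_0_l, !Hrm, Hr0 in HDel.
      assert (P5 : m (5 + n)%nat = m n / g).
      { change (5 + n)%nat with (3 + (2 + n))%nat. rewrite H3, P2. field. lra. }
      rewrite P5 in HDel. fold g in HDel.
      apply (Rmult_le_compat_l (m n / g)) in HDel; [|apply Rlt_le; now apply Rdiv_lt_0_compat].
      assert (G1 : m n / g * ((W n - 1) * (1 / g + 1 / (m n / g))) = (W n - 1) * (1 + / g * (m n / g)))
        by (field; lra).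
      assert (G2 : m n / g * ((W (1 + n)%nat + W (2 + n)%nat) * (1 + 1 / m n))
        = (W (1 + n)%nat + W (2 + n)%nat) * (/ g + m n / g)) by (field; lra).
      lra. }
  pose proof (HD 0%nat) as D0. pose proof (HD 1%nat) as D1. pose proof (HD 2%nat) as D2.
  simpl in D0, D1, D2.
  pose proof (Hne 0%nat) as N0. pose proof (Hne 1%nat) as N1. pose proof (Hne 2%nat) as N2.
  pose proof (Hpos 0%nat) as P0. pose proof (Hpos 1%nat) as P1.
  pose proof (H2 0%nat) as E2. pose proof (H3 0%nat) as E3. simpl in E2, E3.
  set (a := m 0%nat) in *. set (b := m 1%nat) in *.
  assert (E2' : m 2%nat = b / a) by (rewrite E2; field; lra).
  rewrite E2' in *. rewrite E3 in *.
  assert (D1' : 0 <= (b - a) * (1 - a)).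
  { replace ((b - a) * (1 - a)) with (a ^ 2 / b * ((b / a - 1) * (b / a - b))) by (field; lra).
    apply Rmult_le_pos; [|assumption]. apply Rlt_le, Rdiv_lt_0_compat; nra. }
  assert (D2' : 0 <= (1 - a) * (1 - b)).
  { replace ((1 - a) * (1 - b)) with (a ^ 2 * ((/ a - 1) * (/ a - b / a))) by (field; lra).
    apply Rmult_le_pos; [|assumption]. nra. }
  assert (N3 : a <> b).
  { intros E. apply N2. rewrite E. field. lra. }
  destruct (Rlt_or_le a 1), (Rlt_or_le b 1), (Rlt_or_le a b); nra.
Qed.

Lemma eventually_le_all (Q : nat -> nat -> Prop) (N : nat) :
  (forall i, eventually (Q i)) -> eventually (fun n => forall i, (i <= N)%nat -> Q i n).
Proof.
  intros H. generalize (eventually_all_lt Q (S N) (fun i _ => H i)).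
  apply eventually_imp. intros n Hn i Hi. apply Hn. lia.
Qed.

Lemma eventually_lt (u v : nat -> R) (l l' : R) : is_lim_seq u l -> is_lim_seq v l' -> l < l' ->
  eventually (fun n => u n < v n).
Proof.
  intros Hu Hv Hl.
  generalize (eventually_and _ _ (is_lim_seq_eventually_lt _ _ ((l + l') / 2) Hu ltac:(lra))
    (is_lim_seq_eventually_gt _ _ ((l + l') / 2) Hv ltac:(lra))).
  apply eventually_imp. intros n Hn. lra.
Qed.

Lemma pow_unbounded (b B : R) (N : nat) : 1 < b -> exists n, (N < n)%nat /\ B < b ^ n.
Proof.
  intros Hb. destruct (Pow_x_infinity b) with (b := B + 1) as [n Hn].
  { rewrite Rabs_pos_eq; lra. }
  exists (n + S N)%nat. split; [lia|]. specialize (Hn (n + S N)%nat ltac:(lia)).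
  rewrite Rabs_pos_eq in Hn; [lra|]. apply pow_le. lra.
Qed.

Lemma real_spiral_clash (W : nat -> R) (rn : nat -> vertex -> R) (Pn : nat -> vertex -> C)
    (F : vertex -> R) (a b : R) :
  (forall n, layout W (rn n) (Pn n)) -> (forall v, is_lim_seq (fun n => fst (Pn n v)) (F v)) ->
  F (0, 0)%Z = 1 -> (forall v, F (vadd v (dir 0)) = a * F v) ->
  (forall v, F (vadd v (dir 1)) = b * F v) -> a < 0 -> 1 < b -> False.
Proof.
  intros HL Hlim F0 Fa Fb Ha Hb.
  assert (Fp : forall m n, F (m + 1, Z.of_nat n)%Z = a * F (m, Z.of_nat n)).
  { intros m n. rewrite <- Fa. f_equal. unfold vadd; simpl. f_equal; ring. }
  assert (F00 : forall n, F (0%Z, Z.of_nat n) = b ^ n).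
  { induction n; [exact F0|]. rewrite Nat2Z.inj_succ. simpl pow. rewrite <- IHn, <- Fb.
    reflexivity. }
  assert (F1 : forall n, F (1%Z, Z.of_nat n) = a * b ^ n) by (intros; now rewrite (Fp 0%Z), F00).
  assert (F2 : forall n, F (2%Z, Z.of_nat n) = a ^ 2 * b ^ n) by (intros; rewrite (Fp 1%Z), F1; ring).
  assert (F3 : forall n, F (3%Z, Z.of_nat n) = a ^ 3 * b ^ n) by (intros; rewrite (Fp 2%Z), F2; ring).
  assert (Hbn : forall n, 0 < b ^ n) by (intros; apply pow_lt; lra).
  assert (Hbs : forall n, b ^ n < b ^ S n) by (intros n; simpl; specialize (Hbn n); nra).
  assert (Ha2 : 0 < a ^ 2) by nra.
  assert (Ha3 : a ^ 3 < 0) by (replace (a ^ 3) with (a ^ 2 * a) by ring; nra).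
  (* In the limit the vertex (m, n) has abscissa a^m b^n. The choices a^2 b^k' > b and b^k > a^2
     b^k' provide the two size hypotheses of [spiral_clash]. *)
  destruct (pow_unbounded b (b / a ^ 2) 1 Hb) as (k' & K1 & K2).
  destruct (pow_unbounded b (a ^ 2 * b ^ k') k' Hb) as (k & K3 & K4).
  assert (K5 : b < a ^ 2 * b ^ k').
  { apply (Rmult_lt_compat_l (a ^ 2)) in K2; [|assumption].
    replace (a ^ 2 * (b / a ^ 2)) with b in K2 by (field; nra). exact K2. }
  assert (HE : forall m, (m = 0 \/ m = 2)%Z -> eventually (fun n => forall i, (i <= k)%nat ->
    0 < fst (pt (Pn n) m i) < fst (pt (Pn n) m (S i)))).
  { intros m Hm. apply eventually_le_all. intros i.
    assert (X : 0 < F (m, Z.of_nat i) < F (m, Z.of_nat (S i))).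
    { specialize (Hbn i). specialize (Hbs i). destruct Hm as [-> | ->].
      - rewrite !F00. lra.
      - rewrite !F2. nra. }
    apply eventually_and.
    - apply (eventually_lt (fun _ => 0) _ 0 (F (m, Z.of_nat i))); [apply is_lim_seq_const | apply Hlim | lra].
    - apply (eventually_lt _ _ (F (m, Z.of_nat i)) (F (m, Z.of_nat (S i)))); [apply Hlim | apply Hlim | lra]. }
  assert (HO : forall m, (m = 1 \/ m = 3)%Z -> eventually (fun n => forall i, (i <= k)%nat ->
    fst (pt (Pn n) m (S i)) < fst (pt (Pn n) m i) < 0)).
  { intros m Hm. apply eventually_le_all. intros i.
    assert (X : F (m, Z.of_nat (S i)) < F (m, Z.of_nat i) < 0).
    { specialize (Hbn i). specialize (Hbs i). destruct Hm as [-> | ->].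
      - rewrite !F1. nra.
      - rewrite !F3. nra. }
    apply eventually_and.
    - apply (eventually_lt _ _ (F (m, Z.of_nat (S i))) (F (m, Z.of_nat i))); [apply Hlim | apply Hlim | lra].
    - apply (eventually_lt _ (fun _ => 0) (F (m, Z.of_nat i)) 0); [apply Hlim | apply is_lim_seq_const | lra]. }
  assert (X1 : eventually (fun n => fst (pt (Pn n) 3 k') < fst (pt (Pn n) 1 1))).
  { apply (eventually_lt _ _ (F (3%Z, Z.of_nat k')) (F (1%Z, Z.of_nat 1))); [apply Hlim | apply Hlim |].
    rewrite F3, F1. replace (a ^ 3 * b ^ k') with (a * (a ^ 2 * b ^ k')) by ring. rewrite pow_1. nra. }
  assert (X2 : eventually (fun n => fst (pt (Pn n) 2 k') < fst (pt (Pn n) 0 k))).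
  { apply (eventually_lt _ _ (F (2%Z, Z.of_nat k')) (F (0%Z, Z.of_nat k))); [apply Hlim | apply Hlim |].
    rewrite F2, F00. exact K4. }
  destruct (eventually_witness _ (eventually_and _ _ (HE 0%Z ltac:(auto)) (eventually_and _ _ (HE 2%Z ltac:(auto))
    (eventually_and _ _ (HO 1%Z ltac:(auto)) (eventually_and _ _ (HO 3%Z ltac:(auto))
    (eventually_and _ _ X1 X2)))))) as (n & A0 & A2 & A1 & A3 & B1 & B2).
  apply (spiral_clash (Pn n) k k' k); auto.
  - apply (ly_oriented _ _ _ (HL n)).
  - apply (ly_nonoverlapping _ _ _ (HL n)).
  - intros m i [-> | ->]; auto.
  - intros m i [-> | ->]; auto.
Qed.

(** Turning the lattice brings the negative multiplier to direction 0. A similarity that sends [O]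
    to 0 and the vertex (0, 0) to 1 puts the spiral on the real axis. *)
Lemma negative_multiplier_impossible (W : nat -> R) (rn : nat -> vertex -> R)
    (Pn : nat -> vertex -> C) (P : vertex -> C) (O : C) (n : nat) (a b : R) :
  (forall k, layout W (rn k) (Pn k)) ->
  (forall v, is_lim_seq (fun k => fst (Pn k v)) (fst (P v))) ->
  (forall v, is_lim_seq (fun k => snd (Pn k v)) (snd (P v))) ->
  P (0, 0)%Z <> O ->
  (forall v, P (vadd v (dir n)) - O = RtoC a * (P v - O))%C ->
  (forall v, P (vadd v (dir (S n))) - O = RtoC b * (P v - O))%C ->
  a < 0 -> 1 < b -> False.
Proof.
  revert W rn Pn P. induction n as [|n IH]; intros W rn Pn P HL Hf Hs H0 HA HB Ha Hb.
  - set (z := (P (0, 0)%Z - O)%C).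
    assert (Hz : 0 < fst z ^ 2 + snd z ^ 2).
    { rewrite <- Cmod_sqr. apply pow_lt, Cmod_gt_0. intros E. apply H0.
      replace (P (0, 0)%Z) with (z + O)%C by (unfold z; ring). rewrite E. ring. }
    set (N := fst z ^ 2 + snd z ^ 2) in *.
    pose (F := fun v => fst (similar_point (fst z / N) (- snd z / N) O (P v))).
    apply (real_spiral_clash W (fun k v => / sqrt N * rn k (vadd (0, 0)%Z v))
      (fun k v => similar_point (fst z / N) (- snd z / N) O (Pn k (vadd (0, 0)%Z v))) F a b); auto.
    + intros k. pose proof (sqrt_lt_R0 N Hz). apply layout_similar; [now apply Rinv_0_lt_compat | |apply HL].
      rewrite pow_inv, pow2_sqrt by lra.
      transitivity ((fst z ^ 2 + snd z ^ 2) / N ^ 2); [field; lra|]. fold N. field. lra.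
    + intros v. rewrite vadd_0_l. unfold F, similar_point; cbn [fst].
      limits; auto.
    + unfold F, similar_point; cbn [fst].
      change (fst (P (0, 0)%Z) - fst O) with (fst z). change (snd (P (0, 0)%Z) - snd O) with (snd z).
      transitivity ((fst z ^ 2 + snd z ^ 2) / N); [field; lra|]. fold N. field. lra.
    + intros v. specialize (HA v). unfold F, similar_point; cbn [fst].
      apply (f_equal fst) in HA as H1. apply (f_equal snd) in HA as H2. simpl in H1, H2.
      replace (fst (P (vadd v (dir 0))) - fst O) with (a * (fst (P v) - fst O)) by (simpl; lra).
      replace (snd (P (vadd v (dir 0))) - snd O) with (a * (snd (P v) - snd O)) by (simpl; lra). ring.
    + intros v. specialize (HB v). unfold F, similar_point; cbn [fst].
      apply (f_equal fst) in HB as H1. apply (f_equal snd) in HB as H2. simpl in H1, H2.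
      replace (fst (P (vadd v (dir 1))) - fst O) with (b * (fst (P v) - fst O)) by (simpl; lra).
      replace (snd (P (vadd v (dir 1))) - snd O) with (b * (snd (P v) - snd O)) by (simpl; lra). ring.
  - apply (IH (fun i => W (S i)) (fun k v => rn k (rot v)) (fun k v => Pn k (rot v)) (fun v => P (rot v))); auto.
    + intros k. now apply layout_rot.
    + intros v. rewrite rot_vadd. apply (HA (rot v)).
    + intros v. rewrite rot_vadd. apply (HB (rot v)).
Qed.

Lemma log_linear_constant (W : nat -> R) (M : R) (r : vertex -> R) (P : vertex -> C) :
  good_weights W -> log_linear W M r P -> r (dir 0) = 1.
Proof.
  intros G H. apply NNPP; intros Hne.
  pose proof (ll_limit _ _ _ _ H) as HL. pose proof (proj1 HL) as Hr.
  assert (Hdeg : forall n, crs (P (0, 0)%Z) (P (dir n)) (P (dir (S n))) = 0).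
  { intros n. destruct (limit_crs W M r P (0, 0)%Z (dir n) HL (dir_unit n)) as [K | K].
    - rewrite !vadd_0_l in K. destruct (nondegenerate_impossible W M r P n G H Hne K).
    - rewrite !vadd_0_l in K. symmetry. exact K. }
  assert (HW : forall n, 0 <= W n).
  { destruct (gw_cases W G) as [K | K]; [|apply K].
    destruct (log_linear_le1_nondegenerate W M r P 0 G K H (Hdeg 0%nat)). }
  destruct (spiral_form W M r P G H Hne) as (O & A & B & HA & HB & (c & Hc & HO) & Hreal).
  destruct (Hreal (Hdeg 0%nat) (Hdeg 1%nat)) as [A0 B0].
  set (a := fst A). set (b := fst B).
  assert (EA : A = RtoC a) by (rewrite (surjective_pairing A), A0; reflexivity).
  assert (EB : B = RtoC b) by (rewrite (surjective_pairing B), B0; reflexivity).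
  rewrite EA in HA. rewrite EB in HB. clear EA EB A0 B0 Hreal.
  assert (Hn0 : forall v, P v <> O).
  { intros v E. pose proof (HO v) as K. rewrite E in K.
    replace (O - O)%C with (RtoC 0) in K by ring. rewrite Cmod_0 in K. specialize (Hr v). nra. }
  assert (Ha : a <> 0).
  { intros E. apply (Hn0 (vadd (0, 0)%Z (dir 0))). specialize (HA (0, 0)%Z). rewrite E in HA.
    replace (P (vadd (0, 0)%Z (dir 0))) with (P (vadd (0, 0)%Z (dir 0)) - O + O)%C by ring.
    rewrite HA. ring. }
  assert (Hb : b <> 0).
  { intros E. apply (Hn0 (vadd (0, 0)%Z (dir 1))). specialize (HB (0, 0)%Z). rewrite E in HB.
    replace (P (vadd (0, 0)%Z (dir 1))) with (P (vadd (0, 0)%Z (dir 1)) - O + O)%C by ring.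
    rewrite HB. ring. }
  pose (m0 := fun n => match n with
    | O => a | 1%nat => b | 2%nat => b / a | 3%nat => / a | 4%nat => / b | _ => a / b end).
  pose (m := fun n => m0 (n mod 6)%nat).
  assert (Hz : forall x y z : R, x <> 0 -> forall p q : C, (RtoC x * p = RtoC y * q)%C ->
    x * z = y -> (p = RtoC z * q)%C).
  { intros x y z Hx p q E Ez. rewrite <- Ez, RtoC_mult in E.
    assert (Hx' : RtoC x <> 0) by (intros K; apply Hx; now apply RtoC_inj).
    replace p with (RtoC x * p / RtoC x)%C by (field; assumption). rewrite E. field. assumption. }
  assert (Hm0 : forall n, (n < 6)%nat -> forall v, (P (vadd v (dir n)) - O = RtoC (m0 n) * (P v - O))%C).
  { intros n Hn v. destruct n as [|[|[|[|[|[|n]]]]]]; try lia; unfold m0.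
    - apply HA.
    - apply HB.
    - apply (Hz a b); [assumption | | field; assumption]. rewrite <- HA, <- HB.
      f_equal. f_equal. unfold vadd; simpl; f_equal; ring.
    - apply (Hz a 1); [assumption | | field; assumption]. rewrite <- HA.
      rewrite Cmult_1_l. f_equal. f_equal. rewrite (surjective_pairing v) at 2. unfold vadd; simpl; f_equal; ring.
    - apply (Hz b 1); [assumption | | field; assumption]. rewrite <- HB.
      rewrite Cmult_1_l. f_equal. f_equal. rewrite (surjective_pairing v) at 2. unfold vadd; simpl; f_equal; ring.
    - apply (Hz b a); [assumption | | field; assumption]. rewrite <- HA, <- HB.
      f_equal. f_equal. unfold vadd; simpl; f_equal; ring. }
  assert (Hm : forall n v, (P (vadd v (dir n)) - O = RtoC (m n) * (P v - O))%C).
  { intros n v. unfold m. rewrite <- (dir_mod n). apply Hm0. apply Nat.mod_upper_bound. lia. }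
  assert (Hm1 : forall n, m n <> 1).
  { intros n E. destruct (log_linear_triangle W M r P (0, 0)%Z n G H) as [K _].
    specialize (Hm n (0, 0)%Z). rewrite E, Cmult_1_l in Hm.
    rewrite dist2_Cmod in K.
    replace (P (vadd (0, 0)%Z (dir n)) - P (0, 0)%Z)%C with (RtoC 0) in K.
    - rewrite Cmod_0 in K. lra.
    - replace (P (vadd (0, 0)%Z (dir n))) with (P (vadd (0, 0)%Z (dir n)) - O + O)%C by ring.
      rewrite Hm. ring. }
  assert (Hclash : forall n, m n < 0 -> 1 < m (S n) -> False).
  { intros n N1 N2. destruct HL as (_ & rn & Pn & HPn & Hconv).
    apply (negative_multiplier_impossible W rn Pn P O n (m n) (m (S n))); auto.
    - intros k. apply HPn.
    - intros v. apply Hconv.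
    - intros v. apply Hconv. }
  pose proof (Hclash 0%nat) as C0. pose proof (Hclash 1%nat) as C1. pose proof (Hclash 2%nat) as C2.
  pose proof (Hclash 3%nat) as C3. pose proof (Hclash 4%nat) as C4. pose proof (Hclash 5%nat) as C5.
  pose proof (Hm1 0%nat) as N0. pose proof (Hm1 1%nat) as N1. pose proof (Hm1 2%nat) as N2.
  unfold m in C0, C1, C2, C3, C4, C5, N0, N1, N2. simpl in C0, C1, C2, C3, C4, C5, N0, N1, N2.
  assert (Hinv : forall x, 0 < x -> x < 1 -> 1 < / x).
  { intros x X0 X1. rewrite <- Rinv_1. apply Rinv_lt_contravar; lra. }
  (* If a multiplier is negative, some consecutive pair has a negative first and a positive second
     member. As no multiplier is 1, the second exceeds 1 for this pair or for the inverse pair in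
     the opposite directions. *)
  destruct (Rlt_or_le a 0) as [Sa | Sa]; destruct (Rlt_or_le b 0) as [Sb | Sb].
  - assert (Hba : 0 < b / a).
    { replace (b / a) with (- b / - a) by (field; assumption). apply Rdiv_lt_0_compat; lra. }
    destruct (Rlt_or_le 1 (b / a)) as [K | K]; [now apply C1|].
    apply C4; [now apply Rinv_lt_0_compat|].
    replace (a / b) with (/ (b / a)) by (field; auto). apply Hinv; lra.
  - destruct (Rlt_or_le 1 b) as [K | K]; [now apply C0|].
    apply C3; [now apply Rinv_lt_0_compat|]. apply Hinv; lra.
  - destruct (Rlt_or_le 1 a) as [K | K].
    + apply C5; [|assumption]. unfold Rdiv. pose proof (Rinv_lt_0_compat b Sb). nra.
    + apply C2; [|apply Hinv; lra].
      unfold Rdiv. assert (0 < / a) by (apply Rinv_0_lt_compat; lra). nra.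
  - assert (Pa : 0 < a) by lra. assert (Pb : 0 < b) by lra.
    apply (positive_multipliers_impossible W M r P O c m G HW H Hc HO).
    + intros n. rewrite <- (vadd_0_l (dir n)). apply Hm.
    + intros n. unfold m. pose proof (Nat.mod_upper_bound n 6 ltac:(lia)) as Hk.
      destruct (n mod 6)%nat as [|[|[|[|[|[|k]]]]]]; try lia; simpl;
        try assumption; try (apply Rinv_0_lt_compat; assumption); now apply Rdiv_lt_0_compat.
    + intros n. unfold m. rewrite <- (Nat.Div0.add_mod_idemp_r 1 n), <- (Nat.Div0.add_mod_idemp_r 2 n).
      pose proof (Nat.mod_upper_bound n 6 ltac:(lia)) as Hk.
      destruct (n mod 6)%nat as [|[|[|[|[|[|k]]]]]]; try lia; simpl; field; auto.
    + intros n. unfold m. rewrite <- (Nat.Div0.add_mod_idemp_r 3 n).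
      pose proof (Nat.mod_upper_bound n 6 ltac:(lia)) as Hk.
      destruct (n mod 6)%nat as [|[|[|[|[|[|k]]]]]]; try lia; simpl; field; auto.
Qed.

(** * Constancy of the radii and passage to the packing metric *)

Lemma good_weights_shift (W : nat -> R) : good_weights W -> good_weights (fun n => W (S n)).
Proof.
  intros G. split; intros.
  - apply (gw_period W G (S n)).
  - apply (gw_gt W G).
  - apply (gw_structure W G (S n)).
  - now apply (gw_regular W G (S n)).
  - destruct (gw_range W G) as [K | K]; [left | right]; intros n; apply K.
Qed.

(** Extremal limits for direction 0 and again for direction 1 give a log-linear limit whose
    multiplier in direction 0 is still the supremum [K] of the given layout. Hence K = 1. *)
Lemma layout_nonincreasing_base (W : nat -> R) (r : vertex -> R) (P : vertex -> C) (v : vertex) :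
  good_weights W -> layout W r P -> r (vadd v (dir 0)) <= r v.
Proof.
  intros G L. destruct (ring_lemma W r P G L) as (M & _ & HM).
  destruct (extremal_limit W M r P 0 G (layout_limit W M r P L HM))
    as (K & r1 & P1 & Hle & HL1 & _ & H1 & _).
  destruct (extremal_limit W M r1 P1 1 G HL1) as (K' & r2 & P2 & _ & HL2 & HN2 & H2 & Hk).
  pose proof (Hk 0%nat K H1) as H0.
  pose proof (log_linear_constant W M r2 P2 G (log_linear_intro W M r2 P2 K K' HL2 HN2 H0 H2)) as E.
  specialize (H0 (0, 0)%Z). rewrite vadd_0_l, E, (proj1 HN2) in H0.
  specialize (Hle v). replace K with 1 in Hle by lra. lra.
Qed.

Lemma layout_nonincreasing (W : nat -> R) (r : vertex -> R) (P : vertex -> C) (v : vertex) (n : nat) :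
  good_weights W -> layout W r P -> r (vadd v (dir n)) <= r v.
Proof.
  revert W r P v. induction n as [|n IH]; intros W r P v G L.
  - now apply (layout_nonincreasing_base W r P).
  - pose proof (IH _ _ _ (rotinv v) (good_weights_shift W G) (layout_rot W r P L)) as K.
    cbv beta in K. now rewrite rot_vadd, rot_rotinv in K.
Qed.

Lemma layout_constant (W : nat -> R) (r : vertex -> R) (P : vertex -> C) (v : vertex) :
  good_weights W -> layout W r P -> r v = r (0, 0)%Z.
Proof.
  intros G L.
  assert (H : forall n u, r (vadd u (dir n)) = r u).
  { intros n u. apply Rle_antisym; [now apply (layout_nonincreasing W r P)|].
    rewrite <- (dir_back u n) at 1. now apply (layout_nonincreasing W r P). }
  apply (lattice_constant R r); intros u; apply H.
Qed.

Definition edge_weight (I : vertex -> vertex -> R) (n : nat) : R := I (0, 0)%Z (dir n).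

Lemma edge_weight_at (I : vertex -> vertex -> R) (v : vertex) (n : nat) :
  translating_invariant I -> I v (vadd v (dir n)) = edge_weight I n.
Proof.
  intros H. unfold edge_weight. rewrite <- (H (0, 0)%Z (dir n) v).
  - now rewrite vadd_0_l, vadd_comm.
  - rewrite <- (vadd_0_l (dir n)). apply adj_vadd, dir_unit.
Qed.

Lemma dir_opposite (n : nat) : dir (1 + n) <> dir (5 + n).
Proof.
  change (dir (5 + n)) with (rot (rot (rot (rot (dir (1 + n)))))).
  destruct (dir_unit (1 + n)) as [E | [E | [E | [E | [E | E]]]]]; rewrite E; discriminate.
Qed.

Lemma dir_sub' (v : vertex) (n : nat) :
  vadd v (dir n) = vadd (vadd v (dir (5 + n))) (dir (1 + n)).
Proof.
  pose proof (dir_sub v (5 + n)) as E. change (1 + (5 + n))%nat with (6 + n)%nat in E.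
  change (2 + (5 + n))%nat with (6 + (1 + n))%nat in E. now rewrite !dir_period in E.
Qed.

Lemma edge_weight_period (I : vertex -> vertex -> R) (n : nat) : edge_function I ->
  translating_invariant I -> edge_weight I (3 + n) = edge_weight I n.
Proof.
  intros He Ht. rewrite <- (edge_weight_at I (dir n) (3 + n) Ht).
  pose proof (dir_back (0, 0)%Z n) as E. rewrite vadd_0_l in E. rewrite E.
  unfold edge_weight. symmetry. apply He. rewrite <- (vadd_0_l (dir n)). apply adj_vadd, dir_unit.
Qed.

Lemma edge_weight_good (I : vertex -> vertex -> R) : is_weight I -> regular I ->
  translating_invariant I ->
  (forall v v', adj v v' -> - (1 / 2) < I v v' <= 1) \/ (forall v v', adj v v' -> 0 <= I v v') ->
  (forall i j k, face i j k -> 0 <= I i j + I j k * I k i) ->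
  good_weights (edge_weight I).
Proof.
  intros (He & Hgt) Hreg Ht Hrange Hs.
  assert (Hadj : forall v n, adj v (vadd v (dir n))) by (intros; apply adj_vadd, dir_unit).
  assert (Hadj0 : forall n, adj (0, 0)%Z (dir n)) by (intros n; rewrite <- (vadd_0_l (dir n)); apply Hadj).
  assert (Hsub : forall n, dir (1 + n) = vadd (dir n) (dir (2 + n))).
  { intros n. pose proof (dir_sub (0, 0)%Z n) as E. now rewrite !vadd_0_l in E. }
  assert (Hjk : forall n, I (dir n) (dir (1 + n)) = edge_weight I (2 + n)).
  { intros n. rewrite Hsub. now apply edge_weight_at. }
  assert (Hface : forall n, face (0, 0)%Z (dir n) (dir (1 + n))).
  { intros n. pose proof (face_left (0, 0)%Z (dir n) (dir_unit n)) as F. now rewrite !vadd_0_l in F. }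
  assert (Hrev : forall n, I (dir n) (0, 0)%Z = edge_weight I n).
  { intros n. unfold edge_weight. symmetry. now apply He. }
  split.
  - intros n. now apply edge_weight_period.
  - intros n. now apply Hgt.
  - intros n. pose proof (Hs _ _ _ (Hface n)) as K. rewrite Hjk, Hrev in K.
    unfold edge_weight at 1. lra.
  (* The edge from the origin to [dir n] has the third vertices [dir (1 + n)] and [dir (5 + n)]; in
     both triangles the other two weights are W (1 + n) and W (2 + n). *)
  - intros n H1 H2. apply Hreg.
    pose proof (Hface (5 + n)%nat) as F. change (1 + (5 + n))%nat with (6 + n)%nat in F.
    pose proof (Hjk (5 + n)%nat) as J. change (1 + (5 + n))%nat with (6 + n)%nat in J.
    rewrite dir_period in F, J.
    exists (0, 0)%Z, (dir n), (dir (1 + n)), (dir (5 + n)).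
    split; [apply Hface|]. split; [now apply face_swap|].
    split; [apply dir_opposite|]. split; [exact H1|]. split.
    + rewrite Hjk. fold (edge_weight I (1 + n)). lra.
    + fold (edge_weight I (5 + n)).
      rewrite (He (dir n) (dir (5 + n))), J by (apply F || (apply adj_sym, F)).
      change (5 + n)%nat with (3 + (2 + n))%nat. change (2 + (3 + (2 + n)))%nat with (3 + (3 + (1 + n)))%nat.
      rewrite !edge_weight_period by assumption. lra.
  - destruct Hrange as [K | K]; [left | right]; intros n; now apply K.
Qed.

Lemma packing_layout (I : vertex -> vertex -> R) (u : vertex -> R) :
  is_weight I -> translating_invariant I -> is_PL_metric (packing_length I u) ->
  weighted_Delaunay (packing_length I u) (radius u) ->
  isometric_to_open_set (packing_length I u) ->
  exists P, layout (edge_weight I) (radius u) P.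
Proof.
  intros (He & Hgt) Ht Hl HD Hiso.
  destruct (planar_oriented_layout _ Hl Hiso) as (P & HP & Hn & Ho).
  assert (Hpos : forall v, 0 < radius u v) by (intros; apply exp_pos).
  assert (Hadj : forall v n, adj v (vadd v (dir n))) by (intros; apply adj_vadd, dir_unit).
  assert (Hlen : forall v n, packing_length I u v (vadd v (dir n)) ^ 2
    = sqr_length (edge_weight I n) (radius u v) (radius u (vadd v (dir n)))).
  { intros v n. unfold packing_length. rewrite edge_weight_at by assumption.
    replace (exp (2 * u v) + exp (2 * u (vadd v (dir n)))
        + 2 * edge_weight I n * exp (u v + u (vadd v (dir n))))
      with (sqr_length (edge_weight I n) (radius u v) (radius u (vadd v (dir n)))).
    - apply pow2_sqrt, Rlt_le, sqr_length_pos; auto. rewrite <- (edge_weight_at I v n Ht). now apply Hgt.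
    - unfold sqr_length, radius. rewrite exp_plus.
      replace (2 * u v) with (u v + u v) by ring.
      replace (2 * u (vadd v (dir n))) with (u (vadd v (dir n)) + u (vadd v (dir n))) by ring.
      rewrite !exp_plus. ring. }
  assert (Hrev : forall v n, packing_length I u (vadd v (dir n)) v ^ 2
    = sqr_length (edge_weight I n) (radius u v) (radius u (vadd v (dir n)))).
  { intros v n. rewrite <- Hlen. f_equal. symmetry. now apply (proj1 Hl). }
  exists P. split; auto.
  - intros v n. now rewrite HP, Hlen.
  - intros v n Hw. cbv beta.
    assert (P5 : edge_weight I (5 + n) = edge_weight I (2 + n)).
    { change (5 + n)%nat with (3 + (2 + n))%nat. now apply edge_weight_period. }
    assert (K : (edge_weight I n - 1) * (/ radius u (vadd v (dir (1 + n))) + / radius u (vadd v (dir (5 + n))))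
      <= (edge_weight I (1 + n) + edge_weight I (2 + n)) * (/ radius u v + / radius u (vadd v (dir n)))).
    { apply (Delaunay_linear (packing_length I u) (radius u) v (vadd v (dir n))
        (vadd v (dir (1 + n))) (vadd v (dir (5 + n)))); auto.
      - apply face_left, dir_unit.
      - pose proof (face_left v (dir (5 + n)) (dir_unit (5 + n))) as F.
        change (rot (dir (5 + n))) with (dir (6 + n)) in F. rewrite dir_period in F.
        now apply face_swap.
      - intros E. apply (dir_opposite n). now apply (vadd_cancel v).
      - rewrite (dir_sub v n). apply Hlen.
      - rewrite <- P5. apply Hrev.
      - rewrite (dir_sub' v n). rewrite Hrev. unfold sqr_length. ring. }
    pose proof (Hpos v) as Hv.
    (* Multiplication by the radius at [v] turns inverse radii into the quotients used in
       [Delaunay_at]. *)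
    apply (Rmult_le_compat_l (radius u v)) in K; [|lra].
    pose proof (Hpos (vadd v (dir n))).
    set (x := radius u v) in *.
    unfold Rdiv.
    replace (1 + x * / radius u (vadd v (dir n))) with (x * (/ x + / radius u (vadd v (dir n)))) by (field; lra).
    lra.
Qed.

Theorem theorem1p3
  (I : vertex -> vertex -> R)
  (I_weight : is_weight I)
  (I_regular : regular I)
  (I_invariant : translating_invariant I)
  (I_range :
     (forall v v', adj v v' -> - (1 / 2) < I v v' <= 1) \/
     (forall v v', adj v v' -> 0 <= I v v'))
  (I_structure :
     forall i j k, face i j k -> 0 <= I i j + I j k * I k i)
  (l : vertex -> vertex -> R) (u : vertex -> R)
  (l_metric : is_packing_metric I l)
  (l_induced : induced_by I l u)
  (u_constant : is_constant u)
  (l_Delaunay : weighted_Delaunay l (radius u))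
  (w : vertex -> R)
  (wl_metric : is_packing_metric I (rescale I w u))
  (wl_Delaunay :
     weighted_Delaunay (rescale I w u) (radius (label_add w u)))
  (wl_planar : isometric_to_open_set (rescale I w u)) :
  is_constant w.
Proof.
  destruct (packing_layout I (label_add w u)) as (P & HP); auto; [apply wl_metric|].
  pose proof (edge_weight_good I I_weight I_regular I_invariant I_range I_structure) as G.
  destruct u_constant as (c & Hc).
  exists (w (0, 0)%Z). intros v.
  pose proof (layout_constant _ _ _ v G HP) as E. unfold radius, label_add in E.
  apply exp_inv in E. rewrite !Hc in E. lra.
Qed.
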